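(* Let $(M,H,\theta,J)$ be a compact Sasakian manifold of dimension $2n+1$. Then the kernel of the Rumin Laplacian agrees with that of the Hodge-de Rham Laplacian, that is, for every $k$ with $0\le k\le 2n+1$, as subspaces of $\Omega^k(M)$, $$\operatorname{Ker}\bigl(\Delta_{\mathrm{dR}}\colon \Omega^k(M)\to\Omega^k(M)\bigr)=\operatorname{Ker}\bigl(\Delta_{\mathcal{E}}\colon \mathcal{E}^k(M)\to\mathcal{E}^k(M)\bigr).$$
   Context: Contact and Sasakian manifolds. An orientable contact manifold $(M,H)$ of dimension $2n+1$ is a manifold with a codimension-one subbundle $H\subset TM$ for which there is a 1-form $\theta$ (a contact form) with $\operatorname{Ker}\theta=H$ and $\theta\wedge(d\theta)^n\neq 0$ everywhere. The Reeb vector field $T$ is the unique vector field with $\theta(T)=1$, $\operatorname{Int}_T d\theta=0$ ($\operatorname{Int}_T$ is the interior product, $\mathcal{L}_T$ the Lie derivative). An almost complex structure associated with $\theta$ is $J\in\operatorname{End}(TM)$ preserving $H$ with $J^2=-\mathrm{Id}$ on $H$, $JT=0$, and $d\theta(\cdot,J\cdot)$ positive definite on $H$. The Riemannian metric is $g_{\theta,J}(X,Y)=d\theta(X,JY)+\theta(X)\theta(Y)$. Put $H^{1,0}=\{v\in\mathbb{C}H: Jv=\sqrt{-1}v\}$. $(M,H,\theta,J)$ is Sasakian if $\mathcal{L}_TJ=0$ and $[C^\infty(M,H^{1,0}),C^\infty(M,H^{1,0})]\subset C^\infty(M,H^{1,0})$. Rumin complex. $\Omega^k(M)$ is the space of smooth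 $k$-forms; $H^*$ is identified with $\{\phi\in T^*M:\phi(T)=0\}$, and $\Omega^k_H(M)=C^\infty(M,\bigwedge^kH^* )\subset\Omega^k(M)$. Let $L=d\theta\wedge$ and let $\Lambda$ be its pointwise adjoint with respect to $g_{\theta,J}$. Put $\bigwedge^k_{\mathrm{prim}}H^*=\{v\in\bigwedge^kH^*:\Lambda v=0\}$, $\bigwedge^k_LH^*=\{v\in\bigwedge^kH^*:Lv=0\}$, and $\mathcal{E}^k(M)=C^\infty(M,\bigwedge^k_{\mathrm{prim}}H^* )$ for $k\le n$, $\mathcal{E}^k(M)=C^\infty(M,\theta\wedge\bigwedge^{k-1}_LH^* )$ for $k\ge n+1$. For $\phi\in\Omega_H^k(M)$ let $d_b\phi=d\phi-\theta\wedge(\operatorname{Int}_Td\phi)$. Let $D=\theta\wedge(\mathcal{L}_T+d_bL^{-1}d_b)\colon\mathcal{E}^n(M)\to\mathcal{E}^{n+1}(M)$, where $L\colon\bigwedge^{n-1}H^*\to\bigwedge^{n+1}H^*$ is an isomorphism. For $k\le n$ let $P\colon\Omega^k(M)\to\mathcal{E}^k(M)$ be the fiberwise orthogonal projection. Set $d_{\mathrm{R}}^k=P\circ d$ for $k\le n-1$, $d_{\mathrm{R}}^n=D$, $d_{\mathrm{R}}^k=d$ for $k\ge n+1$. Let $a_k=1/\sqrt{|n-k|}$ for $k\ne n$, $a_n=1$, and $d_{\mathcal{E}}^k=a_kd_{\mathrm{R}}^k\colon\mathcal{E}^k(M)\to\mathcal{E}^{k+1}(M)$. $(\mathcal{E}^\bullet(M),d_{\mathcal{E}}^\bullet)$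 is a complex. Laplacians. Adjoints $*$ are formal adjoints for the $L^2$-inner product of $g_{\theta,J}$. The Rumin Laplacian on $\mathcal{E}^k(M)$ is $\Delta_{\mathcal{E}}=(d_{\mathcal{E}}d_{\mathcal{E}}^* )^2+(d_{\mathcal{E}}^*d_{\mathcal{E}})^2$ for $k\ne n,n+1$; $\Delta_{\mathcal{E}}=(d_{\mathcal{E}}d_{\mathcal{E}}^* )^2+D^*D$ for $k=n$; $\Delta_{\mathcal{E}}=DD^*+(d_{\mathcal{E}}^*d_{\mathcal{E}})^2$ for $k=n+1$. The Hodge-de Rham Laplacian is $\Delta_{\mathrm{dR}}=dd^*+d^*d$ on $\Omega^\bullet(M)$, with respect to $g_{\theta,J}$. *)

(* Defs.v *)
From HB Require Import structures.
From mathcomp Require Import all_boot all_order all_algebra fingroup perm.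
From mathcomp Require Import all_classical all_reals all_analysis.
From mathcomp Require Import ring.
Set Implicit Arguments.
Unset Strict Implicit.
Unset Printing Implicit Defensive.
Import Order.TTheory GRing.Theory Num.Theory.
Import numFieldNormedType.Exports.
Local Open Scope classical_set_scope.
Local Open Scope ring_scope.

Section SmoothOn.
Variables (R : realType) (m : nat).
Implicit Types (f g : 'rV[R]_m -> R) (D : set 'rV[R]_m) (s : seq 'I_m).

Definition basis_vec (i : 'I_m) : 'rV[R]_m := delta_mx 0 i.

Definition iter_partial s f := foldl (fun h i => 'D_(basis_vec i) h) f s.

Definition smooth_at_order D s f := forall x, D x ->
  {for x, continuous (iter_partial s f)} /\
  forall i, derivable (iter_partial s f) x (basis_vec i).

(* C^oo on D (always used with D open): all iterated partial derivatives exist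
   and are continuous at the points of D. *)
Definition smooth_on D f := forall s, smooth_at_order D s f.

Lemma iter_partial_congr D s f g : open D -> {in D, f =1 g} ->
  {in D, iter_partial s f =1 iter_partial s g}.
Proof.
move=> oD; elim: s f g => [|i s IH] f g fg //=.
apply: IH => x /set_mem Dx; apply: near_eq_derive.
move/open_nbhs_nbhs: (conj oD Dx).
by apply: filterS => y Dy; apply: fg; rewrite inE.
Qed.

Lemma smooth_at_order_congr D s f g : open D -> {in D, f =1 g} ->
  smooth_at_order D s f -> smooth_at_order D s g.
Proof.
move=> oD fg sf x Dx; have [cf df] := sf x Dx.
have nfg : {near x, iter_partial s f =1 iter_partial s g}.
  move/open_nbhs_nbhs: (conj oD Dx); apply: filterS => y Dy.
  by apply: (iter_partial_congr s oD fg); rewrite inE.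
split=> [|i]; last exact: near_eq_derivable nfg (df i).
rewrite /prop_for /continuous_at.
by rewrite -(nbhs_singleton nfg); apply: (cvg_trans (near_eq_cvg nfg) cf).
Qed.

Let smooth_upto N D f := forall s, (size s <= N)%N -> smooth_at_order D s f.

Let smooth_upto_partial N D f i : smooth_upto N.+1 D f ->
  smooth_upto N D ('D_(basis_vec i) f).
Proof. by move=> sf s sN; exact: (sf (i :: s)). Qed.

Let iter_partialD N D s f g : (size s <= N)%N -> open D ->
  smooth_upto N D f -> smooth_upto N D g ->
  {in D, iter_partial s f + iter_partial s g =1 iter_partial s (f + g)}.
Proof.
move=> + oD; elim: s N f g => [|i s IH] [|N] f g //= sN sf sg x xD.
rewrite (IH N) //; [|exact: smooth_upto_partial..].
apply: iter_partial_congr xD => // y /set_mem Dy.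
by rewrite deriveD //; [apply: (sf [::] _ y Dy).2|apply: (sg [::] _ y Dy).2].
Qed.

Let smooth_uptoD N D f g : open D ->
  smooth_upto N D f -> smooth_upto N D g -> smooth_upto N D (f + g).
Proof.
move=> oD sf sg s sN.
apply: (@smooth_at_order_congr _ [::] _ _ oD (iter_partialD sN oD sf sg)).
move=> x Dx /=; have [[cf df] [cg dg]] := (sf s sN x Dx, sg s sN x Dx).
by split=> [|i]; [exact: continuousD | exact: derivableD].
Qed.

Let smooth_uptoM N D f g : open D ->
  smooth_upto N D f -> smooth_upto N D g -> smooth_upto N D (f * g).
Proof.
move=> oD; elim: N f g => [|N IH] f g sf sg [|i s] // sN; first 2 last.
- have sf' := smooth_upto_partial i sf; have sg' := smooth_upto_partial i sg.
  have sW h : smooth_upto N.+1 D h -> smooth_upto N D h.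
    by move=> sh t tN; apply: sh; rewrite ltnW.
  apply: (@smooth_at_order_congr _ s (f * 'D_(basis_vec i) g +
      g * 'D_(basis_vec i) f) ('D_(basis_vec i) (f * g)) oD).
    move=> x /set_mem Dx; rewrite deriveM //.
      exact: (sf [::] _ x Dx).2.
    exact: (sg [::] _ x Dx).2.
  have s1 := IH _ _ (sW _ sf) sg'; have s2 := IH _ _ (sW _ sg) sf'.
  exact: (smooth_uptoD oD s1 s2 sN).
all: move=> x Dx /=.
all: have [[cf df] [cg dg]] := (sf [::] isT x Dx, sg [::] isT x Dx).
all: by split=> [|j]; [exact: continuousM | exact: derivableM].
Qed.

Lemma smooth_onD D f g : open D ->
  smooth_on D f -> smooth_on D g -> smooth_on D (f + g).
Proof.
by move=> oD sf sg s; apply: (@smooth_uptoD (size s)) => // t _; auto.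
Qed.

Lemma smooth_onM D f g : open D ->
  smooth_on D f -> smooth_on D g -> smooth_on D (f * g).
Proof.
by move=> oD sf sg s; apply: (@smooth_uptoM (size s)) => // t _; auto.
Qed.

Let derive_cst0 (a : R) i : 'D_(basis_vec i) (cst a) = cst 0.
Proof. by apply/funext => x; rewrite derive_cst. Qed.

Lemma smooth_on_cst D (a : R) : smooth_on D (cst a).
Proof.
move=> s; have [b e] : exists b, iter_partial s (cst a) = cst b.
  elim: s a => [|i s IH] a; first by exists a.
  have [b e] := IH 0; exists b; rewrite -e.
  by rewrite -[RHS]/(iter_partial s (cst 0)) -(derive_cst0 a i).
by move=> x _; rewrite e; split=> [|i]; [exact: cst_continuous | exact: derivable_cst].
Qed.

End SmoothOn.

Section Derivation.
Variables (K A : comPzRingType) (c : K -> A).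
Implicit Types X Y : A -> A^o.

Definition is_derivation : {pred A -> A^o} := fun X =>
  `[< (forall a f g, X (c a * f + g) = c a * X f + X g) /\
      (forall f g, X (f * g) = X f * g + f * X g) >].

Fact derivation_submod_closed : submod_closed is_derivation.
Proof.
split=> [|h X Y /asboolP[Xl XM] /asboolP[Yl YM]]; apply/asboolP.
  split=> [a|] f g.
    by change (0 = c a * 0 + 0 :> A); rewrite mulr0 addr0.
  by change (0 = 0 * g + f * 0 :> A); rewrite mulr0 mul0r addr0.
split=> [a|] f g.
  change (h * X (c a * f + g) + Y (c a * f + g) =
    c a * (h * X f + Y f) + (h * X g + Y g) :> A).
  by rewrite Xl Yl; ring.
change (h * X (f * g) + Y (f * g) =
  (h * X f + Y f) * g + f * (h * X g + Y g) :> A).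
by rewrite XM YM; ring.
Qed.

Fact derivation_bracket X Y : c 1 = 1 ->
  X \in is_derivation -> Y \in is_derivation ->
  (fun f => X (Y f) - Y (X f)) \in is_derivation.
Proof.
move=> c1 /asboolP[Xl XM] /asboolP[Yl YM].
have XD f g : X (f + g) = X f + X g by have := Xl 1 f g; rewrite c1 !mul1r.
have YD f g : Y (f + g) = Y f + Y g by have := Yl 1 f g; rewrite c1 !mul1r.
apply/asboolP; split=> [a|] f g.
  by rewrite !(Xl, Yl); ring.
by rewrite XM YM XD YD !XM !YM; ring.
Qed.

End Derivation.

Section Manifold.
Variables (R : realType) (m : nat).

(* Only the values of [cmap] on [cdom] and of [cinv] on [cmap @` cdom] are
   meaningful. *)
Record chart (M : topologicalType) := Chart {
  cdom : set M;
  cmap : M -> 'rV[R]_m;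
  cinv : 'rV[R]_m -> M;
  cdom_open : open cdom;
  cimage_open : open (cmap @` cdom);
  cmapK : {in cdom, cancel cmap cinv};
  cmap_continuous : {in cdom, continuous cmap};
  cinv_continuous : {in cmap @` cdom, continuous cinv}
}.

Record manifold := Manifold {
  points :> topologicalType;
  atlas : set (chart points);
  atlas_cover : forall p, exists2 c, atlas c & cdom c p;
  atlas_smooth : forall c c', atlas c -> atlas c' -> forall j,
    smooth_on (cmap c @` (cdom c `&` cdom c')) (fun x => cmap c' (cinv c x) 0 j);
  manifold_hausdorff : hausdorff_space points;
  manifold_second_countable : @second_countable points
}.

Variable M : manifold.

Definition smooth : {pred M -> R} := fun f : M -> R =>
  `[< forall c, atlas c -> smooth_on (cmap c @` cdom c) (f \o cinv c) >].

Fact smooth_cst (a : R) : (cst a : M -> R) \in smooth.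
Proof. by apply/asboolP => c _; exact: smooth_on_cst. Qed.

Fact smooth_subring_closed : subring_closed smooth.
Proof.
have mulP f g : f \in smooth -> g \in smooth -> f * g \in smooth.
  move=> /asboolP sf /asboolP sg; apply/asboolP => c ac.
  exact: (smooth_onM (@cimage_open _ c) (sf c ac) (sg c ac)).
split; [exact: (smooth_cst 1) | | exact: mulP].
move=> f g /asboolP sf sg.
have /asboolP sg' := mulP _ _ (smooth_cst (-1)) sg.
apply/asboolP => c ac; rewrite -mulN1r.
exact: (smooth_onD (@cimage_open _ c) (sf c ac) (sg' c ac)).
Qed.

HB.instance Definition _ :=
  GRing.isSubringClosed.Build (M -> R) smooth smooth_subring_closed.

Record Cinf := MkCinf { Cinf_val :> M -> R; Cinf_valP : Cinf_val \in smooth }.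

HB.instance Definition _ := [isSub for Cinf_val].
HB.instance Definition _ := [Choice of Cinf by <:].
HB.instance Definition _ := 
  GRing.SubChoice_isSubComPzRing.Build (M -> R) smooth Cinf smooth_subring_closed.

Definition Cinf_cst (a : R) : Cinf := MkCinf (smooth_cst a).

(* Vector fields on M, as derivations of the algebra C^oo(M). *)
Definition is_vfield : {pred Cinf -> Cinf^o} := is_derivation Cinf_cst.

HB.instance Definition _ :=
  GRing.isSubmodClosed.Build Cinf (Cinf -> Cinf^o) is_vfield
    (derivation_submod_closed Cinf_cst).

Record vfield :=
  MkVfield { vfield_val :> Cinf -> Cinf^o; vfield_valP : vfield_val \in is_vfield }.

HB.instance Definition _ := [isSub for vfield_val].
HB.instance Definition _ := [Choice of vfield by <:].
HB.instance Definition _ := 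
  GRing.SubChoice_isSubLmodule.Build Cinf (Cinf -> Cinf^o) is_vfield vfield
    (derivation_submod_closed Cinf_cst).

Fact bracket_subproof (X Y : vfield) :
  (fun f => X (Y f) - Y (X f)) \in is_vfield.
Proof.
apply: derivation_bracket (vfield_valP X) (vfield_valP Y).
exact: val_inj.
Qed.

Definition bracket (X Y : vfield) : vfield := MkVfield (bracket_subproof X Y).

End Manifold.

Section Forms.
Variables (R : realType) (m : nat) (M : manifold R m).

(* The operators on differential forms are defined on arbitrary functions of k
   vector fields; the forms are singled out by [is_form]. *)
Definition cochain k := ('I_k -> vfield M) -> Cinf M.

HB.instance Definition _ k := GRing.Zmodule.on (cochain k).

Definition is_form k : set (cochain k) := [set w : cochain k |
  (forall X i f Y Z, w [eta X with i |-> f *: Y + Z] =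
     f * w [eta X with i |-> Y] + w [eta X with i |-> Z]) /\
  (forall X i j, i != j -> X i = X j -> w X = 0)].

Definition rscale k (a : R) (w : cochain k) : cochain k :=
  fun X => Cinf_cst M a * w X.

(* Normalized so that (a /\ b)(X, Y) = a(X) b(Y) - a(Y) b(X) on 1-forms. *)
Definition wedge k l (a : cochain k) (b : cochain l) : cochain (k + l) :=
  fun X => \sum_(s : 'S_(k + l))
    Cinf_cst M ((-1) ^+ s / (k`! * l`!)%:R) *
    (a (fun i => X (s (lshift l i))) * b (fun j => X (s (rshift k j)))).

(* The invariant formula, with dw(X, Y) = X w(Y) - Y w(X) - w([X, Y]) on
   1-forms. In the second sum, for i < j, the argument X_j is dropped and X_i is
   replaced by [X_i, X_j]; moving the bracket to the front contributes (-1)^i,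
   which gives the usual sign (-1)^(i + j). *)
Definition extd k (w : cochain k) : cochain k.+1 := fun X =>
  \sum_(i < k.+1) (-1) ^+ i * X i (w (X \o lift i)) +
  \sum_(j < k.+1) \sum_(i < k | (i < j)%N) (-1) ^+ j *
    w [eta X \o lift j with i |-> bracket (X (lift j i)) (X j)].

Definition interior (T : vfield M) k (w : cochain k.+1) : cochain k :=
  fun X => w (fun i => if unlift ord0 i is Some j then X j else T).

Definition lie_derivative (T : vfield M) k (w : cochain k) : cochain k :=
  fun X => T (w X) - \sum_i w [eta X with i |-> bracket T (X i)].

Definition app1 (w : cochain 1) (X : vfield M) : Cinf M := w (fun=> X).

Definition app2 (w : cochain 2) (X Y : vfield M) : Cinf M :=
  w (fun i => if i == ord0 then X else Y).

End Forms.

Section Riemannian.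
Variables (R : realType) (m : nat) (M : manifold R m).
Variable g : vfield M -> vfield M -> Cinf M.

Definition orthonormal_at (p : M) : set ('I_m -> vfield M) :=
  [set E : 'I_m -> vfield M | forall i j, g (E i) (E j) p = (i == j)%:R].

(* The inner product on the k-covectors at p for which the e^I, with I strictly
   increasing and (e_i) an orthonormal basis, are orthonormal; the sum runs over
   all multi-indices, hence the factor 1/k!. *)
Definition form_ip k (a b : cochain M k) (p : M) : R :=
  let E := xget (fun=> 0) (orthonormal_at p) in
  (k`!%:R)^-1 * \sum_(s : {ffun 'I_k -> 'I_m}) a (E \o s) p * b (E \o s) p.

Definition chart_frame_at (c : chart R m M) (p : M) : set ('I_m -> vfield M) :=
  [set X : 'I_m -> vfield M | forall i (f : Cinf M),
    X i f p = 'D_(basis_vec R i) (f \o cinv c) (cmap c p)].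

Definition vol_density (c : chart R m M) (p : M) : R :=
  let X := xget (fun=> 0) (chart_frame_at c p) in
  Num.sqrt (\det (\matrix_(i, j) g (X i) (X j) p)).

(* Integral over R^k as an iterated Lebesgue integral; only used for continuous
   functions with compact support. *)
Fixpoint iterated_integral k : ('rV[R]_k -> R) -> R :=
  match k with
  | 0 => fun F => F 0
  | k'.+1 => fun F => \int[lebesgue_measure]_t
      iterated_integral (fun v : 'rV_k' => F (row_mx (t%:M : 'rV_1) v))
  end.

(* I is the integral against the Riemannian volume measure on smooth functions:
   by a partition of unity, it is determined by linearity and by its values on
   the functions supported in a chart. *)
Definition riemannian_integral (I : (M -> R) -> R) :=
  (forall (a : R) (f h : Cinf M),
     I (fun p => a * f p + h p) = a * I f + I h) /\
  (forall c (f : Cinf M), atlas c ->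
     closure [set p | f p != 0] `<=` cdom c ->
     I f = iterated_integral (fun x => if x \in cmap c @` cdom c
       then f (cinv c x) * vol_density c (cinv c x) else 0)).

Definition pointwise_adjoint k l (A : cochain M k -> cochain M l)
    (B : cochain M l -> cochain M k) :=
  forall b, is_form b -> is_form (B b) /\
    forall a, is_form a -> forall p, form_ip (A a) b p = form_ip a (B b) p.

Definition orthogonal_projection k (E : set (cochain M k))
    (P : cochain M k -> cochain M k) :=
  forall a, is_form a -> E (P a) /\
    forall b, E b -> forall p, form_ip (a - P a) b p = 0.

(* D' : F -> E is the L^2 formal adjoint of D : E -> F. *)
Definition formal_adjoint (I : (M -> R) -> R) k l
    (E : set (cochain M k)) (F : set (cochain M l))
    (D : cochain M k -> cochain M l) (D' : cochain M l -> cochain M k) :=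
  forall b, F b -> E (D' b) /\
    forall a, E a -> I (form_ip (D a) b) = I (form_ip a (D' b)).

(* [dadj] stands for the formal adjoint d^* of d. *)
Definition hodge_laplacian (dadj : forall k, cochain M k.+1 -> cochain M k) k :
    cochain M k -> cochain M k :=
  match k with
  | 0 => fun w => dadj 0 (extd w)
  | j.+1 => fun w => extd (dadj j w) + dadj j.+1 (extd w)
  end.

Definition hodge_ker (dadj : forall k, cochain M k.+1 -> cochain M k) k :
    set (cochain M k) :=
  [set w : cochain M k | is_form w /\ hodge_laplacian dadj w = 0].

End Riemannian.

Section Contact.
Variables (R : realType) (n : nat) (M : manifold R n.*2.+1).
Variables (theta : cochain M 1) (J : {linear vfield M -> vfield M}).
Variable (T : vfield M).

Definition lefschetz k (w : cochain M k) : cochain M k.+2 :=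
  wedge (extd theta) w.

Definition theta_wedge k (w : cochain M k) : cochain M k.+1 := wedge theta w.

Fixpoint dtheta_pow j : cochain M j.*2 :=
  match j with
  | 0 => fun=> 1
  | j'.+1 => lefschetz (@dtheta_pow j')
  end.

Definition contact_form := is_form theta /\
  forall p : M, exists X, theta_wedge (@dtheta_pow n) X p <> 0.

Definition reeb_field :=
  app1 theta T = 1 /\ interior T (extd theta) = 0.

(* The sections of H = Ker theta. *)
Definition contact_sub : set (vfield M) := [set X : vfield M | app1 theta X = 0].

Definition nonzero_at (X : vfield M) (p : M) := exists f : Cinf M, X f p <> 0.

(* The fourth clause is the symmetry implicit in "positive definite". *)
Definition associated_J :=
  [/\ forall X, contact_sub X -> contact_sub (J X),
      forall X, contact_sub X -> J (J X) = - X,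
      J T = 0,
      forall X Y, contact_sub X -> contact_sub Y ->
        app2 (extd theta) X (J Y) = app2 (extd theta) Y (J X)
    & forall X p, contact_sub X -> nonzero_at X p ->
        0 < app2 (extd theta) X (J X) p].

Definition metric (X Y : vfield M) : Cinf M :=
  app2 (extd theta) X (J Y) + app1 theta X * app1 theta Y.

(* A complex vector field X + i Y is encoded as the pair (X, Y). *)
Definition H10 : set (vfield M * vfield M) :=
  [set Z : vfield M * vfield M | [/\ contact_sub Z.1, contact_sub Z.2, J Z.1 = - Z.2 & J Z.2 = Z.1]].

Definition cbracket (Z W : vfield M * vfield M) : vfield M * vfield M :=
  (bracket Z.1 W.1 - bracket Z.2 W.2, bracket Z.1 W.2 + bracket Z.2 W.1).

Definition sasakian :=
  [/\ contact_form, reeb_field, associated_J,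
      forall X, bracket T (J X) = J (bracket T X)
    & forall Z W, H10 Z -> H10 W -> H10 (cbracket Z W)].

Definition horizontal k : set (cochain M k) :=
  [set w : cochain M k | forall X i, X i = T -> w X = 0].

Variable Lam : forall k, cochain M k.+2 -> cochain M k.

(* Lambda vanishes on forms of degree 0 and 1. *)
Definition primitive k : set (cochain M k) :=
  match k with
  | j.+2 => [set w : cochain M j.+2 | Lam w = 0]
  | _ => setT
  end.

Definition rumin_low k : set (cochain M k) :=
  [set w : cochain M k | [/\ is_form w, horizontal w & primitive w]].

Definition rumin_high k : set (cochain M k) :=
  match k with
  | 0 => set0
  | j.+1 => [set theta_wedge v | v in
      [set v : cochain M j | [/\ is_form v, horizontal v & lefschetz v = 0]]]
  end.

Definition rumin_space k : set (cochain M k) :=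
  if (k <= n)%N then @rumin_low k else @rumin_high k.

Variable P : forall k, cochain M k -> cochain M k.
Variable Linv : forall k, cochain M k.+2 -> cochain M k.

Definition db k (w : cochain M k) : cochain M k.+1 :=
  extd w - theta_wedge (interior T (extd w)).

Definition lefschetz_inverse := forall k, k.+1 = n ->
  forall w : cochain M k.+2, is_form w -> horizontal w ->
  [/\ is_form (Linv w), horizontal (Linv w) & lefschetz (Linv w) = w].

(* Only used in degree k = n; for n = 0 the second term is absent since
   L^-1 takes values in forms of degree n - 1. *)
Definition rumin_D k : cochain M k -> cochain M k.+1 :=
  match k with
  | 0 => fun w => theta_wedge (lie_derivative T w)
  | j.+1 => fun w => theta_wedge (lie_derivative T w + db (Linv (db w)))
  end.

Definition dR k (w : cochain M k) : cochain M k.+1 :=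
  if (k < n)%N then P (extd w)
  else if k == n then rumin_D w
  else extd w.

Definition acoef (k : nat) : R :=
  if k == n then 1 else (Num.sqrt `|n%:R - k%:R|)^-1.

Definition dE k (w : cochain M k) : cochain M k.+1 := rscale (acoef k) (dR w).

Variable dEadj : forall k, cochain M k.+1 -> cochain M k.

(* Since a_n = 1, [dE] in degree n is D, and [dEadj] is then D^*. *)
Definition rumin_lap_up k (w : cochain M k) : cochain M k :=
  if k == n then dEadj (dE w) else dEadj (dE (dEadj (dE w))).

Definition rumin_lap_down k : cochain M k -> cochain M k :=
  match k with
  | 0 => fun=> 0
  | j.+1 => fun w =>
      if j == n then dE (dEadj w) else dE (dEadj (dE (dEadj w)))
  end.

Definition rumin_laplacian k (w : cochain M k) : cochain M k :=
  rumin_lap_down w + rumin_lap_up w.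

Definition rumin_ker k : set (cochain M k) :=
  [set w : cochain M k | rumin_space w /\ rumin_laplacian w = 0].

End Contact.

(* Main.v *)
(* On a Sasakian manifold the exterior derivative splits as
     d = d0 + theta /\ L_T + L i_T,
   where d0 = sum_c F_c^* /\ nabla_(F'_c) is the horizontal part for the Tanaka-Webster
   connection. Since J is parallel, d0 and its conjugate d1 by J satisfy the Kaehler
   identities [Lam, d0] = - d1^*, [Lam, d1] = d0^*, d0 d1 + d1 d0 = 0 and
   d0^2 = d1^2 = - L L_T. Hence d0 and d1 have the same Laplacian, and every vanishing
   result is a Bochner type argument with the L^2 norm, for which formal adjoints come
   from the divergence theorem; no Hodge decomposition is needed.
   - If w is harmonic, then L_T w = 0, and pairing the horizontal components of
     dw = d^*w = 0 with the forms themselves shows that w is horizontal and primitive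
     (degree <= n) or theta /\ v with L v = 0 (degree > n); it is closed and coclosed for
     the Rumin complex.
   - If w is closed and coclosed for the Rumin complex in degree k < n, then
     (n - k + 1) d0 w + L d1^* w is primitive, hence orthogonal to d0 w, hence zero; comparing
     the norms of d0 w and d1^* w through the common Laplacian gives d0 w = 0. Degree
     k > n + 1 is dual. In degree n, L_T w = d0 d1^* w is orthogonal to itself, and
     y = d1^* w is killed by the common Laplacian; degree n + 1 is similar. *)
From HB Require Import structures.
From mathcomp Require Import all_boot all_order all_algebra fingroup perm.
From mathcomp Require Import all_classical all_reals all_analysis.
From mathcomp Require Import zify ring lra.
Require Import Defs.
Set Implicit Arguments.
Unset Strict Implicit.
Unset Printing Implicit Defensive.
Import Order.TTheory GRing.Theory Num.Theory.
Import numFieldNormedType.Exports.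
Local Open Scope classical_set_scope.
Local Open Scope ring_scope.

(** * Smooth functions of several variables *)

(** The obstacle is the absence of a global orthonormal frame: vector fields are global derivations
    and forms are tensorial functions of them. Traces are therefore taken over a pair of finite
    global families with [X = sum_c g(X, F'_c) F_c], obtained by gluing Cramer's rule over a finite
    cover; an identity at a point is recovered by testing it on function-linear maps. Expanding a
    derivation in coordinates rests on Hadamard's lemma. The integral is known only through
    linearity and its values on functions supported in a chart, so positivity and the divergence
    theorem are proved chart by chart with a partition of unity. The given [dadj] and [Lam] are
    identified with explicit operators by nondegeneracy of the L^2 product, whereas [dEadj] is never
    computed: only its adjunction on the Rumin spaces is used. The Hodge argument itself is isolated
    over an abstract inner product space whose operators obey the Kaehler identities. *)

Lemma nbhs_forall (T : topologicalType) (K : finType) (P : K -> set T)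
    (x : T) :
  (forall i, nbhs x (P i)) -> nbhs x (fun y => forall i, P i y).
Proof. by move=> nP; exact: (@filter_forall T K P (nbhs x) _ nP). Qed.

Lemma continuous_distP (R : realType) (T : topologicalType) (f : T -> R) (x : T) :
  {for x, continuous f} <->
  (forall e : R, 0 < e -> nbhs x (fun y => `|f x - f y| < e)).
Proof.
split=> [/cvgrPdist_lt cf e /cf //|H].
by apply/cvgrPdist_lt => e e0; exact: H.
Qed.

Lemma rV_continuous (R : realType) k (T : topologicalType) (phi : T -> 'rV[R]_k)
    (x : T) : (forall j, {for x, continuous (fun y => phi y 0 j)}) ->
  {for x, continuous phi}.
Proof.
move=> cphi; apply/cvgrPdist_lt => e e0.
have n : nbhs x (fun y => forall j : 'I_k, `|phi x 0 j - phi y 0 j| < e).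
  by apply: nbhs_forall => j; have /cvgrPdist_lt := cphi j; exact.
apply: filterS n => y xy; rewrite [ltLHS]/Num.Def.normr/= mx_normrE.
by apply/bigmax_ltP; split => // -[i j] _ /=; rewrite ord1 !mxE.
Qed.

Section LineDerivative.
Variables (R : realType) (V : normedModType R).
Implicit Types (f : V -> R) (v y : V).

Lemma is_derive_line f v y (t : R) : derivable f (t *: v + y) v ->
  is_derive t 1 (fun s : R => f (s *: v + y)) ('D_v f (t *: v + y)).
Proof.
have e : (fun h : R => h^-1 *: (f ((h *: 1 + t) *: v + y) - f (t *: v + y))) =
    (fun h => h^-1 *: (f (h *: v + (t *: v + y)) - f (t *: v + y))).
  by apply/funext => h; rewrite [h *: 1]mulr1 scalerDl addrA.
move=> df; split; first by rewrite /derivable /= e.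
by rewrite /derive /= e.
Qed.

(** Either sign of [a] occurs when coordinates are changed one at a time, so the intermediate point
    is only confined by [|t| <= |a|]. *)
Lemma line_MVT f v y (a : R) :
  (forall t : R, `|t| <= `|a| -> derivable f (t *: v + y) v) ->
  exists2 t : R, `|t| <= `|a| &
    f (a *: v + y) - f y = a * 'D_v f (t *: v + y).
Proof.
move=> df; pose g := fun s : R => f (s *: v + y).
pose dg := fun s : R => 'D_v f (s *: v + y).
have ey : f y = g 0 by rewrite /g scale0r add0r.
rewrite ey -[f (a *: v + y)]/(g a).
have dgg (t : R) : `|t| <= `|a| -> is_derive t (1 : R) g (dg t).
  by move=> ta; exact: is_derive_line (df t ta).
have [a0|a0] := lerP 0 a.
  have la t : t \in `[0, a]%R -> `|t| <= `|a|.
    by rewrite in_itv/= => /andP[t0 ta]; rewrite !ger0_norm.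
  have [||c cab ->] := @MVT_segment R g dg 0 a a0.
  - move=> t t01; apply: dgg; apply: la; move: t01.
    by rewrite !in_itv/= => /andP[/ltW -> /ltW ->].
  - apply: derivable_within_continuous => t ta; case: (dgg t (la t ta)) => //.
  exists c; first exact: la.
  by rewrite subr0 mulrC.
have la t : t \in `[a, 0]%R -> `|t| <= `|a|.
  by rewrite in_itv/= => /andP[t0 ta]; rewrite ler0_norm // ltr0_norm // lerN2.
have [||c cab e] := @MVT_segment R g dg a 0 (ltW a0).
- move=> t t01; apply: dgg; apply: la; move: t01.
  by rewrite !in_itv/= => /andP[/ltW -> /ltW ->].
- apply: derivable_within_continuous => t ta; case: (dgg t (la t ta)) => //.
exists c; first exact: la.
rewrite -opprB e sub0r mulrN opprK mulrC //.
Qed.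

End LineDerivative.

Section C1.
Variables (R : realType) (k : nat).
Implicit Types (f : 'rV[R]_k -> R) (D : set 'rV[R]_k).
Local Notation e_ := (basis_vec R).

Lemma rV_norm_lt (v : 'rV[R]_k) (r : R) : 0 < r ->
  (forall i, `|v 0 i| < r) -> `|v| < r.
Proof.
move=> r0 vr; rewrite [ltLHS]/Num.Def.normr/= mx_normrE.
by apply/bigmax_ltP; split => // -[i j] _ /=; rewrite ord1.
Qed.

Lemma rV_norm_ge (v : 'rV[R]_k) i : `|v 0 i| <= `|v|.
Proof.
rewrite [leRHS]/Num.Def.normr/= mx_normrE.
exact: (@le_bigmax _ _ _ _ (fun ij => `|v ij.1 ij.2|) (0, i)).
Qed.

Lemma rV_norm_le (v : 'rV[R]_k) (r : R) : 0 <= r ->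
  (forall i, `|v 0 i| <= r) -> `|v| <= r.
Proof.
move=> r0 vr; rewrite [leLHS]/Num.Def.normr/= mx_normrE.
by apply/bigmax_leP; split => // -[i j] _ /=; rewrite ord1.
Qed.

Definition lin_form (c : 'I_k -> R) (h : 'rV[R]_k) : R := \sum_i h 0 i * c i.

Lemma lin_form_is_linear c : linear (lin_form c).
Proof.
move=> a u v; rewrite /lin_form scaler_sumr -big_split /=.
by apply: eq_bigr => i _; rewrite !mxE mulrDl scalerAl.
Qed.

HB.instance Definition _ c :=
  GRing.isLinear.Build R 'rV[R]_k R *:%R (lin_form c) (lin_form_is_linear c).

Lemma sum_continuous_at (T : topologicalType) n (F : 'I_n -> T -> R) x :
  (forall i, {for x, continuous (F i)}) ->
  {for x, continuous (fun y => \sum_i F i y)}.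
Proof.
move=> cF; rewrite (_ : (fun y => _) = \sum_i F i); last first.
  by apply/funext => y; rewrite fct_sumE.
elim/big_ind : _ => [|f g cf cg|i _]; [exact: cst_continuous| |exact: cF].
exact: continuousD.
Qed.

Lemma lin_form_continuous c : continuous (lin_form c).
Proof.
move=> x; apply: sum_continuous_at => i; apply: continuousM.
  exact: coord_continuous.
exact: cst_continuous.
Qed.

(** The increment is telescoped by switching on one coordinate at a time; each summand is a mean
    value along a coordinate line, where the partial derivative is close to its value at [x]. *)
Lemma C1_diff f D x : open D -> D x ->
  (forall y i, D y -> derivable f y (e_ i)) ->
  (forall i, {for x, continuous ('D_(e_ i) f)}) ->
  differentiable f x /\
  'd f x = lin_form (fun i => 'D_(e_ i) f x) :> ('rV[R]_k -> R).
Proof.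
move=> oD Dx df cf.
have ek (e : R) : 0 < e -> e / k.+1%:R *+ k <= e.
  by move=> e0; rewrite -mulr_natr mulrAC ler_pdivrMr // ler_pM2l // ler_nat.
set L := lin_form _.
have main : (f : 'rV[R]_k -> R^o) \o shift x =
    cst (f x : R^o) + (L : 'rV[R]_k -> R^o) +o_ (0 : 'rV[R]_k) id.
  apply/eqaddoP => e e0.
  (* Each of the [k] summands may cost [e / k.+1]; the successor covers [k = 0]. *)
  have e'0 : 0 < e / k.+1%:R by rewrite divr_gt0.
  have /nbhs_ballP[r /= r0 rD] : nbhs x (fun y => D y /\ forall i,
      `|'D_(e_ i) f x - 'D_(e_ i) f y| < e / k.+1%:R).
    apply: filterI; first exact: open_nbhs_nbhs.
    apply: nbhs_forall => i; have /cvgrPdist_lt := cf i; exact.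
  have nr : nbhs (0 : 'rV[R]_k) (fun h : 'rV[R]_k => `|h| < r).
    apply/nbhs_ballP; exists r => //= y; rewrite -ball_normE /= sub0r normrN.
    exact.
  apply: filterS nr => h hr /=.
  pose hp (j : nat) : 'rV[R]_k := \row_i (if (i < j)%N then h 0 i else 0).
  have hpS (j : 'I_k) : x + hp j.+1 = h 0 j *: e_ j + (x + hp j).
    apply/rowP => i; rewrite !mxE addrCA; congr (_ + _).
    rewrite eqxx /= ltnS [(i <= j)%N]leq_eqVlt -[_ == _ :> nat]/(i == j).
    have [->|ij] := eqVneq i j; first by rewrite ltnn mulr1 addr0.
    by rewrite mulr0 add0r.
  have tele : f (h + x) - f x = \sum_(j < k) (f (x + hp j.+1) - f (x + hp j)).
    rewrite -(big_mkord xpredT (fun j => f (x + hp j.+1) - f (x + hp j))).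
    rewrite telescope_sumr //; congr (f _ - f _).
      by apply/rowP => i; rewrite !mxE ltn_ord addrC.
    by apply/rowP => i; rewrite !mxE addr0.
  have near_x (j : 'I_k) (t : R) : `|t| <= `|h 0 j| ->
      ball x r (t *: e_ j + (x + hp j)).
    move=> th; rewrite -ball_normE /=; apply: rV_norm_lt => // i.
    have -> : x - (t *: e_ j + (x + hp j)) = - (t *: e_ j + hp j).
      by rewrite addrCA opprD addrA subrr sub0r.
    rewrite mxE normrN !mxE eqxx /= (le_lt_trans _ hr) //.
    have [->|ij] := eqVneq i j.
      by rewrite ltnn mulr1 addr0 (le_trans th) ?rV_norm_ge.
    rewrite mulr0 add0r; case: ifP => _; first exact: rV_norm_ge.
    by rewrite normr0.
  rewrite -[(f \o _ - _) h]/(f (h + x) - (f x + L h)) opprD addrA tele.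
  rewrite /L /lin_form -sumrB.
  apply: (@le_trans _ _ (\sum_(j < k) e / k.+1%:R * `|h|)).
    apply: (le_trans (ler_norm_sum _ _ _)); apply: ler_sum => j _.
    rewrite hpS; have [t th ->] := @line_MVT _ _ f (e_ j) (x + hp j) (h 0 j)
      (fun t th => df _ _ (rD _ (near_x j t th)).1).
    rewrite -mulrBr normrM mulrC ler_pM //; last exact: rV_norm_ge.
    by rewrite distrC ltW //; have [_ ] := rD _ (near_x j t th).
  rewrite -mulr_suml sumr_const card_ord ler_wpM2r //.
  exact: ek.
have cL : continuous L by exact: lin_form_continuous.
have dL := diff_unique cL main.
by split => //; apply/diff_locallyP; rewrite dL.
Qed.

End C1.

Lemma derive_line (R : realType) (V U : normedModType R) (f : V -> U) (x v : V) :
  'D_v f x = 'D_1 (fun h : R => f (h *: v + x)) 0.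
Proof.
rewrite /derive; suff -> : (fun h : R => h^-1 *: ((f \o shift x) (h *: v) - f x)) =
    (fun h : R => h^-1 *: (f ((h *: (1 : R) + 0 : R) *: v + x) -
      f ((0 : R) *: v + x))) by [].
by apply/funext => h; rewrite /= addr0 scale0r add0r [h *: 1]mulr1.
Qed.

Section Chain.
Variables (R : realType) (V W : normedModType R).

(** [phi] is only derivable along [v], so the rule is applied to the curve [h |-> phi (h v + x)],
    which is differentiable at 0. *)
Lemma chain_rule (F : W -> R) (phi : V -> W) x v : differentiable F (phi x) ->
  derivable phi x v ->
  is_derive x v (F \o phi) ('d F (phi x) ('D_v phi x)).
Proof.
move=> dF dphi.
pose gam (h : R) := phi (h *: v + x).
have egam : gam 0 = phi x by rewrite /gam scale0r add0r.
have dgam : differentiable gam 0.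
  by apply/derivable1_diffP; apply/(derivable1P phi x v).
have dFg : differentiable F (gam 0) by rewrite egam.
have dc : differentiable (F \o gam) 0 by exact: differentiable_comp.
split; first by apply/derivable1P/derivable1_diffP.
rewrite derive_line -[fun h : R => _]/(F \o gam) deriveE // diff_comp //= egam.
by congr ('d F _ _); rewrite derive_line deriveE.
Qed.

End Chain.

(** * Smoothness from algebras stable under partial derivatives *)

Section SmoothOnLemmas.
Variables (R : realType) (m : nat).
Implicit Types (f g : 'rV[R]_m -> R) (D : set 'rV[R]_m).
Local Notation e_ := (@basis_vec R m).

(** The algebra generated by [G] over the smooth functions on [D]. *)
Inductive alg_closure D (G : set ('rV[R]_m -> R)) : set ('rV[R]_m -> R) :=
| alg_smooth f : smooth_on D f -> alg_closure D G f
| alg_gen f : G f -> alg_closure D G f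
| alg_add f g : alg_closure D G f -> alg_closure D G g ->
    alg_closure D G (f + g)
| alg_mul f g : alg_closure D G f -> alg_closure D G g ->
    alg_closure D G (f * g).

Lemma alg_sum D G n (F : 'I_n -> 'rV[R]_m -> R) :
  (forall i, alg_closure D G (F i)) -> alg_closure D G (\sum_i F i).
Proof.
move=> GF; elim/big_ind : _ => // [|f g]; last exact: alg_add.
by apply: alg_smooth; exact: (@smooth_on_cst R m D 0).
Qed.

(* Coinduction principle: a family whose first partial derivatives stay, on D,
   in the algebra it generates consists of smooth functions. *)
Lemma smooth_alg D G : open D ->
  (forall g, G g -> forall x, D x -> {for x, continuous g} /\
    forall i, derivable g x (e_ i)) ->
  (forall g, G g -> forall i, exists2 h, alg_closure D G h &
    {in D, 'D_(e_ i) g =1 h}) ->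
  forall f, alg_closure D G f -> smooth_on D f.
Proof.
move=> oD G0 G1.
have A0 f : alg_closure D G f -> smooth_at_order D [::] f.
  elim=> {f} [f sf|f Gf|f g _ f0 _ g0|f g _ f0 _ g0] x Dx /=.
  - exact: (sf [::] x Dx).
  - exact: G0.
  - have [[cf df] [cg dg]] := (f0 x Dx, g0 x Dx).
    by split=> [|i]; [exact: continuousD|exact: derivableD].
  - have [[cf df] [cg dg]] := (f0 x Dx, g0 x Dx).
    by split=> [|i]; [exact: continuousM|exact: derivableM].
have A1 f i : alg_closure D G f -> exists2 h, alg_closure D G h &
    {in D, 'D_(e_ i) f =1 h}.
  elim=> {f} [f sf|f Gf|f g Gf [h1 Gh1 e1] Gg [h2 Gh2 e2]
             |f g Gf [h1 Gh1 e1] Gg [h2 Gh2 e2]].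
  - by exists ('D_(e_ i) f) => //; apply: alg_smooth => s; exact: (sf (i :: s)).
  - exact: G1.
  - exists (h1 + h2); first exact: alg_add.
    move=> x /[dup] Dx; rewrite inE => Dx'.
    rewrite deriveD ?e1 ?e2 //; first exact: (A0 f Gf x Dx').2.
    exact: (A0 g Gg x Dx').2.
  - exists (f * h2 + g * h1); first by apply: alg_add; exact: alg_mul.
    move=> x /[dup] Dx; rewrite inE => Dx'.
    rewrite deriveM ?e1 ?e2 //; first exact: (A0 f Gf x Dx').2.
    exact: (A0 g Gg x Dx').2.
move=> f Gf s; elim: s f Gf => [|i s IH] f Gf; first exact: A0.
have [h Gh eh] := A1 f i Gf.
apply: (@smooth_at_order_congr _ _ D s h ('D_(e_ i) f)) => //; last exact: IH.
by move=> x Dx; rewrite eh.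
Qed.

Lemma smooth_on_local D f :
  (forall x, D x -> exists2 D', D' x & smooth_on D' f) -> smooth_on D f.
Proof. by move=> sf s x /sf[D' D'x]; apply. Qed.

Lemma smooth_on_sub D D' f : D `<=` D' -> smooth_on D' f -> smooth_on D f.
Proof. by move=> sD sf s x Dx; exact/sf/sD. Qed.

Lemma smooth_on_congr D f g : open D -> {in D, f =1 g} ->
  smooth_on D f -> smooth_on D g.
Proof. by move=> oD fg sf s; exact: smooth_at_order_congr (sf s). Qed.

Lemma smooth_on_partial D f i : smooth_on D f -> smooth_on D ('D_(e_ i) f).
Proof. by move=> sf s; exact: (sf (i :: s)). Qed.

Lemma smooth_on_continuous D f x : smooth_on D f -> D x ->
  {for x, continuous f}.
Proof. by move=> sf Dx; exact: (sf [::] x Dx).1. Qed.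

Lemma smooth_on_derivable D f x i : smooth_on D f -> D x ->
  derivable f x (e_ i).
Proof. by move=> sf Dx; exact: (sf [::] x Dx).2. Qed.

Lemma smooth_on_diff D f x : open D -> smooth_on D f -> D x ->
  differentiable f x /\
  'd f x = lin_form (fun i => 'D_(e_ i) f x) :> ('rV[R]_m -> R).
Proof.
move=> oD sf Dx; apply: (@C1_diff _ _ f D x oD Dx) => [y i Dy|i].
  exact: smooth_on_derivable.
exact: (smooth_on_continuous (smooth_on_partial i sf)).
Qed.

Lemma is_derive_coord (x v : 'rV[R]_m) j :
  is_derive x v (fun y : 'rV[R]_m => y 0 j) (v 0 j).
Proof.
have dc : differentiable (fun y : 'rV[R]_m => y 0 j) x.
  exact: differentiable_coord.
split; first exact: diff_derivable.
have /derive_mx : derivable (@id 'rV[R]_m) x v by exact: derivable_id.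
by rewrite derive_id => /matrixP /(_ 0 j); rewrite mxE.
Qed.

Lemma smooth_on_coord D j : open D -> smooth_on D (fun y : 'rV[R]_m => y 0 j).
Proof.
move=> oD; apply: (@smooth_alg D [set (fun y : 'rV[R]_m => y 0 j)]) => //.
- move=> _ -> x _; split; first exact: coord_continuous.
  by move=> i; case: (is_derive_coord x (e_ i) j).
- move=> _ -> i; exists (cst ((e_ i) 0 j)).
    by apply: alg_smooth; exact: smooth_on_cst.
  by move=> x _; case: (is_derive_coord x (e_ i) j) => _ ->.
- exact: alg_gen.
Qed.

Lemma smooth_on_comp1 (H : set (R -> R)) (P : set R) D f h :
  (forall h, H h -> exists2 h', H h' & forall t, P t -> is_derive t 1 h (h' t)) ->
  open D -> smooth_on D f -> (forall x, D x -> P (f x)) -> H h ->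
  smooth_on D (h \o f).
Proof.
move=> H1 oD sf Pf Hh.
have der (k k' : R -> R) x i : (forall t, P t -> is_derive t 1 k (k' t)) -> D x ->
    is_derive x (e_ i) (k \o f) (k' (f x) * 'D_(e_ i) f x).
  move=> kk' Dx; have [dk dk'] := kk' _ (Pf x Dx).
  have dfk : differentiable k (f x) by apply/derivable1_diffP.
  apply: is_derive_eq (chain_rule dfk (smooth_on_derivable sf Dx)) _.
  by rewrite diff1E //= derive1E dk'; exact: mulrC.
apply: (@smooth_alg D [set k \o f | k in H]) => //; last first.
- by apply: alg_gen; exists h.
- move=> _ [k Hk <-] i; have [k' Hk' kk'] := H1 k Hk.
  exists ((k' \o f) * 'D_(e_ i) f).
    apply: alg_mul; first by apply: alg_gen; exists k'.
    by apply: alg_smooth; exact: smooth_on_partial.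
  by move=> x; rewrite inE => Dx; case: (der k k' x i kk' Dx) => _ ->.
- move=> _ [k Hk <-] x Dx; have [k' Hk' kk'] := H1 k Hk.
  split; last by move=> i; case: (der k k' x i kk' Dx).
  apply: continuous_comp; first exact: (smooth_on_continuous sf).
  have [dk _] := kk' _ (Pf x Dx).
  by apply: differentiable_continuous; apply/derivable1_diffP.
Qed.

End SmoothOnLemmas.

(** By the chain rule a partial derivative of [K \o phi] is a combination, with smooth coefficients,
    of the functions ['D_j K \o phi], which belong to the same family. *)
Lemma smooth_on_comp (R : realType) m k (D : set 'rV[R]_m) (U : set 'rV[R]_k)
    (F : 'rV[R]_k -> R) (phi : 'rV[R]_m -> 'rV[R]_k) :
  open D -> open U -> smooth_on U F ->
  (forall j, smooth_on D (fun x => phi x 0 j)) ->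
  (forall x, D x -> U (phi x)) -> smooth_on D (F \o phi).
Proof.
move=> oD oU sF sphi DU.
have dphi x v : D x -> derivable phi x (basis_vec R v).
  by move=> Dx; apply/derivable_mxP => i j; rewrite ord1;
    exact: (smooth_on_derivable (sphi j) Dx).
have cphi x : D x -> {for x, continuous phi}.
  move=> Dx; apply: rV_continuous => j.
  exact: (smooth_on_continuous (sphi j) Dx).
have der K x i : smooth_on U K -> D x -> is_derive x (basis_vec R i) (K \o phi)
    (\sum_j 'D_(basis_vec R i) (fun x => phi x 0 j) x *
      'D_(basis_vec R j) K (phi x)).
  move=> sK Dx; have [dK dKe] := smooth_on_diff oU sK (DU x Dx).
  have := chain_rule dK (dphi x i Dx); rewrite dKe /lin_form.
  rewrite derive_mx; last exact: dphi.
  by under eq_bigr do rewrite mxE.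
apply: (@smooth_alg _ _ D [set K \o phi | K in smooth_on U]) => //; last first.
- by apply: alg_gen; exists F.
- move=> _ [K sK <-] i.
  exists (\sum_j 'D_(basis_vec R i) (fun x => phi x 0 j) *
      ('D_(basis_vec R j) K \o phi)).
    apply: alg_sum => j; apply: alg_mul.
      by apply: alg_smooth; exact: smooth_on_partial.
    by apply: alg_gen; exists ('D_(basis_vec R j) K);
      [exact: smooth_on_partial|].
  move=> x; rewrite inE => Dx; case: (der K x i sK Dx) => _ ->.
  by rewrite fct_sumE.
- move=> _ [K sK <-] x Dx; split; last by move=> i; case: (der K x i sK Dx).
  apply: continuous_comp; first exact: cphi.
  exact: (smooth_on_continuous sK (DU x Dx)).
Qed.

(** * Powers and functions flat at the origin *)

Section OneVariableFamilies.
Variable R : realType.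

Lemma smooth_on_powR m (D : set 'rV[R]_m) f a : open D -> smooth_on D f ->
  (forall x, D x -> 0 < f x) -> smooth_on D (fun x => f x `^ a).
Proof.
move=> oD sf f0.
have -> : (fun x => f x `^ a) = (fun t : R => 1 * t `^ a) \o f.
  by apply/funext => x; rewrite /= mul1r.
apply: (@smooth_on_comp1 _ _ [set h | exists c b, h = fun t : R => c * t `^ b]
  [set t | 0 < t]) => //; last by exists 1, a.
move=> _ [c [b ->]]; exists (fun t => (c * b) * t `^ (b - 1)).
  by exists (c * b), (b - 1).
move=> t t0; apply: is_derive_eq (is_deriveZ c (is_derive1_powR b t0)) _.
exact: mulrA.
Qed.

(** A family containing [exp(-1/x)] and stable under differentiation, which sends [p] to
    [X^2 (p - p')]. *)
Definition flat (p : {poly R}) (x : R) : R :=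
  if 0 < x then p.[x^-1] * expR (- x^-1) else 0.

(** Monomial by monomial, from [y^n / n! <= exp y]. *)
Lemma horner_expRN_bound (p : {poly R}) :
  exists2 K : R, 0 <= K & forall y, 0 <= y -> `|p.[y] * expR (- y)| <= K.
Proof.
exists (\sum_(i < size p) `|p`_i| * i`!%:R).
  by apply: sumr_ge0 => i _; rewrite mulr_ge0.
move=> y y0; rewrite horner_coef mulr_suml.
apply: (le_trans (ler_norm_sum _ _ _)); apply: ler_sum => i _.
rewrite -mulrA normrM ler_wpM2l // ger0_norm ?mulr_ge0 ?exprn_ge0 ?expR_ge0 //.
rewrite expRN ler_pdivrMr ?expR_gt0 //.
case: (nat_of_ord i) => [|n].
  by rewrite expr0 fact0 mul1r (le_trans _ (expR_ge1Dx y)) // lerDl.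
rewrite mulrC -ler_pdivrMr ?ltr0n ?fact_gt0 //.
by rewrite (le_trans _ (expR_ge1Dxn n y0)) // lerDr.
Qed.

Lemma is_derive_flat (p : {poly R}) (x : R) :
  is_derive x (1 : R) (flat p) (flat ('X^2 * (p - p^`())) x).
Proof.
have [x0|x0|<-] := ltgtP 0 x.
- have e : (horner p \o GRing.inv) * (expR \o (- GRing.inv)) =
      (fun t => p.[t^-1] * expR (- t^-1)) by [].
  apply: (@near_eq_is_derive _ _ _
    ((horner p \o GRing.inv) * (expR \o (- GRing.inv)))).
    have := @lt_nbhsr R 0 x x0; apply: filterS => t t0.
    by rewrite /flat t0.
  have dinv : is_derive x (1 : R) GRing.inv (- x ^- 2).
    have d := @is_derive_id R R^o x 1.
    split; first by apply: (@derivableV _ _ id) => //; rewrite gt_eqF.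
    by rewrite (@deriveV _ _ id) ?gt_eqF // derive_id scaler1.
  have d1 := @is_derive1_comp R (horner p) GRing.inv x _ _
    (is_derive_poly p x^-1) dinv.
  have d2 := @is_derive1_comp R expR (- GRing.inv) x _ _
    (is_derive_expR _) (is_deriveN dinv).
  apply: is_derive_eq (is_deriveM d1 d2) _.
  rewrite /flat x0 /= hornerM hornerXn !hornerE.
  rewrite -![_ *: _]/(_ * _) -![(- GRing.inv) x]/(- x^-1) exprVn.
  by ring.
- apply: (@near_eq_is_derive _ _ _ (cst 0)).
    have := @lt_nbhsl R x 0 x0; apply: filterS => t t0.
    by rewrite /flat ltNge (ltW t0).
  by apply: is_derive_eq; rewrite /flat ltNge (ltW x0).
(* At 0 the difference quotient is [t] times the value at [t] of [flat ('X^2 * p)], and the latter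
   is bounded. *)
have [K K0 bK] := horner_expRN_bound ('X^2 * p).
have -> : flat ('X^2 * (p - p^`())) 0 = 0 by rewrite /flat ltxx.
suff H : (fun h : R => h^-1 *: (flat p (h *: 1 + 0) - flat p 0)) @ 0^' --> (0:R).
  by split; [apply/cvg_ex; exists 0|apply/cvg_lim].
apply/cvgrPdist_le => e e0.
have n0 : nbhs (0:R) (fun t : R => `|t| < e / (K + 1)).
  apply/nbhs_ballP; exists (e / (K + 1)).
    by rewrite /= divr_gt0 // ltr_wpDl.
  by move=> t /=; rewrite -ball_normE /= sub0r normrN.
apply: nbhs_dnbhs; apply: filterS n0 => t te.
rewrite sub0r normrN addr0 [t *: 1]mulr1 {2}/flat ltxx subr0 /flat.
case: ifPn => [t0|_]; last by rewrite scaler0 normr0 ltW.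
have := bK t^-1; rewrite invr_ge0 (ltW t0) => /(_ isT).
rewrite hornerM hornerXn -mulrA normrM => b.
rewrite -[_ *: _]/(_ * _) normrM.
have -> : `|t^-1| * `|p.[t^-1] * expR (- t^-1)| =
   t * (`|t^-1 ^+ 2| * `|p.[t^-1] * expR (- t^-1)|).
  rewrite mulrA; congr (_ * _); rewrite !gtr0_norm ?exprn_gt0 ?invr_gt0 //.
  by rewrite expr2 mulrA divff ?mul1r // gt_eqF.
move: te; rewrite (gtr0_norm t0) ltr_pdivlMr ?ltr_wpDl // => te.
apply: le_trans (ltW te); rewrite ler_wpM2l ?ltW //.
by rewrite (le_lt_trans b) // ltrDl.
Qed.

Definition hflat : R -> R := flat 1.

Lemma hflat_gt0 x : 0 < x -> 0 < hflat x.
Proof. by move=> x0; rewrite /hflat /flat x0 hornerC mul1r expR_gt0. Qed.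

Lemma hflat_eq0 x : x <= 0 -> hflat x = 0.
Proof. by rewrite leNgt /hflat /flat => /negbTE ->. Qed.

Lemma hflat_ge0 x : 0 <= hflat x.
Proof. by case: (ltP 0 x) => [/hflat_gt0/ltW //|/hflat_eq0 ->]. Qed.

Lemma smooth_on_hflat m (D : set 'rV[R]_m) f : open D -> smooth_on D f ->
  smooth_on D (hflat \o f).
Proof.
move=> oD sf.
have R1 : range flat hflat by exact: (imageT flat 1).
apply: (smooth_on_comp1 (P := setT) _ oD sf _ R1) => // _ [p _ <-].
exists (flat ('X^2 * (p - p^`()))); first exact: imageT.
by move=> t _; exact: is_derive_flat.
Qed.

End OneVariableFamilies.

Section RealIntegrable.
Variables (R : realType) (D : set R).
Hypothesis mD : measurable D.
Let mu := @lebesgue_measure R.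

Lemma integrableDr (f g : R -> R) : mu.-integrable D (EFin \o f) ->
  mu.-integrable D (EFin \o g) -> mu.-integrable D (EFin \o (fun t => f t + g t)).
Proof.
move=> fi gi; rewrite (_ : EFin \o _ = ((EFin \o f) \+ (EFin \o g))%E) //.
exact: integrableD.
Qed.

Lemma integrableZr (a : R) (f : R -> R) : mu.-integrable D (EFin \o f) ->
  mu.-integrable D (EFin \o (fun t => a * f t)).
Proof.
move=> fi.
rewrite (_ : EFin \o _ = (fun t => a%:E * (EFin \o f) t)%E) //.
exact: integrableZl.
Qed.

End RealIntegrable.

(** * Hadamard's lemma *)

Section Hadamard.
Variables (R : realType) (m : nat) (p : 'rV[R]_m) (r : R).
Hypothesis r0 : 0 < r.
Let B := ball p r.
Let mu := @lebesgue_measure R.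

Let pt (t : R) (x : 'rV[R]_m) := t *: (x - p) + p.

Let oB : open B. Proof. exact: ball_open. Qed.

Let pt_in (t : R) (x : 'rV[R]_m) : t \in `[0, 1]%R -> B x -> B (pt t x).
Proof.
rewrite in_itv /= => /andP[t0 t1]; rewrite /B -ball_normE /= => xr.
rewrite /pt opprD addrCA subrr addr0 normrN normrZ ger0_norm //.
by rewrite distrC (le_lt_trans _ xr) // ler_piMl.
Qed.

Let pt_cont (t : R) (x : 'rV[R]_m) : {for (t, x), continuous (fun z : R * 'rV[R]_m => pt z.1 z.2)}.
Proof.
apply: cvgD; last exact: cvg_cst.
apply: cvgZ; first exact: cvg_fst.
by apply: cvgB; [exact: cvg_snd|exact: cvg_cst].
Qed.

(** The weight [t ^+ n] makes the averages [Phi G n] below stable under partial derivatives: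
    differentiating along a coordinate turns [G] into its partial derivative and [n] into [n.+1]. *)
Let phi (G : 'rV[R]_m -> R) (n : nat) (x : 'rV[R]_m) (t : R) :=
  t ^+ n * G (pt t x).

Let phi_cont G n (t : R) (x : 'rV[R]_m) : smooth_on B G -> t \in `[0, 1]%R -> B x ->
  {for (t, x), continuous (fun z : R * 'rV[R]_m => phi G n z.2 z.1)}.
Proof.
move=> sG t01 Bx.
have c1 : {for (t, x), continuous (fun z : R * 'rV[R]_m => z.1 ^+ n)}.
  apply: (@continuous_comp _ _ _ fst (fun t : R => t ^+ n)).
    exact: cvg_fst.
  exact: exprn_continuous.
have c2 : {for (t, x), continuous (fun z : R * 'rV[R]_m => G (pt z.1 z.2))}.
  apply: (@continuous_comp _ _ _ (fun z : R * 'rV[R]_m => pt z.1 z.2) G).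
    exact: pt_cont.
  exact: (smooth_on_continuous sG (pt_in t01 Bx)).
exact: continuousM c1 c2.
Qed.

Let phi_cont1 G n (t : R) (x : 'rV[R]_m) : smooth_on B G -> t \in `[0, 1]%R -> B x ->
  {for t, continuous (phi G n x)}.
Proof.
move=> sG t01 Bx.
apply: (@continuous_comp _ _ _ (fun t : R => (t, x))
  (fun z : R * 'rV[R]_m => phi G n z.2 z.1)); last exact: phi_cont.
by apply: (@cvg_pair _ _ _ (nbhs t) (nbhs t) (nbhs x) _ _ _ id (cst x));
  [exact: cvg_id|exact: cvg_cst].
Qed.

Let I01 : set R := `[0, 1]%classic.

Let mI01 : measurable I01. Proof. exact: measurable_itv. Qed.

Let int01_cst (c : R) : \int[mu]_(t in I01) (cst c t) = c.
Proof.
have e1 : mu I01 = 1%E.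
  by rewrite /mu /I01 lebesgue_measure_itv /= lte_fin ltr01 -EFinB subr0.
rewrite /cst Rintegral_cst // -[RHS]mulr1; congr (_ * _).
exact: (congr1 fine e1).
Qed.

Let phi_within G n (x : 'rV[R]_m) : smooth_on B G -> B x ->
  {within I01, continuous (phi G n x)}.
Proof.
move=> sG Bx; apply: continuous_in_subspaceT => t; rewrite inE /= => t01.
exact: phi_cont1.
Qed.

Let phi_int G n (x : 'rV[R]_m) : smooth_on B G -> B x ->
  mu.-integrable I01 (EFin \o phi G n x).
Proof.
move=> sG Bx; apply: continuous_compact_integrable; first exact: segment_compact.
exact: phi_within.
Qed.

(** Uniformity in [t] comes from the compactness of the segment. *)
Let phi_near G n (x : 'rV[R]_m) (e : R) : smooth_on B G -> B x -> 0 < e ->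
  nbhs x (fun y => forall t, t \in `[0, 1]%R ->
    `|phi G n x t - phi G n y t| < e).
Proof.
move=> sG Bx e0.
have := @segment_compact R 0 1; rewrite compact_near_coveringP => /(_ _ (nbhs x)
  (fun y t => `|phi G n x t - phi G n y t| < e)).
move=> H; suff nA : nbhs x (fun y : 'rV[R]_m => `[0, 1]%classic `<=`
    (fun t => `|phi G n x t - phi G n y t| < e)).
  by apply: filterS nA => y Ay t t01; exact: Ay.
apply: H => t t01.
have /continuous_distP/(_ (e / 2)) := phi_cont (n := n) sG t01 Bx.
have /continuous_distP/(_ (e / 2)) := phi_cont1 (n := n) sG t01 Bx.
rewrite divr_gt0 // => /(_ isT) n1 /(_ isT) n2.
have n1' : nbhs (t, x) (fun z : R * 'rV[R]_m =>
    `|phi G n x t - phi G n x z.1| < e / 2).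
  exact: (@cvg_fst _ _ (nbhs t) (nbhs x) _ _ n1).
have n3 : nbhs (t, x) (fun z : R * 'rV[R]_m =>
    `|phi G n x z.1 - phi G n z.2 z.1| < e); last exact: n3.
apply: filterS (filterI n1' n2) => -[t' y] [/= h1 h2].
rewrite -(subrKA (phi G n x t)) (le_lt_trans (ler_normD _ _)) //.
by rewrite [e]splitr ltrD // distrC.
Qed.

Let Phi G n x := \int[mu]_(t in I01) phi G n x t.

Let Phi_cont G n (x : 'rV[R]_m) : smooth_on B G -> B x -> {for x, continuous (Phi G n)}.
Proof.
move=> sG Bx; apply/continuous_distP => e' e'0.
have [e e0 ee'] : exists2 e : R, 0 < e & e < e'.
  by exists (e' / 2); rewrite ?divr_gt0 // ltr_pdivrMr // ltr_pMr // ltr1n.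
have nB : nbhs x B by apply: open_nbhs_nbhs.
apply: filterS (filterI nB (@phi_near G n x e sG Bx e0)) => y [By xy].
apply: le_lt_trans ee'.
rewrite /Phi -RintegralB //; [|exact: (@phi_int G n x)|exact: (@phi_int G n y)].
have iB : mu.-integrable I01 (EFin \o (fun t => phi G n x t - phi G n y t)).
  rewrite (_ : _ \o _ = (EFin \o phi G n x) \- (EFin \o phi G n y))%E //.
  by apply: integrableB => //;
    [exact: (@phi_int G n x)|exact: (@phi_int G n y)].
apply: (le_trans (le_normr_Rintegral _ iB)) => //.
have -> : e = \int[mu]_(t in I01) (cst e t).
  by rewrite int01_cst.
apply: le_Rintegral => //.
- rewrite (_ : EFin \o _ = abse \o (EFin \o (fun t => phi G n x t - phi G n y t))) //.
  exact: integrable_abse.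
- apply: continuous_compact_integrable; first exact: segment_compact.
  exact: cst_continuous.
- by move=> t t01; rewrite ltW // xy.
Qed.

Let Phi_der G n (x : 'rV[R]_m) i : smooth_on B G -> B x ->
  is_derive x (basis_vec R i) (Phi G n)
    (Phi ('D_(basis_vec R i) G) n.+1 x).
Proof.
move=> sG Bx; set e := basis_vec R i; set dG := 'D_e G.
have sdG : smooth_on B dG by exact: smooth_on_partial.
have cl : {for (0 : R), continuous (fun h : R => h *: e + x)}.
  apply: (@cvgD _ _ _ (nbhs (0:R)) _ (fun h : R => h *: e) (cst x)).
    by apply: cvgZr_tmp; exact: cvg_id.
  exact: cvg_cst.
have nB : nbhs x B by apply: open_nbhs_nbhs.
have nW : nbhs x (fun y : 'rV[R]_m => B y /\ forall t, t \in `[0, 1]%R ->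
    `|phi dG n.+1 x t - phi dG n.+1 y t| < 1).
  by apply: filterI nB _; exact: phi_near.
have /nbhs_ballP[d /= d0 dB] : nbhs (0 : R) (fun h : R => B (h *: e + x) /\
    forall t, t \in `[0, 1]%R ->
      `|phi dG n.+1 x t - phi dG n.+1 (h *: e + x) t| < 1).
  by have := cl _; rewrite scale0r add0r => /(_ _ nW).
have inB (h : R) : h \in `]- d, d[%R -> ball (0 : R) d h.
  by rewrite in_itv /= -ball_normE /= sub0r normrN => hd; rewrite ltr_norml.
pose f (h : R) (t : R) := phi G n (h *: e + x) t.
have der (h t : R) : h \in `]- d, d[%R -> t \in `[0, 1]%R ->
    is_derive h 1 (f ^~ t) (phi dG n.+1 (h *: e + x) t).
  move=> hd t01; have [Bh _] := dB h (inB h hd).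
  have dGp : derivable G (pt t (h *: e + x)) e.
    exact: (smooth_on_derivable sG (pt_in t01 Bh)).
  have [oG eG] := smooth_on_diff oB sG (pt_in t01 Bh).
  have ept : (fun s : R => pt t (s *: e + x)) = fun s => s *: (t *: e) + pt t x.
    by apply/funext => s; rewrite /pt -addrA scalerDr scalerA mulrC -scalerA addrA.
  have dpt : is_derive h (1 : R) (fun s : R => pt t (s *: e + x)) (t *: e).
    rewrite ept.
    have d1 : is_derive h (1 : R) (fun s : R => s *: (t *: e)) (t *: e).
      have dd : differentiable (fun s : R => s *: (t *: e)) h by [].
      split; first exact: diff_derivable.
      by rewrite deriveE // diff_val scale1r.
    have := @is_deriveD _ _ _ _ (cst (pt t x)) _ _ _ _ d1 (is_derive_cst _ _ _).
    by rewrite addr0.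
  have [dpt1 dpt2] := dpt.
  have := chain_rule (phi := fun s : R => pt t (s *: e + x)) oG dpt1.
  rewrite dpt2 linearZ /= => dc.
  have := is_deriveZ (t ^+ n) dc.
  rewrite (_ : (t ^+ n) *: _ = phi dG n.+1 (h *: e + x) t) //.
  rewrite /phi exprSr -![_ *: _]/(_ * _) -mulrA; congr (_ * (_ * _)).
  by rewrite /dG deriveE.
have ud0 : `]- d, d[%classic (0 : R).
  by rewrite /= in_itv /= oppr_lt0 d0.
have ifh (h : R) : `]- d, d[%classic h -> mu.-integrable I01 (EFin \o f h).
  by move=> hd; have [Bh _] := dB h (inB h hd); exact: phi_int.
have df (h t : R) : `]- d, d[%classic h -> I01 t -> derivable (f ^~ t) h 1.
  by move=> hd tI; case: (der h t hd tI).
(* Uniform closeness of the derivative of the integrand to its value at [x] makes this a dominating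
   function for all small [h]. *)
pose K (t : R) := 1 + `|phi dG n.+1 x t|.
have K0 (t : R) : 0 <= K t by rewrite addr_ge0.
have iK : mu.-integrable I01 (EFin \o K).
  apply: continuous_compact_integrable; first exact: segment_compact.
  apply: continuous_in_subspaceT => t; rewrite inE /= => t01.
  apply/continuous_distP => e' e'0.
  have /continuous_distP/(_ e' e'0) := @phi_cont1 dG n.+1 t x sdG t01 Bx.
  apply: filterS => s hs; rewrite /K opprD addrACA subrr add0r.
  exact: le_lt_trans (ler_dist_dist _ _) hs.
have dE (h t : R) : `]- d, d[%classic h -> I01 t ->
    partial1of2 f h t = phi dG n.+1 (h *: e + x) t.
  by move=> hd tI; rewrite partial1of2E; case: (der h t hd tI).
have KG (h t : R) : `]- d, d[%classic h -> I01 t -> `|partial1of2 f h t| <= K t.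
  move=> hd tI; rewrite dE //; have [_ /(_ t tI)] := dB h (inB h hd).
  move=> /ltW lh; rewrite -lerBlDr (le_trans _ lh) // distrC.
  exact: lerB_dist.
have D1 := @derivable_under_integral R _ _ mu f I01 mI01 0 (- d) d ud0 ifh df K
  K0 iK KG.
have D2 := @differentiation_under_integral R _ _ mu f I01 mI01 0 (- d) d ud0 ifh
  df K K0 iK KG.
have eF : (fun h : R => \int[mu]_(t in I01) f h t) = fun h => Phi G n (h *: e + x).
  by [].
rewrite eF in D1 D2; split; first exact/derivable1P.
rewrite derive_line -derive1E D2; apply: eq_Rintegral => t; rewrite inE => tI.
by rewrite (dE 0 t ud0 tI) scale0r add0r.
Qed.

Let Phi_smooth G n : smooth_on B G -> smooth_on B (Phi G n).
Proof.
move=> sG.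
apply: (@smooth_alg _ _ B [set f | exists G n, smooth_on B G /\ f = Phi G n]) => //.
- move=> _ [G' [k [sG' ->]]] x Bx; split; first exact: Phi_cont.
  by move=> i; case: (Phi_der k i sG' Bx).
- move=> _ [G' [k [sG' ->]]] i; exists (Phi ('D_(basis_vec R i) G') k.+1).
    by apply: alg_gen; exists ('D_(basis_vec R i) G'), k.+1; split;
      [exact: smooth_on_partial|].
  by move=> x; rewrite inE => Bx; case: (Phi_der k i sG' Bx).
- by apply: alg_gen; exists G, n.
Qed.

(** The fundamental theorem of calculus along the segment from [p] to [x], with [g i] the average of
    the [i]-th partial derivative over it. This is what makes a derivation at [p] a combination of
    partial derivatives. *)
Lemma hadamard F : smooth_on B F -> exists g : 'I_m -> 'rV[R]_m -> R,
  [/\ forall i, smooth_on B (g i), forall i, g i p = 'D_(basis_vec R i) F p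
    & forall x, B x -> F x = F p + \sum_i (x 0 i - p 0 i) * g i x].
Proof.
move=> sF; exists (fun i => Phi ('D_(basis_vec R i) F) 0).
split=> [i|i|x Bx]; first exact/Phi_smooth/smooth_on_partial.
  rewrite /Phi (_ : (fun t => _) = cst ('D_(basis_vec R i) F p)); last first.
    by apply/funext => t; rewrite /phi expr0 mul1r /pt subrr scaler0 add0r.
  exact: int01_cst.
have dFi i : smooth_on B ('D_(basis_vec R i) F) by exact: smooth_on_partial.
pose f (t : R) := \sum_i (x 0 i - p 0 i) * phi ('D_(basis_vec R i) F) 0 x t.
pose H (t : R) := F (pt t x).
have dH (t : R) : t \in `[0, 1]%R -> is_derive t (1 : R) H (f t).
  move=> t01; have [dF eF] := smooth_on_diff oB sF (pt_in t01 Bx).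
  have dpt : is_derive t (1 : R) (fun s : R => pt s x) (x - p).
    have dd : differentiable (fun s : R => s *: (x - p)) t by [].
    have d1 : is_derive t (1 : R) (fun s : R => s *: (x - p)) (x - p).
      split; first exact: diff_derivable.
      by rewrite deriveE // diff_val scale1r.
    have := @is_deriveD _ _ _ _ (cst p) _ _ _ _ d1 (is_derive_cst _ _ _).
    by rewrite addr0.
  have [dpt1 dpt2] := dpt.
  have := chain_rule (phi := fun s : R => pt s x) dF dpt1.
  rewrite dpt2 eF /lin_form => dc; apply: is_derive_eq dc _.
  by apply: eq_bigr => i _; rewrite !mxE /phi expr0 mul1r.
have cf : {within `[0, 1], continuous f}.
  apply: continuous_in_subspaceT => t; rewrite inE /= => t01.
  apply: sum_continuous_at => i; apply: continuousM; first exact: cst_continuous.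
  exact: phi_cont1.
have cH (t : R) : t \in `[0, 1]%R -> {for t, continuous H}.
  by move=> /dH[dHt _]; apply: differentiable_continuous; apply/derivable1_diffP.
have dLR : derivable_oo_LRcontinuous H 0 1.
  split.
  - by move=> t; rewrite in_itv /= => /andP[t0 t1]; case: (dH t) => //;
      rewrite in_itv /= !ltW.
  - by apply: cvg_at_right_filter; apply: cH; rewrite in_itv /= lexx ler01.
  - by apply: cvg_at_left_filter; apply: cH; rewrite in_itv /= lexx ler01.
have H'f : {in `]0, 1[%R, H^`()%classic =1 f}.
  move=> t; rewrite in_itv /= => /andP[t0 t1]; rewrite derive1E.
  by case: (dH t) => //; rewrite in_itv /= !ltW.
have := continuous_FTC2 ltr01 cf dLR H'f.
rewrite -EFinB => FTC.
have eH : H 1 - H 0 = \int[mu]_(t in I01) f t by rewrite /Rintegral FTC.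
have H1 : H 1 = F x by rewrite /H /pt scale1r subrK.
have H0 : H 0 = F p by rewrite /H /pt scale0r add0r.
rewrite -H1 -H0 -[LHS](subrK (H 0)) addrC; congr (_ + _); rewrite eH /f.
suff S (s : seq 'I_m) : mu.-integrable I01 (EFin \o (fun t => \sum_(i <- s)
     (x 0 i - p 0 i) * phi ('D_(basis_vec R i) F) 0 x t)) /\
   \int[mu]_(t in I01) (\sum_(i <- s)
     (x 0 i - p 0 i) * phi ('D_(basis_vec R i) F) 0 x t) =
   \sum_(i <- s) (x 0 i - p 0 i) * Phi ('D_(basis_vec R i) F) 0 x.
  exact: (S _).2.
elim: s => [|i s [ih1 ih2]].
  split.
    rewrite (_ : EFin \o _ = cst 0%E); first exact: integrable0.
    by apply/funext => t /=; rewrite big_nil.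
  rewrite big_nil (_ : (fun t => _) = cst 0); last first.
    by apply/funext => t; rewrite big_nil.
  by rewrite Rintegral_cst // mul0r.
have ii : mu.-integrable I01 (EFin \o (fun t => (x 0 i - p 0 i) *
    phi ('D_(basis_vec R i) F) 0 x t)).
  by apply: integrableZr => //; exact: phi_int.
have eS : (fun t => \sum_(j <- i :: s)
     (x 0 j - p 0 j) * phi ('D_(basis_vec R j) F) 0 x t) =
   fun t => (x 0 i - p 0 i) * phi ('D_(basis_vec R i) F) 0 x t +
     \sum_(j <- s) (x 0 j - p 0 j) * phi ('D_(basis_vec R j) F) 0 x t.
  by apply/funext => t; rewrite big_cons.
rewrite eS big_cons; split.
  exact: integrableDr ii ih1.
rewrite RintegralD // ih2; congr (_ + _).
by rewrite RintegralZl //; exact: phi_int.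
Qed.

End Hadamard.

(** * Iterated integrals of compactly supported continuous functions *)

Section CompactlySupported.
Variable R : realType.
Let mu := @lebesgue_measure R.

(** The norm is the sup norm, so slices keep the same radius. *)
Definition supp_cont k (r : R) (F : 'rV[R]_k -> R) :=
  continuous F /\ forall x, r < `|x| -> F x = 0.

Definition cons_row k (t : R) (v : 'rV[R]_k) : 'rV[R]_k.+1 :=
  \row_i oapp (fun j => v 0 j) t (unlift ord0 i).

Lemma cons_row0 k t (v : 'rV[R]_k) : cons_row t v 0 ord0 = t.
Proof. by rewrite mxE unlift_none. Qed.

Lemma cons_rowS k t (v : 'rV[R]_k) j : cons_row t v 0 (lift ord0 j) = v 0 j.
Proof. by rewrite mxE liftK. Qed.

Lemma row_mx_cons k t (v : 'rV[R]_k) : row_mx (t%:M : 'rV_1) v = cons_row t v.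
Proof.
apply/rowP => i; rewrite !mxE; case: splitP => [j|j] /= e.
  have -> : i = ord0 by apply: val_inj; rewrite /= e [j]ord1.
  by rewrite unlift_none /= [j]ord1 mxE.
have -> : i = lift ord0 j by apply: val_inj.
by rewrite liftK.
Qed.

Lemma cons_row_norm k t (v : 'rV[R]_k) (r : R) : 0 <= r ->
  (`|cons_row t v| <= r) = (`|t| <= r) && (`|v| <= r).
Proof.
move=> r0; apply/idP/andP => [H|[tr vr]].
  split; first by rewrite -(cons_row0 t v) (le_trans (rV_norm_ge _ _)).
  apply: rV_norm_le => // j.
  by rewrite -(cons_rowS t v j) (le_trans (rV_norm_ge _ _)).
apply: rV_norm_le => // i; case: (unliftP ord0 i) => [j|] ->.
  by rewrite cons_rowS (le_trans (rV_norm_ge _ _)).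
by rewrite cons_row0.
Qed.

Lemma cons_rowB k s t (v w : 'rV[R]_k) :
  cons_row s v - cons_row t w = cons_row (s - t) (v - w).
Proof.
apply/rowP => i; case: (unliftP ord0 i) => [j|] ->.
  by rewrite !mxE liftK /= !mxE.
by rewrite !mxE unlift_none.
Qed.

Lemma cons_row_line0 k (s t : R) (v : 'rV[R]_k) :
  cons_row (s + t) v = s *: basis_vec R ord0 + cons_row t v.
Proof.
apply/rowP => i; case: (unliftP ord0 i) => [j|] ->.
  by rewrite !mxE liftK /= mulr0 add0r.
by rewrite !mxE unlift_none /= mulr1.
Qed.

Lemma cons_row_lineS k (s t : R) (v : 'rV[R]_k) j :
  cons_row t (s *: basis_vec R j + v) =
  s *: basis_vec R (lift ord0 j) + cons_row t v.
Proof.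
apply/rowP => i; case: (unliftP ord0 i) => [l|] ->.
  by rewrite !mxE liftK /= !mxE /= (inj_eq lift_inj).
by rewrite !mxE unlift_none /= mulr0 add0r.
Qed.

Lemma cons_row_continuous k t : continuous (@cons_row k t).
Proof.
move=> v; apply: rV_continuous => i; case: (unliftP ord0 i) => [j|] ->.
  rewrite (_ : (fun y => _) = fun y : 'rV[R]_k => y 0 j).
    exact: coord_continuous.
  by apply/funext => y; rewrite cons_rowS.
rewrite (_ : (fun y => _) = cst t); first exact: cst_continuous.
by apply/funext => y; rewrite cons_row0.
Qed.

Lemma supp_cont_slice k r (F : 'rV[R]_k.+1 -> R) t : 0 <= r ->
  supp_cont r F -> supp_cont r (fun v : 'rV_k => F (cons_row t v)).
Proof.
move=> r0 [cF sF]; split=> [v|v rv].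
  by apply: continuous_comp; [exact: cons_row_continuous|exact: cF].
by apply: sF; rewrite ltNge cons_row_norm // negb_and -!ltNge rv orbT.
Qed.

Lemma supp_cont_lin k r a (F G : 'rV[R]_k -> R) : supp_cont r F ->
  supp_cont r G -> supp_cont r (fun x => a * F x + G x).
Proof.
move=> [cF sF] [cG sG]; split=> [x|x rx]; last by rewrite sF // sG // mulr0 addr0.
rewrite (_ : (fun y => _) = cst a * F + G) //; apply: continuousD; last exact: cG.
by apply: continuousM; [exact: cst_continuous|exact: cF].
Qed.

Lemma supp_cont_unif k r (F : 'rV[R]_k -> R) (e : R) : supp_cont r F -> 0 < e ->
  exists2 d : R, 0 < d & forall x y, `|x - y| < d -> `|F x - F y| < e.
Proof.
move=> [cF sF] e0.
(* The margin 1 handles points outside the compact set: if [|x| > r + 1] and [|x - y| < 1], both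
   values vanish. *)
have cK : compact [set x : 'rV[R]_k | `|x| <= r + 1].
  apply: bounded_closed_compact.
    exists (r + 1); split; first exact: num_real.
    by move=> M rM x /= /le_trans; apply; rewrite ltW.
  rewrite (_ : [set x | _] = (@Num.norm R 'rV[R]_k) @^-1` [set t | t <= r + 1]) //.
  apply: closed_comp => [x _|]; first exact: norm_continuous.
  exact: closed_le.
move: cK; rewrite compact_near_coveringP => /(_ R 0^'+
  (fun d x => forall y, `|x - y| < d -> `|F x - F y| < e) _) cK.
suff /cK : forall x : 'rV[R]_k, [set x : 'rV[R]_k | `|x| <= r + 1] x ->
   \forall x' \near x & d \near 0^'+,
     forall y, `|x' - y| < d -> `|F x' - F y| < e.
  move=> nd; have n1 : \forall d \near 0^'+, (d : R) < 1 by exact: nbhs_right_lt.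
  have n0 : \forall d \near 0^'+, 0 < (d : R) by exact: nbhs_right_gt.
  have [d [dK [d1 d0]]] := @filter_ex _ _ (at_right_proper_filter 0) _
    (filterI nd (filterI n1 n0)).
  exists d => // x y xy; have [xr|xr] := leP `|x| (r + 1); first exact: dK.
  rewrite sF; last by rewrite (le_lt_trans _ xr) // lerDl.
  rewrite sF ?subr0 ?normr0 //.
  have h : `|x| - `|y| <= `|x - y| by exact: lerB_dist.
  by move: h xy d1 xr; lra.
move=> x _; have e20 : 0 < e / 2 by rewrite divr_gt0.
have /continuous_distP/(_ _ e20)/nbhs_ballP[d /= d0 dF] := cF x.
have nx : nbhs x (ball x (d / 2)) by apply: nbhsx_ballx; rewrite divr_gt0.
have nd : \forall d' \near 0^'+, (d' : R) < d / 2.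
  by apply: nbhs_right_lt; rewrite divr_gt0.
exists (ball x (d / 2), [set d' : R | d' < d / 2]); first by split.
move=> [x' d'] [/= xx' dd'] y x'y.
rewrite -(subrKA (F x)) (le_lt_trans (ler_normD _ _)) // [e]splitr ltrD //.
  rewrite distrC; apply: dF; apply: le_ball xx'.
  by rewrite ler_pdivrMr // ler_pMr // ler1n.
apply: dF; rewrite [d]splitr; apply: ball_triangle xx' _.
by rewrite -ball_normE /=; exact: lt_trans x'y dd'.
Qed.

Lemma supp_integrable (h : R -> R) (r : R) : continuous h ->
  (forall t, r < `|t| -> h t = 0) -> mu.-integrable setT (EFin \o h).
Proof.
move=> ch sh.
have i1 : mu.-integrable `[- r, r] (EFin \o h).
  apply: continuous_compact_integrable; first exact: segment_compact.
  exact: continuous_subspaceT.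
have := (@integrable_mkcond _ _ _ mu _ (EFin \o h)
  (measurable_itv `[- r, r])).1 i1.
rewrite (_ : (EFin \o h) \_ _ = EFin \o h) //.
apply/funext => t; rewrite patchE; case: ifPn => // /negP.
rewrite inE /= in_itv /= -ler_norml => /negP; rewrite -ltNge => rt.
by rewrite sh.
Qed.

Lemma supp_Rintegral (h : R -> R) (r : R) : (forall t, r < `|t| -> h t = 0) ->
  \int[mu]_t h t = \int[mu]_(t in `[- r, r]) h t.
Proof.
move=> sh; rewrite [RHS]Rintegral_mkcond; congr Rintegral.
apply/funext => t; rewrite patchE; case: ifPn => // /negP.
rewrite inE /= in_itv /= -ler_norml => /negP; rewrite -ltNge => rt.
by rewrite sh.
Qed.

Lemma itv_measure (r : R) : 0 < r -> fine (mu `[- r, r]) = 2 * r.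
Proof.
move=> r0; rewrite /mu lebesgue_measure_itv /= lte_fin gtrN //.
by rewrite -EFinB /= opprK mulr2n mulrDl mul1r.
Qed.

Lemma supp_Rintegral_bound (h : R -> R) (r M : R) : 0 < r -> continuous h ->
  (forall t, r < `|t| -> h t = 0) -> (forall t, `|h t| <= M) ->
  `|\int[mu]_t h t| <= 2 * r * M.
Proof.
move=> r0 ch sh hM; rewrite (supp_Rintegral sh).
have mI : measurable (`[- r, r] : set R) by exact: measurable_itv.
have i1 : mu.-integrable `[- r, r] (EFin \o h).
  apply: continuous_compact_integrable; first exact: segment_compact.
  exact: continuous_subspaceT.
apply: (le_trans (le_normr_Rintegral _ i1)) => //.
have <- : \int[mu]_(t in `[- r, r]) (cst M t) = 2 * r * M.
  by rewrite /cst Rintegral_cst // mulrC -(itv_measure r0).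
apply: le_Rintegral => //.
- rewrite (_ : EFin \o _ = abse \o (EFin \o h)) //; exact: integrable_abse.
- apply: continuous_compact_integrable; first exact: segment_compact.
  exact: continuous_subspaceT (@cst_continuous _ _ M).
Qed.

(** The two clauses are proved together by induction on [k]: linearity and the sup bound in
    dimension [k] make the slice integrals continuous and compactly supported, hence integrable,
    which is needed in dimension [k.+1]. *)
Definition iterated_spec k (r : R) :=
  (forall a F G, supp_cont r F -> supp_cont r G ->
    iterated_integral (fun x : 'rV[R]_k => a * F x + G x) =
    a * iterated_integral F + iterated_integral G) /\
  (forall F (M : R), supp_cont r F -> (forall x : 'rV[R]_k, `|F x| <= M) ->
    `|iterated_integral F| <= (2 * r) ^+ k * M).

Section Slices.
Variables (k : nat) (r : R) (F : 'rV[R]_k.+1 -> R).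
Hypotheses (spec : iterated_spec k r) (r0 : 0 < r) (cF : supp_cont r F).
Let sl t (v : 'rV[R]_k) := F (cons_row t v).
Let h t := iterated_integral (sl t).

Lemma iterated_integralS : iterated_integral F = \int[mu]_t h t.
Proof.
congr Rintegral; apply/funext => t; congr iterated_integral.
by apply/funext => v; rewrite row_mx_cons.
Qed.

Lemma slice_supp t : r < `|t| -> h t = 0.
Proof.
move=> rt; apply/eqP; rewrite -normr_le0.
have [_ bound] := spec.
have sC : supp_cont r (sl t) by apply: supp_cont_slice => //; exact: ltW.
rewrite (le_trans (bound (sl t) 0 sC _)) ?mulr0 // => v.
rewrite /sl cF.2 ?normr0 // ltNge (cons_row_norm _ _ (ltW r0)) negb_and.
by rewrite -!ltNge rt.
Qed.

Lemma slice_dist s t (e : R) : (forall v, `|sl s v - sl t v| <= e) ->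
  `|h s - h t| <= (2 * r) ^+ k * e.
Proof.
move=> He; have [lin bound] := spec.
have sC u : supp_cont r (sl u) by apply: supp_cont_slice => //; exact: ltW.
have -> : h s - h t = iterated_integral (fun v => -1 * sl t v + sl s v).
  by rewrite (lin (-1) (sl t) (sl s) (sC t) (sC s)) mulN1r addrC.
apply: bound; first exact: supp_cont_lin.
by move=> v; rewrite mulN1r addrC.
Qed.

Lemma cons_row_dist (s t : R) (v : 'rV[R]_k) :
  `|cons_row s v - cons_row t v| <= `|s - t|.
Proof. by rewrite cons_rowB subrr cons_row_norm // lexx normr0 normr_ge0. Qed.

Lemma slice_continuous : continuous h.
Proof.
move=> s; apply/continuous_distP => e e0.
pose C := (2 * r) ^+ k + 1.
have C0 : 0 < C by rewrite ltr_wpDl // exprn_ge0 // mulr_ge0 // ltW.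
have eC0 : 0 < e / C by rewrite divr_gt0.
have [d d0 dF] := supp_cont_unif cF eC0.
apply: filterS (nbhsx_ballx s d d0) => t; rewrite -ball_normE /= => st.
apply: (le_lt_trans (slice_dist (e := e / C) _)).
  by move=> v; rewrite ltW // dF // (le_lt_trans (cons_row_dist _ _ _)).
by rewrite mulrCA gtr_pMr // ltr_pdivrMr // mul1r /C ltrDl.
Qed.

Lemma slice_integrable : mu.-integrable setT (EFin \o h).
Proof. exact: supp_integrable slice_continuous slice_supp. Qed.

End Slices.

Lemma iterated_integralP k (r : R) : 0 < r -> iterated_spec k r.
Proof.
move=> r0; elim: k => [|k spec].
  by split=> [a F G _ _ //|F M _ FM /=]; rewrite expr0 mul1r.
have [lin bound] := spec.
split=> [a F G cF cG|F M cF FM].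
  have iF := slice_integrable spec r0 cF; have iG := slice_integrable spec r0 cG.
  rewrite !iterated_integralS -RintegralZl //.
  rewrite -RintegralD //; last exact: integrableZr.
  congr Rintegral; apply/funext => t; rewrite -lin //;
    by apply: supp_cont_slice => //; exact: ltW.
have M0 : 0 <= M by exact: le_trans (normr_ge0 _) (FM 0).
rewrite iterated_integralS (le_trans (supp_Rintegral_bound
  (M := (2 * r) ^+ k * M) r0 (slice_continuous spec r0 cF)
  (slice_supp spec r0 cF) _)) // => [t|].
  by apply: bound; [apply: supp_cont_slice => //; exact: ltW|move=> v; exact: FM].
by rewrite mulrA exprS.
Qed.

Lemma iterated_integral_ge0 k (F : 'rV[R]_k -> R) : (forall x, 0 <= F x) ->
  0 <= iterated_integral F.
Proof.
elim: k F => [|k IH] F F0 /=; first exact: F0.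
by apply: Rintegral_ge0 => t _; exact: IH.
Qed.

(** By induction the slice through [x0] has positive integral [h t0]; by continuity [h] stays above
    half of it on an interval of length [d]. *)
Lemma iterated_integral_gt0 k (r : R) (F : 'rV[R]_k -> R) x0 : 0 < r ->
  supp_cont r F -> (forall x, 0 <= F x) -> 0 < F x0 -> 0 < iterated_integral F.
Proof.
move=> r0; elim: k F x0 => [|k IH] F x0 cF F0 Fx.
  by rewrite /= (_ : 0 = x0) //; apply/rowP => -[].
rewrite iterated_integralS; set h := fun t => _.
pose t0 := x0 0 ord0; pose v0 : 'rV_k := \row_j x0 0 (lift ord0 j).
have e0 : x0 = cons_row t0 v0.
  apply/rowP => i; case: (unliftP ord0 i) => [j|] ->.
    by rewrite cons_rowS mxE.
  by rewrite cons_row0.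
have h0 t : 0 <= h t by apply: iterated_integral_ge0.
have ht0 : 0 < h t0.
  apply: (IH _ v0); rewrite ?e0 -?e0 //.
  by apply: supp_cont_slice => //; exact: ltW.
have spec := iterated_integralP k r0.
have ch : continuous h by exact: slice_continuous spec r0 cF.
have ht2 : 0 < h t0 / 2 by rewrite divr_gt0.
have /continuous_distP/(_ _ ht2)/nbhs_ballP[d /= d0 dh] := ch t0.
pose J : set R := `[t0 - d / 2, t0 + d / 2]%classic.
have mJ : measurable J by exact: measurable_itv.
have ih : mu.-integrable setT (EFin \o h) by exact: slice_integrable spec r0 cF.
have iJ : mu.-integrable J (EFin \o h) by exact: integrableS ih.
have le1 : \int[mu]_(t in J) h t <= \int[mu]_t h t.
  rewrite [leLHS]Rintegral_mkcond; apply: le_Rintegral => //.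
    by have := (@integrable_mkcond _ _ _ mu _ (EFin \o h) mJ).1 iJ;
      rewrite -restrict_EFin.
  move=> t _; rewrite patchE; case: ifP => // _; exact: h0.
apply: lt_le_trans le1.
apply: (@lt_le_trans _ _ (\int[mu]_(t in J) (cst (h t0 / 2) t))).
  rewrite /cst Rintegral_cst // mulr_gt0 //.
  have -> : fine (mu J) = d.
    rewrite /mu /J lebesgue_measure_itv /= lte_fin ltrD2l gtrN ?divr_gt0 //.
    by rewrite -EFinB /= opprD opprK addrACA subrr add0r -splitr.
  by [].
apply: le_Rintegral => //.
  apply: continuous_compact_integrable; first exact: segment_compact.
  exact: continuous_subspaceT (@cst_continuous _ _ _).
move=> t; rewrite /J /= in_itv /= => /andP[t1 t2].
have /dh : ball t0 d t.
  rewrite -ball_normE /= ltr_norml; apply/andP; split; first by move: t2 d0; lra.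
  by move: t1 d0; lra.
by rewrite ltr_norml => /andP[_]; rewrite ltrBlDl -ltrBlDr => /ltW; move: ht0; lra.
Qed.

(** For a later coordinate the slices are treated by induction. For the first one, the slice
    integral of [F] has derivative the slice integral of [G], by the mean value theorem and the
    uniform continuity of [G], and the fundamental theorem leaves only boundary terms. *)
Lemma iterated_integral_partial k (r : R) (F G : 'rV[R]_k -> R) i : 0 < r ->
  supp_cont r F -> supp_cont r G ->
  (forall x, is_derive x (basis_vec R i) F (G x)) ->
  iterated_integral G = 0.
Proof.
move=> r0; elim: k F G i => [|k IH] F G i cF cG dF; first by case: i dF.
rewrite iterated_integralS; case: (unliftP ord0 i) dF => [j|] -> dF.
  transitivity (\int[mu]_t (cst 0 t)); last by rewrite /cst Rintegral_cst // mul0r.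
  congr Rintegral; apply/funext => t.
  apply: (IH (fun v => F (cons_row t v)) _ j).
  - by apply: supp_cont_slice => //; exact: ltW.
  - by apply: supp_cont_slice => //; exact: ltW.
  move=> v; have [d1 d2] := dF (cons_row t v).
  have e : (fun s : R => s^-1 *: (F (cons_row t (s *: basis_vec R j + v)) -
      F (cons_row t v))) = (fun s : R => s^-1 *:
      (F (s *: basis_vec R (lift ord0 j) + cons_row t v) - F (cons_row t v))).
    by apply/funext => s; rewrite cons_row_lineS.
  by split; [rewrite /derivable /= e|rewrite /derive /= e].
pose h t := iterated_integral (fun v : 'rV_k => F (cons_row t v)).
pose g t := iterated_integral (fun v : 'rV_k => G (cons_row t v)).
rewrite -[fun t => _]/g.
have slF t : supp_cont r (fun v : 'rV_k => F (cons_row t v)).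
  by apply: supp_cont_slice => //; exact: ltW.
have slG t : supp_cont r (fun v : 'rV_k => G (cons_row t v)).
  by apply: supp_cont_slice => //; exact: ltW.
have spec := iterated_integralP k r0; have [lin bound] := spec.
have dh t : is_derive t (1 : R) h (g t).
  suff H : (fun s : R => s^-1 *: (h (s *: 1 + t) - h t)) @ 0^' --> g t.
    by split; [apply/cvg_ex; exists (g t)|apply/cvg_lim].
  apply/cvgrPdist_le => e e0.
  pose C := (2 * r) ^+ k + 1.
  have C0 : 0 < C by rewrite ltr_wpDl // exprn_ge0 // mulr_ge0 // ltW.
  have eC0 : 0 < e / C by rewrite divr_gt0.
  have [d d0 dG] := supp_cont_unif cG eC0.
  have nd : nbhs (0 : R) (fun s : R => `|s| < d).
    apply/nbhs_ballP; exists d => //= s; rewrite -ball_normE /= sub0r normrN.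
    by [].
  have nd0 : (0 : R)^' (fun s : R => `|s| < d /\ s != 0).
    exact: (filterS (fun s sd s0 => conj sd s0) nd).
  apply: filterS nd0 => s [sd s0].
  rewrite [s *: 1]mulr1 -[_ *: _]/(_ * _).
  have -> : g t - s^-1 * (h (s + t) - h t) = iterated_integral (fun v : 'rV_k =>
      - s^-1 * (-1 * F (cons_row t v) + F (cons_row (s + t) v)) +
      G (cons_row t v)).
    rewrite lin //; last exact: supp_cont_lin.
    by rewrite lin // -/(h _) -/(h _) -/(g _); ring.
  apply: (@le_trans _ _ ((2 * r) ^+ k * (e / C))).
    apply: bound.
      by apply: supp_cont_lin => //; exact: supp_cont_lin.
    move=> v; rewrite cons_row_line0.
    have dFx u : derivable F (u *: basis_vec R ord0 + cons_row t v)
        (basis_vec R ord0) by case: (dF (u *: basis_vec R ord0 + cons_row t v)).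
    have [u us E] := @line_MVT _ _ F (basis_vec R ord0) (cons_row t v) s
      (fun u _ => dFx u).
    rewrite mulN1r [- F _ + _]addrC E.
    have [_ ->] := dF (u *: basis_vec R ord0 + cons_row t v).
    rewrite mulNr mulrA mulVf // mul1r addrC ltW //; apply: dG.
    rewrite -cons_row_line0 (le_lt_trans (cons_row_dist _ _ _)) //.
    by rewrite opprD addrC subrK normrN (le_lt_trans us).
  rewrite mulrCA ger_pMr // ler_pdivrMr // mul1r /C lerDl //.
have cg : continuous g by exact: slice_continuous spec r0 cG.
(* Slices are known to vanish only for [|t| > r]; the interval [[-(r + 1), r + 1]] is chosen so that
   the boundary values are 0. *)
have gs : forall t, r + 1 < `|t| -> g t = 0.
  by move=> t rt; apply: (slice_supp spec r0 cG); apply: lt_trans rt; rewrite ltrDl.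
rewrite (supp_Rintegral gs).
have ch t : {for t, continuous h}.
  by have [dht _] := dh t; apply: differentiable_continuous; apply/derivable1_diffP.
have dLR : derivable_oo_LRcontinuous h (- (r + 1)) (r + 1).
  split.
  - by move=> t _; case: (dh t).
  - by apply: cvg_at_right_filter; exact: ch.
  - by apply: cvg_at_left_filter; exact: ch.
have h'g : {in `]- (r + 1), (r + 1)[%R, h^`()%classic =1 g}.
  by move=> t _; rewrite derive1E; case: (dh t).
have r1 : - (r + 1) < r + 1 by move: r0; lra.
have cgs : {within `[- (r + 1), (r + 1)], continuous g}.
  exact: continuous_subspaceT.
have hend (t : R) : `|t| = r + 1 -> h t = 0.
  by move=> et; apply: (slice_supp spec r0 cF); rewrite et ltrDl.
have rn : `|r + 1| = r + 1 by rewrite ger0_norm //; move: r0; lra.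
rewrite /Rintegral (continuous_FTC2 r1 cgs dLR h'g) hend // hend ?normrN //.
by rewrite subee.
Qed.

End CompactlySupported.

Lemma dist_continuous (R : realType) (V : normedModType R) (x0 : V) :
  continuous (fun x => `|x0 - x|).
Proof.
move=> x; apply: cvg_norm; apply: cvgB; [exact: cvg_cst|exact: cvg_id].
Qed.

(** * Smooth functions and vector fields on a manifold *)

Section SmoothFunctions.
Variables (R : realType) (m : nat) (M : manifold R m).
Implicit Types (f g : Cinf M) (c : chart R m M) (U D K : set M) (p q : M).

Lemma Cinf_eq f g : (forall p, f p = g p) -> f = g.
Proof. by move=> fg; apply: val_inj; apply/funext. Qed.

Lemma CinfD f g p : (f + g : Cinf M) p = f p + g p. Proof. by []. Qed.
Lemma CinfM f g p : (f * g : Cinf M) p = f p * g p. Proof. by []. Qed.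
Lemma CinfN f p : (- f : Cinf M) p = - f p. Proof. by []. Qed.
Lemma Cinf0 p : (0 : Cinf M) p = 0. Proof. by []. Qed.
Lemma Cinf1 p : (1 : Cinf M) p = 1. Proof. by []. Qed.
Lemma CinfC (a : R) p : Cinf_cst M a p = a. Proof. by []. Qed.
Lemma Cinf_sum (I : Type) (s : seq I) (P : pred I) (F : I -> Cinf M) p :
  (\sum_(i <- s | P i) F i) p = \sum_(i <- s | P i) F i p.
Proof. by elim/big_rec2 : _ => // i x y _ <-. Qed.
Lemma Cinf_prod (I : Type) (s : seq I) (P : pred I) (F : I -> Cinf M) p :
  (\prod_(i <- s | P i) F i) p = \prod_(i <- s | P i) F i p.
Proof. by elim/big_rec2 : _ => // i x y _ <-. Qed.
Lemma CinfX f n p : (f ^+ n) p = f p ^+ n.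
Proof. by elim: n => [|n IH]; rewrite ?expr0 // !exprS CinfM IH. Qed.

Definition CinfE := (CinfD, CinfM, CinfN, Cinf0, Cinf1, CinfC, Cinf_sum,
  Cinf_prod, CinfX).

Lemma Cinf_smooth_on f c : atlas c ->
  smooth_on (cmap c @` cdom c) (f \o cinv c).
Proof. by move=> ac; have /asboolP := Cinf_valP f; exact. Qed.

Lemma chart_cinv c q : cdom c q -> cinv c (cmap c q) = q.
Proof. by move=> cq; apply: cmapK; rewrite inE. Qed.

Lemma chart_image_open c U : open U -> open (cmap c @` (cdom c `&` U)).
Proof.
move=> oU; rewrite openE => _ [q [cq Uq] <-].
have nV : nbhs (cmap c q) (cmap c @` cdom c).
  by apply: open_nbhs_nbhs; split; [exact: cimage_open|exists q].
have cc : {for cmap c q, continuous (cinv c)}.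
  by apply: cinv_continuous; rewrite inE; exists q.
have nU : nbhs (cmap c q) (cinv c @^-1` U).
  by apply: cc; rewrite chart_cinv //; apply: open_nbhs_nbhs.
apply: filterS (filterI nV nU) => _ [[q' cq' <-] Uq'].
by exists q' => //; split => //; move: Uq'; rewrite /= chart_cinv.
Qed.

Lemma Cinf_continuous f : continuous f.
Proof.
move=> q; have [c ac cq] := atlas_cover q.
have cf : {for cmap c q, continuous (f \o cinv c)}.
  by apply: (smooth_on_continuous (Cinf_smooth_on f ac)); exists q.
have cm : {for q, continuous (cmap c)} by apply: cmap_continuous; rewrite inE.
have cfm : {for q, continuous ((f \o cinv c) \o cmap c)}.
  exact: continuous_comp cm cf.
apply/continuous_distP => e e0.
have nc : nbhs q (cdom c) by apply: open_nbhs_nbhs; split => //; exact: cdom_open.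
move/continuous_distP : cfm => /(_ e e0) n1.
by apply: filterS (filterI nc n1) => q' [cq']; rewrite /= !chart_cinv.
Qed.

Lemma open_gt f (a : R) : open [set q | a < f q].
Proof. by apply: (@open_comp _ _ f [set t | a < t]) => [x _|];
  [exact: Cinf_continuous|exact: open_gt]. Qed.

Lemma closed_ge f (a : R) : closed [set q | a <= f q].
Proof. by apply: (@closed_comp _ _ f [set t | a <= t]) => [x _|];
  [exact: Cinf_continuous|exact: closed_ge]. Qed.

(** Smoothness is local: on [D] the extension is [F] read in the chart, on the complement of [K] it
    is 0, and these two open sets cover [M]. *)
Lemma ext0_smooth c D K (F : 'rV[R]_m -> R) : atlas c -> open D ->
  D `<=` cdom c -> closed K -> K `<=` D -> smooth_on (cmap c @` D) F ->
  (forall q, D q -> ~ K q -> F (cmap c q) = 0) ->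
  (fun q => if q \in D then F (cmap c q) else 0) \in @smooth R m M.
Proof.
move=> ac oD Dc cK KD sF F0; apply/asboolP => c' ac'.
apply: smooth_on_local => _ [q cq' <-].
have [Dq|nDq] := pselect (D q).
  exists (cmap c' @` (cdom c' `&` D)); first by exists q.
  have oD' := @chart_image_open c' D oD.
  have oDm : open (cmap c @` D).
    by rewrite (_ : D = cdom c `&` D); [exact: chart_image_open|
      apply/esym/setIidPr].
  apply: (@smooth_on_congr _ _ _ (F \o (cmap c \o cinv c'))) => //.
    move=> x; rewrite inE => -[q' [cq'' Dq'] <-] /=.
    by rewrite chart_cinv // mem_set.
  apply: (smooth_on_comp oD' oDm sF) => [j|_ [q' [cq'' Dq'] <-]].
    apply: smooth_on_sub (atlas_smooth ac' ac j) => _ [q' [c1 D1] <-].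
    by exists q' => //; split => //; exact: Dc.
  by rewrite /= chart_cinv //; exists q'.
have oK : open (~` K) by exact: closed_openC.
exists (cmap c' @` (cdom c' `&` ~` K)).
  by exists q => //; split => // /KD.
apply: (@smooth_on_congr _ _ _ (cst 0)).
- exact: chart_image_open.
- move=> x; rewrite inE => -[q' [cq'' nK] <-] /=; rewrite chart_cinv //.
  by case: ifPn => //; rewrite inE => Dq'; rewrite F0.
- exact: smooth_on_cst.
Qed.

(** In the chart the function is [hflat] of [s^2 - |x - x0|^2]. It is nonzero only on the image [K]
    of a closed ball, which is compact, hence closed since [M] is Hausdorff. *)
Lemma bump_exists p U c : atlas c -> cdom c p -> open U -> U p ->
  exists2 b : Cinf M, 0 < b p /\ (forall q, 0 <= b q) &
  exists2 K, closed K & K `<=` cdom c `&` U /\ forall q, b q != 0 -> K q.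
Proof.
move=> ac cp oU Up; set x0 := cmap c p.
pose D := cdom c `&` U.
have oD : open D by apply: openI => //; exact: cdom_open.
have oV := @chart_image_open c U oU.
have [r /= r0 rV] : exists2 r : R, 0 < r & ball x0 r `<=` cmap c @` D.
  have : nbhs x0 (cmap c @` D) by apply: open_nbhs_nbhs; split => //; exists p.
  by case/nbhs_ballP => r /= r0 rV; exists r.
pose s := r / 2; have s0 : 0 < s by rewrite divr_gt0.
have sr : s < r by rewrite /s; move: r0; lra.
(* The Euclidean square is smooth, unlike the sup norm, and dominates the square of the sup norm. *)
pose rho (x : 'rV[R]_m) := \sum_j (x 0 j - x0 0 j) ^+ 2.
pose F (x : 'rV[R]_m) := hflat (s ^+ 2 - rho x).
have srho E : open E -> smooth_on E rho.
  move=> oE; rewrite (_ : rho = \sum_j (fun x : 'rV[R]_m => (x 0 j - x0 0 j) ^+ 2));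
    last by apply/funext => x; rewrite fct_sumE.
  elim/big_ind : _ => [|f g|j _]; first exact: (@smooth_on_cst R m E 0).
    exact: smooth_onD.
  rewrite (_ : (fun x => _) = ((fun x : 'rV[R]_m => x 0 j) + cst (- x0 0 j)) *
    ((fun x : 'rV[R]_m => x 0 j) + cst (- x0 0 j))) //.
  by apply: smooth_onM => //; apply: smooth_onD => //;
    [exact: smooth_on_coord|exact: smooth_on_cst|exact: smooth_on_coord|
     exact: smooth_on_cst].
have rho0 x : rho x < s ^+ 2 -> `|x0 - x| < s.
  move=> rs; apply: rV_norm_lt => // j; rewrite !mxE distrC.
  rewrite ltNge; apply/negP => sx; move: rs; rewrite ltNge => /negP; apply.
  apply: (@le_trans _ _ ((x 0 j - x0 0 j) ^+ 2)).
    rewrite -(real_normK (num_real (x 0 j - x0 0 j))).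
    by apply: lerXn2r; rewrite ?nnegrE // ltW.
  rewrite /rho (bigD1 j) //= lerDl.
  by apply: sumr_ge0 => i _; exact: sqr_ge0.
have F0 x : F x != 0 -> `|x0 - x| < s.
  move=> Fx; apply: rho0; rewrite -subr_gt0 ltNge; apply/negP => /hflat_eq0 e.
  by move: Fx; rewrite /F e eqxx.
pose C := [set x : 'rV[R]_m | `|x0 - x| <= s].
have CV : C `<=` cmap c @` D.
  by move=> x xs; apply: rV; rewrite -ball_normE /=; exact: le_lt_trans xs sr.
pose K := cinv c @` C.
have cK : closed K.
  apply: compact_closed; first exact: manifold_hausdorff.
  apply: continuous_compact.
    apply: continuous_in_subspaceT => x; rewrite inE => /CV [q [cq _] <-].
    by apply: cinv_continuous; rewrite inE; exists q.
  apply: bounded_closed_compact.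
    exists (`|x0| + s); split; first exact: num_real.
    move=> N hN x /= xs; rewrite (le_trans _ (ltW hN)) //.
    rewrite -[x](subKr x0) (le_trans (ler_normB _ _)) // lerD2l //.
  rewrite (_ : C = (fun x : 'rV[R]_m => `|x0 - x|) @^-1` [set t | t <= s]) //.
  apply: closed_comp => [x _|]; last exact: closed_le.
  exact: dist_continuous.
have KD : K `<=` D.
  by move=> _ [x /CV [q [cq Uq] <-] <-]; rewrite chart_cinv.
have sb : (fun q => if q \in D then F (cmap c q) else 0) \in @smooth R m M.
  apply: (@ext0_smooth c D K) => //.
  - by move=> q [].
  - apply: (@smooth_on_hflat _ _ _ (fun x => s ^+ 2 - rho x)) => //.
    rewrite (_ : (fun x => _) = cst (s ^+ 2) + cst (-1) * rho); last first.
      by apply/funext => x; rewrite !fctE mulN1r.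
    apply: smooth_onD => //; first exact: smooth_on_cst.
    by apply: smooth_onM => //; [exact: smooth_on_cst|exact: srho].
  - move=> q [cq Uq] nK; apply/eqP; case: eqP => // /eqP/F0 h.
    by case: nK; exists (cmap c q); [exact: ltW|rewrite chart_cinv].
exists (MkCinf sb).
  split=> /= [|q].
    rewrite mem_set // /F hflat_gt0 // subr_gt0 /rho big1 ?exprn_gt0 // => j _.
    by rewrite subrr expr0n.
  by case: ifP => // _; exact: hflat_ge0.
exists K => //; split=> // q /=.
case: ifPn => [|_]; last by rewrite eqxx.
rewrite inE => -[cq Uq] /F0 h.
by exists (cmap c q); [exact: ltW|rewrite chart_cinv].
Qed.

Lemma Cinf_hflat_subproof f : (@hflat R \o f) \in @smooth R m M.
Proof.
apply/asboolP => c ac.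
exact: (@smooth_on_hflat _ _ _ (f \o cinv c) (@cimage_open _ _ _ c)
  (Cinf_smooth_on f ac)).
Qed.
Definition Cinf_hflat f : Cinf M := MkCinf (Cinf_hflat_subproof f).

Lemma Cinf_powR_subproof f (a : R) : (forall p, 0 < f p) ->
  (fun p => f p `^ a) \in @smooth R m M.
Proof.
move=> f0; apply/asboolP => c ac.
by apply: (@smooth_on_powR _ _ _ (f \o cinv c) a (@cimage_open _ _ _ c)
  (Cinf_smooth_on f ac)) => x _; exact: f0.
Qed.
Definition Cinf_powR f (a : R) (f0 : forall p, 0 < f p) : Cinf M :=
  MkCinf (Cinf_powR_subproof a f0).

Lemma Cinf_inv f : (forall p, 0 < f p) -> exists2 g, f * g = 1 & forall p, 0 < g p.
Proof.
move=> f0; exists (Cinf_powR (-1) f0) => [|p /=]; last exact: powR_gt0.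
apply: Cinf_eq => p; rewrite CinfM /= powR_inv1 ?ltW //.
by rewrite divff // gt_eqF.
Qed.

(** The quotient [hflat b / (hflat b + hflat (t - b))], whose denominator is everywhere positive. *)
Lemma Cinf_cutoff (b : Cinf M) (t : R) : 0 < t ->
  exists chi : Cinf M, (forall q, t <= b q -> chi q = 1) /\
    (forall q, b q <= 0 -> chi q = 0).
Proof.
move=> t0; pose h1 := Cinf_hflat b; pose h2 := Cinf_hflat (Cinf_cst M t - b).
have h12 q : 0 < (h1 + h2) q.
  rewrite CinfE /=; have [bq|bq] := ltP 0 (b q).
    by rewrite ltr_wpDr ?hflat_ge0 // hflat_gt0.
  by rewrite ltr_wpDl ?hflat_ge0 // hflat_gt0 // subr_gt0 (le_lt_trans bq).
have [g hg _] := Cinf_inv h12; exists (h1 * g).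
have e q : (h1 + h2) q * g q = 1 by rewrite -CinfM hg.
split=> q bq; move: (e q); rewrite !CinfE /=.
  by rewrite [hflat (t - _)]hflat_eq0 ?subr_le0 // addr0.
by rewrite [hflat (b q)]hflat_eq0 // mul0r.
Qed.

End SmoothFunctions.

(** * Vector fields as derivations; coordinate frames *)

Section VectorFields.
Variables (R : realType) (m : nat) (M : manifold R m).
Implicit Types (f g : Cinf M) (X Y : vfield M) (c : chart R m M) (p q : M).

Lemma vfield_eq X Y : (forall f, X f = Y f) -> X = Y.
Proof. by move=> XY; apply: val_inj; apply/funext. Qed.

Lemma vfieldP X : (forall a f g, X (Cinf_cst M a * f + g) =
    Cinf_cst M a * X f + X g) /\ (forall f g, X (f * g) = X f * g + f * X g).
Proof. by have /asboolP := vfield_valP X. Qed.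

Lemma vfM X f g : X (f * g) = X f * g + f * X g.
Proof. exact: (vfieldP X).2. Qed.

Lemma Cinf_cst1 : Cinf_cst M 1 = 1. Proof. exact: val_inj. Qed.

Lemma vfD X f g : X (f + g) = X f + X g.
Proof. by have := (vfieldP X).1 1 f g; rewrite Cinf_cst1 !mul1r. Qed.

Lemma vf0 X : X 0 = 0.
Proof. by have := vfD X 0 0; rewrite addr0 => /eqP; rewrite -subr_eq subrr => /eqP. Qed.

Lemma vfN X f : X (- f) = - X f.
Proof. by apply/eqP; rewrite -addr_eq0 -vfD addrC subrr vf0. Qed.

Lemma vfB X f g : X (f - g) = X f - X g.
Proof. by rewrite vfD vfN. Qed.

Lemma vf1 X : X 1 = 0.
Proof.
have := vfM X 1 1; rewrite !mulr1 mul1r => /eqP.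
by rewrite -subr_eq subrr => /eqP.
Qed.

Lemma vfC X (a : R) : X (Cinf_cst M a) = 0.
Proof.
have := (vfieldP X).1 a 1 0; rewrite mulr1 !addr0 vf1 vf0 mulr0 addr0; exact.
Qed.

Lemma vf_sum X (I : Type) (s : seq I) (P : pred I) (F : I -> Cinf M) :
  X (\sum_(i <- s | P i) F i) = \sum_(i <- s | P i) X (F i).
Proof. by elim/big_rec2 : _ => [|i x y _ <-]; rewrite ?vf0 // vfD. Qed.

Lemma vfieldDE X Y f : (X + Y : vfield M) f = X f + Y f. Proof. by []. Qed.
Lemma vfieldNE X f : (- X : vfield M) f = - X f. Proof. by []. Qed.
Lemma vfieldZE g X f : (g *: X : vfield M) f = g * X f. Proof. by []. Qed.
Lemma bracketE X Y f : bracket X Y f = X (Y f) - Y (X f). Proof. by []. Qed.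
Lemma vfield_sumE (I : Type) (s : seq I) (P : pred I) (F : I -> vfield M) f :
  (\sum_(i <- s | P i) F i) f = \sum_(i <- s | P i) F i f.
Proof. by elim/big_rec2 : _ => // i x y _ <-. Qed.

(** A bump function [b] at [q] supported in [U] gives [b (f - g) = 0]; the Leibniz rule for [X]
    isolates [b q] times the difference of [X f] and [X g] at [q]. *)
Lemma vfield_local X f g (U : set M) q : open U -> U q ->
  (forall q', U q' -> f q' = g q') -> X f q = X g q.
Proof.
move=> oU Uq fg; have [c ac cq] := atlas_cover q.
have [b [b0 _] [K _ [KU bK]]] := bump_exists ac cq oU Uq.
have e : b * (f - g) = 0.
  apply: Cinf_eq => q'; rewrite !CinfE.
  have [->|/bK/KU[_ Uq']] := eqVneq (b q') 0; first by rewrite mul0r.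
  by rewrite fg // subrr mulr0.
have := congr1 (fun h : Cinf M => X h q) e; rewrite vf0 vfM vfB !CinfE fg //.
rewrite subrr mulr0 add0r => /eqP; rewrite mulf_eq0 gt_eqF //= subr_eq0.
by move/eqP.
Qed.

(** The cutoff [chi] lets the partial derivative be extended by 0 outside the chart. *)
Lemma coord_vfield_exists c (chi : Cinf M) (K : set M) i : atlas c ->
  closed K -> K `<=` cdom c -> (forall q, chi q != 0 -> K q) ->
  exists X : vfield M, forall f q, cdom c q ->
    X f q = chi q * 'D_(basis_vec R i) (f \o cinv c) (cmap c q).
Proof.
move=> ac cK Kc chiK.
pose F (f : Cinf M) := (chi \o cinv c) * 'D_(basis_vec R i) (f \o cinv c).
have FE f q : cdom c q -> F f (cmap c q) =
    chi q * 'D_(basis_vec R i) (f \o cinv c) (cmap c q).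
  by move=> cq; rewrite /F -[LHS]/(_ * _) /= chart_cinv.
have sF f : (fun q => if q \in cdom c then F f (cmap c q) else 0)
    \in @smooth R m M.
  apply: (@ext0_smooth _ _ _ c (cdom c) K) => //.
  - exact: cdom_open.
  - apply: smooth_onM; first exact: cimage_open.
      exact: Cinf_smooth_on.
    exact/smooth_on_partial/Cinf_smooth_on.
  - move=> q cq nK; rewrite FE //; have [->|/chiK //] := eqVneq (chi q) 0.
    by rewrite mul0r.
pose X0 (f : Cinf M) : Cinf M := MkCinf (sF f).
have der f q : cdom c q ->
    derivable (f \o cinv c) (cmap c q) (basis_vec R i).
  move=> cq; apply: (smooth_on_derivable (Cinf_smooth_on f ac)).
  by exists q.
have X0P : X0 \in @is_vfield R m M.
  apply/asboolP; split=> [a f g|f g]; apply: Cinf_eq => q; rewrite !CinfE /=.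
    case: ifPn => [|_]; last by rewrite mulr0 addr0.
    rewrite inE => cq; rewrite !FE //.
    have -> : (Cinf_cst M a * f + g : Cinf M) \o cinv c =
      a *: (f \o cinv c) + (g \o cinv c) by [].
    rewrite deriveD; [|by apply: derivableZ; exact: der|exact: der].
    rewrite deriveZ; last exact: der.
    by rewrite mulrDr -[_ *: _]/(_ * _); ring.
  case: ifPn => [|_]; last by rewrite mul0r mulr0 addr0.
  rewrite inE => cq; rewrite !FE //.
  have -> : (f * g : Cinf M) \o cinv c = (f \o cinv c) * (g \o cinv c) by [].
  rewrite deriveM; [|exact: der|exact: der].
  by rewrite -![_ *: _]/(_ * _) /= chart_cinv //; ring.
exists (MkVfield X0P) => f q cq /=.
by rewrite mem_set // FE.
Qed.

Definition frame_on c (W : set M) (xi : 'I_m -> Cinf M) (X : 'I_m -> vfield M) :=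
  [/\ forall q, W q -> forall i f,
        X i f q = 'D_(basis_vec R i) (f \o cinv c) (cmap c q),
      forall q, W q -> forall i j, X i (xi j) q = (i == j)%:R
    & forall q, W q -> forall (Y : vfield M) f,
        Y f q = \sum_i Y (xi i) q * X i f q].

(** The substantial point is the last clause of [frame_on]: by Hadamard's lemma [f] minus [f q] is,
    near [q], a sum of products of [xi i - xi i q] with smooth functions, and a derivation at [q]
    sees only the values of the latter at [q]. *)
Lemma frame_exists p : exists c W K, exists b : Cinf M,
  exists (xi : 'I_m -> Cinf M) (X : 'I_m -> vfield M),
  [/\ atlas c, open W, closed K, K `<=` W & W `<=` cdom c] /\
  [/\ forall q, 0 <= b q, 0 < b p, forall q, b q != 0 -> K q & frame_on c W xi X].
Proof.
have [c ac cp] := atlas_cover p; exists c.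
have [beta [b0 bge0] [C cC [CU bC]]] :=
  bump_exists ac cp openT (I : [set: M] p).
have {}CU : C `<=` cdom c by move=> q /CU[].
(* With [beta p = 3 t], the nested regions [beta > 2 t], [beta >= 2 t] and [beta > t] carry [b], [K]
   and [W]; [chi] is 1 on the last. *)
pose t := beta p / 3; have t0 : 0 < t by rewrite divr_gt0.
have [chi [chi1 chi0]] := Cinf_cutoff beta t0.
pose W := [set q | t < beta q]; pose K := [set q | 2 * t <= beta q].
have oW : open W by exact: open_gt.
have cK : closed K by exact: closed_ge.
have chiC q : chi q != 0 -> C q.
  move=> /eqP h; apply: bC; apply/eqP => bq; apply: h.
  by apply: chi0; rewrite bq.
have Wc : W `<=` cdom c.
  by move=> q tq; apply/CU/bC; rewrite gt_eqF // (lt_trans t0).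
have KW : K `<=` W by move=> q; rewrite /K /W /=; move: t0; lra.
have chiW q : W q -> chi q = 1 by move=> /ltW; exact: chi1.
have sx j : (fun q => if q \in cdom c then
    ((chi \o cinv c) * (fun x : 'rV[R]_m => x 0 j)) (cmap c q) else 0)
    \in @smooth R m M.
  apply: (@ext0_smooth _ _ _ c (cdom c) C) => //.
  - exact: cdom_open.
  - apply: smooth_onM; first exact: cimage_open.
      exact: Cinf_smooth_on.
    by apply: smooth_on_coord; exact: cimage_open.
  - move=> q cq nC; rewrite -[LHS]/(_ * _) /= chart_cinv //.
    have [->|/chiC //] := eqVneq (chi q) 0; by rewrite mul0r.
pose xi j : Cinf M := MkCinf (sx j).
have xiE j q : W q -> xi j q = cmap c q 0 j.
  move=> Wq; rewrite /= mem_set; last exact: Wc.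
  by rewrite -[LHS]/(_ * _) /= chart_cinv ?chiW ?mul1r //; exact: Wc.
have [X XE] : exists X : 'I_m -> vfield M, forall i f q, cdom c q ->
    X i f q = chi q * 'D_(basis_vec R i) (f \o cinv c) (cmap c q).
  have XS i := cid (coord_vfield_exists i ac cC CU chiC).
  by exists (fun i => projT1 (XS i)) => i f q cq; rewrite (projT2 (XS i)).
have XW i f q : W q ->
    X i f q = 'D_(basis_vec R i) (f \o cinv c) (cmap c q).
  by move=> Wq; rewrite XE ?chiW ?mul1r //; exact: Wc.
have nW q : W q -> nbhs (cmap c q) (cmap c @` W).
  move=> Wq; apply: open_nbhs_nbhs; split; last by exists q.
  rewrite (_ : W = cdom c `&` W); first exact: chart_image_open.
  exact/esym/setIidPr.
have Xxi i j q : W q -> X i (xi j) q = (i == j)%:R.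
  move=> Wq; rewrite XW //.
  have -> : 'D_(basis_vec R i) (xi j \o cinv c) (cmap c q) =
      'D_(basis_vec R i) (fun x : 'rV[R]_m => x 0 j) (cmap c q).
    apply: near_eq_derive; apply: filterS (nW q Wq) => _ [q' Wq' <-] /=.
    rewrite chart_cinv; last exact: Wc.
    exact: xiE.
  have [_ ->] := is_derive_coord (cmap c q) (basis_vec R i) j.
  by rewrite !mxE eqxx /= eq_sym.
exists W, K, (Cinf_hflat (beta - Cinf_cst M (2 * t))), xi, X; split => //.
split=> [q||q|]; first exact: hflat_ge0.
- rewrite /= hflat_gt0 // /t; move: b0 => /=.
  by rewrite -[X in _ -> _ < X]/(beta p - 2 * (beta p / 3)); lra.
- rewrite /= => h; rewrite /K /= leNgt; apply/negP => bq; move/eqP: h; apply.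
  by apply: hflat_eq0; rewrite -[X in X <= _]/(beta q - 2 * t) subr_le0 ltW.
split=> [q Wq i f|q Wq i j|q Wq Y f]; [exact: XW|exact: Xxi|].
pose x0 := cmap c q.
have [r /= r0 rW] : exists2 r : R, 0 < r & ball x0 r `<=` cmap c @` W.
  by have /nbhs_ballP[r /= r0 rW] := nW q Wq; exists r.
pose B := ball x0 r.
have sB : smooth_on B (f \o cinv c).
  apply: smooth_on_sub (Cinf_smooth_on f ac) => x /rW[q' /Wc cq' <-].
  by exists q'.
have [g [sg gp gE]] := hadamard sB.
pose U := W `&` (cmap c @^-1` B).
have oU : open U.
  rewrite openE => q' [Wq' Bq']; apply: filterI; first exact: open_nbhs_nbhs.
  have cm : {for q', continuous (cmap c)}.
    by apply: cmap_continuous; rewrite inE; exact: Wc.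
  by apply: cm; apply: open_nbhs_nbhs; split => //; exact: ball_open.
have Uq : U q by split => //; exact: ballxx.
have [eta [eta0 _] [N cN [NU etaN]]] := bump_exists ac (Wc q Wq) oU Uq.
have sG i : (fun q => if q \in U then ((eta \o cinv c) * g i) (cmap c q) else 0)
    \in @smooth R m M.
  apply: (@ext0_smooth _ _ _ c U N) => //.
  - by move=> q' [/Wc].
  - by move=> q' /NU[].
  - have Uc : U `<=` cdom c by move=> q' [/Wc].
    apply: smooth_onM.
    + rewrite (_ : U = cdom c `&` U); first exact: chart_image_open.
      exact/esym/setIidPr.
    + by apply: smooth_on_sub (Cinf_smooth_on eta ac) => _ [q' /Uc cq' <-]; exists q'.
    + by apply: smooth_on_sub (sg i) => _ [q' [_ Bq'] <-].
  - move=> q' [/Wc cq' _] nN; rewrite -[LHS]/(_ * _) /= chart_cinv //.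
    have [->|/etaN //] := eqVneq (eta q') 0; by rewrite mul0r.
pose G i : Cinf M := MkCinf (sG i).
have GE i q' : U q' -> G i q' = eta q' * g i (cmap c q').
  by move=> Uq'; rewrite /= mem_set // -[LHS]/(_ * _) /= chart_cinv //; case: Uq' => /Wc.
(* Multiplication by [eta] turns the local identity into one between global functions, to which [Y]
   applies. *)
have key : eta * (f - Cinf_cst M (f q)) =
    \sum_i (xi i - Cinf_cst M (xi i q)) * G i.
  apply: Cinf_eq => q'; rewrite !CinfE.
  have [Uq'|nU] := pselect (U q'); last first.
    have -> : eta q' = 0.
      by apply/eqP; case: eqP => // /eqP/etaN/NU[].
    have G0 i : G i q' = 0 by rewrite /= (memNset nU).
    by rewrite mul0r big1 // => i _; rewrite CinfM G0 mulr0.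
  have [Wq' Bq'] := Uq'.
  have e := gE _ Bq'; rewrite /= !chart_cinv in e; [|exact: Wc..].
  rewrite e [f q + _]addrC addrK mulr_sumr; apply: eq_bigr => i _.
  by rewrite !CinfE GE // !xiE //; ring.
have := congr1 (fun h : Cinf M => Y h q) key.
rewrite vf_sum Cinf_sum vfM vfB vfC !CinfE subrr mulr0 add0r subr0.
have term i : Y ((xi i - Cinf_cst M (xi i q)) * G i) q =
    eta q * (Y (xi i) q * X i f q).
  rewrite vfM vfB vfC subr0 CinfD !CinfM CinfD CinfN CinfC subrr mul0r addr0.
  by rewrite GE // gp XW // mulrCA.
rewrite (eq_bigr _ (fun i _ => term i)) -mulr_sumr.
by move/(mulfI (lt0r_neq0 eta0)).
Qed.

End VectorFields.

(** * Differential forms as functions of lists of vector fields *)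

(* A function of lists of vectors carries one cochain in every degree, so that
   interior products, exterior products and Lie derivatives are plain structural
   recursions and the (anti)commutation rules hold by computation. *)
Section ListForms.
Variables (A : comPzRingType) (V : lmodType A).
Local Notation Om := (seq V -> A).
Implicit Types (u v w : Om) (X Y Z : V) (al be : V -> A) (f : A) (s t : seq V).

Definition iota X w : Om := fun s => w (X :: s).
Definition scl f w : Om := fun s => f * w s.

(** Exterior product with the 1-form [al], defined by [i_Y (al /\ w) = al(Y) w - al /\ i_Y w]. *)
Fixpoint eps al w s : A :=
  if s is Y :: s' then al Y * w s' - eps al (iota Y w) s' else 0.

(* The extension to forms of a derivation [D] of scalars and an operator [B] on
   vectors. *)
Fixpoint der (D : A -> A) (B : V -> V) w s : A :=
  if s is Y :: s' then der D B (iota Y w) s' - w (B Y :: s') else D (w [::]).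

Definition mlin w := forall t f X Y s,
  w (t ++ (f *: X + Y) :: s) = f * w (t ++ X :: s) + w (t ++ Y :: s).
Definition alt w := forall t X s, w (t ++ X :: X :: s) = 0.
Definition isF w := mlin w /\ alt w.

Definition lin1 al := forall f X Y, al (f *: X + Y) = f * al X + al Y.

Lemma OmD u v s : (u + v : Om) s = u s + v s. Proof. by []. Qed.
Lemma OmN u s : (- u : Om) s = - u s. Proof. by []. Qed.
Lemma Om0 s : (0 : Om) s = 0. Proof. by []. Qed.
Lemma sclE f w s : scl f w s = f * w s. Proof. by []. Qed.
Lemma iotaE X w s : iota X w s = w (X :: s). Proof. by []. Qed.
Lemma Om_sum (I : Type) (r : seq I) (P : pred I) (W : I -> Om) s :
  (\sum_(i <- r | P i) W i) s = \sum_(i <- r | P i) W i s.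
Proof. by elim/big_rec2 : _ => // i x y _ <-. Qed.
Definition OmE := (OmD, OmN, Om0, sclE, iotaE).

Lemma iotaD X u v : iota X (u + v) = iota X u + iota X v. Proof. by []. Qed.
Lemma iotaN X u : iota X (- u) = - iota X u. Proof. by []. Qed.
Lemma iota0 X : iota X 0 = 0. Proof. by []. Qed.
Lemma iota_scl X f u : iota X (scl f u) = scl f (iota X u). Proof. by []. Qed.
Lemma iota_sum X (I : Type) (r : seq I) (P : pred I) (W : I -> Om) :
  iota X (\sum_(i <- r | P i) W i) = \sum_(i <- r | P i) iota X (W i).
Proof. by elim/big_rec2 : _ => // i x y _ <-. Qed.

Lemma epsD al u v : eps al (u + v) = eps al u + eps al v.
Proof.
apply/funext => s; elim: s u v => [|Y s IH] u v /=; first by rewrite OmE addr0.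
by rewrite iotaD IH !OmE /=; ring.
Qed.

Lemma eps_scl al f u : eps al (scl f u) = scl f (eps al u).
Proof.
apply/funext => s; elim: s u => [|Y s IH] u /=; first by rewrite OmE mulr0.
by rewrite iota_scl IH !OmE /=; ring.
Qed.

Lemma scl0 f : scl f 0 = 0.
Proof. by apply/funext => s; rewrite !OmE mulr0. Qed.

Lemma sclD f u v : scl f (u + v) = scl f u + scl f v.
Proof. by apply/funext => s; rewrite !OmE mulrDr. Qed.

Lemma sclN f u : scl f (- u) = - scl f u.
Proof. by apply/funext => s; rewrite !OmE mulrN. Qed.

Lemma scl_sum f (I : Type) (r : seq I) (P : pred I) (W : I -> Om) :
  scl f (\sum_(i <- r | P i) W i) = \sum_(i <- r | P i) scl f (W i).
Proof. by elim/big_rec2 : _ => [|i x y _ <-]; rewrite ?scl0 ?sclD. Qed.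

Lemma eps0 al : eps al 0 = 0.
Proof.
apply/funext => s; elim: s => [|Y s IH] //=.
by rewrite iota0 IH !OmE mulr0 subr0.
Qed.

Lemma epsN al u : eps al (- u) = - eps al u.
Proof. by apply/eqP; rewrite -addr_eq0 -epsD addrC subrr eps0. Qed.

Lemma eps_sum al (I : Type) (r : seq I) (P : pred I) (W : I -> Om) :
  eps al (\sum_(i <- r | P i) W i) = \sum_(i <- r | P i) eps al (W i).
Proof. by elim/big_rec2 : _ => [|i x y _ <-]; rewrite ?eps0 ?epsD. Qed.

Lemma eps_lin al be f w :
  eps (fun Y => f * al Y + be Y) w = scl f (eps al w) + eps be w.
Proof.
apply/funext => s; elim: s w => [|Y s IH] w /=; first by rewrite !OmE mulr0 addr0.
by rewrite IH !OmE /=; ring.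
Qed.

Lemma eps_ext al be w : al =1 be -> eps al w = eps be w.
Proof. by move=> /funext ->. Qed.

Lemma iota_eps al Y w : iota Y (eps al w) = scl (al Y) w - eps al (iota Y w).
Proof. by []. Qed.

Lemma eps_eps al be w : eps al (eps be w) = - eps be (eps al w).
Proof.
apply/funext => s; elim: s w => [|Y s IH] w /=; first by rewrite !OmE oppr0.
rewrite OmE /= !iota_eps !epsD !epsN !eps_scl !OmE IH !OmE.
by ring.
Qed.

(** Anticommutation only gives twice the claim, hence the division by 2. *)
Lemma eps_eps_id al w : (forall s, exists h : A, h * 2 = 1) -> eps al (eps al w) = 0.
Proof.
move=> h2; apply/funext => s; have [h hh] := h2 s.
have := congr1 (fun u : Om => h * u s) (eps_eps al al w).
rewrite !OmE => e; have : h * 2 * eps al (eps al w) s = 0.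
  by rewrite mulr_natr mulr2n mulrDl {1}e; ring.
by rewrite hh mul1r.
Qed.

Section Der.
Variables (D : A -> A) (B : V -> V).
Hypothesis DD : forall f g, D (f + g) = D f + D g.
Hypothesis DM : forall f g, D (f * g) = D f * g + f * D g.

Lemma der_add u v : der D B (u + v) = der D B u + der D B v.
Proof.
apply/funext => s; elim: s u v => [|Y s IH] u v /=; first by rewrite !OmE DD.
by rewrite iotaD IH !OmE /=; ring.
Qed.

Lemma der0 : der D B 0 = 0.
Proof.
have h := der_add 0 0; rewrite addr0 in h.
by move/eqP: h; rewrite -subr_eq subrr => /eqP.
Qed.

Lemma der_opp u : der D B (- u) = - der D B u.
Proof. by apply/eqP; rewrite -addr_eq0 -der_add addrC subrr der0. Qed.

Lemma der_sum (I : Type) (r : seq I) (P : pred I) (W : I -> Om) :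
  der D B (\sum_(i <- r | P i) W i) = \sum_(i <- r | P i) der D B (W i).
Proof. by elim/big_rec2 : _ => [|i x y _ <-]; rewrite ?der0 ?der_add. Qed.

Lemma der_scl f u : der D B (scl f u) = scl (D f) u + scl f (der D B u).
Proof.
apply/funext => s; elim: s u => [|Y s IH] u /=; first by rewrite !OmE DM.
by rewrite iota_scl IH !OmE /=; ring.
Qed.

Lemma iota_der Y w : iota Y (der D B w) = der D B (iota Y w) - iota (B Y) w.
Proof. by []. Qed.

Lemma der_eps al w : der D B (eps al w) =
  eps al (der D B w) + eps (fun Y => D (al Y) - al (B Y)) w.
Proof.
apply/funext => s; elim: s w => [|Y s IH] w /=.
  rewrite !OmE addr0; have := DD 0 0; rewrite addr0 => /eqP.
  by rewrite -subr_eq subrr => /eqP <-.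
rewrite OmE /= iota_eps der_add der_opp der_scl !OmE IH !OmE /= iota_der.
by rewrite epsD epsN !OmE; ring.
Qed.

End Der.

(** Specialised later to [[L_X, L_Y] = L_[X, Y]] and, with both brackets zero, to the commutation of
    the [J] rotation with [nabla] and with [L_T]. *)
Lemma der_comm D1 B1 D2 B2 w :
  (forall f g, D1 (f + g) = D1 f + D1 g) ->
  (forall f g, D2 (f + g) = D2 f + D2 g) ->
  (forall t s X Y, w (t ++ (X + Y) :: s) = w (t ++ X :: s) + w (t ++ Y :: s)) ->
  der D1 B1 (der D2 B2 w) - der D2 B2 (der D1 B1 w) =
  der (fun f => D1 (D2 f) - D2 (D1 f)) (fun X => B1 (B2 X) - B2 (B1 X)) w.
Proof.
move=> DD1 DD2; move=> hw; apply/funext => s; elim: s w hw => [|Y s IH] w hw //.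
have e1 := iota_der D1 B1 Y; have e2 := iota_der D2 B2 Y.
have N X : w ((- X) :: s) = - w (X :: s).
  apply/eqP; rewrite -addr_eq0 -(hw [::] s) addrC subrr.
  have := hw [::] s 0 0; rewrite /= addr0 => /eqP.
  by rewrite -subr_eq subrr eq_sym.
rewrite !OmE /= !iota_der !der_add // !der_opp // !OmE /=.
have := IH (iota Y w) (fun t => hw (Y :: t)); rewrite !OmE => <-.
by have := hw [::] s (B1 (B2 Y)) (- B2 (B1 Y)) => /= ->; rewrite N; ring.
Qed.

Lemma isF_iota X w : isF w -> isF (iota X w).
Proof.
by move=> [l a]; split=> [t f Y Z s|t Y s]; rewrite !iotaE -!cat_cons ?l ?a.
Qed.

Lemma isF0 : isF 0.
Proof. by split=> [t f Y Z s|t Y s]; rewrite !OmE ?mulr0 ?addr0. Qed.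

Lemma isFD u v : isF u -> isF v -> isF (u + v).
Proof.
move=> [l a] [l' a']; split=> [t f Y Z s|t Y s]; rewrite !OmE.
  by rewrite l l'; ring.
by rewrite a a' addr0.
Qed.

Lemma isF_scl f u : isF u -> isF (scl f u).
Proof.
move=> [l a]; split=> [t h Y Z s|t Y s]; rewrite !OmE.
  by rewrite l; ring.
by rewrite a mulr0.
Qed.

Lemma isFN u : isF u -> isF (- u).
Proof.
move=> Fu; have -> : - u = scl (-1) u by apply/funext => s; rewrite !OmE mulN1r.
exact: isF_scl.
Qed.

Lemma isF_sum (I : Type) (r : seq I) (P : pred I) (W : I -> Om) :
  (forall i, P i -> isF (W i)) -> isF (\sum_(i <- r | P i) W i).
Proof. by move=> FW; elim/big_ind : _ => //; [exact: isF0|exact: isFD]. Qed.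

Lemma iota_lin f X Y w : isF w -> iota (f *: X + Y) w = scl f (iota X w) + iota Y w.
Proof. by move=> [l _]; apply/funext => s; exact: (l [::]). Qed.

Lemma isF_add w t s X Y : isF w ->
  w (t ++ (X + Y) :: s) = w (t ++ X :: s) + w (t ++ Y :: s).
Proof. by move=> [l _]; have := l t 1 X Y s; rewrite scale1r mul1r. Qed.

Lemma isF_anti w t X Y s : isF w -> w (t ++ X :: Y :: s) = - w (t ++ Y :: X :: s).
Proof.
move=> Fw; have [_ a] := Fw; apply/eqP; rewrite -addr_eq0; apply/eqP.
have := a t (X + Y) s; rewrite isF_add //.
rewrite -!(cat_rcons _ t) !isF_add // !cat_rcons !a add0r addr0.
by [].
Qed.

Lemma iota_iota w X Y : isF w -> iota X (iota Y w) = - iota Y (iota X w).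
Proof. by move=> Fw; apply/funext => s; rewrite !OmE; exact: (isF_anti [::]). Qed.

Lemma iota_iota_id w X : isF w -> iota X (iota X w) = 0.
Proof. by move=> [_ a]; apply/funext => s; exact: (a [::]). Qed.

Lemma isF_eps al w : lin1 al -> isF w -> isF (eps al w).
Proof.
move=> la Fw; split.
  move=> t; elim: t w Fw => [|Z t IH] w Fw f X Y s /=.
    by rewrite la iota_lin // epsD eps_scl !OmE; ring.
  have [l _] := Fw; rewrite l IH; last exact: isF_iota.
  by ring.
move=> t; elim: t w Fw => [|Z t IH] w Fw X s /=.
  by rewrite iota_iota_id // eps0 !OmE; ring.
by have [_ a] := Fw; rewrite a mulr0 IH ?subr0 //; exact: isF_iota.
Qed.

(** The terms [D f *: X] in [B] cancel the Leibniz terms of [D], so the result is again linear over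
    functions. *)
Lemma isF_der D B w : (forall f g, D (f + g) = D f + D g) ->
  (forall f g, D (f * g) = D f * g + f * D g) ->
  (forall f X Y, B (f *: X + Y) = f *: B X + D f *: X + B Y) ->
  isF w -> isF (der D B w).
Proof.
move=> DD DM BL Fw; split.
  move=> t; elim: t w Fw => [|Z t IH] w Fw f X Y s.
    rewrite /= BL -addrA iota_lin // der_add // der_scl // !OmE.
    have [l _] := Fw; have := l [::] f (B X) (D f *: X + B Y) s => /= ->.
    by have := l [::] (D f) X (B Y) s => /= ->; ring.
  have [l _] := Fw; rewrite /= IH; last exact: isF_iota.
  by have := l (B Z :: t) f X Y s => /= ->; ring.
move=> t; elim: t w Fw => [|Z t IH] w Fw X s.
  rewrite /= iota_iota_id // der0 // Om0 !iotaE.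
  by rewrite [w (B X :: _)](isF_anti [::]) //; ring.
rewrite /= IH; last exact: isF_iota.
by have [_ a] := Fw; have := a (B Z :: t) X s => /= ->; rewrite subr0.
Qed.

End ListForms.

(** * The Tanaka-Webster connection *)

(* An algebraic Sasakian structure over a module [V] of derivations of [A]. The
   pair of families [Fr], [Fr'] is a global substitute for a local orthonormal
   frame: traces over it do not depend on the choice, and it exists on every compact
   manifold. *)
Record sasaki_data (A : comPzRingType) (V : lmodType A) := SasakiData {
  act : V -> A -> A;
  br : V -> V -> V;
  actD : forall X f h, act X (f + h) = act X f + act X h;
  actM : forall X f h, act X (f * h) = act X f * h + f * act X h;
  actL : forall f X Y h, act (f *: X + Y) h = f * act X h + act Y h;
  brN : forall X Y, br X Y = - br Y X;
  brL : forall X f Y Z, br X (f *: Y + Z) = f *: br X Y + act X f *: Y + br X Z;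
  act_br : forall X Y f, act (br X Y) f = act X (act Y f) - act Y (act X f);
  jacobi : forall X Y Z, br X (br Y Z) = br (br X Y) Z + br Y (br X Z);
  half : A;
  halfP : half * 2 = 1;
  ninv : nat -> A;
  ninvP : forall k, ninv k * k.+1%:R = 1;
  gm : V -> V -> A;
  gmS : forall X Y, gm X Y = gm Y X;
  gmL : forall f X Y Z, gm (f *: X + Y) Z = f * gm X Z + gm Y Z;
  Tv : V;
  gmTT : gm Tv Tv = 1;
  Jv : V -> V;
  JvL : forall f X Y, Jv (f *: X + Y) = f *: Jv X + Jv Y;
  JvT : Jv Tv = 0;
  JvJ : forall X, Jv (Jv X) = gm Tv X *: Tv - X;
  gmJ : forall X Y, gm (Jv X) Y = - gm X (Jv Y);
  dthE : forall X Y, gm (Jv X) Y = act X (gm Tv Y) - act Y (gm Tv X) - gm Tv (br X Y);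
  brTJ : forall X, br Tv (Jv X) = Jv (br Tv X);
  nijenhuis : forall X Y, gm Tv X = 0 -> gm Tv Y = 0 ->
    Jv (br X Y - br (Jv X) (Jv Y)) = br X (Jv Y) + br (Jv X) Y;
  fidx : finType;
  Fr : fidx -> V;
  Fr' : fidx -> V;
  frameP : forall X, X = \sum_c gm X (Fr' c) *: Fr c }.

Section TanakaWebster.
Variables (A : comPzRingType) (V : lmodType A) (S : sasaki_data V).
Implicit Types (f h : A) (X Y Z W : V).
Local Notation "X ⋅ f" := (act S X f) (at level 38, left associativity).
Local Notation "⟦ X , Y ⟧" := (br S X Y).
Local Notation g := (gm S).
Local Notation J := (Jv S).
Local Notation T := (Tv S).
Local Notation th := (gm S (Tv S)).
Local Notation hf := (half S).
Local Notation F := (@Fr A V S).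
Local Notation F' := (@Fr' A V S).

Lemma lin1D (al : V -> A) X Y : lin1 al -> al (X + Y) = al X + al Y.
Proof. by move=> l; have := l 1 X Y; rewrite scale1r mul1r. Qed.

Lemma lin1_0 (al : V -> A) : lin1 al -> al 0 = 0.
Proof.
move=> l; have := lin1D 0 0 l; rewrite addr0 => /eqP.
by rewrite -subr_eq subrr => /eqP.
Qed.

Lemma lin1Z (al : V -> A) f X : lin1 al -> al (f *: X) = f * al X.
Proof. by move=> l; have := l f X 0; rewrite addr0 (lin1_0 l) addr0. Qed.

Lemma lin1N (al : V -> A) X : lin1 al -> al (- X) = - al X.
Proof. by move=> l; rewrite -scaleN1r lin1Z // mulN1r. Qed.

Lemma lin1_sum (al : V -> A) (I : Type) (r : seq I) (P : pred I) (W : I -> V) :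
  lin1 al -> al (\sum_(i <- r | P i) W i) = \sum_(i <- r | P i) al (W i).
Proof.
by move=> l; elim/big_rec2 : _ => [|i x y _ <-]; rewrite ?lin1_0 ?lin1D.
Qed.

Lemma gm_linl Y : lin1 (g ^~ Y).
Proof. by move=> f X Z; rewrite gmL. Qed.

Lemma gm_linr X : lin1 (g X).
Proof. by move=> f Y Z; rewrite gmS gmL !(gmS _ _ X). Qed.

Lemma gDl X Y Z : g (X + Y) Z = g X Z + g Y Z. Proof. exact: (lin1D _ _ (gm_linl Z)). Qed.
Lemma gNl X Z : g (- X) Z = - g X Z. Proof. exact: (lin1N _ (gm_linl Z)). Qed.
Lemma gZl f X Z : g (f *: X) Z = f * g X Z. Proof. exact: (lin1Z _ _ (gm_linl Z)). Qed.
Lemma g0l Z : g 0 Z = 0. Proof. exact: (lin1_0 (gm_linl Z)). Qed.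
Lemma gDr X Y Z : g X (Y + Z) = g X Y + g X Z. Proof. exact: (lin1D _ _ (gm_linr X)). Qed.
Lemma gNr X Z : g X (- Z) = - g X Z. Proof. exact: (lin1N _ (gm_linr X)). Qed.
Lemma gZr f X Z : g X (f *: Z) = f * g X Z. Proof. exact: (lin1Z _ _ (gm_linr X)). Qed.
Lemma g0r X : g X 0 = 0. Proof. exact: (lin1_0 (gm_linr X)). Qed.

Lemma g_suml X (I : Type) (r : seq I) (P : pred I) (W : I -> V) :
  g (\sum_(i <- r | P i) W i) X = \sum_(i <- r | P i) g (W i) X.
Proof. exact: (lin1_sum _ _ _ (gm_linl X)). Qed.

Lemma g_sumr X (I : Type) (r : seq I) (P : pred I) (W : I -> V) :
  g X (\sum_(i <- r | P i) W i) = \sum_(i <- r | P i) g X (W i).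
Proof. exact: (lin1_sum _ _ _ (gm_linr X)). Qed.

Definition gE := (gDl, gNl, gZl, g0l, gDr, gNr, gZr, g0r).

Lemma g_inj X Y : (forall Z, g X Z = g Y Z) -> X = Y.
Proof.
by move=> XY; rewrite (frameP S X) (frameP S Y); apply: eq_bigr => c _; rewrite XY.
Qed.

Lemma frameP' X : X = \sum_c g X (F c) *: F' c.
Proof.
apply: g_inj => Z; rewrite g_suml {1}(frameP S Z) g_sumr.
by apply: eq_bigr => c _; rewrite !gE mulrC (gmS S Z).
Qed.

Lemma lin1_frame (al : V -> A) X : lin1 al -> al X = \sum_c g X (F' c) * al (F c).
Proof.
move=> l; rewrite {1}(frameP S X) (lin1_sum _ _ _ l).
by apply: eq_bigr => c _; rewrite lin1Z.
Qed.

Lemma lin1_frame' (al : V -> A) X : lin1 al -> al X = \sum_c g X (F c) * al (F' c).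
Proof.
move=> l; rewrite {1}(frameP' X) (lin1_sum _ _ _ l).
by apply: eq_bigr => c _; rewrite lin1Z.
Qed.

Lemma act_lin f : lin1 (fun X => X ⋅ f).
Proof. by move=> h X Y; rewrite actL. Qed.

Lemma act0 X : X ⋅ 0 = 0.
Proof. by have := actD S X 0 0; rewrite addr0 => /eqP; rewrite -subr_eq subrr => /eqP. Qed.

Lemma act1 X : X ⋅ 1 = 0.
Proof.
have := actM S X 1 1; rewrite !mulr1 mul1r => /eqP.
by rewrite -subr_eq subrr => /eqP.
Qed.

Lemma actN X f : X ⋅ (- f) = - (X ⋅ f).
Proof. by apply/eqP; rewrite -addr_eq0 -actD addrC subrr act0. Qed.

Lemma act_nat X k : X ⋅ k%:R = 0.
Proof. by elim: k => [|k IH]; rewrite ?act0 // -natr1 actD act1 IH addr0. Qed.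

Lemma act_half X : X ⋅ hf = 0.
Proof.
have h := actM S X hf 2; rewrite halfP act1 act_nat mulr0 addr0 in h.
by rewrite -[LHS]mulr1 -(halfP S) mulrCA -h mulr0.
Qed.

Lemma act_ninv X k : X ⋅ ninv S k = 0.
Proof.
have h := actM S X (ninv S k) k.+1%:R; rewrite ninvP act1 act_nat mulr0 addr0 in h.
by rewrite -[LHS]mulr1 -(ninvP S k) mulrCA -h mulr0.
Qed.

Lemma actXD X Y f : (X + Y) ⋅ f = X ⋅ f + Y ⋅ f. Proof. exact: (lin1D _ _ (act_lin f)). Qed.
Lemma actXN X f : (- X) ⋅ f = - (X ⋅ f). Proof. exact: (lin1N _ (act_lin f)). Qed.
Lemma actXZ h X f : (h *: X) ⋅ f = h * (X ⋅ f). Proof. exact: (lin1Z _ _ (act_lin f)). Qed.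

Definition actE := (actD, actN, actM, act0, act1, actXD, actXN, actXZ).

Lemma brDr X Y Z : ⟦X, Y + Z⟧ = ⟦X, Y⟧ + ⟦X, Z⟧.
Proof. by have := brL S X 1 Y Z; rewrite !scale1r act1 scale0r addr0. Qed.

Lemma br0r X : ⟦X, 0⟧ = 0.
Proof. by have := brDr X 0 0; rewrite addr0 => /eqP; rewrite -subr_eq subrr => /eqP. Qed.

Lemma brZr X f Y : ⟦X, f *: Y⟧ = f *: ⟦X, Y⟧ + (X ⋅ f) *: Y.
Proof. by have := brL S X f Y 0; rewrite !addr0 br0r addr0. Qed.

Lemma brDl X Y Z : ⟦X + Y, Z⟧ = ⟦X, Z⟧ + ⟦Y, Z⟧.
Proof. by rewrite brN brDr opprD -!brN. Qed.

Lemma brZl X f Y : ⟦f *: Y, X⟧ = f *: ⟦Y, X⟧ - (X ⋅ f) *: Y.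
Proof. by rewrite brN brZr opprD -scalerN -brN. Qed.

Lemma brNr X Y : ⟦X, - Y⟧ = - ⟦X, Y⟧.
Proof. by apply/eqP; rewrite -addr_eq0 -brDr addrC subrr br0r. Qed.

Definition brE := (brDr, brZr, brDl, brZl, brNr).

Lemma JD X Y : J (X + Y) = J X + J Y.
Proof. by have := JvL S 1 X Y; rewrite !scale1r. Qed.
Lemma J0 : J 0 = 0.
Proof. by have := JD 0 0; rewrite addr0 => /eqP; rewrite -subr_eq subrr => /eqP. Qed.
Lemma JZ f X : J (f *: X) = f *: J X.
Proof. by have := JvL S f X 0; rewrite !addr0 J0 addr0. Qed.
Lemma JN X : J (- X) = - J X.
Proof. by rewrite -scaleN1r JZ scaleN1r. Qed.
Lemma thJ X : th (J X) = 0.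
Proof. by rewrite gmS gmJ JvT g0r oppr0. Qed.

Lemma gJJ X Y : g (J X) (J Y) = g X Y - th X * th Y.
Proof. by rewrite gmJ JvJ !gE (gmS S X T); ring. Qed.

Definition om X Y := g (J X) Y.

Lemma omN X Y : om X Y = - om Y X.
Proof. by rewrite /om gmJ gmS. Qed.

(** The structure equation [dthE] at [T], with [J T = 0]; in other words [L_T theta = 0]. *)
Lemma act_th X : T ⋅ th X = th ⟦T, X⟧.
Proof.
have := dthE S T X; rewrite JvT g0l gmTT act1 subr0 => /esym/eqP.
by rewrite subr_eq0 => /eqP.
Qed.

Lemma omT X : om T X = 0.
Proof. by rewrite /om JvT g0l. Qed.

Lemma omTr X : om X T = 0.
Proof. by rewrite omN omT oppr0. Qed.

(** This is [d (d theta) = 0]: once [om] is expanded by [dthE], second derivatives cancel by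
    [act_br] and the rest is the Jacobi identity under [theta]. *)
Lemma om_closed X Y Z : X ⋅ om Y Z - Y ⋅ om X Z + Z ⋅ om X Y
  - om ⟦X, Y⟧ Z + om ⟦X, Z⟧ Y - om ⟦Y, Z⟧ X = 0.
Proof.
rewrite /om !dthE !actE !act_br.
have j := congr1 th (jacobi S X Y Z); rewrite gDr in j.
rewrite [⟦⟦X, Y⟧, Z⟧]brN [⟦⟦X, Z⟧, Y⟧]brN [⟦⟦Y, Z⟧, X⟧]brN !gNr.
rewrite [⟦⟦X, Y⟧, Z⟧]brN gNr in j.
by ring: j.
Qed.

Lemma lie_om X Y : T ⋅ om X Y = om ⟦T, X⟧ Y + om X ⟦T, Y⟧.
Proof.
have := om_closed T X Y.
rewrite !omT omTr !act0 (omN X ⟦T, Y⟧) => h.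
by rewrite -[LHS]subr0 -h; ring.
Qed.

(** The metric is built from [om], [J] and [theta], each of which is preserved by [L_T]. *)
Lemma killing X Y : T ⋅ g X Y = g ⟦T, X⟧ Y + g X ⟦T, Y⟧.
Proof.
have e U W : g U W = om U (J W) + th U * th W by rewrite /om gJJ subrK.
rewrite (e X Y) (e ⟦T, X⟧ Y) (e X ⟦T, Y⟧) actD actM lie_om brTJ !act_th.
by ring.
Qed.

(* [cov] is the Tanaka-Webster connection: the metric connection with torsion
   [X, Y |-> dtheta(X, Y) T]. It comes from Koszul's formula with the bracket replaced
   by [tb], and [T] and [J] are parallel for it. *)
Definition tb X Y := ⟦X, Y⟧ + om X Y *: T.

Definition koszul X Y Z :=
  X ⋅ g Y Z + Y ⋅ g X Z - Z ⋅ g X Y + g (tb X Y) Z - g (tb X Z) Y - g (tb Y Z) X.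

Lemma koszul_lin X Y : lin1 (koszul X Y).
Proof.
move=> f Z W; rewrite /koszul /tb /om.
rewrite !(gDr, gZr, gDl, gZl, brDr, brZr, actD, actM, actXD, actXZ).
rewrite (gmS S Y Z) (gmS S Y W) (gmS S X Z) (gmS S X W); ring.
Qed.

Definition cov X Y : V := \sum_c (hf * koszul X Y (F' c)) *: F c.

Lemma covE X Y Z : g (cov X Y) Z = hf * koszul X Y Z.
Proof.
rewrite /cov g_suml (lin1_frame' Z (koszul_lin X Y)) mulr_sumr.
by apply: eq_bigr => c _; rewrite gZl (gmS S Z); ring.
Qed.

Lemma half_split f : f = hf * (f + f).
Proof. by rewrite -mulr2n -mulr_natr mulrCA halfP mulr1. Qed.

Lemma cov_metric X Y Z : X ⋅ g Y Z = g (cov X Y) Z + g Y (cov X Z).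
Proof.
rewrite (gmS S Y (cov X Z)) !covE -mulrDr [LHS]half_split; congr (_ * _).
by rewrite /koszul (gmS S Z Y) /tb !gE (omN Z Y) (brN S Z Y) !gE; ring.
Qed.

Lemma cov_torsion X Y : cov X Y - cov Y X = tb X Y.
Proof.
apply: g_inj => Z; rewrite gDl gNl !covE -mulrBr [RHS]half_split; congr (_ * _).
by rewrite /koszul (gmS S Y X) /tb !gE (omN Y X) (brN S Y X) !gE; ring.
Qed.

Lemma covL f X Y Z : cov (f *: X + Y) Z = f *: cov X Z + cov Y Z.
Proof.
apply: g_inj => W; rewrite gDl gZl !covE /koszul /tb /om !brE JD JZ !gE !actE.
by rewrite (gmS S X Z) (gmS S X W) (gmS S Z X); ring.
Qed.

Lemma cov_leibniz f X Y Z : cov X (f *: Y + Z) = f *: cov X Y + (X ⋅ f) *: Y + cov X Z.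
Proof.
apply: g_inj => W; rewrite !gDl !gZl !covE.
rewrite (_ : (X ⋅ f) * g Y W = hf * ((X ⋅ f) * g Y W + (X ⋅ f) * g Y W));
  last exact: half_split.
rewrite /koszul /tb /om !brE JD JZ !gE !actE.
by rewrite (gmS S Y X); ring.
Qed.

Lemma covDr X Y Z : cov X (Y + Z) = cov X Y + cov X Z.
Proof. by have := cov_leibniz 1 X Y Z; rewrite !scale1r act1 scale0r addr0. Qed.

Lemma cov0r X : cov X 0 = 0.
Proof. by have := covDr X 0 0; rewrite addr0 => /eqP; rewrite -subr_eq subrr => /eqP. Qed.

Lemma covZr X f Y : cov X (f *: Y) = f *: cov X Y + (X ⋅ f) *: Y.
Proof. by have := cov_leibniz f X Y 0; rewrite !addr0 cov0r addr0. Qed.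

Lemma covNr X Y : cov X (- Y) = - cov X Y.
Proof. by apply/eqP; rewrite -addr_eq0 -covDr addrC subrr cov0r. Qed.

Lemma covDl X Y Z : cov (X + Y) Z = cov X Z + cov Y Z.
Proof. by have := covL 1 X Y Z; rewrite !scale1r. Qed.

Lemma cov0l X : cov 0 X = 0.
Proof. by have := covDl 0 0 X; rewrite addr0 => /eqP; rewrite -subr_eq subrr => /eqP. Qed.

Lemma covZl f X Y : cov (f *: X) Y = f *: cov X Y.
Proof. by have := covL f X 0 Y; rewrite !addr0 cov0l addr0. Qed.

Lemma cov_suml (I : Type) (r : seq I) (P : pred I) (W : I -> V) Y :
  cov (\sum_(i <- r | P i) W i) Y = \sum_(i <- r | P i) cov (W i) Y.
Proof. by elim/big_rec2 : _ => [|i x y _ <-]; rewrite ?cov0l ?covDl. Qed.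

(** In the Koszul expression the torsion term cancels [d theta(X, Z)], and what remains is the
    Killing equation. *)
Lemma cov_T X : cov X T = 0.
Proof.
apply: g_inj => Z; rewrite covE g0l.
rewrite (_ : koszul X T Z = 0) ?mulr0 // /koszul /tb.
have d := dthE S X Z; have k := killing X Z.
rewrite !gE gmTT (omN X T) /om JvT !g0l (brN S X T) !gE killing (gmS S X T).
rewrite (gmS S ⟦X, Z⟧ T) (gmS S ⟦T, Z⟧ X) d.
by ring.
Qed.

Lemma cov_Tl Y : cov T Y = ⟦T, Y⟧.
Proof.
have := cov_torsion T Y; rewrite cov_T subr0 => ->.
by rewrite /tb /om JvT g0l scale0r addr0.
Qed.

Definition hpr X := X - th X *: T.

Lemma th_hpr X : th (hpr X) = 0.
Proof. by rewrite /hpr !gE gmTT; ring. Qed.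

Lemma hprK X : hpr X + th X *: T = X. Proof. by rewrite subrK. Qed.

Lemma J_hpr X : J (hpr X) = J X.
Proof. by rewrite /hpr JD JN JZ JvT scaler0 subr0. Qed.

(** The classical Kaehler computation: [d om (X, Y, Z) - d om (X, JY, JZ)] and the Nijenhuis
    identity paired with [X] add up to the left-hand side. *)
Lemma cov_J_horizontal X Y Z : th X = 0 -> th Y = 0 -> th Z = 0 ->
  koszul X (J Y) Z + koszul X Y (J Z) = 0.
Proof.
move=> hX hY hZ.
have d1 := om_closed X Y Z; have d2 := om_closed X (J Y) (J Z).
have n := congr1 (fun U => g U X) (nijenhuis hY hZ).
have gh U W : th W = 0 -> g (J U) (J W) = g U W.
  by move=> hW; rewrite gJJ hW mulr0 subr0.
have omJ U W : th W = 0 -> om U (J W) = g U W by exact: gh.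
have omJJ : om (J Y) (J Z) = om Y Z.
  by rewrite /om gh // gmJ gmS /om -[RHS]opprK -omN /om gmS opprK.
move: d1 d2 n; rewrite /koszul /tb !gE hX hY hZ !thJ !mulr0 !addr0.
rewrite omJJ !omJ //.
rewrite JD JN !gE /om !gmJ !actN => d1 d2 /eqP; rewrite -subr_eq0 => /eqP n.
have h := congr2 +%R (congr2 (fun a b => a - b) d1 d2) n; rewrite /= subrr addr0 in h.
by apply: etrans h; ring.
Qed.

(** Horizontal arguments are [cov_J_horizontal]; along [T] the connection is [L_T], which commutes
    with [J]; and neither side has a component along [T]. *)
Lemma cov_J X Y : cov X (J Y) = J (cov X Y).
Proof.
apply: g_inj => Z.
have covT U W : g (cov U W) T = U ⋅ g W T.
  by rewrite cov_metric cov_T g0r addr0.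
have -> : cov X (J Y) = cov X (J (hpr Y)) by rewrite J_hpr.
have -> : J (cov X Y) = J (cov X (hpr Y)).
  rewrite -{1}(hprK Y) covDr covZr cov_T scaler0 add0r JD JZ JvT scaler0.
  by rewrite addr0.
have red W : g W Z = g W (hpr Z) + th Z * g W T.
  by rewrite -{1}(hprK Z) gDr gZr.
rewrite (red (cov X (J (hpr Y)))) (red (J (cov X (hpr Y)))) covT [g (J (hpr Y)) T]gmS thJ act0
  [g (J (cov _ _)) T]gmS thJ.
congr (_ + _); rewrite -(hprK X) covDl covZl cov_Tl brTJ.
rewrite [in RHS]covDl covZl cov_Tl JD JZ !gDl; congr (_ + _).
apply/eqP; rewrite -subr_eq0 gmJ opprK !covE -mulrDr.
by rewrite cov_J_horizontal ?mulr0 // th_hpr.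
Qed.

End TanakaWebster.

(** * Operators on forms and transverse Kaehler identities *)

Section Operators.
Variables (A : comPzRingType) (V : lmodType A) (S : sasaki_data V).
Local Notation Om := (seq V -> A).
Implicit Types (f h : A) (X Y Z W : V) (a b w : Om).
Local Notation "X ⋅ f" := (act S X f) (at level 38, left associativity).
Local Notation "⟦ X , Y ⟧" := (br S X Y).
Local Notation g := (gm S).
Local Notation J := (Jv S).
Local Notation T := (Tv S).
Local Notation th := (gm S (Tv S)).
Local Notation hf := (half S).
Local Notation F := (@Fr A V S).
Local Notation F' := (@Fr' A V S).

Definition eX X := eps (g X).
Definition nab X := der (act S X) (cov S X).
Definition lie X := der (act S X) (br S X).
(** The derivation sending [w] to the sum of the [w(.., J X_i, ..)]; the sign undoes the one in
    [der]. *)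
Definition Jder := der (fun=> 0 : A) (fun X => - J X).
(** Frame expression of the exterior product with [d theta]; the factor 1/2 is there because each
    pair is met twice. [lam] is its adjoint, with the contractions in the opposite order. *)
Definition lef w : Om := scl hf (\sum_c eX (F c) (eX (J (F' c)) w)).
Definition lam w : Om := scl hf (\sum_c iota (J (F' c)) (iota (F c) w)).
(** A common shape for [d0] ([B] the horizontal projection) and [d1] ([B = J]), so that each
    identity is proved once; [delB] is the formal adjoint. *)
Definition dB (B : V -> V) w : Om := \sum_c eX (B (F c)) (nab (F' c) w).
Definition delB (B : V -> V) w : Om := - \sum_c iota (B (F c)) (nab (F' c) w).

Definition lin2 (B : V -> V) := forall f X Y, B (f *: X + Y) = f *: B X + B Y.

Lemma lin2_J : lin2 J. Proof. exact: JvL. Qed.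
Lemma lin2_hpr : lin2 (hpr S).
Proof.
by move=> f X Y; rewrite /hpr gDr gZr scalerDl opprD addrACA -scalerA -scalerBr.
Qed.

Lemma isF_eX X w : isF w -> isF (eX X w).
Proof. by apply: isF_eps; exact: gm_linr. Qed.

Lemma isF_nab X w : isF w -> isF (nab X w).
Proof.
apply: isF_der; [exact: actD|exact: actM|].
by move=> f Y Z; rewrite cov_leibniz.
Qed.

Lemma isF_Jder w : isF w -> isF (Jder w).
Proof.
apply: isF_der => [f h|f h|f Y Z]; rewrite ?addr0 ?mul0r ?mulr0 ?addr0 //.
by rewrite scale0r addr0 JD JZ opprD scalerN.
Qed.

Lemma isF_lef w : isF w -> isF (lef w).
Proof. by move=> Fw; apply/isF_scl/isF_sum => c _; do 2 apply: isF_eX. Qed.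

Lemma isF_lam w : isF w -> isF (lam w).
Proof. by move=> Fw; apply/isF_scl/isF_sum => c _; do 2 apply: isF_iota. Qed.

Lemma isF_dB B w : isF w -> isF (dB B w).
Proof. by move=> Fw; apply: isF_sum => c _; exact/isF_eX/isF_nab. Qed.

Lemma isF_delB B w : isF w -> isF (delB B w).
Proof. by move=> Fw; apply/isFN/isF_sum => c _; exact/isF_iota/isF_nab. Qed.

Lemma eXL B w s : lin2 B -> lin1 (fun X => eX (B X) w s).
Proof.
move=> l f X Y; rewrite l /eX.
rewrite (@eps_ext _ _ _ (fun Z => f * g (B X) Z + g (B Y) Z)) ?eps_lin //.
by move=> Z; exact: gmL.
Qed.

Lemma iotaL B w s : lin2 B -> isF w -> lin1 (fun X => iota (B X) w s).
Proof. by move=> l Fw f X Y; rewrite l iota_lin. Qed.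

Lemma lin2_id : lin2 id. Proof. by []. Qed.

Lemma eX_frame B X w : lin2 B ->
  \sum_c scl (g X (F c)) (eX (B (F' c)) w) = eX (B X) w.
Proof.
move=> l; apply/funext => s; rewrite Om_sum.
by rewrite [RHS](lin1_frame' S X (eXL w s l)); apply: eq_bigr => c _; rewrite sclE.
Qed.

Lemma eX_frame' B X w : lin2 B ->
  \sum_c scl (g X (F' c)) (eX (B (F c)) w) = eX (B X) w.
Proof.
move=> l; apply/funext => s; rewrite Om_sum.
by rewrite [RHS](lin1_frame S X (eXL w s l)); apply: eq_bigr => c _; rewrite sclE.
Qed.

Lemma iota_frame B X w : lin2 B -> isF w ->
  \sum_c scl (g X (F c)) (iota (B (F' c)) w) = iota (B X) w.
Proof.
move=> l Fw; apply/funext => s; rewrite Om_sum.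
by rewrite [RHS](lin1_frame' S X (iotaL s l Fw)); apply: eq_bigr => c _; rewrite sclE.
Qed.

Lemma iota_frame' B X w : lin2 B -> isF w ->
  \sum_c scl (g X (F' c)) (iota (B (F c)) w) = iota (B X) w.
Proof.
move=> l Fw; apply/funext => s; rewrite Om_sum.
by rewrite [RHS](lin1_frame S X (iotaL s l Fw)); apply: eq_bigr => c _; rewrite sclE.
Qed.

Lemma sclNl f w : scl (- f) w = - scl f w.
Proof. by apply/funext => s; rewrite !OmE mulNr. Qed.
Lemma scl_scl f h w : scl f (scl h w) = scl (f * h) w.
Proof. by apply/funext => s; rewrite !OmE mulrA. Qed.
Lemma scl0l w : scl 0 w = 0.
Proof. by apply/funext => s; rewrite !OmE mul0r. Qed.
Lemma scl1 w : scl 1 w = w.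
Proof. by apply/funext => s; rewrite !OmE mul1r. Qed.
Lemma scl_half w : scl hf (w + w) = w.
Proof. by apply/funext => s; rewrite !OmE -half_split. Qed.

Lemma iota_eX X Y w : iota X (eX Y w) = scl (g Y X) w - eX Y (iota X w).
Proof. by []. Qed.

Lemma eX_anti X Y w : eX X (eX Y w) = - eX Y (eX X w).
Proof. exact: eps_eps. Qed.

Lemma eX_sq X w : eX X (eX X w) = 0.
Proof. by apply: eps_eps_id => _; exists hf; exact: halfP. Qed.

Lemma lefD a b : lef (a + b) = lef a + lef b.
Proof.
rewrite /lef -sclD -big_split; congr (scl _ _); apply: eq_bigr => c _.
by rewrite /eX !epsD.
Qed.

Lemma lamD a b : lam (a + b) = lam a + lam b.
Proof. by rewrite /lam -sclD -big_split. Qed.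

Lemma nabD X a b : nab X (a + b) = nab X a + nab X b.
Proof. by apply: der_add; exact: actD. Qed.

Lemma dBD B a b : dB B (a + b) = dB B a + dB B b.
Proof.
by rewrite /dB -big_split; apply: eq_bigr => c _; rewrite nabD /eX epsD.
Qed.

Lemma delBD B a b : delB B (a + b) = delB B a + delB B b.
Proof.
by rewrite /delB -opprD -big_split; congr (- _); apply: eq_bigr => c _;
  rewrite nabD.
Qed.

Lemma nabN X a : nab X (- a) = - nab X a.
Proof. by apply: der_opp; exact: actD. Qed.

(** Contracting [X] with either factor of [lef] gives one half of the exterior product with [J X],
    for the second factor by skewness of [J]. *)
Lemma iota_lef X w : iota X (lef w) = lef (iota X w) + eX (J X) w.
Proof.
rewrite /lef iota_scl iota_sum -[eX (J X) w]scl_half -sclD; congr (scl _ _).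
rewrite -{1}(eX_frame X w lin2_J) -[X in _ + (_ + X)]opprK.
have -> : - eX (J X) w = \sum_c scl (g X (J (F' c))) (eX (F c) w).
  rewrite -(eX_frame' (J X) w lin2_id) -sumrN; apply: eq_bigr => c _.
  by rewrite gmJ sclNl opprK.
rewrite -sumrN -!big_split; apply: eq_bigr => c _ /=.
rewrite !iota_eX /eX epsD epsN eps_scl !(gmS S X) opprB.
exact: addrCA.
Qed.

Lemma eX_lef X w : eX X (lef w) = lef (eX X w).
Proof.
rewrite /lef /eX eps_scl eps_sum; congr (scl _ _); apply: eq_bigr => c _.
by rewrite -!/(eX _) eX_anti [eX X (eX (J _) _)]eX_anti /eX epsN opprK.
Qed.

(** The counterpart of [iota_lef] for contractions. Together with [nab_lam] it yields the
    commutators of [lam] with [d0] and [d1]. *)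
Lemma lam_eX X w : isF w -> lam (eX X w) = eX X (lam w) + iota (J X) w.
Proof.
move=> Fw; rewrite /lam /eX eps_scl eps_sum -!/(eX _).
rewrite -[iota (J X) w]scl_half -sclD; congr (scl _ _).
rewrite -{1}(iota_frame X lin2_J Fw) -[X in _ + (_ + X)]opprK.
have -> : - iota (J X) w = \sum_c scl (g X (J (F' c))) (iota (F c) w).
  rewrite -(iota_frame' (J X) lin2_id Fw) -sumrN; apply: eq_bigr => c _.
  by rewrite gmJ sclNl opprK.
rewrite -sumrN -!big_split; apply: eq_bigr => c _ /=.
rewrite !iota_eX iotaD iotaN iota_scl iota_eX opprB.
exact: addrCA.
Qed.

Lemma lam_iota X w : isF w -> lam (iota X w) = iota X (lam w).
Proof.
move=> Fw; rewrite /lam iota_scl iota_sum; congr (scl _ _); apply: eq_bigr => c _.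
rewrite (iota_iota (F c) X Fw) iotaN [RHS]iota_iota //; exact: isF_iota.
Qed.

Lemma eXD X a b : eX X (a + b) = eX X a + eX X b. Proof. exact: epsD. Qed.
Lemma eXN X a : eX X (- a) = - eX X a. Proof. exact: epsN. Qed.
Lemma eX_scl f X a : eX X (scl f a) = scl f (eX X a). Proof. exact: eps_scl. Qed.
Lemma eX_sum X (I : Type) (r : seq I) (P : pred I) (W : I -> Om) :
  eX X (\sum_(i <- r | P i) W i) = \sum_(i <- r | P i) eX X (W i).
Proof. exact: eps_sum. Qed.

Lemma lef_sum (I : Type) (r : seq I) (P : pred I) (W : I -> Om) :
  lef (\sum_(i <- r | P i) W i) = \sum_(i <- r | P i) lef (W i).
Proof.
elim/big_rec2 : _ => [|i x y _ <-]; last by rewrite lefD.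
rewrite /lef big1 ?scl0 // => c _; rewrite /eX !eps0 //.
Qed.

Lemma lam0 : lam 0 = 0.
Proof. by rewrite /lam big1 ?scl0. Qed.

Lemma lam_sum (I : Type) (r : seq I) (P : pred I) (W : I -> Om) :
  lam (\sum_(i <- r | P i) W i) = \sum_(i <- r | P i) lam (W i).
Proof. by elim/big_rec2 : _ => [|i x y _ <-]; rewrite ?lam0 ?lamD. Qed.

Section MetricDerivation.
Variables (D : A -> A) (B : V -> V).
Hypothesis DD : forall f h, D (f + h) = D f + D h.
Hypothesis DM : forall f h, D (f * h) = D f * h + f * D h.
Hypothesis BL : forall f X Y, B (f *: X + Y) = f *: B X + D f *: X + B Y.
Hypothesis Dg : forall X Y, D (g X Y) = g (B X) Y + g X (B Y).
Local Notation dr := (der D B).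

Lemma der_eX X w : dr (eX X w) = eX X (dr w) + eX (B X) w.
Proof.
rewrite /eX der_eps //; congr (_ + _); apply: eps_ext => Y.
by rewrite Dg addrK.
Qed.

(** A derivation preserving the metric preserves traces: apply it to the expansion
    [X = sum_c g(X, F'_c) F_c]. Hence operators written with the frame commute with [nabla_X], [L_T]
    and the [J] rotation, although the frame is not parallel. *)
Lemma tr_der (be : V -> V -> A) : (forall Y, lin1 (be ^~ Y)) ->
  (forall X, lin1 (be X)) ->
  \sum_c (be (B (F c)) (F' c) + be (F c) (B (F' c))) = 0.
Proof.
move=> l1 l2.
have BD X Y : B (X + Y) = B X + B Y.
  have D1 : D 1 = 0.
    have := DM 1 1; rewrite !mulr1 mul1r => /eqP.
    by rewrite -subr_eq subrr => /eqP.
  by have := BL 1 X Y; rewrite !scale1r D1 scale0r addr0.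
have B0 : B 0 = 0.
  by have := BD 0 0; rewrite addr0 => /eqP; rewrite -subr_eq subrr => /eqP.
have BZ f X : B (f *: X) = f *: B X + D f *: X.
  by have := BL f X 0; rewrite !addr0 B0 addr0.
have Bsum (I : Type) (r : seq I) (W : I -> V) :
    B (\sum_(i <- r) W i) = \sum_(i <- r) B (W i).
  by elim/big_rec2 : _ => [|i x y _ <-]; rewrite ?B0 ?BD.
have key X : \sum_c (g X (F' c) *: B (F c) + g X (B (F' c)) *: F c) = 0.
  have := congr1 B (frameP S X); rewrite Bsum.
  under eq_bigr do rewrite BZ Dg scalerDl addrCA.
  rewrite big_split /= -frameP.
  by move/eqP; rewrite -{1}[B X]addr0 (inj_eq (addrI _)) eq_sym => /eqP.
under eq_bigr => c _.
  rewrite (lin1_frame' S (F' c) (l2 (B (F c)))).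
  rewrite (lin1_frame' S (B (F' c)) (l2 (F c))).
  rewrite -big_split /=.
  over.
rewrite exchange_big /= big1 // => e _.
transitivity (be (\sum_c (g (F e) (F' c) *: B (F c) + g (F e) (B (F' c)) *: F c))
  (F' e)); last by rewrite key (lin1_0 (l1 _)).
rewrite (lin1_sum _ _ _ (l1 _)); apply: eq_bigr => c _.
by rewrite (lin1D _ _ (l1 _)) !(lin1Z _ _ (l1 _)) ![g (F e) _]gmS.
Qed.

Hypothesis Dhf : D hf = 0.
Hypothesis BJ : forall X, B (J X) = J (B X).

Lemma der_lef w : dr (lef w) = lef (dr w).
Proof.
rewrite /lef der_scl // Dhf scl0l add0r der_sum //; congr (scl _ _).
apply/eqP; rewrite -subr_eq0 -sumrB; apply/eqP/funext => s; rewrite Om_sum.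
transitivity (0 : A) => //; rewrite -[RHS](@tr_der (fun X Y => eX X (eX (J Y) w) s)).
- apply: eq_bigr => c _.
  by rewrite !der_eX BJ eXD !OmE; ring.
- by move=> Y f X Z; exact: (eXL _ s lin2_id).
- move=> X f Y Z /=.
  have -> : eX (J (f *: Y + Z)) w = scl f (eX (J Y) w) + eX (J Z) w.
    by apply/funext => t; exact: (eXL w t lin2_J).
  by rewrite eXD eX_scl !OmE.
Qed.

Lemma der_lam w : isF w -> dr (lam w) = lam (dr w).
Proof.
move=> Fw; rewrite /lam der_scl // Dhf scl0l add0r der_sum //; congr (scl _ _).
apply/eqP; rewrite -subr_eq0 -sumrB; apply/eqP/funext => s; rewrite Om_sum.
transitivity (0 : A) => //; rewrite -[RHS](@tr_der (fun X Y => iota (J Y) (iota X w) s)).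
- apply: eq_bigr => c _.
  rewrite !iota_der iotaD iotaN iota_der -BJ !OmE.
  by ring.
- by move=> Y f X Z; rewrite !iotaE; have [l _] := Fw; exact: (l [::]).
- move=> X f Y Z /=; exact: (iotaL s lin2_J (isF_iota X Fw)).
Qed.

End MetricDerivation.

Lemma nab_eX X Y w : nab X (eX Y w) = eX Y (nab X w) + eX (cov S X Y) w.
Proof. by apply: der_eX; [exact: actD|exact: actM|exact: cov_metric]. Qed.

Lemma nab_lef X w : nab X (lef w) = lef (nab X w).
Proof.
by apply: der_lef; auto; first [exact: actD|exact: actM|move=> *; exact: cov_leibniz
  |exact: cov_metric|exact: act_half|exact: cov_J].
Qed.

Lemma nab_lam X w : isF w -> nab X (lam w) = lam (nab X w).
Proof.
by apply: der_lam; auto; first [exact: actD|exact: actM|move=> *; exact: cov_leibniz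
  |exact: cov_metric|exact: act_half|exact: cov_J].
Qed.

Lemma Jder_eX X w : Jder (eX X w) = eX X (Jder w) - eX (J X) w.
Proof.
rewrite /Jder der_eX => [|f h|f h|Y Z]; rewrite ?addr0 ?mul0r ?mulr0 ?addr0 //.
  congr (_ + _); apply/funext => s; rewrite OmE.
  have := eXL w s lin2_id (-1) (J X) 0; rewrite /= addr0 scaleN1r => ->.
  by rewrite (lin1_0 (eXL w s lin2_id)) mulN1r addr0.
by rewrite gNl gNr gmJ opprK subrr.
Qed.

Lemma Jder_lef w : Jder (lef w) = lef (Jder w).
Proof.
apply: der_lef => [f h|f h|f X Y|X Y|//|X]; rewrite ?addr0 ?mul0r ?mulr0 ?addr0 //.
- by rewrite scale0r addr0 JD JZ opprD scalerN.
- by rewrite gNl gNr gmJ opprK subrr.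
- by rewrite JN.
Qed.

Lemma nab_lin w s : isF w -> lin1 (fun X => nab X w s).
Proof.
move=> + f X Y; elim: s w => [|Z s IH] w Fw /=; first by rewrite /nab /= actL.
rewrite /nab /= -!/(nab _ _ s) IH; last exact: isF_iota.
by rewrite covL -!/(iota _ w s) iota_lin // !OmE; ring.
Qed.

Lemma nab_frame X w : isF w -> \sum_c scl (g X (F c)) (nab (F' c) w) = nab X w.
Proof.
move=> Fw; apply/funext => s; rewrite Om_sum.
by rewrite [RHS](lin1_frame' S X (nab_lin s Fw)); apply: eq_bigr => c _; rewrite sclE.
Qed.

Lemma der0B w (B : V -> V) : isF w -> lin2 B ->
  der (fun=> 0) B w = - \sum_c eX (F c) (iota (B (F' c)) w).
Proof.
move=> Fw lB; apply/funext => s; elim: s w Fw => [|Y s IH] w Fw /=.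
  by rewrite OmE Om_sum /= big1 ?oppr0.
rewrite IH; last exact: isF_iota.
rewrite !OmE !Om_sum -[w _]/(iota (B Y) w s) -(iota_frame Y lB Fw) Om_sum.
rewrite -opprD -big_split /=; congr (- _); apply: eq_bigr => c _ /=.
rewrite -[eX (F c) _ (Y :: s)]/(iota Y (eX (F c) (iota (B (F' c)) w)) s).
rewrite iota_eX (iota_iota Y (B (F' c)) Fw) eXN opprK !OmE (gmS S Y).
by rewrite addrC.
Qed.

Lemma nab_T w : isF w -> nab T w = lie T w.
Proof.
move=> Fw; apply/funext => s; rewrite /nab /lie; congr (der _ _ w s).
by apply/funext => X; exact: cov_Tl.
Qed.

End Operators.

(** * The exterior derivative and the transverse Kaehler identities *)

Section Kaehler.
Variables (A : comPzRingType) (V : lmodType A) (S : sasaki_data V).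
Local Notation Om := (seq V -> A).
Implicit Types (f h : A) (X Y Z W : V) (a b w : Om).
Local Notation "X ⋅ f" := (act S X f) (at level 38, left associativity).
Local Notation "⟦ X , Y ⟧" := (br S X Y).
Local Notation g := (gm S).
Local Notation J := (Jv S).
Local Notation T := (Tv S).
Local Notation th := (gm S (Tv S)).
Local Notation hf := (half S).
Local Notation F := (@Fr A V S).
Local Notation F' := (@Fr' A V S).
Local Notation eX := (eX S).
Local Notation nab := (nab S).
Local Notation lie := (lie S).
Local Notation Jder := (Jder S).
Local Notation lef := (lef S).
Local Notation lam := (lam S).
Local Notation dB := (dB S).
Local Notation delB := (delB S).

Lemma isF_lie X w : isF w -> isF (lie X w).
Proof. by apply: isF_der; [exact: actD|exact: actM|exact: brL]. Qed.

Hint Resolve isF_iota isF_eX isF_nab isF_Jder isF_lef isF_lam isF_dB isF_delB isF_lie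
  isF0 isFD isF_scl isFN : isf.
Hint Extern 0 (isF _) => solve [auto 6 with isf nocore] : core.

(** Exterior derivative, defined by Cartan's formula [i_Y d = L_Y - d i_Y]. *)
Fixpoint dd w s : A := if s is Y :: s' then lie Y w s' - dd (iota Y w) s' else 0.

Lemma iota_dd Y w : iota Y (dd w) = lie Y w - dd (iota Y w). Proof. by []. Qed.

Lemma iota_lie X Y w : iota Y (lie X w) = lie X (iota Y w) - iota ⟦X, Y⟧ w.
Proof. by []. Qed.

Lemma lieD X a b : lie X (a + b) = lie X a + lie X b.
Proof. by apply: der_add; exact: actD. Qed.
Lemma lieN X a : lie X (- a) = - lie X a.
Proof. by apply: der_opp; exact: actD. Qed.
Lemma ddD a b : dd (a + b) = dd a + dd b.
Proof.
apply/funext => s; elim: s a b => [|Y s IH] a b /=; first by rewrite OmE addr0.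
by rewrite iotaD IH lieD !OmE /=; ring.
Qed.
Lemma dd0 : dd 0 = 0.
Proof. by have := ddD 0 0; rewrite addr0 => /eqP; rewrite -subr_eq subrr => /eqP. Qed.
Lemma ddN a : dd (- a) = - dd a.
Proof. by apply/eqP; rewrite -addr_eq0 -ddD addrC subrr dd0. Qed.

Lemma lie_comm X Y w : isF w -> lie X (lie Y w) - lie Y (lie X w) = lie ⟦X, Y⟧ w.
Proof.
move=> Fw; rewrite /lie der_comm; [|exact: actD|exact: actD|].
  congr (der _ _ w); first by apply/funext => f; rewrite act_br.
  by apply/funext => Z; rewrite jacobi addrK.
by move=> t s Y' Z; exact: isF_add.
Qed.

Lemma lie_dd Z w : isF w -> lie Z (dd w) = dd (lie Z w).
Proof.
move=> Fw; apply/funext => s; elim: s w Fw => [|Y s IH] w Fw.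
  by rewrite /lie /= act0.
rewrite -!iotaE iota_lie !iota_dd iota_lie lieD lieN ddD ddN !OmE IH //.
have := congr1 (fun u : Om => u s) (lie_comm Z Y Fw); rewrite !OmE => <-.
by ring.
Qed.

(** By Cartan's formula [i_Y d d = [L_Y, d] + d d i_Y], so induction on the number of arguments
    applies. *)
Lemma dd_dd w : isF w -> dd (dd w) = 0.
Proof.
move=> Fw; apply/funext => s; elim: s w Fw => [|Y s IH] w Fw //.
rewrite -iotaE !iota_dd ddD ddN !OmE IH // lie_dd //.
by rewrite Om0; ring.
Qed.

Lemma iota0v w : isF w -> iota 0 w = 0.
Proof.
move=> Fw; have := iota_lin 1 0 0 Fw.
rewrite scale1r addr0 scl1 => /eqP.
by rewrite -subr_eq subrr eq_sym => /eqP.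
Qed.

Lemma iotaNv X w : isF w -> iota (- X) w = - iota X w.
Proof.
move=> Fw; have := iota_lin (-1) X 0 Fw.
by rewrite scaleN1r addr0 iota0v // addr0 sclNl scl1.
Qed.

Lemma iotaDv X Y w : isF w -> iota (X + Y) w = iota X w + iota Y w.
Proof. by move=> Fw; have := iota_lin 1 X Y Fw; rewrite scale1r scl1. Qed.

Lemma iotaZv f X w : isF w -> iota (f *: X) w = scl f (iota X w).
Proof. by move=> Fw; have := iota_lin f X 0 Fw; rewrite addr0 iota0v // addr0. Qed.

Lemma eX_lin1 w s : lin1 (fun X => eX X w s).
Proof. exact: (eXL S w s (lin2_id (V := V))). Qed.

Lemma eXDv X Y w : eX (X + Y) w = eX X w + eX Y w.
Proof. by apply/funext => s; exact: (lin1D _ _ (eX_lin1 w s)). Qed.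
Lemma eX0v w : eX 0 w = 0.
Proof. by apply/funext => s; exact: (lin1_0 (eX_lin1 w s)). Qed.
Lemma eXNv X w : eX (- X) w = - eX X w.
Proof. by apply/funext => s; exact: (lin1N _ (eX_lin1 w s)). Qed.
Lemma eXZv f X w : eX (f *: X) w = scl f (eX X w).
Proof. by apply/funext => s; exact: (lin1Z _ _ (eX_lin1 w s)). Qed.

Lemma br_id X : ⟦X, X⟧ = 0.
Proof.
rewrite -[LHS]scale1r -(halfP S) mulr_natr mulr2n scalerDl.
by rewrite {2}(brN S X X) scalerN subrr.
Qed.

Lemma iota_nab X Y w : iota Y (nab X w) = nab X (iota Y w) - iota (cov S X Y) w.
Proof. by []. Qed.

Lemma nab_iota X Y w : nab X (iota Y w) = iota Y (nab X w) + iota (cov S X Y) w.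
Proof. by rewrite iota_nab subrK. Qed.

(** [L_Y - nabla_Y] kills functions, so it is the tensorial extension of an endomorphism, which the
    torsion identifies as [Z |-> - nabla_Z Y - om(Y, Z) T]. *)
Lemma lie_nab Y w : isF w ->
  lie Y w = nab Y w + \sum_c eX (F c) (iota (cov S (F' c) Y) w) + eX (J Y) (iota T w).
Proof.
move=> Fw; have lB : lin2 (fun Z => - cov S Z Y - om S Y Z *: T).
  move=> f X Z; rewrite covL /om gDr gZr !opprD scalerDr !scalerN scalerDl scalerA.
  by rewrite opprD addrACA.
have e : lie Y w - nab Y w = der (fun=> 0) (fun Z => - cov S Z Y - om S Y Z *: T) w.
  apply/funext => s; elim: s w Fw => [|Z s IH] w Fw; first by rewrite /lie /nab !OmE /= subrr.
  have := IH _ (isF_iota Z Fw); rewrite !OmE => IH'.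
  rewrite -[in RHS]iotaE iota_der !OmE -IH' -!iotaE iota_lie iota_nab.
  have -> : - cov S Z Y - om S Y Z *: T = ⟦Y, Z⟧ - cov S Y Z.
    have := cov_torsion S Y Z; rewrite /tb => h.
    by rewrite -(subrK (cov S Z Y) (cov S Y Z)) h !opprD !addrA subrr sub0r addrC.
  by have := iotaDv ⟦Y, Z⟧ (- cov S Y Z) Fw => /(congr1 (fun u : Om => u s));
    rewrite iotaNv // !OmE => ->; ring.
rewrite -[LHS](subrK (nab Y w)) e (der0B S Fw lB) addrC -addrA; congr (_ + _).
rewrite -sumrN -(eX_frame' S (J Y) (iota T w) (lin2_id (V := V))) -big_split.
apply: eq_bigr => c _ /=; rewrite -eXN -iotaNv // opprD !opprK iotaDv // iotaZv // eXD eX_scl.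
by [].
Qed.

Lemma act_thE X Y : X ⋅ th Y = th (cov S X Y).
Proof. by rewrite cov_metric cov_T g0l add0r. Qed.

Lemma cov_hpr X Y : cov S X (hpr S Y) = hpr S (cov S X Y).
Proof.
by rewrite /hpr covDr covNr covZr cov_T scaler0 add0r act_thE.
Qed.

(* [d0] is the transverse exterior derivative and [d1] its conjugate by [J]. *)
Definition d0 := dB (hpr S).
Definition d1 := dB J.
Definition del0 := delB (hpr S).
Definition del1 := delB J.

Lemma g_hpr X Y : g (hpr S X) Y = g X (hpr S Y).
Proof. by rewrite /hpr !gE (gmS S X T) (gmS S T Y); ring. Qed.

Lemma eX_hpr X w : eX (hpr S X) w = eX X w - scl (th X) (eX T w).
Proof. by rewrite /hpr eXDv eXNv eXZv. Qed.

Lemma iota_d0 Y w : isF w -> iota Y (d0 w) + d0 (iota Y w) =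
  nab (hpr S Y) w + \sum_c eX (hpr S (F c)) (iota (cov S (F' c) Y) w).
Proof.
move=> Fw; rewrite -(nab_frame S (hpr S Y) Fw) /d0 /dB iota_sum -!big_split /=.
apply: eq_bigr => c _; rewrite iota_eX nab_iota eXD g_hpr (gmS S (F c)).
by rewrite addrA subrK.
Qed.

(** Both sides obey Cartan's formula, by [lie_nab] and [iota_lef]: the torsion term of [lie_nab] is
    the anticommutator of [i_Y] with [L i_T]. *)
Lemma ddE w : isF w -> dd w = d0 w + eX T (lie T w) + lef (iota T w).
Proof.
move=> Fw; apply/funext => s; elim: s w Fw => [|Y s IH] w Fw.
  rewrite !OmE /d0 /dB Om_sum big1 // /lef !OmE Om_sum big1 //.
  by rewrite /= mulr0 !addr0.
rewrite -!(iotaE Y) iota_dd !iotaD OmE [in LHS]OmE IH // lie_nab //.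
have e1 : \sum_c eX (hpr S (F c)) (iota (cov S (F' c) Y) w) =
    \sum_c eX (F c) (iota (cov S (F' c) Y) w) - eX T (iota ⟦T, Y⟧ w).
  rewrite -cov_Tl; under eq_bigr do rewrite eX_hpr; rewrite big_split /= sumrN; congr (_ - _).
  rewrite -[cov S T Y in RHS](_ : \sum_c g T (F c) *: cov S (F' c) Y = _); last first.
    under eq_bigr do rewrite -covZl; by rewrite -cov_suml -frameP'.
  have -> : iota (\sum_c g T (F c) *: cov S (F' c) Y) w =
      \sum_c scl (g T (F c)) (iota (cov S (F' c) Y) w).
    elim/big_rec2 : _ => [|c a b _ <-]; first by rewrite iota0v.
    by rewrite iotaDv // iotaZv.
  by rewrite eX_sum; apply: eq_bigr => c _; rewrite eX_scl.
have e2 : nab Y w = nab (hpr S Y) w + scl (th Y) (lie T w).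
  rewrite -nab_T // -[Y in LHS](hprK S Y); apply/funext => t.
  by rewrite (lin1D _ _ (nab_lin S t Fw)) (lin1Z _ _ (nab_lin S t Fw)).
have e3 := iota_d0 Y Fw; rewrite e1 in e3.
have {}e3 : iota Y (d0 w) = nab (hpr S Y) w +
  (\sum_c eX (F c) (iota (cov S (F' c) Y) w) - eX T (iota ⟦T, Y⟧ w)) - d0 (iota Y w).
  by rewrite -e3 addrK.
rewrite e3 e2 iota_eX iota_lie eXD eXN iota_lef (iota_iota Y T Fw).
rewrite (_ : lef (- iota T (iota Y w)) = - lef (iota T (iota Y w))); last first.
  by apply/eqP; rewrite -addr_eq0 -lefD addrC subrr /lef big1 ?scl0 // => c _; rewrite /eX !eps0.
by rewrite !OmE; ring.
Qed.

Lemma isF_dd w : isF w -> isF (dd w).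
Proof. by move=> Fw; rewrite ddE // /d0; auto 6 with isf. Qed.

Lemma lam_dB B w : isF w ->
  lam (dB B w) = dB B (lam w) - delB (fun X => J (B X)) w.
Proof.
move=> Fw; rewrite /dB /delB opprK lam_sum -big_split; apply: eq_bigr => c _ /=.
by rewrite lam_eX // nab_lam.
Qed.

Lemma lef_dB B w : lef (dB B w) = dB B (lef w).
Proof.
by rewrite /dB lef_sum; apply: eq_bigr => c _; rewrite nab_lef eX_lef.
Qed.

Lemma dB_ext B C w : B =1 C -> dB B w = dB C w.
Proof. by move=> /funext ->. Qed.
Lemma delB_ext B C w : B =1 C -> delB B w = delB C w.
Proof. by move=> /funext ->. Qed.

Lemma delBN B w : isF w -> delB (fun X => - B X) w = - delB B w.
Proof.
move=> Fw; rewrite /delB; congr (- _); rewrite -sumrN; apply: eq_bigr => c _.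
by rewrite iotaNv.
Qed.
Lemma dBN B w : dB (fun X => - B X) w = - dB B w.
Proof. by rewrite /dB -sumrN; apply: eq_bigr => c _; rewrite eXNv. Qed.

Lemma JJ_hpr X : J (J X) = - hpr S X.
Proof. by rewrite JvJ /hpr opprB. Qed.

Lemma lam_d0 w : isF w -> lam (d0 w) = d0 (lam w) - del1 w.
Proof. by move=> Fw; rewrite lam_dB //; congr (_ - _); apply: delB_ext => X; rewrite J_hpr. Qed.

Lemma lam_d1 w : isF w -> lam (d1 w) = d1 (lam w) + del0 w.
Proof.
move=> Fw; rewrite /del0 lam_dB //.
have -> : delB (fun X => J (J X)) w = - delB (hpr S) w; last by rewrite opprK.
by rewrite -delBN //; apply: delB_ext => X; rewrite JJ_hpr.
Qed.

Lemma iotaT_dB B w : isF w -> (forall X, th (B X) = 0) -> iota T (dB B w) = - dB B (iota T w).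
Proof.
move=> Fw hB; rewrite /dB iota_sum -sumrN; apply: eq_bigr => c _.
by rewrite iota_eX gmS hB scl0l add0r nab_iota cov_T iota0v // addr0.
Qed.

Lemma eXT_dB B w : eX T (dB B w) = - dB B (eX T w).
Proof.
rewrite /dB eX_sum -sumrN; apply: eq_bigr => c _.
by rewrite nab_eX cov_T eX0v addr0 eX_anti.
Qed.

Lemma dBN_arg B w : dB B (- w) = - dB B w.
Proof.
by rewrite /dB -sumrN; apply: eq_bigr => c _; rewrite nabN eXN.
Qed.

Lemma lefN w : lef (- w) = - lef w.
Proof.
rewrite /lef -sclN -sumrN; congr (scl _ _); apply: eq_bigr => c _.
by rewrite !eXN.
Qed.

Lemma JderD a b : Jder (a + b) = Jder a + Jder b.
Proof. by apply: der_add => f h; rewrite addr0. Qed.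
Lemma JderN a : Jder (- a) = - Jder a.
Proof. by apply: der_opp => f h; rewrite addr0. Qed.
Lemma Jder_sum (I : Type) (r : seq I) (P : pred I) (W : I -> Om) :
  Jder (\sum_(i <- r | P i) W i) = \sum_(i <- r | P i) Jder (W i).
Proof. by apply: der_sum => f h; rewrite addr0. Qed.

Lemma Jder_nab X w : isF w -> Jder (nab X w) = nab X (Jder w).
Proof.
move=> Fw; apply/eqP; rewrite -subr_eq0; apply/eqP.
rewrite /Jder /nab der_comm => [|f h|f h|t s Y Z]; rewrite ?addr0 ?actD ?isF_add //.
have -> : (fun f => 0 - X ⋅ 0) = fun=> 0 by apply/funext => f; rewrite act0 subr0.
have -> : (fun Y => - J (cov S X Y) - cov S X (- J Y)) = fun=> 0.
  by apply/funext => Y; rewrite covNr cov_J opprK addrC subrr.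
apply/funext => s; elim: s w Fw => [|Y s IH] w Fw //=.
by rewrite IH // !Om0 sub0r -[w _]/(iota 0 w s) iota0v // oppr0.
Qed.

Lemma Jder_dB B w : isF w -> Jder (dB B w) = dB B (Jder w) - dB (fun X => J (B X)) w.
Proof.
move=> Fw; rewrite /dB Jder_sum -sumrB; apply: eq_bigr => c _.
by rewrite Jder_eX Jder_nab.
Qed.

Lemma d1E w : isF w -> d1 w = d0 (Jder w) - Jder (d0 w).
Proof.
move=> Fw; rewrite /d0 Jder_dB // opprB addrC subrK.
by apply: dB_ext => X; rewrite J_hpr.
Qed.

Lemma Jder_d1 w : isF w -> Jder (d1 w) = d1 (Jder w) + d0 w.
Proof.
move=> Fw; rewrite /d1 Jder_dB //; congr (_ + _); rewrite -dBN.
by apply: dB_ext => X; rewrite JJ_hpr opprK.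
Qed.

Lemma lieT_eXT w : lie T (eX T w) = eX T (lie T w).
Proof.
rewrite /lie der_eX; [|exact: actD|exact: actM|exact: killing].
by rewrite br_id eX0v addr0.
Qed.

Lemma lieT_iotaT w : isF w -> lie T (iota T w) = iota T (lie T w).
Proof. by move=> Fw; rewrite iota_lie br_id iota0v // subr0. Qed.

Lemma lieT_lef w : lie T (lef w) = lef (lie T w).
Proof.
by apply: der_lef; auto; first [exact: actD|exact: actM|move=> *; exact: brL
  |exact: killing|exact: act_half|exact: brTJ].
Qed.

Lemma lieT_Jder w : isF w -> lie T (Jder w) = Jder (lie T w).
Proof.
move=> Fw; apply/eqP; rewrite -subr_eq0; apply/eqP.
rewrite /Jder /lie der_comm => [|f h|f h|t s Y Z]; rewrite ?addr0 ?actD ?isF_add //.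
have -> : (fun f => T ⋅ 0 - 0) = fun=> 0 by apply/funext => f; rewrite act0 subr0.
have -> : (fun Y => ⟦T, - J Y⟧ - - J ⟦T, Y⟧) = fun=> 0.
  by apply/funext => Y; rewrite brNr brTJ opprK addrC subrr.
apply/funext => s; elim: s w Fw => [|Y s IH] w Fw //=.
by rewrite IH // !Om0 sub0r -[w _]/(iota 0 w s) iota0v // oppr0.
Qed.

Lemma isF_d0 w : isF w -> isF (d0 w). Proof. exact: isF_dB. Qed.
Lemma isF_d1 w : isF w -> isF (d1 w). Proof. exact: isF_dB. Qed.
Hint Resolve isF_d0 isF_d1 isF_dd : isf.

(** [L_T] commutes with [dd] and with the last two terms of its splitting, hence with the first. *)
Lemma lieT_d0 w : isF w -> lie T (d0 w) = d0 (lie T w).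
Proof.
move=> Fw; have := lie_dd T Fw; rewrite !ddE // !lieD lieT_eXT lieT_lef lieT_iotaT //.
by move=> /addIr/addIr.
Qed.

Lemma lieT_d1 w : isF w -> lie T (d1 w) = d1 (lie T w).
Proof.
by move=> Fw; rewrite !d1E // lieD lieN lieT_d0 // !lieT_Jder // lieT_d0.
Qed.

Lemma eXT_iotaT w : iota T (eX T w) = w - eX T (iota T w).
Proof. by rewrite iota_eX gmTT scl1. Qed.

Lemma lef_eXT w : lef (eX T w) = eX T (lef w).
Proof. by rewrite eX_lef. Qed.

Lemma lef_iotaT w : iota T (lef w) = lef (iota T w).
Proof. by rewrite iota_lef JvT eX0v addr0. Qed.

Lemma eXT_d0 w : eX T (d0 w) = - d0 (eX T w). Proof. exact: eXT_dB. Qed.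
Lemma iotaT_d0 w : isF w -> iota T (d0 w) = - d0 (iota T w).
Proof. by move=> Fw; apply: iotaT_dB => // X; exact: th_hpr. Qed.
Lemma iotaT_d1 w : isF w -> iota T (d1 w) = - d1 (iota T w).
Proof. by move=> Fw; apply: iotaT_dB => // X; exact: thJ. Qed.
Lemma lef_d0 w : lef (d0 w) = d0 (lef w). Proof. exact: lef_dB. Qed.
Lemma lef_d1 w : lef (d1 w) = d1 (lef w). Proof. exact: lef_dB. Qed.

Lemma d0D a b : d0 (a + b) = d0 a + d0 b. Proof. exact: dBD. Qed.
Lemma d1D a b : d1 (a + b) = d1 a + d1 b. Proof. exact: dBD. Qed.
Lemma d0N a : d0 (- a) = - d0 a. Proof. exact: dBN_arg. Qed.
Lemma d1N a : d1 (- a) = - d1 a. Proof. exact: dBN_arg. Qed.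

(** Insert the splitting of [dd] into [dd (dd w) = 0]; all other terms cancel. *)
Lemma d0_d0 w : isF w -> d0 (d0 w) = - lef (lie T w).
Proof.
move=> Fw; apply/eqP; rewrite -addr_eq0; apply/eqP; rewrite -[RHS](dd_dd Fw).
have l0 : lef 0 = 0 by apply: (addrI (lef 0)); rewrite -lefD !addr0.
rewrite [dd (dd w)]ddE // lie_dd // iota_dd !ddE // iota_iota_id // l0 addr0.
rewrite (lieT_iotaT Fw) lefD lefN.
rewrite (lefD S (d0 (iota T w)) (eX T _)) (d0D _ (lef _)) (d0D (d0 w)).
rewrite (eXD S T _ (lef _)) (eXD S T (d0 _)) eX_sq eXT_d0 lef_d0 lef_eXT.
by apply/funext => s; rewrite !OmE; ring.
Qed.

(** Write [d1] as the commutator of [d0] with the [J] rotation: what is left is the commutator of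
    [d0 d0 = - L L_T] with the rotation, which is zero. *)
Lemma d0_d1 w : isF w -> d0 (d1 w) + d1 (d0 w) = 0.
Proof.
move=> Fw; rewrite !d1E // d0D d0N !d0_d0 // JderN Jder_lef lieT_Jder //.
by apply/funext => s; rewrite !OmE; ring.
Qed.

(** Commuting the relation [d0 d1 + d1 d0 = 0] with the [J] rotation gives
    [2 (d0 d0 - d1 d1) = 0]. *)
Lemma d1_d1 w : isF w -> d1 (d1 w) = d0 (d0 w).
Proof.
move=> Fw; have e1 := d0_d1 (isF_Jder S Fw).
have e2 := congr1 Jder (d0_d1 Fw); rewrite JderD Jder_d1 // in e2.
have e3 := d1E (isF_d1 Fw); rewrite Jder_d1 // d0D in e3.
rewrite -[LHS](scl_half S) -[RHS](scl_half S); congr (scl _ _).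
have e4 : Jder 0 = 0 by apply: (addrI (Jder 0)); rewrite -JderD !addr0.
have e5 := d1E Fw; have e6 : Jder (d0 w) = d0 (Jder w) - d1 w.
  by rewrite e5 opprB addrC subrK.
rewrite e4 e6 d1D d1N in e2.
have e7 : Jder (d0 (d1 w)) = d0 (d1 (Jder w)) + d0 (d0 w) - d1 (d1 w).
  by rewrite e3 opprB addrC subrK.
rewrite e7 in e2; apply/eqP; rewrite -subr_eq0; apply/eqP.
apply/funext => s; have := congr1 (fun u : Om => u s) e1.
have := congr1 (fun u : Om => u s) e2; rewrite !OmE => h1 h2.
rewrite -[LHS]opprK; apply/eqP; rewrite oppr_eq0; apply/eqP; rewrite -h1.
by move/eqP: h2; rewrite addr_eq0 => /eqP ->; ring.
Qed.

Lemma tr_swap (be : V -> V -> A) : (forall Y, lin1 (be ^~ Y)) ->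
  (forall X, lin1 (be X)) -> \sum_c be (F' c) (F c) = \sum_c be (F c) (F' c).
Proof.
move=> l1 l2; under eq_bigr => c _ do rewrite (lin1_frame S (F' c) (l1 _)).
rewrite exchange_big; apply: eq_bigr => e _ /=.
rewrite [in RHS](lin1_frame S (F' e) (l2 _)).
by apply: eq_bigr => c _; rewrite gmS.
Qed.

Lemma tr_skew (be : V -> V -> A) : (forall Y, lin1 (be ^~ Y)) ->
  (forall X, lin1 (be X)) -> \sum_c be (J (F c)) (F' c) = - \sum_c be (F c) (J (F' c)).
Proof.
move=> l1 l2; have h := @tr_der _ _ S (fun=> 0) J _ _ _ be l1 l2.
apply/eqP; rewrite -addr_eq0 -big_split h // => [f k|f X Y|X Y].
- by rewrite mul0r mulr0 addr0.
- by rewrite scale0r addr0 JvL.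
- by rewrite gmJ addrC subrr.
Qed.

Variable n : nat.
Hypothesis trace_frame : \sum_c g (F c) (F' c) = n.*2.+1%:R.

Definition num w : Om := \sum_c eX (F c) (iota (F' c) w).

Lemma numE w s : isF w -> num w s = (size s)%:R * w s.
Proof.
elim: s w => [|Y s IH] w Fw; first by rewrite /num Om_sum big1 ?mul0r.
have h : iota Y (num w) = num (iota Y w) + iota Y w.
  rewrite -[X in _ + X](iota_frame S Y (lin2_id (V := V)) Fw) /num iota_sum -big_split.
  apply: eq_bigr => c _ /=; rewrite iota_eX (iota_iota Y (F' c) Fw) eXN opprK addrC.
  by rewrite gmS.
rewrite -iotaE h OmE IH // iotaE /= -natr1 mulrDl mul1r.
by [].
Qed.

(** On horizontal forms of degree [q] this is the sl(2) relation [[Lam, L] = n - q]; here [n] is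
    half the trace of [- J^2]. *)
Lemma lam_lef w : isF w ->
  lam (lef w) = lef (lam w) + scl n%:R w - num w + eX T (iota T w).
Proof.
move=> Fw; apply/funext => s.
have lb : forall Y, lin1 (fun X => eX X (iota Y w) s) by move=> Y; exact: eX_lin1.
have lb' X : lin1 (fun Y => eX X (iota Y w) s).
  by move=> f Y Z; rewrite iota_lin // eXD eX_scl !OmE.
rewrite /lef; have lam_scl f u : lam (scl f u) = scl f (lam u).
  rewrite /lam scl_scl mulrC -scl_scl; congr (scl _ _).
  by rewrite scl_sum; apply: eq_bigr.
rewrite lam_scl lam_sum.
have e c : lam (eX (F c) (eX (J (F' c)) w)) = eX (F c) (eX (J (F' c)) (lam w)) +
   (scl (th (F' c)) (eX (F c) (iota T w)) - eX (F c) (iota (F' c) w)) +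
   (scl (g (J (F' c)) (J (F c))) w - eX (J (F' c)) (iota (J (F c)) w)).
  rewrite !lam_eX // iota_eX eXD JvJ iotaDv // iotaNv // iotaZv // eXD eXN eX_scl.
  by [].
under eq_bigr do rewrite e.
rewrite !big_split /= !sumrN !OmE !Om_sum.
have e1 : \sum_c scl (th (F' c)) (eX (F c) (iota T w)) s = eX T (iota T w) s.
  by rewrite -[in RHS](eX_frame' S T (iota T w) (lin2_id (V := V))) Om_sum.
(* [- J^2] has trace [2 n]: the full trace [2 n + 1] minus the direction [T]. *)
have e2 : \sum_c scl (g (J (F' c)) (J (F c))) w s = (n%:R * w s) * 2.
  under eq_bigr do rewrite OmE gJJ gmS; rewrite -mulr_suml sumrB trace_frame.
  have -> : \sum_c th (F' c) * th (F c) = 1.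
    by rewrite -(gmTT S) [RHS](lin1_frame S T (gm_linr S T)).
  by rewrite -addnn -natr1 natrD; ring.
have e3 : \sum_c eX (J (F' c)) (iota (J (F c)) w) s = num w s - eX T (iota T w) s.
  rewrite (tr_swap (be := fun X Y => eX (J X) (iota (J Y) w) s)).
  - rewrite (tr_skew (be := fun X Y => eX X (iota (J Y) w) s)) => [|Y|X f Y Z]; first last.
  + by rewrite JvL iota_lin // eXD eX_scl !OmE.
  + exact: eX_lin1.
  + rewrite /num -sumrN Om_sum -e1 -sumrB; apply: eq_bigr => c _.
    by rewrite JvJ iotaDv // iotaNv // iotaZv // eXD eXN eX_scl !OmE; ring.
  - by move=> Y f X Z; rewrite JvL -eX_lin1.
  - by move=> X f Y Z; rewrite JvL iota_lin // eXD eX_scl !OmE.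
rewrite e1 e2 e3 /num Om_sum.
have hh x : hf * (x * 2) = x by rewrite mulrCA halfP mulr1.
set P := \sum_i eX _ (eX _ _) s; set y := \sum_i eX _ _ s.
transitivity (hf * P + hf * ((n%:R * w s + eX T (iota T w) s - y) * 2)); first by ring.
by rewrite hh; ring.
Qed.

End Kaehler.

(** * The inner product of forms and formal adjoints *)

Section InnerProduct.
Variables (A : comPzRingType) (V : lmodType A) (S : sasaki_data V).
Local Notation Om := (seq V -> A).
Implicit Types (f h : A) (X Y Z W : V) (a b w : Om) (k : nat).
Local Notation "X ⋅ f" := (act S X f) (at level 38, left associativity).
Local Notation "⟦ X , Y ⟧" := (br S X Y).
Local Notation g := (gm S).
Local Notation J := (Jv S).
Local Notation T := (Tv S).
Local Notation th := (gm S (Tv S)).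
Local Notation hf := (half S).
Local Notation F := (@Fr A V S).
Local Notation F' := (@Fr' A V S).
Local Notation eX := (eX S).
Local Notation nab := (nab S).
Local Notation lie := (lie S).
Local Notation lef := (lef S).
Local Notation lam := (lam S).
Local Notation dB := (dB S).
Local Notation delB := (delB S).
Local Notation ninv := (ninv S).

Hint Resolve isF_iota isF_eX isF_nab isF_Jder isF_lef isF_lam isF_dB isF_delB isF_lie
  isF0 isFD isF_scl isFN : isf.
Hint Extern 0 (isF _) => solve [auto 6 with isf nocore] : core.

(** The successive factors [ninv] multiply to the [1 / k!] of the sum over all multi-indices. *)
Fixpoint ip k a b : A :=
  if k is k'.+1 then ninv k' * \sum_c ip k' (iota (F c) a) (iota (F' c) b)
  else a [::] * b [::].

Lemma ip_lin f k a a' b : ip k (scl f a + a') b = f * ip k a b + ip k a' b.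
Proof.
elim: k a a' b => [|k IH] a a' b /=; first by rewrite !OmE; ring.
rewrite [f * _]mulrCA -mulrDr [f * _]mulr_sumr -big_split; congr (_ * _); apply: eq_bigr => c _ /=.
by rewrite iotaD iota_scl IH.
Qed.

Lemma ip_linr f k a b b' : ip k a (scl f b + b') = f * ip k a b + ip k a b'.
Proof.
elim: k a b b' => [|k IH] a b b' /=; first by rewrite !OmE; ring.
rewrite [f * _]mulrCA -mulrDr [f * _]mulr_sumr -big_split; congr (_ * _); apply: eq_bigr => c _ /=.
by rewrite iotaD iota_scl IH.
Qed.

Lemma ipDl k a a' b : ip k (a + a') b = ip k a b + ip k a' b.
Proof. by have := ip_lin 1 k a a' b; rewrite scl1 mul1r. Qed.
Lemma ipDr k a b b' : ip k a (b + b') = ip k a b + ip k a b'.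
Proof. by have := ip_linr 1 k a b b'; rewrite scl1 mul1r. Qed.
Lemma ip0l k b : ip k 0 b = 0.
Proof. by apply: (addrI (ip k 0 b)); rewrite -ipDl !addr0. Qed.
Lemma ip0r k a : ip k a 0 = 0.
Proof. by apply: (addrI (ip k a 0)); rewrite -ipDr !addr0. Qed.
Lemma ipZl f k a b : ip k (scl f a) b = f * ip k a b.
Proof. by have := ip_lin f k a 0 b; rewrite addr0 ip0l addr0. Qed.
Lemma ipZr f k a b : ip k a (scl f b) = f * ip k a b.
Proof. by have := ip_linr f k a b 0; rewrite addr0 ip0r addr0. Qed.
Lemma ipNl k a b : ip k (- a) b = - ip k a b.
Proof. by apply/eqP; rewrite -addr_eq0 -ipDl addrC subrr ip0l. Qed.
Lemma ipNr k a b : ip k a (- b) = - ip k a b.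
Proof. by apply/eqP; rewrite -addr_eq0 -ipDr addrC subrr ip0r. Qed.
Lemma ip_suml k b (I : Type) (r : seq I) (P : pred I) (W : I -> Om) :
  ip k (\sum_(i <- r | P i) W i) b = \sum_(i <- r | P i) ip k (W i) b.
Proof. by elim/big_rec2 : _ => [|i x y _ <-]; rewrite ?ip0l ?ipDl. Qed.
Lemma ip_sumr k a (I : Type) (r : seq I) (P : pred I) (W : I -> Om) :
  ip k a (\sum_(i <- r | P i) W i) = \sum_(i <- r | P i) ip k a (W i).
Proof. by elim/big_rec2 : _ => [|i x y _ <-]; rewrite ?ip0r ?ipDr. Qed.

Lemma ip_iota_linl k a b : isF a -> lin1 (fun X => ip k (iota X a) b).
Proof. by move=> Fa f X Y; rewrite iota_lin // ip_lin. Qed.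
Lemma ip_iota_linr k a b : isF b -> lin1 (fun X => ip k a (iota X b)).
Proof. by move=> Fb f X Y; rewrite iota_lin // ip_linr. Qed.

Lemma ip_sym k a b : isF a -> isF b -> ip k a b = ip k b a.
Proof.
elim: k a b => [|k IH] a b Fa Fb /=; first by rewrite mulrC.
congr (_ * _); under eq_bigr => c _ do rewrite IH //.
rewrite -(tr_swap S (be := fun X Y => ip k (iota X b) (iota Y a))) //.
  by move=> Y; exact: ip_iota_linl.
by move=> X; exact: ip_iota_linr.
Qed.

(** Contraction with the frame gives one term in which it hits [X] and, by induction, [k.+1] equal
    terms in which it does not; [ninv] normalises the total. *)
Lemma ip_eX k X a b : isF a -> isF b -> ip k.+1 (eX X a) b = ip k a (iota X b).
Proof.
elim: k a b => [|k IH] a b Fa Fb.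
  have c0 := ninvP S 0; rewrite mulr1 in c0; rewrite /= c0 mul1r.
  rewrite -[RHS]/(ip 0 a (iota X b)) (lin1_frame' S X (ip_iota_linr 0 a Fb)) /=.
  apply: eq_bigr => c _.
  by rewrite iota_eX !OmE (_ : eX X _ [::] = 0) //; ring.
rewrite -[LHS]/(ninv k.+1 * \sum_c ip k.+1 (iota (F c) (eX X a)) (iota (F' c) b)).
under eq_bigr => c _ do
  rewrite iota_eX ipDl ipNl ipZl IH // (iota_iota X (F' c) Fb) ipNr opprK.
rewrite big_split /= -(lin1_frame' S X (ip_iota_linr k.+1 a Fb)).
rewrite -[X in _ * (_ + X)](_ : k.+1%:R * ip k.+1 a (iota X b) = _); last first.
  by rewrite [ip k.+1 _ _]/= mulrA (mulrC _ (ninv k)) ninvP mul1r.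
rewrite -[X in _ * (X + _)]mul1r -mulrDl mulrA.
have -> : 1 + k.+1%:R = k.+2%:R :> A by rewrite -[k.+2%:R]natr1 addrC.
by rewrite ninvP mul1r.
Qed.

Section MetricDerivationIp.
Variables (D : A -> A) (B : V -> V).
Hypothesis DD : forall f h, D (f + h) = D f + D h.
Hypothesis DM : forall f h, D (f * h) = D f * h + f * D h.
Hypothesis BL : forall f X Y, B (f *: X + Y) = f *: B X + D f *: X + B Y.
Hypothesis Dg : forall X Y, D (g X Y) = g (B X) Y + g X (B Y).
Hypothesis Dninv : forall k, D (ninv k) = 0.
Local Notation dr := (der D B).

Lemma der_ip k a b : isF a -> isF b -> D (ip k a b) = ip k (dr a) b + ip k a (dr b).
Proof.
have D0 : D 0 = 0 by apply: (addrI (D 0)); rewrite -DD !addr0.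
elim: k a b => [|k IH] a b Fa Fb; first by rewrite /= DM.
have Dsum (I : finType) (x : I -> A) : D (\sum_i x i) = \sum_i D (x i).
  by elim/big_rec2 : _ => [|i u v _ <-] //.
rewrite [LHS]/= DM Dninv mul0r add0r Dsum [RHS]/= -mulrDr -big_split; congr (_ * _).
have := @tr_der _ _ S D B DM BL Dg (fun X Y => ip k (iota X a) (iota Y b)).
move=> /(_ (fun Y => ip_iota_linl _ _ Fa) (fun X => ip_iota_linr _ _ Fb)) h.
rewrite -[LHS]subr0 -[X in _ - X]h -sumrN -!big_split.
apply: eq_bigr => c _ /=; rewrite IH // !iota_der !ipDl !ipDr !ipNl !ipNr.
by ring.
Qed.

End MetricDerivationIp.

Lemma nab_ip X k a b : isF a -> isF b ->
  X ⋅ ip k a b = ip k (nab X a) b + ip k a (nab X b).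
Proof.
apply: der_ip; first [exact: actD|exact: actM|move=> *; exact: cov_leibniz
  |exact: cov_metric|exact: act_ninv].
Qed.

Lemma lieT_ip k a b : isF a -> isF b ->
  T ⋅ ip k a b = ip k (lie T a) b + ip k a (lie T b).
Proof.
apply: der_ip; first [exact: actD|exact: actM|move=> *; exact: brL
  |exact: killing|exact: act_ninv].
Qed.

(** Taken with [cov]; [piece_div] relates it to the Riemannian volume density. *)
Definition div W := \sum_c g (cov S (F' c) W) (F c).

(** [W] is the field dual to [Y |-> <a, i_(B Y) b>]; since [B] is parallel, the covariant Leibniz
    rule along the frame produces its divergence. *)
Lemma ip_dB (B : V -> V) k a b : lin2 B ->
  (forall X Y, cov S X (B Y) = B (cov S X Y)) -> isF a -> isF b ->
  ip k.+1 (dB B a) b = ip k a (delB B b) +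
    div (\sum_c ip k a (iota (B (F c)) b) *: F' c).
Proof.
move=> lB pB Fa Fb; set W := (X in div X).
have al : lin1 (fun Y => ip k a (iota (B Y) b)).
  by move=> f X Y; rewrite lB iota_lin // ip_linr.
have gW Y : g W Y = ip k a (iota (B Y) b).
  rewrite /W g_suml (lin1_frame S Y al); apply: eq_bigr => c _.
  by rewrite gZl (gmS S Y) mulrC.
rewrite /div /dB /delB ip_suml ipNr ip_sumr -sumrN -big_split; apply: eq_bigr => c _.
have := cov_metric S (F' c) W (F c).
rewrite !gW nab_ip // nab_iota pB ipDr => h.
rewrite [LHS]ip_eX //; apply: (addIr (ip k a (iota (B (cov S (F' c) (F c))) b))).
by rewrite -[RHS]addrA -h; ring.
Qed.

Lemma div_T f : div (f *: T) = T ⋅ f.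
Proof.
rewrite [RHS](lin1_frame' S T (act_lin S f)) /div; apply: eq_bigr => c _.
by rewrite covZr cov_T scaler0 add0r gZl mulrC.
Qed.

End InnerProduct.

(** * Hodge theory from the Kaehler identities *)

Section KaehlerAlgebra.
Variables (R : realFieldType) (Om : zmodType) (ip : Om -> Om -> R).
Variables (d0 d1 s0 s1 L Lam e i l : {additive Om -> Om}).
Variables (n : nat) (hz : nat -> Om -> Prop).

(** [e], [i], [l] stand for exterior product by theta, interior product by [T] and Lie derivative
    along [T]; [hz q] selects the horizontal forms of degree [q], on which the sl(2) relation
    [K_Lam_L] takes its scalar form. *)
Record kaehler_algebra : Prop := KaehlerAlgebra {
  K_ipDl : forall a b c, ip (a + b) c = ip a c + ip b c;
  K_ipS : forall a b, ip a b = ip b a;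
  K_ip_ge0 : forall a, 0 <= ip a a;
  K_ip_eq0 : forall a, ip a a = 0 -> a = 0;
  K_adj_d0 : forall a b, ip (d0 a) b = ip a (s0 b);
  K_adj_d1 : forall a b, ip (d1 a) b = ip a (s1 b);
  K_adj_L : forall a b, ip (L a) b = ip a (Lam b);
  K_adj_e : forall a b, ip (e a) b = ip a (i b);
  K_adj_l : forall a b, ip (l a) b = - ip a (l b);
  K_Lam_d0 : forall w, Lam (d0 w) = d0 (Lam w) - s1 w;
  K_Lam_d1 : forall w, Lam (d1 w) = d1 (Lam w) + s0 w;
  K_L_d0 : forall w, L (d0 w) = d0 (L w);
  K_L_d1 : forall w, L (d1 w) = d1 (L w);
  K_d0_d0 : forall w, d0 (d0 w) = - L (l w);
  K_d1_d1 : forall w, d1 (d1 w) = - L (l w);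
  K_d0_d1 : forall w, d0 (d1 w) + d1 (d0 w) = 0;
  K_l_L : forall w, l (L w) = L (l w);
  K_l_e : forall w, l (e w) = e (l w);
  K_l_i : forall w, l (i w) = i (l w);
  K_l_d0 : forall w, l (d0 w) = d0 (l w);
  K_l_d1 : forall w, l (d1 w) = d1 (l w);
  K_i_e : forall w, i (e w) = w - e (i w);
  K_i_i : forall w, i (i w) = 0;
  K_e_e : forall w, e (e w) = 0;
  K_e_d0 : forall w, e (d0 w) = - d0 (e w);
  K_i_d0 : forall w, i (d0 w) = - d0 (i w);
  K_L_e : forall w, L (e w) = e (L w);
  K_L_i : forall w, i (L w) = L (i w);
  K_hz_i : forall q w, hz q w -> i w = 0;
  K_Lam_L : forall q w, hz q w -> Lam (L w) = L (Lam w) + w *+ n - w *+ q;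
  K_hzD : forall q a b, hz q a -> hz q b -> hz q (a + b);
  K_hzN : forall q a, hz q a -> hz q (- a);
  K_hz_d0 : forall q w, hz q w -> hz q.+1 (d0 w);
  K_hz_d1 : forall q w, hz q w -> hz q.+1 (d1 w);
  K_hz_s0 : forall q w, hz q.+1 w -> hz q (s0 w);
  K_hz_s1 : forall q w, hz q.+1 w -> hz q (s1 w);
  K_hz_L : forall q w, hz q w -> hz q.+2 (L w);
  K_hz_Lam : forall q w, hz q.+2 w -> hz q (Lam w);
  K_hz_l : forall q w, hz q w -> hz q (l w);
  K_s0_0 : forall w, hz 0 w -> s0 w = 0;
  K_s1_0 : forall w, hz 0 w -> s1 w = 0 }.

End KaehlerAlgebra.

Section AbstractHodge.
Variables (R : realFieldType) (Om : zmodType) (ip : Om -> Om -> R).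
Variables (d0 d1 s0 s1 L Lam e i l : {additive Om -> Om}).
Variables (n : nat) (hz : nat -> Om -> Prop).
Hypothesis K : kaehler_algebra ip d0 d1 s0 s1 L Lam e i l n hz.
Implicit Types (a b u v w x y : Om) (q : nat).

Let ipDl := K_ipDl K.
Let ipS := K_ipS K.
Let ip_ge0 := K_ip_ge0 K.
Let ip_eq0 := K_ip_eq0 K.
Let adj_d0 := K_adj_d0 K.
Let adj_d1 := K_adj_d1 K.
Let adj_L := K_adj_L K.
Let adj_e := K_adj_e K.
Let adj_l := K_adj_l K.
Let Lam_d0 := K_Lam_d0 K.
Let Lam_d1 := K_Lam_d1 K.
Let L_d0 := K_L_d0 K.
Let L_d1 := K_L_d1 K.
Let d0_d0 := K_d0_d0 K.
Let d1_d1 := K_d1_d1 K.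
Let d0_d1 := K_d0_d1 K.
Let l_L := K_l_L K.
Let l_e := K_l_e K.
Let l_i := K_l_i K.
Let l_d0 := K_l_d0 K.
Let l_d1 := K_l_d1 K.
Let i_e := K_i_e K.
Let i_i := K_i_i K.
Let e_e := K_e_e K.
Let e_d0 := K_e_d0 K.
Let i_d0 := K_i_d0 K.
Let L_e := K_L_e K.
Let L_i := K_L_i K.
Let hz_i := K_hz_i K.
Let Lam_L := K_Lam_L K.
Let hzD := K_hzD K.
Let hzN := K_hzN K.
Let hz_d0 := K_hz_d0 K.
Let hz_d1 := K_hz_d1 K.
Let hz_s0 := K_hz_s0 K.
Let hz_s1 := K_hz_s1 K.
Let hz_L := K_hz_L K.
Let hz_Lam := K_hz_Lam K.
Let hz_l := K_hz_l K.
Let s0_0 := K_s0_0 K.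
Let s1_0 := K_s1_0 K.

(** The full exterior derivative and its adjoint [sOm] in terms of the horizontal operators; the
    minus sign in [sOm] is the skewness of [l]. *)
Definition dOm w := d0 w + e (l w) + L (i w).
Definition sOm w := s0 w - i (l w) + e (Lam w).
Definition lap w := d0 (s0 w) + s0 (d0 w).

Lemma dOm0 : dOm 0 = 0. Proof. by rewrite /dOm !raddf0 !addr0. Qed.

Lemma sOm0 : sOm 0 = 0. Proof. by rewrite /sOm !raddf0 !addr0. Qed.

Lemma hipDr a b c : ip a (b + c) = ip a b + ip a c.
Proof. by rewrite ipS ipDl !(ipS a). Qed.
Lemma hip0 b : ip 0 b = 0.
Proof. by apply: (addrI (ip 0 b)); rewrite -ipDl !addr0. Qed.
Lemma hipNl a b : ip (- a) b = - ip a b.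
Proof. by apply/eqP; rewrite -addr_eq0 -ipDl addrC subrr hip0. Qed.
Lemma hipNr a b : ip a (- b) = - ip a b.
Proof. by rewrite ipS hipNl ipS. Qed.
Lemma hip0r a : ip a 0 = 0. Proof. by rewrite ipS hip0. Qed.
Lemma hipMn a b q : ip (a *+ q) b = ip a b *+ q.
Proof. by elim: q => [|q IH]; rewrite ?hip0 // !mulrS ipDl IH. Qed.

Lemma ip_ext a b : (forall c, ip a c = ip b c) -> a = b.
Proof.
move=> ab; apply/eqP; rewrite -subr_eq0; apply/eqP/ip_eq0.
by rewrite ipDl hipNl ab subrr.
Qed.

Lemma adj_s0 a b : ip (s0 a) b = ip a (d0 b). Proof. by rewrite ipS -adj_d0 ipS. Qed.
Lemma adj_s1 a b : ip (s1 a) b = ip a (d1 b). Proof. by rewrite ipS -adj_d1 ipS. Qed.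
Lemma adj_Lam a b : ip (Lam a) b = ip a (L b). Proof. by rewrite ipS -adj_L ipS. Qed.
Lemma adj_i a b : ip (i a) b = ip a (e b). Proof. by rewrite ipS -adj_e ipS. Qed.

(** Here and below, the adjoints of the relations of the record are obtained by testing against all
    forms. *)
Lemma L_s0 w : L (s0 w) = s0 (L w) + d1 w.
Proof.
apply: ip_ext => b; rewrite !(adj_L, adj_s0, ipDl, adj_d1) Lam_d0 hipDr hipNr.
by rewrite subrK.
Qed.

Lemma L_s1 w : L (s1 w) = s1 (L w) - d0 w.
Proof.
apply: ip_ext => b; rewrite !(adj_L, adj_s1, ipDl, hipNl, adj_d0) Lam_d1 hipDr.
by rewrite addrK.
Qed.

Lemma Lam_s0 w : Lam (s0 w) = s0 (Lam w).
Proof. by apply: ip_ext => b; rewrite !(adj_Lam, adj_s0) L_d0. Qed.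

Lemma Lam_s1 w : Lam (s1 w) = s1 (Lam w).
Proof. by apply: ip_ext => b; rewrite !(adj_Lam, adj_s1) L_d1. Qed.

Lemma l_Lam w : l (Lam w) = Lam (l w).
Proof. by apply: ip_ext => b; rewrite adj_l !adj_Lam adj_l l_L. Qed.

Lemma l_s0 w : l (s0 w) = s0 (l w).
Proof. by apply: ip_ext => b; rewrite adj_l !adj_s0 adj_l l_d0. Qed.

Lemma l_s1 w : l (s1 w) = s1 (l w).
Proof. by apply: ip_ext => b; rewrite adj_l !adj_s1 adj_l l_d1. Qed.

Lemma s0_s0 w : s0 (s0 w) = Lam (l w).
Proof. by apply: ip_ext => b; rewrite !adj_s0 d0_d0 adj_Lam adj_l hipNr l_L. Qed.

Lemma s0_s1 w : s0 (s1 w) = - s1 (s0 w).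
Proof.
apply: ip_ext => b; rewrite hipNl !(adj_s0, adj_s1); apply/eqP.
by rewrite -addr_eq0 -hipDr addrC d0_d1 hip0r.
Qed.

Lemma i_s0 w : i (s0 w) = - s0 (i w).
Proof. by apply: ip_ext => b; rewrite hipNl adj_i !adj_s0 adj_i e_d0 hipNr opprK. Qed.

Lemma e_s0 w : e (s0 w) = - s0 (e w).
Proof. by apply: ip_ext => b; rewrite hipNl adj_e !adj_s0 adj_e i_d0 hipNr opprK. Qed.

Lemma i_Lam w : i (Lam w) = Lam (i w).
Proof. by apply: ip_ext => b; rewrite adj_i !adj_Lam adj_i L_e. Qed.

Lemma e_Lam w : e (Lam w) = Lam (e w).
Proof. by apply: ip_ext => b; rewrite adj_e !adj_Lam adj_e L_i. Qed.

Lemma ip_d a b : ip (dOm a) b = ip a (sOm b).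
Proof.
rewrite /dOm /sOm !(ipDl, hipDr, hipNr) adj_d0 adj_e adj_l adj_L adj_i.
by rewrite l_i.
Qed.

(** With both adjoints written as commutators with [Lam], the two Laplacians have the same terms
    once [d0] and [d1] anticommute. *)
Lemma lap1 w : lap w = d1 (s1 w) + s1 (d1 w).
Proof.
have s1E x : s1 x = d0 (Lam x) - Lam (d0 x) by rewrite Lam_d0 opprB addrC subrK.
have s0E x : s0 x = Lam (d1 x) - d1 (Lam x) by rewrite Lam_d1 addrAC subrr add0r.
have h x : d1 (d0 x) = - d0 (d1 x).
  by apply/eqP; rewrite -addr_eq0 addrC d0_d1.
rewrite /lap s0E s0E !s1E !raddfB /= !h raddfN /=.
by rewrite addrACA addrC.
Qed.

Lemma ip_lap w : ip (lap w) w = ip (s0 w) (s0 w) + ip (d0 w) (d0 w).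
Proof. by rewrite /lap ipDl adj_d0 (adj_s0 (d0 w)). Qed.

Lemma ip_lap1 w : ip (lap w) w = ip (s1 w) (s1 w) + ip (d1 w) (d1 w).
Proof. by rewrite lap1 ipDl adj_d1 (adj_s1 (d1 w)). Qed.

Lemma lap_eq0 w : ip (lap w) w = 0 ->
  [/\ d0 w = 0, s0 w = 0, d1 w = 0 & s1 w = 0].
Proof.
move=> h; have h0 := ip_lap w; have h1 := ip_lap1 w.
have p0 := ip_ge0 (s0 w); have p1 := ip_ge0 (s1 w).
have p2 := ip_ge0 (d0 w); have p3 := ip_ge0 (d1 w).
by split; apply: ip_eq0; lra.
Qed.

(** Pairing the sl(2) relation with [u] gives [|Lam u|^2 + (n - q) |u|^2 = 0]. *)
Lemma L_inj q u : hz q u -> (q < n)%N -> L u = 0 -> u = 0.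
Proof.
move=> hu qn Lu; apply: ip_eq0; have := Lam_L hu; rewrite Lu raddf0.
move/(congr1 (ip ^~ u)); rewrite hip0 !ipDl hipNl !hipMn adj_L => h.
have p := ip_ge0 u; have p' := ip_ge0 (Lam u).
move: h; rewrite -(subnK (ltnW qn)) mulrnDr addrA addrK => /esym/eqP.
rewrite paddr_eq0 ?mulrn_wge0 // mulrn_eq0 subn_eq0 leqNgt qn /=.
by case/andP => _ /eqP.
Qed.

Lemma Lam_inj q u : hz q u -> (n < q)%N -> Lam u = 0 -> u = 0.
Proof.
move=> hu qn Lu; apply: ip_eq0; have := Lam_L hu; rewrite Lu raddf0 add0r.
move/(congr1 (ip ^~ u)); rewrite ipDl hipNl !hipMn adj_Lam => h.
have p := ip_ge0 u; have p' := ip_ge0 (L u).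
have /eqP : ip (L u) (L u) + ip u u *+ (q - n) = 0.
  by rewrite h -[in X in _ - X](subnK (ltnW qn)) mulrnDr; ring.
rewrite paddr_eq0 ?mulrn_wge0 // mulrn_eq0 subn_eq0 leqNgt qn /=.
by case/andP => _ /eqP.
Qed.

(** In degree [n] the sl(2) relation reads [Lam L = L Lam], so [|L u| = |Lam u|]. *)
Lemma L_Lam_mid u : hz n u -> L u = 0 <-> Lam u = 0.
Proof.
move=> hu; have := Lam_L hu; rewrite addrK => h.
have e1 : ip (L u) (L u) = ip (Lam u) (Lam u) by rewrite -adj_Lam -adj_L -h adj_Lam.
by split=> h0; apply: ip_eq0; rewrite -?e1 ?h0 ?hip0 // e1 h0 hip0.
Qed.

(** The components [a] and [u] satisfy the coupled system [d0 a = - L u], [s0 u = Lam a], whose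
    second order form couples them through [d1 u] and [s1 a]. Applying [d1] decouples it, because
    [d1 d1 = 0] on the kernel of [l]. *)
Lemma harmonic_split w : dOm w = 0 -> sOm w = 0 ->
  let u := i w in let a := w - e u in
  [/\ l w = 0, [/\ d0 a = 0, s0 a = 0 & Lam a = 0] & [/\ d0 u = 0, s0 u = 0 & L u = 0]].
Proof.
move=> dw sw u a.
have iu : i u = 0 by rewrite /u i_i.
have ia : i a = 0 by rewrite /a raddfB /= i_e iu raddf0 subr0 subrr.
have l_d x : l (dOm x) = dOm (l x).
  by rewrite /dOm !raddfD /= l_d0 l_e l_L l_i.
(* Contraction of [dOm w = 0] with [T] makes [l w] exact, and it is then orthogonal to itself, since
   [w] is coclosed and [l] is skew and commutes with [dOm]. *)
have lw : l w = 0.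
  have lE : l w = dOm (i w).
    have := congr1 i dw; rewrite /dOm raddf0 !raddfD /= i_d0 i_e L_i i_i raddf0 addr0.
    by rewrite addr0 addrCA -opprD => /eqP; rewrite subr_eq0 -l_i => /eqP.
  apply: ip_eq0; rewrite {1}lE -[X in _ = X]oppr0 -[LHS]opprK; congr (- _).
  by rewrite -adj_l l_d ip_d sw hip0r.
have lu : l u = 0 by rewrite /u l_i lw raddf0.
have la : l a = 0 by rewrite /a raddfB /= l_e lu lw raddf0 subr0.
have wE : w = a + e u by rewrite subrK.
have e1 : d0 a + L u - e (d0 u) = 0.
  have h : d0 w = d0 a + d0 (e u) by rewrite -raddfD -wE.
  by rewrite -dw /dOm lw raddf0 addr0 -/u h e_d0 opprK addrAC.
have d0u : d0 u = 0.
  have := congr1 i e1; rewrite raddf0 raddfB raddfD /= i_d0 ia raddf0 oppr0 add0r.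
  by rewrite L_i iu raddf0 add0r i_e i_d0 iu raddf0 oppr0 raddf0 subr0 => /eqP;
    rewrite oppr_eq0 => /eqP.
have d0a : d0 a = - L u.
  by move: e1; rewrite d0u raddf0 subr0 => /eqP; rewrite addr_eq0 => /eqP.
have e2 : s0 a - e (s0 u) + e (Lam a) = 0.
  rewrite -sw /sOm lw raddf0 subr0 [in RHS]wE !raddfD /= -[Lam (e u)]e_Lam e_e addr0.
  by rewrite e_s0 opprK.
have s0u : s0 u = Lam a.
  have := congr1 i e2; rewrite raddf0 raddfD raddfB /= i_s0 ia raddf0 oppr0 add0r.
  rewrite !i_e i_s0 iu i_Lam ia !raddf0 ?subr0 ?addr0 => /eqP.
  by rewrite addrC subr_eq0 => /eqP.
have s0a : s0 a = 0 by move: e2; rewrite s0u subrK.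
have Lapa : lap a + L (Lam a) = d1 u.
  by rewrite /lap s0a raddf0 add0r d0a raddfN /= -s0u L_s0 addKr.
have Lapu : lap u + Lam (L u) = s1 a.
  rewrite /lap d0u raddf0 addr0 s0u -[L u]opprK -d0a raddfN /= Lam_d0.
  by rewrite opprB addrC subrK.
have lap_d1 x : l x = 0 -> lap (d1 x) = d1 (lap x).
  move=> lx; rewrite !lap1 raddfD /= !d1_d1 l_s1 lx !raddf0 ?add0r ?addr0.
  by [].
have lapD x y : lap (x + y) = lap x + lap y.
  by rewrite /lap !raddfD /= addrACA.
(* [d1 a] is annihilated by the nonnegative operator [lap + L Lam], hence by [s1]; lying in the
   image of [d1], it vanishes. *)
have d1a : d1 a = 0.
  have s0x x : Lam (d1 x) = d1 (Lam x) + s0 x := Lam_d1 x.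
  have h : lap (d1 a) + L (Lam (d1 a)) = 0.
    rewrite lap_d1 // Lam_d1 s0a addr0 L_d1 -raddfD /= Lapa d1_d1 lu raddf0 oppr0.
    by [].
  have h' := congr1 (ip ^~ (d1 a)) h; rewrite hip0 ipDl adj_L ip_lap in h'.
  have p0 := ip_ge0 (s0 (d1 a)); have p1 := ip_ge0 (d0 (d1 a)).
  have p2 := ip_ge0 (Lam (d1 a)).
  have /lap_eq0[_ _ _ s1d1] : ip (lap (d1 a)) (d1 a) = 0 by rewrite ip_lap; lra.
  by apply: ip_eq0; rewrite adj_d1 s1d1 hip0r.
have d1u : d1 u = 0.
  have h : lap (d1 u) + Lam (L (d1 u)) = 0.
    have h1 : lap a = d1 (s1 a) by rewrite lap1 d1a raddf0 addr0.
    rewrite -Lapu raddfD /= -lap_d1 // in h1.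
    have h2 : d1 (Lam (L u)) = Lam (L (d1 u)) - s0 (L u).
      by rewrite L_d1 Lam_d1 addrK.
    have h3 : s0 (L u) = L (Lam a) - d1 u by rewrite -s0u L_s0 addrK.
    have h4 : lap a = d1 u - L (Lam a) by rewrite -Lapa addrK.
    move: h1; rewrite h2 h3 h4 opprB addrA => /eqP.
    by rewrite -[X in X == _]add0r (inj_eq (addIr _)) eq_sym => /eqP.
  have h' := congr1 (ip ^~ (d1 u)) h; rewrite hip0 ipDl adj_Lam ip_lap in h'.
  have p0 := ip_ge0 (s0 (d1 u)); have p1 := ip_ge0 (d0 (d1 u)).
  have p2 := ip_ge0 (L (d1 u)).
  have /lap_eq0[_ _ _ s1d1] : ip (lap (d1 u)) (d1 u) = 0 by rewrite ip_lap; lra.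
  by apply: ip_eq0; rewrite adj_d1 s1d1 hip0r.
have h' := congr1 (ip ^~ a) Lapa; rewrite d1u hip0 ipDl adj_L ip_lap s0a hip0 add0r in h'.
have p1 := ip_ge0 (d0 a); have p2 := ip_ge0 (Lam a).
have Lama : Lam a = 0 by apply: ip_eq0; lra.
have d0a0 : d0 a = 0 by apply: ip_eq0; lra.
have Lu : L u = 0 by rewrite -[L u]opprK -d0a d0a0 oppr0.
by rewrite s0u Lama.
Qed.

(** [s0 w] is again primitive, hence a legitimate test form. *)
Lemma low_coclosed k w : hz k w -> Lam w = 0 ->
  (forall j v, j.+1 = k -> hz j v -> Lam v = 0 -> ip (dOm v) w = 0) -> s0 w = 0.
Proof.
move=> hw Lw h; case: k hw h => [|k] hw h; first exact: s0_0.
have := h k (s0 w) erefl (hz_s0 hw); rewrite Lam_s0 Lw raddf0 => /(_ erefl).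
rewrite ip_d /sOm Lw raddf0 addr0 -l_i (hz_i hw) raddf0 subr0.
exact: ip_eq0.
Qed.

Lemma low_dOm k w : hz k w -> Lam w = 0 -> d0 w = 0 -> s0 w = 0 -> l w = 0 ->
  dOm w = 0 /\ sOm w = 0.
Proof.
move=> hw Lw dw sw lw.
by rewrite /dOm /sOm dw sw lw Lw (hz_i hw) !raddf0 !addr0 ?subr0.
Qed.

Lemma rumin_low_harmonic k w : (k < n)%N -> hz k w -> Lam w = 0 ->
  (forall b, hz k.+1 b -> Lam b = 0 -> ip (dOm w) b = 0) ->
  (forall j v, j.+1 = k -> hz j v -> Lam v = 0 -> ip (dOm v) w = 0) ->
  dOm w = 0 /\ sOm w = 0.
Proof.
move=> kn hw Lw hup hdn; have s0w := low_coclosed hw Lw hdn.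
suff d0w : d0 w = 0.
  (* Once [d0 w = 0], the relation [d0 d0 = - L l] and the injectivity of [L] below degree [n] give
     [l w = 0]. *)
  apply: (low_dOm hw) => //; apply: (L_inj (hz_l hw) kn).
  by have := d0_d0 w; rewrite d0w raddf0 => /esym/eqP; rewrite oppr_eq0 => /eqP.
have Ld : Lam (d0 w) = - s1 w by rewrite Lam_d0 Lw raddf0 add0r.
have [c cE] : exists c, (n - k = c.+1)%N by exists (n - k).-1; rewrite prednK // subn_gt0.
have h1 : Lam (L (s1 w)) = s1 w *+ c.+2.
  case: k hw hup hdn kn cE => [|k] hw hup hdn kn cE; first by rewrite s1_0 // !raddf0 mul0rn.
  rewrite (Lam_L (hz_s1 hw)) Lam_s1 Lw !raddf0 add0r -mulrnBr; last exact: ltnW (ltnW kn).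
  by congr (_ *+ _); rewrite -cE -subSn // ltnW.
(* [c.+2 = n - k + 1] is the eigenvalue of [Lam L] on the primitive form [s1 w]; [x] is that
   multiple of the primitive part of [d0 w]. *)
pose x := d0 w *+ c.+2 + L (s1 w).
have Lx : Lam x = 0 by rewrite /x raddfD /= raddfMn /= Ld h1 mulNrn addNr.
have hMn q a j : hz q a -> hz q (a *+ j.+1).
  by move=> ha; elim: j => // j IH; rewrite mulrS; apply: hzD.
have hx : hz k.+1 x.
  apply: hzD; first exact/hMn/hz_d0.
  case: k hw {hup hdn kn cE} => [|k] hw; last exact/hz_L/hz_s1.
  rewrite (s1_0 hw) raddf0 -(subrr (d0 w)); apply: hzD; first exact: hz_d0.
  exact/hzN/hz_d0.
have dx : ip (d0 w) x = 0.
  have := hup _ hx Lx; rewrite /dOm (hz_i hw) raddf0 addr0 ipDl adj_e (hz_i hx).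
  by rewrite hip0r addr0.
have x0 : x = 0.
  by apply: ip_eq0; rewrite {1}/x ipDl hipMn dx mul0rn add0r adj_L Lx hip0r.
have nd : ip (d0 w) (d0 w) *+ c.+2 = ip (s1 w) (s1 w).
  have := congr1 (ip ^~ (d0 w)) x0; rewrite hip0 /x ipDl hipMn adj_L Ld hipNr.
  by move/eqP; rewrite subr_eq0 => /eqP.
have e1 := ip_lap w; have e2 := ip_lap1 w; rewrite s0w hip0 add0r in e1.
have p1 := ip_ge0 (d0 w); have p2 := ip_ge0 (d1 w).
have p3 : 0 <= ip (d0 w) (d0 w) *+ c by rewrite mulrn_wge0.
(* Here [(c + 2) |d0 w|^2 = |s1 w|^2], while the common Laplacian gives
   [|d0 w|^2 = |s1 w|^2 + |d1 w|^2]. *)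
by apply: ip_eq0; move: nd; rewrite !mulrS; lra.
Qed.

(** The hypothesis on [l w - d0 (s1 w)] is the form taken by [D w = 0], see [fo_rumin_D]; the last
    one expresses coclosedness by orthogonality. *)
Lemma rumin_mid_harmonic w : hz n w -> Lam w = 0 -> l w - d0 (s1 w) = 0 ->
  (forall j v, j.+1 = n -> hz j v -> Lam v = 0 -> ip (dOm v) w = 0) ->
  dOm w = 0 /\ sOm w = 0.
Proof.
move=> hw Lw Dw hdn; have s0w := low_coclosed hw Lw hdn.
have Lw0 : L w = 0 by apply/(L_Lam_mid hw).
have lE : l w = d0 (s1 w) by apply/eqP; rewrite -subr_eq0 Dw.
have lw : l w = 0.
  by apply: ip_eq0; rewrite {1}lE adj_d0 -l_s0 s0w raddf0 hip0r.
apply: (low_dOm hw) => //.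
have /lap_eq0[_ _ d1y _] : ip (lap (s1 w)) (s1 w) = 0.
  by rewrite ip_lap -lE lw hip0 addr0 s0_s1 s0w raddf0 oppr0 hip0.
have s1w : s1 w = 0 by apply: ip_eq0; rewrite adj_s1 d1y hip0r.
by have := L_s1 w; rewrite Lw0 s1w !raddf0 add0r => /esym/eqP; rewrite oppr_eq0 => /eqP.
Qed.

Lemma high_dOm v : i v = 0 -> dOm (e v) = - e (d0 v) + L v.
Proof.
move=> iv; rewrite /dOm l_e e_e addr0 i_e iv raddf0 subr0 e_d0 opprK.
by [].
Qed.

Lemma high_sOm v : i v = 0 -> sOm (e v) = - e (s0 v) - l v.
Proof.
move=> iv; rewrite /sOm l_e i_e -l_i iv !raddf0 ?subr0 ?addr0 -e_Lam e_e ?addr0 e_s0 opprK.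
by [].
Qed.

Lemma e_inj v : i v = 0 -> e v = 0 -> v = 0.
Proof.
by move=> iv ev; have := i_e v; rewrite ev iv !raddf0 ?subr0 ?addr0.
Qed.

(** The Lefschetz dual of the low case: [L] and [Lam], and each differential and its adjoint,
    exchange roles; [x] is a multiple of the component of [s0 v] in the kernel of [L]. *)
Lemma rumin_high_harmonic j v : (n < j)%N -> hz j v -> L v = 0 -> dOm (e v) = 0 ->
  (forall y, hz j.-1 y -> L y = 0 -> ip (dOm (e y)) (e v) = 0) ->
  dOm (e v) = 0 /\ sOm (e v) = 0.
Proof.
move=> nj hv Lv dv hdn; split=> //; have iv := hz_i hv.
have d0v : d0 v = 0.
  apply: e_inj; first by rewrite i_d0 iv raddf0 oppr0.
  by move: dv; rewrite high_dOm // Lv addr0 => /eqP; rewrite oppr_eq0 => /eqP.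
suff s0v : s0 v = 0.
  rewrite high_sOm // s0v raddf0 oppr0 add0r.
  suff -> : l v = 0 by rewrite oppr0.
  by apply: (Lam_inj (hz_l hv) nj); rewrite -s0_s0 s0v raddf0.
case: j nj hv hdn => // j nj hv hdn /=.
have Ls : L (s0 v) = d1 v by rewrite L_s0 Lv raddf0 add0r.
have hs := hz_s0 hv.
have [c cE] : exists c, (j - n = c)%N by exists (j - n)%N.
have e1 : L (Lam (d1 v)) = d1 v *+ c.+2.
  have := Lam_L (hz_d1 hv); rewrite L_d1 Lv !raddf0 => /esym/eqP.
  rewrite -addrA addr_eq0 opprD opprK => /eqP ->.
  rewrite addrC -mulrnBr; last by rewrite ltnW // ltnW.
  by congr (_ *+ _); rewrite -cE -!subSn // ltnW.
have hMn q a k : hz q a -> hz q (a *+ k.+1).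
  by move=> ha; elim: k => // k IH; rewrite mulrS; apply: hzD.
pose x := s0 v *+ c.+2 - Lam (d1 v).
have Lx : L x = 0 by rewrite /x raddfB raddfMn /= Ls e1 subrr.
have hx : hz j x by apply: hzD; [exact: hMn|apply/hzN/hz_Lam/hz_d1].
have sx : ip (s0 v) x = 0.
  have := hdn _ hx Lx; rewrite high_dOm ?(hz_i hx) // Lx addr0 hipNl adj_e i_e iv.
  by rewrite raddf0 subr0 adj_d0 ipS => /eqP; rewrite oppr_eq0 => /eqP.
have x0 : x = 0.
  by apply: ip_eq0; rewrite {1}/x ipDl hipMn sx mul0rn add0r hipNl adj_Lam Lx hip0r oppr0.
have ns : ip (s0 v) (s0 v) *+ c.+2 = ip (d1 v) (d1 v).
  have := congr1 (ip ^~ (s0 v)) x0; rewrite hip0 /x ipDl hipMn hipNl adj_Lam Ls.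
  by move/eqP; rewrite subr_eq0 => /eqP.
have e2 := ip_lap v; have e3 := ip_lap1 v; rewrite d0v hip0 addr0 in e2.
have p1 := ip_ge0 (s0 v); have p2 := ip_ge0 (s1 v).
have p3 : 0 <= ip (s0 v) (s0 v) *+ c by rewrite mulrn_wge0.
by apply: ip_eq0; move: ns; rewrite !mulrS; lra.
Qed.

Lemma rumin_mid_high_harmonic v : hz n v -> L v = 0 -> dOm (e v) = 0 ->
  (forall a, hz n a -> Lam a = 0 -> ip (e (l a - d0 (s1 a))) (e v) = 0) ->
  dOm (e v) = 0 /\ sOm (e v) = 0.
Proof.
move=> hv Lv dv hdn; split=> //; have iv := hz_i hv.
have Lamv : Lam v = 0 by apply/(L_Lam_mid hv).
have d0v : d0 v = 0.
  apply: e_inj; first by rewrite i_d0 iv raddf0 oppr0.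
  by move: dv; rewrite high_dOm // Lv addr0 => /eqP; rewrite oppr_eq0 => /eqP.
have s0E : s0 v = Lam (d1 v) by rewrite Lam_d1 Lamv raddf0 add0r.
(* Up to sign, [D^*] applied to [e v]; being primitive of degree [n], it may be tested against
   itself. *)
pose a := l v + d1 (s0 v).
have hds : hz n (d1 (s0 v)).
  case: (posnP n) => [n0|n_gt0].
    have hv0 : hz 0 v by rewrite -n0.
    rewrite (s0_0 hv0) raddf0 -(subrr v); apply: hzD => //.
    exact: hzN.
  by rewrite -(prednK n_gt0); apply/hz_d1/hz_s0; rewrite prednK.
have ha : hz n a by apply: hzD => //; exact: hz_l.
have La : Lam a = 0.
  by rewrite /a raddfD /= -l_Lam Lamv raddf0 add0r Lam_d1 Lam_s0 Lamv !raddf0 add0r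
    s0_s0 -l_Lam Lamv raddf0.
have a0 : a = 0.
  have := hdn _ ha La; rewrite adj_e i_e iv raddf0 subr0 ipDl adj_l hipNl adj_d0 adj_s1.
  by rewrite -opprD -hipDr => /eqP; rewrite oppr_eq0 => /eqP/ip_eq0.
have lE : l v = - d1 (s0 v) by apply/eqP; rewrite -addr_eq0 -/a a0.
have ds : d1 (s0 v) + s0 (d1 v) = 0.
  have -> : s0 (d1 v) = Lam (d1 (d1 v)) - d1 (Lam (d1 v)).
    by rewrite Lam_d1 addrAC subrr add0r.
  by rewrite -s0E addrC subrK d1_d1 -l_L Lv !raddf0 ?oppr0 ?raddf0.
(* [l v = s0 (d1 v)] is orthogonal to itself because [d0 v = 0] and [l] commutes with [d0]. *)
have lv : l v = 0.
  apply: ip_eq0; rewrite {1}lE -[X in ip X _](_ : s0 (d1 v) = _); last first.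
    by apply/eqP; rewrite -addr_eq0 addrC ds.
  by rewrite adj_s0 -l_d0 d0v raddf0 hip0r.
have d1y : d1 (s0 v) = 0 by move/eqP: lE; rewrite lv eq_sym oppr_eq0 => /eqP.
have s1v : s1 v = 0.
  by have := Lam_d0 v; rewrite d0v Lamv !raddf0 add0r => /esym/eqP; rewrite oppr_eq0 => /eqP.
have s1y : s1 (s0 v) = 0.
  have := s0_s1 v; rewrite s1v raddf0 => /esym/eqP.
  by rewrite oppr_eq0 => /eqP.
have /lap_eq0[d0y _ _ _] : ip (lap (s0 v)) (s0 v) = 0.
  by rewrite ip_lap1 s1y d1y hip0 addr0.
have s0v : s0 v = 0 by apply: ip_eq0; rewrite adj_s0 d0y hip0r.
by rewrite high_sOm // s0v lv raddf0 oppr0 addr0.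
Qed.

(** For [k <= n] the vertical part [i w] has degree below [n], where [L] is injective; dually, above
    [n] the horizontal part is killed by the injectivity of [Lam]. *)
Lemma harmonic_low w : forall k, (k <= n)%N -> hz k (w - e (i w)) ->
  (forall q, k = q.+1 -> hz q (i w)) -> (k = 0%N -> i w = 0) ->
  dOm w = 0 -> sOm w = 0 ->
  [/\ i w = 0, Lam w = 0, d0 w = 0, s0 w = 0 & l w = 0].
Proof.
move=> k kn ha hu hu0 dw sw; have [lw [da sa La] [_ _ Lu]] := harmonic_split dw sw.
have iw : i w = 0.
  case: k kn ha hu hu0 => [|k] kn ha hu hu0; first exact: hu0.
  exact: (L_inj (hu k erefl) kn).
by move: da sa La; rewrite iw raddf0 subr0.
Qed.

Lemma harmonic_high w k : (n < k)%N -> hz k (w - e (i w)) -> dOm w = 0 -> sOm w = 0 ->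
  [/\ w = e (i w), d0 (i w) = 0, s0 (i w) = 0, L (i w) = 0 & l (i w) = 0].
Proof.
move=> nk ha dw sw; have [lw [da sa La] [du su Lu]] := harmonic_split dw sw.
have a0 := Lam_inj ha nk La.
split=> //; first by apply/eqP; rewrite -subr_eq0 a0.
by rewrite l_i lw raddf0.
Qed.

End AbstractHodge.

(** * Riemannian metrics on compact manifolds *)

Section GramSchmidt.
Variables (R : rcfType) (m : nat) (G : 'M[R]_m).
Hypothesis Gsym : G^T = G.
Hypothesis Gpos : forall v : 'rV[R]_m, v != 0 -> 0 < (v *m G *m v^T) 0 0.

(** With [k < m] rows there is a nonzero vector orthogonal to all of them, in the left kernel of
    [G *m E^T]; normalised, it is the next row. *)
Lemma orthonormal_rows k : (k <= m)%N -> exists E : 'M[R]_(k, m), E *m G *m E^T = 1%:M.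
Proof.
elim: k => [|k IH] km; first by exists 0; apply/matrixP => -[].
have [E EG] := IH (ltnW km).
have [v v0 vK] : exists2 v : 'rV[R]_m, v != 0 & v *m (G *m E^T) = 0.
  have : kermx (G *m E^T) != 0.
    rewrite kermx_eq0 /row_free neq_ltn; apply/orP; left.
    by rewrite (leq_ltn_trans (rank_leq_col _)).
  case/rowV0Pn => v /sub_kermxP vK v0; by exists v.
pose a := (v *m G *m v^T) 0 0; have a0 : 0 < a by exact: Gpos.
pose s := (Num.sqrt a)^-1.
pose E' : 'M[R]_(1 + k, m) := col_mx (s *: v) E.
suff h : E' *m G *m E'^T = 1%:M by exists E'.
rewrite /E' mul_col_mx tr_col_mx mul_col_row EG (@scalar_mx_block _ 1 k).
have vGE : s *: v *m G *m E^T = 0 by rewrite -mulmxA -scalemxAl vK scaler0.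
have EGv : E *m G *m (s *: v)^T = 0.
  by apply: trmx_inj; rewrite !trmx_mul trmxK Gsym trmx0 mulmxA vGE.
rewrite vGE EGv; congr block_mx; apply/matrixP => i j.
rewrite !ord1 linearZ /= -!scalemxAl -scalemxAr [LHS]mxE [X in _ * X]mxE -/a [RHS]mxE eqxx.
rewrite mulrA -expr2 /s exprVn (sqr_sqrtr (ltW a0)) mulVf // gt_eqF //.
Qed.

Lemma orthonormal_basis_exists : exists E : 'M[R]_m, E *m G *m E^T = 1%:M.
Proof. exact: orthonormal_rows (leqnn m). Qed.

(** From [E G E^T = 1], the determinant is the inverse of a square. *)
Lemma posdef_det_gt0 : 0 < \det G.
Proof.
have [E EG] := orthonormal_basis_exists.
have := congr1 determinant EG; rewrite !det_mulmx det_tr det1 => h.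
have : 0 < \det E ^+ 2 * \det G by rewrite expr2 mulrAC h.
have E0 : \det E != 0 by apply: contra_eq_neq h => ->; rewrite mulr0 eq_sym oner_eq0.
by rewrite pmulr_rgt0 // exprn_even_gt0.
Qed.

End GramSchmidt.

Section JacobiFormula.
Variables (A : comPzRingType) (D : A -> A).
Hypothesis DD : forall f h, D (f + h) = D f + D h.
Hypothesis DM : forall f h, D (f * h) = D f * h + f * D h.

Lemma derivation0 : D 0 = 0.
Proof. by apply: (addrI (D 0)); rewrite -DD !addr0. Qed.

Lemma derivation1 : D 1 = 0.
Proof. by apply: (addrI (D 1)); have := DM 1 1; rewrite !mulr1 mul1r addr0 => <-. Qed.

Lemma derivation_sum (I : Type) (r : seq I) (P : pred I) (x : I -> A) :
  D (\sum_(i <- r | P i) x i) = \sum_(i <- r | P i) D (x i).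
Proof. by elim/big_rec2 : _ => [|i u v _ <-]; rewrite ?derivation0 ?DD. Qed.

Lemma derivation_prod (I : finType) (x : I -> A) :
  D (\prod_i x i) = \sum_i \prod_j (if j == i then D (x j) else x j).
Proof.
have h (r : seq I) : uniq r -> D (\prod_(i <- r) x i) =
    \sum_(i <- r) \prod_(j <- r) (if j == i then D (x j) else x j).
  elim: r => [|a r IH]; first by rewrite !big_nil derivation1.
  case/andP => ar ur; rewrite !big_cons DM IH // eqxx; congr (_ + _).
    congr (_ * _); rewrite !big_seq; apply: eq_bigr => j jr.
    by case: eqP jr => // -> /(negP ar).
  rewrite mulr_sumr !big_seq; apply: eq_bigr => i ir; rewrite big_cons.
  by case: eqP ir => // <- /(negP ar).
by rewrite h // index_enum_uniq.
Qed.

Lemma derivation_det m (G : 'M[A]_m) :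
  D (\det G) = \sum_i \sum_k D (G i k) * cofactor G i k.
Proof.
have Dsign (b : bool) f : D ((-1) ^+ b * f) = (-1) ^+ b * D f.
  case: b; rewrite ?expr1 ?expr0 ?mul1r // !mulN1r.
  by apply/eqP; rewrite -addr_eq0 -DD addrC subrr derivation0.
rewrite /determinant derivation_sum.
under eq_bigr do rewrite Dsign derivation_prod mulr_sumr.
rewrite exchange_big; apply: eq_bigr => i _ /=.
pose H := \matrix_(a, b) (if a == i then D (G a b) else G a b).
transitivity (\det H).
  by apply: eq_bigr => s _; congr (_ * _); apply: eq_bigr => j _; rewrite mxE.
rewrite (expand_det_row H i); apply: eq_bigr => k _; rewrite mxE eqxx; congr (_ * _).
rewrite /cofactor; congr (_ * \det _); apply/matrixP => a b; rewrite !mxE.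
by rewrite eq_sym (negPf (neq_lift _ _)).
Qed.

End JacobiFormula.

(** * Local pieces of a metric and global dual frames *)

Section MetricLayer.
Variables (R : realType) (m : nat) (M : manifold R m).
Local Notation A := (Cinf M).
Local Notation V := (vfield M).

(** The expansion at one point is expressed through function-linear maps [al], because a vector
    field has no value in a tangent space here. *)
Definition frame_at (q : M) (xi : 'I_m -> A) (X : 'I_m -> V) :=
  (forall i j, X i (xi j) q = (i == j)%:R) /\
  forall al : V -> A, lin1 al -> forall Y, al Y q = \sum_i Y (xi i) q * al (X i) q.

(** After multiplication by a bump function the expansion of [Y] holds globally, and [al] can be
    applied to it. *)
Lemma frame_on_at c W xi X q : atlas c -> open W -> W `<=` cdom c ->
  frame_on c W xi X -> W q -> frame_at q xi X.
Proof.
move=> ac oW Wc [_ Xxi Xe] Wq; split=> [i j|al la Y]; first exact: Xxi.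
have [b [b0 _] [K _ [KW bK]]] := bump_exists ac (Wc _ Wq) oW Wq.
have bY : b *: Y = \sum_i (b * Y (xi i)) *: X i.
  apply: vfield_eq => f; rewrite vfieldZE vfield_sumE; apply: Cinf_eq => q'.
  rewrite CinfE Cinf_sum; under eq_bigr do rewrite vfieldZE !CinfE -mulrA.
  rewrite -mulr_sumr; have [->|/bK/KW[_ Wq']] := eqVneq (b q') 0; first by rewrite !mul0r.
  by rewrite -Xe.
have := congr1 (fun Z => al Z q) bY; rewrite lin1Z // lin1_sum // CinfE Cinf_sum.
under eq_bigr do rewrite lin1Z // !CinfE -mulrA.
by rewrite -mulr_sumr => /mulfI; apply; rewrite gt_eqF.
Qed.

(** A coordinate frame with two functions: [prho] is a weight for gluing; [pchi] is 1 wherever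
    [prho] is nonzero and vanishes off the closed set [pK], which allows local densities to be
    extended. *)
Record piece := Piece {
  pc : chart R m M;
  pW : set M;
  pK : set M;
  prho : A;
  pchi : A;
  pxi : 'I_m -> A;
  pX : 'I_m -> V;
  p_atlas : atlas pc;
  p_open : open pW;
  p_closed : closed pK;
  pKW : pK `<=` pW;
  pWc : pW `<=` cdom pc;
  prho_ge0 : forall q, 0 <= prho q;
  prho_chi : forall q, prho q != 0 -> pchi q = 1;
  pchi_K : forall q, pchi q != 0 -> pK q;
  p_frame : frame_on pc pW pxi pX }.

Lemma piece_exists p : exists P : piece, 0 < prho P p.
Proof.
have [c [W [K [b [xi [X [[ac oW cK KW Wc] [b0 bp bK fr]]]]]]]] := frame_exists p.
pose t := b p / 2; have t0 : 0 < t by rewrite divr_gt0.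
have [chi [chi1 chi0]] := Cinf_cutoff b t0.
have rc q : Cinf_hflat (b - Cinf_cst M t) q != 0 -> chi q = 1.
  move=> h; apply: chi1; rewrite leNgt; apply/negP => bt; move/eqP: h; apply.
  by apply: hflat_eq0; rewrite -[X in X <= _]/(b q - t) subr_le0 ltW.
have cKq q : chi q != 0 -> K q.
  move=> h; apply: bK; apply: contraNneq h => bq; apply/eqP/chi0.
  by rewrite bq.
have r0 q : 0 <= Cinf_hflat (b - Cinf_cst M t) q by exact: hflat_ge0.
exists (Piece ac oW cK KW Wc r0 rc cKq fr) => /=.
by rewrite hflat_gt0 // -[X in _ < X]/(b p - t) /t; lra.
Qed.

Lemma finite_pieces : compact [set: M] ->
  exists (I : finType) (P : I -> piece), forall q, exists i, 0 < prho (P i) q.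
Proof.
have [P Pp] : exists P : M -> piece, forall p, 0 < prho (P p) p.
  by exists (fun p => projT1 (cid (piece_exists p))) => p; case: cid.
move=> /compact_near_coveringP cM.
(* Finite sets of points, directed by inclusion, as a filter on lists. *)
pose Fl : set_system (seq M) :=
    [set S : set (seq M) | exists s0 : seq M, forall s : seq M, {subset s0 <= s} -> S s].
have FF : Filter Fl.
  split; first by exists [::].
    move=> S1 S2 [s1 h1] [s2 h2]; exists (s1 ++ s2) => s sub.
    by split; [apply: h1|apply: h2] => x xs; apply: sub; rewrite mem_cat xs ?orbT.
  by move=> S1 S2 sub [s1 h1]; exists s1 => s /h1; exact: sub.
have := cM _ Fl (fun s q => exists2 p, p \in s & 0 < prho (P p) q) FF.
case=> [x _|s0 /(_ s0) h].
  exists ([set q | 0 < prho (P x) q], [set s : seq M | x \in s]) => /=.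
    split; first by apply: open_nbhs_nbhs; split; [exact: open_gt|exact: Pp].
    by exists [:: x] => s; apply; rewrite mem_head.
  by move=> [q s] /= [xq xs]; exists x.
exists (seq_sub s0), (fun i => P (ssval i)) => q.
by have [//|p ps pq] := h _ q I; exists (SeqSub ps).
Qed.

Section Metric.
Variable g : V -> V -> A.
Hypothesis gL : forall f X Y Z, g (f *: X + Y) Z = f * g X Z + g Y Z.
Hypothesis gS : forall X Y, g X Y = g Y X.
Hypothesis gpos : forall (X : V) (p : M), (exists f : A, X f p <> 0) -> 0 < g X X p.

Lemma metric_lin1l Y : lin1 (g ^~ Y). Proof. by move=> f X Z; rewrite gL. Qed.
Lemma metric_lin1r X : lin1 (g X).
Proof. by move=> f Y Z; rewrite gS gL !(gS _ X). Qed.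

Definition gram (X : 'I_m -> V) : 'M[A]_m := \matrix_(i, j) g (X i) (X j).
Definition gram_at (X : 'I_m -> V) q : 'M[R]_m := \matrix_(i, j) g (X i) (X j) q.

Lemma gram_at_sym X q : (gram_at X q)^T = gram_at X q.
Proof. by apply/matrixP => i j; rewrite !mxE gS. Qed.

Lemma metric_frame q xi X Y Z : frame_at q xi X ->
  g Y Z q = \sum_i \sum_j Y (xi i) q * Z (xi j) q * gram_at X q i j.
Proof.
move=> [_ fr]; rewrite (fr _ (metric_lin1l Z) Y); apply: eq_bigr => i _.
rewrite (fr _ (metric_lin1r (X i)) Z) mulr_sumr; apply: eq_bigr => j _.
by rewrite mxE mulrA.
Qed.

Definition comb (E : 'I_m -> R) (X : 'I_m -> V) : V := \sum_i Cinf_cst M (E i) *: X i.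

Lemma comb_lin al E X q : lin1 al -> al (comb E X) q = \sum_i E i * al (X i) q.
Proof.
by move=> la; rewrite /comb lin1_sum // Cinf_sum; apply: eq_bigr => i _; rewrite lin1Z // CinfE.
Qed.

Lemma eval_lin1 f : lin1 (fun Y : V => Y f).
Proof. by move=> h Y Z; rewrite vfieldDE vfieldZE. Qed.

Lemma comb_xi q xi X E j : frame_at q xi X -> comb E X (xi j) q = E j.
Proof.
move=> [Xxi _]; rewrite (comb_lin E X q (eval_lin1 (xi j))) (bigD1 j) //= Xxi eqxx mulr1.
by rewrite big1 ?addr0 // => i ij; rewrite Xxi (negPf ij) mulr0.
Qed.

Lemma metric_comb q X E E' :
  g (comb E X) (comb E' X) q = \sum_i \sum_j E i * E' j * gram_at X q i j.
Proof.
rewrite (comb_lin _ _ _ (metric_lin1l _)); apply: eq_bigr => i _.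
rewrite (comb_lin _ _ _ (metric_lin1r _)) mulr_sumr; apply: eq_bigr => j _.
by rewrite mxE mulrA.
Qed.

Lemma gram_form q X (E E' : 'rV[R]_m) : (E *m gram_at X q *m E'^T) 0 0 =
  \sum_i \sum_j E 0 i * E' 0 j * gram_at X q i j.
Proof.
rewrite mxE exchange_big; apply: eq_bigr => j _; rewrite !mxE mulr_suml.
by apply: eq_bigr => i _; rewrite mulrAC.
Qed.

Lemma gram_pos q xi X : frame_at q xi X -> forall v : 'rV[R]_m, v != 0 ->
  0 < (v *m gram_at X q *m v^T) 0 0.
Proof.
move=> fr v v0; rewrite gram_form -metric_comb; apply: gpos.
have [j vj] : exists j, v 0 j != 0.
  apply/existsP; apply: contraNT v0 => /existsPn h; apply/eqP/rowP => j.
  by rewrite mxE; apply/eqP; move: (h j); rewrite negbK.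
exists (xi j); rewrite (comb_xi (fun i => v 0 i) j fr).
exact/eqP.
Qed.

Lemma gram_det_gt0 q xi X : frame_at q xi X -> 0 < \det (gram_at X q).
Proof. by move=> fr; apply: posdef_det_gt0 (gram_at_sym X q) (gram_pos fr). Qed.

Lemma orthonormal_at_nonempty q xi X : frame_at q xi X ->
  exists E, orthonormal_at g q E.
Proof.
move=> fr; have [E EG] := orthonormal_basis_exists (gram_at_sym X q) (gram_pos fr).
exists (fun i => comb (E i) X) => i j; rewrite metric_comb.
have := congr1 (fun B : 'M[R]_m => B i j) EG; rewrite !mxE => <-.
rewrite exchange_big; apply: eq_bigr => b _; rewrite !mxE mulr_suml.
by apply: eq_bigr => a _; rewrite mulrAC.
Qed.

(* The Gram matrix of an orthonormal system in a frame is inverted by the matrix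
   of its coefficients, so the system spans. *)
Lemma orthonormal_expand q xi X E : frame_at q xi X -> orthonormal_at g q E ->
  forall al : V -> A, lin1 al -> forall Y, al Y q = \sum_i g Y (E i) q * al (E i) q.
Proof.
move=> fr oE al la Y; pose C : 'M[R]_m := \matrix_(i, j) E i (xi j) q.
pose G := gram_at X q.
have CG : C *m (G *m C^T) = 1%:M.
  apply/matrixP => i j; rewrite mulmxA [RHS]mxE -oE (metric_frame _ _ fr) mxE exchange_big.
  apply: eq_bigr => b _; rewrite !mxE mulr_suml.
  by apply: eq_bigr => a _; rewrite !mxE mulrAC.
have GC : G *m C^T *m C = 1%:M by apply: mulmx1C.
pose y : 'rV[R]_m := \row_i Y (xi i) q.
have gE i : g Y (E i) q = (y *m (G *m C^T)) 0 i.
  rewrite (metric_frame _ _ fr) mulmxA mxE exchange_big; apply: eq_bigr => b _.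
  rewrite !mxE mulr_suml; apply: eq_bigr => a _; by rewrite !mxE mulrAC.
have yE j : Y (xi j) q = \sum_i g Y (E i) q * E i (xi j) q.
  have := congr1 (fun B : 'rV[R]_m => B 0 j) (mulmx1 y); rewrite -GC mulmxA [in RHS]mxE => <-.
  by rewrite [LHS]mxE; apply: eq_bigr => i _; rewrite gE [C _ _]mxE.
have [_ fr2] := fr; rewrite (fr2 _ la Y); under eq_bigr do rewrite yE mulr_suml.
rewrite exchange_big; apply: eq_bigr => i _ /=; rewrite (fr2 _ la (E i)) mulr_sumr.
by apply: eq_bigr => j _; rewrite mulrA.
Qed.

Lemma det_eval q (G : 'M[A]_m) : (\det G) q = \det (\matrix_(i, j) G i j q).
Proof.
rewrite /determinant Cinf_sum; apply: eq_bigr => s _.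
rewrite CinfM CinfX CinfN Cinf1 Cinf_prod; congr (_ * _).
by apply: eq_bigr => i _; rewrite mxE.
Qed.

Lemma gram_det_at X q : (\det (gram X)) q = \det (gram_at X q).
Proof. by rewrite det_eval; congr (\det _); apply/matrixP => i j; rewrite !mxE. Qed.

(** Cramer's rule without the division: where [X] is a frame this is [\det (gram X) *: Y], and it is
    defined globally. *)
Definition cramer X Y : V :=
  \sum_k (\sum_l g Y (X l) * (\adj (gram X)) l k) *: X k.

Lemma cramer_lin1 al X : lin1 al -> lin1 (fun Y => al (cramer X Y) : A).
Proof.
move=> la f Y Z; rewrite -la /cramer; congr (al _).
rewrite scaler_sumr -big_split; apply: eq_bigr => k _ /=.
rewrite scalerA -scalerDl mulr_sumr -big_split; congr (_ *: _).
by apply: eq_bigr => l _; rewrite gL mulrDl mulrA.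
Qed.

Lemma cramer_frame X i : cramer X (X i) = \det (gram X) *: X i.
Proof.
set D := \det _.
have e k : \sum_l g (X i) (X l) * (\adj (gram X)) l k = D *+ (i == k).
  have := congr1 (fun B : 'M[A]_m => B i k) (mul_mx_adj (gram X)).
  rewrite [LHS]mxE [RHS]mxE => <-.
  by apply: eq_bigr => l _; rewrite [gram X i l]mxE.
rewrite /cramer (eq_bigr (fun k => (D *+ (i == k)) *: X k)) => [|k _]; last by rewrite e.
rewrite (bigD1 i isT) eqxx mulr1n big1 => [|k ki]; first exact: addr0.
by rewrite eq_sym (negPf ki) mulr0n scale0r.
Qed.

Lemma cramerE q xi X al Y : frame_at q xi X -> lin1 al ->
  al (cramer X Y) q = (\det (gram X) * al Y) q.
Proof.
move=> [_ fr] la; rewrite (fr _ (cramer_lin1 X la)) CinfE (fr _ la Y) mulr_sumr.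
by apply: eq_bigr => i _; rewrite cramer_frame lin1Z // CinfE; ring.
Qed.

Lemma piece_frame (P : piece) q : pW P q -> frame_at q (pxi P) (pX P).
Proof.
by case: P => c W K rho chi xi X ac oW cK KW Wc r0 rc cK' fr; exact: (frame_on_at ac oW Wc fr).
Qed.

Lemma prho_W (P : piece) q : prho P q != 0 -> pW P q.
Proof.
by move=> h; apply/pKW/pchi_K; rewrite (prho_chi h) oner_neq0.
Qed.

(** Adding up Cramer's rule with the weights [prho] gives [H *: Y] with [H] everywhere positive, and
    division by [H] gives the expansion. To the trace each piece contributes [m] times its share of
    [H]. *)
Lemma dual_frames : compact [set: M] -> exists (I : finType) (F F' : I -> V),
  (forall X, X = \sum_c g X (F' c) *: F c) /\ \sum_c g (F c) (F' c) = m%:R.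
Proof.
case/finite_pieces => I [P cover].
pose D j := \det (gram (pX (P j))).
pose H := \sum_j prho (P j) * D j.
have D_gt0 j q : prho (P j) q != 0 -> 0 < D j q.
  by move=> /prho_W/piece_frame fr; rewrite /D gram_det_at; apply: gram_det_gt0 fr.
have rD j q : 0 <= (prho (P j) * D j) q.
  rewrite CinfE; have [->|/D_gt0 h] := eqVneq (prho (P j) q) 0; first by rewrite mul0r.
  by rewrite mulr_ge0 ?prho_ge0 // ltW.
have H0 q : 0 < H q.
  have [j jq] := cover q; rewrite /H Cinf_sum (bigD1 j) // ltr_wpDr //.
    by apply: sumr_ge0 => k _; exact: rD.
  by rewrite CinfE mulr_gt0 // D_gt0 // gt_eqF.
have [h hH _] := Cinf_inv H0.
have rN j Y : prho (P j) *: cramer (pX (P j)) Y = (prho (P j) * D j) *: Y.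
  apply: vfield_eq => f; apply: Cinf_eq => q; rewrite !vfieldZE !CinfM.
  have [->|/prho_W/piece_frame fr] := eqVneq (prho (P j) q) 0; first by rewrite !mul0r.
  by rewrite -mulrA (cramerE Y fr (eval_lin1 f)) CinfM.
exists (I * 'I_m)%type, (fun c => pX (P c.1) c.2),
  (fun c => \sum_l (h * prho (P c.1) * (\adj (gram (pX (P c.1)))) l c.2) *: pX (P c.1) l).
have gF' Y c : g Y (\sum_l (h * prho (P c.1) * (\adj (gram (pX (P c.1)))) l c.2) *: pX (P c.1) l)
    = h * prho (P c.1) * \sum_l g Y (pX (P c.1) l) * (\adj (gram (pX (P c.1)))) l c.2.
  rewrite (lin1_sum _ _ _ (metric_lin1r Y)) mulr_sumr; apply: eq_bigr => l _.
  by rewrite (lin1Z _ _ (metric_lin1r Y)); ring.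
split=> [Y|].
  under eq_bigr do rewrite gF'.
  rewrite -(pair_bigA _ (fun j k => (h * prho (P j) *
    \sum_l g Y (pX (P j) l) * (\adj (gram (pX (P j)))) l k) *: pX (P j) k)) /=.
  transitivity (\sum_j h *: ((prho (P j) * D j) *: Y)).
    by rewrite -scaler_sumr -scaler_suml -/H scalerA mulrC hH scale1r.
  apply: eq_bigr => j _; rewrite -rN /cramer !scaler_sumr; apply: eq_bigr => k _.
  by rewrite !scalerA.
under eq_bigr do rewrite gF'.
rewrite -(pair_bigA _ (fun j k => h * prho (P j) *
    \sum_l g (pX (P j) k) (pX (P j) l) * (\adj (gram (pX (P j)))) l k)) /=.
transitivity (\sum_j h * (prho (P j) * D j) * m%:R).
  apply: eq_bigr => j _; rewrite -mulr_sumr -!mulrA; congr (_ * (_ * _)).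
  transitivity (\sum_(k < m) D j); last by rewrite sumr_const card_ord mulr_natr.
  apply: eq_bigr => k _; have := congr1 (fun B : 'M[A]_m => B k k) (mul_mx_adj (gram (pX (P j)))).
  rewrite [LHS]mxE [RHS]mxE eqxx mulr1n /D => <-.
  by apply: eq_bigr => l _; rewrite [gram _ k l]mxE.
by rewrite -mulr_suml -mulr_sumr -/H [h * _]mulrC hH mul1r.
Qed.

End Metric.

Lemma isF_repeat (w : seq V -> A) X s : isF w -> X \in s -> w (X :: s) = 0.
Proof.
elim: s w => // Y s IH w Fw; rewrite inE; case: (eqVneq X Y) => [->|_] /= h.
  by have [_ a] := Fw; exact: (a [::]).
by rewrite [LHS](isF_anti [::]) //= -iotaE IH ?oppr0 //; exact: isF_iota.
Qed.

Lemma isF_not_uniq (w : seq V -> A) s : isF w -> ~~ uniq s -> w s = 0.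
Proof.
elim: s w => // Y s IH w Fw; rewrite /= negb_and negbK => /orP[|us].
  exact: isF_repeat.
by rewrite -iotaE IH //; exact: isF_iota.
Qed.

(* Near a point each field is a combination of the [m] fields of a frame, so some
   argument is repeated after expansion. *)
Lemma isF_top (w : seq V -> A) s : isF w -> (m < size s)%N -> w s = 0.
Proof.
move=> Fw ms; apply: Cinf_eq => q.
have [P Pq] := piece_exists q.
have [_ fr] := piece_frame (prho_W (lt0r_neq0 Pq)).
pose X := pX P.
suff h s2 : forall s1, all [in codom X] s1 -> (m < size (s1 ++ s2))%N ->
    w (s1 ++ s2) q = 0 by exact: (h s [::]).
elim: s2 => [|Y s2 IH] s1 Xs1.
  rewrite cats0 => sz; rewrite isF_not_uniq //.
  apply: contraTN sz => us1; rewrite -leqNgt.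
  have := uniq_leq_size us1 (fun Y => allP Xs1 Y); rewrite size_codom card_ord.
  exact.
rewrite size_cat /= addnS => sz.
have la : lin1 (fun Y => w (s1 ++ Y :: s2)) by move=> f Y' Z; have [l _] := Fw; exact: l.
rewrite (fr _ la Y) big1 // => i _; rewrite -cat_rcons IH ?mulr0 //.
  by rewrite all_rcons Xs1 andbT /= codom_f.
by rewrite size_cat size_rcons addSn.
Qed.

End MetricLayer.

(** * Integration *)

Section Integration.
Variables (R : realType) (m : nat) (M : manifold R m).
Local Notation A := (Cinf M).
Local Notation V := (vfield M).
Variable S : sasaki_data V.
Local Notation g := (gm S).
Local Notation F := (@Fr A V S).
Local Notation F' := (@Fr' A V S).
Hypothesis actS : forall X f, act S X f = X f.
Hypothesis brS : forall X Y, br S X Y = bracket X Y.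
Hypothesis gpos : forall (X : V) (p : M), (exists f : A, X f p <> 0) -> 0 < g X X p.
Let gL : forall f X Y Z, g (f *: X + Y) Z = f * g X Z + g Y Z := gmL S.
Let gS : forall X Y, g X Y = g Y X := gmS S.

Lemma point_frame (q : M) : exists xi X, frame_at q xi X.
Proof.
have [P Pq] := piece_exists q; exists (pxi P), (pX P).
exact: piece_frame (prho_W (lt0r_neq0 Pq)).
Qed.

(** Expand [F' c] in the orthonormal basis, exchange the sums, and recognise the frame expansion of
    each [E i]. *)
Lemma orthonormal_trace q E (be : V -> V -> A) : orthonormal_at g q E ->
  (forall Y, lin1 (be ^~ Y)) -> (forall X, lin1 (be X)) ->
  (\sum_c be (F c) (F' c)) q = \sum_i be (E i) (E i) q.
Proof.
move=> oE l1 l2; have [xi [X fr]] := point_frame q.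
rewrite Cinf_sum; under eq_bigr => c _ do
  rewrite (orthonormal_expand gL gS fr oE (l2 (F c)) (F' c)).
rewrite exchange_big; apply: eq_bigr => i _ /=.
rewrite (lin1_frame S (E i) (l1 (E i))) Cinf_sum; apply: eq_bigr => c _.
by rewrite CinfM gS.
Qed.

Lemma frame_trace q xi X (be : V -> V -> A) : frame_at q xi X ->
  (forall Y, lin1 (be ^~ Y)) -> (forall X, lin1 (be X)) ->
  (\det (gram g X) * \sum_c be (F c) (F' c)) q =
  (\sum_k \sum_l (\adj (gram g X)) l k * be (X l) (X k)) q.
Proof.
move=> fr l1 l2; rewrite mulr_sumr Cinf_sum.
under eq_bigr => c _ do rewrite -(cramerE gL (F' c) fr (l2 (F c))).
rewrite -Cinf_sum; congr (Cinf_val _ q).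
rewrite /cramer; under eq_bigr => c _ do rewrite (lin1_sum _ _ _ (l2 _)).
rewrite exchange_big; apply: eq_bigr => k _ /=.
under eq_bigr => c _ do rewrite (lin1Z _ _ (l2 _)) mulr_suml.
rewrite exchange_big; apply: eq_bigr => l _ /=.
rewrite (lin1_frame S (X l) (l1 (X k))) mulr_sumr; apply: eq_bigr => c _.
by rewrite gS; ring.
Qed.

Fixpoint ip_at (E : 'I_m -> V) q k (a b : seq V -> A) : R :=
  if k is k'.+1 then k'.+1%:R^-1 * \sum_i ip_at E q k' (iota (E i) a) (iota (E i) b)
  else a [::] q * b [::] q.

Lemma ninvE k q : ninv S k q = k.+1%:R^-1.
Proof.
have := congr1 (fun f : A => f q) (ninvP S k); rewrite CinfM => h.
have natE j : (j%:R : A) q = j%:R.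
  by elim: j => [|j IH]; rewrite ?Cinf0 // -natr1 CinfD Cinf1 IH natr1.
rewrite natE Cinf1 in h.
by apply: (mulIf (x := k.+1%:R)); rewrite ?pnatr_eq0 // h mulVf // pnatr_eq0.
Qed.

Lemma ip_atE E q k a b : orthonormal_at g q E -> isF a -> isF b ->
  ip S k a b q = ip_at E q k a b.
Proof.
move=> oE; elim: k a b => [|k IH] a b Fa Fb; first exact: CinfM.
have -> : ip S k.+1 a b q =
  (ninv S k * \sum_c ip S k (iota (F c) a) (iota (F' c) b)) q by [].
rewrite CinfM ninvE [RHS]/=; congr (_ * _).
rewrite (orthonormal_trace (be := fun X Y => ip S k (iota X a) (iota Y b)) oE).
- by apply: eq_bigr => i _; apply: IH; exact: isF_iota.
- by move=> Y; exact: ip_iota_linl.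
- by move=> X; exact: ip_iota_linr.
Qed.

Lemma big_ffunS (k : nat) (C : finType) (Q : {ffun 'I_k.+1 -> C} -> R) :
  \sum_s Q s = \sum_i \sum_(t : {ffun 'I_k -> C})
    Q [ffun j => oapp t i (unlift ord0 j)].
Proof.
rewrite pair_bigA /=.
rewrite (reindex (fun p : C * {ffun 'I_k -> C} =>
  [ffun j => oapp p.2 p.1 (unlift ord0 j)])) //=.
exists (fun s : {ffun 'I_k.+1 -> C} => (s ord0, [ffun j => s (lift ord0 j)])).
  move=> [i t] _ /=; congr pair; first by rewrite ffunE unlift_none.
  by apply/ffunP => j; rewrite !ffunE liftK.
move=> s _; apply/ffunP => j; rewrite ffunE /=.
by case: (unliftP ord0 j) => [j'|] -> //=; rewrite ffunE.
Qed.

Lemma ip_at_sum E q k a b : ip_at E q k a b = (k`!%:R)^-1 *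
  \sum_(s : {ffun 'I_k -> 'I_m}) a [seq E (s i) | i <- enum 'I_k] q *
    b [seq E (s i) | i <- enum 'I_k] q.
Proof.
elim: k a b => [|k IH] a b.
  rewrite /= fact0 invr1 mul1r (big_pred1 (ffun0 (card_ord 0))).
    by have -> : enum 'I_0 = [::] by apply: size0nil; rewrite size_enum_ord.
  by move=> s; apply/esym/eqP/ffunP => -[].
rewrite /= big_ffunS factS natrM invfM -mulrA; congr (_ * _).
rewrite mulr_sumr; apply: eq_bigr => i _; rewrite IH; congr (_ * _).
apply: eq_bigr => s _; rewrite !iotaE.
have -> : [seq E ([ffun j => oapp s i (unlift ord0 j)] i0) | i0 <- enum 'I_k.+1] =
    E i :: [seq E (s j) | j <- enum 'I_k].
  rewrite enum_ordSl /= ffunE unlift_none /=; congr (_ :: _).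
  by rewrite -map_comp; apply: eq_map => j /=; rewrite ffunE liftK.
by [].
Qed.

Lemma ip_ge0 k a q : isF a -> 0 <= ip S k a a q.
Proof.
move=> Fa; have [xi [X fr]] := point_frame q.
have [E oE] := orthonormal_at_nonempty gL gS gpos fr.
rewrite (ip_atE k oE) // ip_at_sum mulr_ge0 ?invr_ge0 ?ler0n // sumr_ge0 // => s _.
by rewrite -expr2 sqr_ge0.
Qed.

Lemma ip_def k a s : isF a -> ip S k a a = 0 -> size s = k -> a s = 0.
Proof.
elim: k a s => [|k IH] a s Fa aa.
  move=> /size0nil ->; apply: Cinf_eq => q.
  have : (a [::] * a [::]) q = 0 := congr1 (fun f : A => f q) aa; rewrite CinfM => /eqP.
  by rewrite mulf_eq0 orbb => /eqP.
case: s => // Y s [sk]; apply: Cinf_eq => q; rewrite Cinf0.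
have [xi [X fr]] := point_frame q.
have [E oE] := orthonormal_at_nonempty gL gS gpos fr.
have la : lin1 (fun Y => a (Y :: s)) by move=> f Z W; have [l _] := Fa; exact: (l [::]).
rewrite (orthonormal_expand gL gS fr oE la); apply: big1 => i _.
have h : ip_at E q k (iota (E i) a) (iota (E i) a) = 0.
  have := congr1 (fun f : A => f q) aa; rewrite Cinf0 (ip_atE _ oE) // /= => /eqP.
  rewrite mulf_eq0 invr_eq0 pnatr_eq0 /= psumr_eq0 => [|j _].
    by move=> /allP/(_ i); rewrite mem_index_enum => /(_ isT)/eqP.
  by rewrite -(ip_atE k oE) ?ip_ge0 //; exact: isF_iota.
have pt (b : seq V -> A) j t : ip_at E q j b b = 0 -> isF b -> size t = j -> b t q = 0.
  elim: j b t => [|j IHj] b t.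
    by move=> /= /eqP; rewrite mulf_eq0 orbb => /eqP b0 _ /size0nil ->.
  case: t => // Z t /= b0 Fb [st].
  have lb : lin1 (fun Y => b (Y :: t)) by move=> f Z' W; have [l _] := Fb; exact: (l [::]).
  rewrite (orthonormal_expand gL gS fr oE lb); apply: big1 => l _.
  rewrite -iotaE IHj ?mulr0 //; last exact: isF_iota.
  move/eqP: b0; rewrite mulf_eq0 invr_eq0 pnatr_eq0 /= psumr_eq0 => [|l' _].
    by move=> /allP/(_ l); rewrite mem_index_enum => /(_ isT)/eqP.
  by rewrite -(ip_atE j oE) ?ip_ge0 //; exact: isF_iota.
by rewrite -iotaE (pt _ k) ?mulr0 //; exact: isF_iota.
Qed.

(** The density has to be a global positive smooth function, since it is divided by later. [D'] is
    the Gram determinant where [prho] is nonzero and stays positive everywhere. *)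
Lemma piece_density (P : piece M) : exists mu : A,
  [/\ forall q, 0 < mu q,
      forall q, prho P q != 0 -> mu q = vol_density g (pc P) q
    & forall q, prho P q != 0 -> (mu * mu) q = (\det (gram g (pX P))) q].
Proof.
pose D := \det (gram g (pX P)); pose chi := pchi P.
pose D' := chi * chi * D + (1 - chi) * (1 - chi).
have D'E q : D' q = chi q ^+ 2 * D q + (1 - chi q) ^+ 2.
  by rewrite /D' CinfD !CinfM !CinfD !CinfN Cinf1 !expr2.
have D_gt0 q : pW P q -> 0 < D q.
  by move=> /piece_frame fr; rewrite /D gram_det_at; exact: gram_det_gt0 fr.
have D'0 q : 0 < D' q.
  rewrite D'E; have [->|h] := eqVneq (chi q) 0; first by rewrite subr0 expr1n expr0n mul0r add0r.
  rewrite ltr_wpDr ?sqr_ge0 // mulr_gt0 ?exprn_even_gt0 // D_gt0 //.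
  exact/pKW/pchi_K.
have D'D q : prho P q != 0 -> D' q = D q.
  by move=> h; rewrite D'E (prho_chi h) subrr expr1n expr0n mul1r addr0.
have muE q : Cinf_powR 2^-1 D'0 q = Num.sqrt (D' q) by exact: powR12_sqrt (ltW (D'0 q)).
exists (Cinf_powR 2^-1 D'0); split=> [q|q rq|q rq].
- by rewrite muE sqrtr_gt0.
- have Wq := prho_W rq; rewrite muE D'D // /D gram_det_at.
  congr (Num.sqrt (\det _)); apply/matrixP => i j; rewrite !mxE.
  (* [vol_density] uses a chosen family of fields; only their values at [q] count, and these are
     fixed by the chart. *)
  set X' := xget _ _.
  have [_ fr] := piece_frame Wq.
  have [Xc _ _] := p_frame P.
  have cX' : chart_frame_at (pc P) q X'.
    by apply: xgetPex; exists (pX P) => k f; exact: Xc.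
  have e al k : lin1 al -> al (X' k) q = al (pX P k) q :> R.
    move=> la; rewrite (fr _ la) [RHS](fr _ la); apply: eq_bigr => l _.
    by rewrite cX' Xc.
  by rewrite (e _ i (metric_lin1l gL (X' j))) (e _ j (metric_lin1r gL gS (pX P i))).
- by rewrite CinfM !muE -expr2 sqr_sqrtr ?D'D // -D'D // ltW.
Qed.

Definition chart_ext (P : piece M) (h : A) (x : 'rV[R]_m) : R :=
  if x \in cmap (pc P) @` cdom (pc P) then h (cinv (pc P) x) else 0.

(** * Functions supported in a piece, read in its chart *)

Section ChartExtension.
Hypothesis cM : compact [set: M].
Variable P : piece M.
Implicit Types (h : A) (q : M) (x : 'rV[R]_m).
Local Notation c := (pc P).
Local Notation K := (pK P).

Lemma chart_ext_cmap h q : cdom c q -> chart_ext P h (cmap c q) = h q.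
Proof.
by move=> cq; rewrite /chart_ext mem_set ?chart_cinv //; exists q.
Qed.

Lemma chart_image_compact : compact (cmap c @` K).
Proof.
have cK : compact K := subclosed_compact (@p_closed _ _ _ P) cM (fun _ _ => I).
apply: continuous_compact cK; apply: continuous_in_subspaceT => q /set_mem Kq.
by apply: cmap_continuous; rewrite inE; exact/pWc/pKW.
Qed.

(** Near each point the extension is either [h] read in the chart or identically 0, because the
    image of [K] is compact, hence closed. *)
Lemma chart_ext_cases h x : (forall q, h q != 0 -> K q) ->
  (exists q, [/\ K q, x = cmap c q & \forall y \near x, h (cinv c y) = chart_ext P h y]) \/
  (\forall y \near x, 0 = chart_ext P h y) /\ (forall q, cdom c q -> x = cmap c q -> ~ K q).
Proof.
move=> hK; have [[q Kq <-]|nx] := pselect ((cmap c @` K) x).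
  left; exists q; split => //; have cq : cdom c q by exact/pWc/pKW.
  have : nbhs (cmap c q) (cmap c @` cdom c).
    by apply: open_nbhs_nbhs; split; [exact: cimage_open|exists q].
  by apply: filterS => y Dy; rewrite /chart_ext mem_set.
right; split; last by move=> q cq xq Kq; apply: nx; exists q.
have cl : closed (cmap c @` K).
  by apply: compact_closed chart_image_compact; exact: norm_hausdorff.
have : nbhs x (~` (cmap c @` K)).
  by apply: open_nbhs_nbhs; split => //; exact: closed_openC.
apply: filterS => y ny; rewrite /chart_ext; case: ifPn => // /set_mem[q cq qy].
rewrite -qy chart_cinv //; apply/esym/eqP; apply: contraT => /hK Kq.
by case: ny; exists q.
Qed.

Lemma chart_ext_supp : exists2 r : R, 0 < r &
  forall h, (forall q, h q != 0 -> K q) -> supp_cont r (chart_ext P h).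
Proof.
have /pinfty_ex_gt0[r r0 bd] := compact_bounded chart_image_compact.
exists r => // h hK; split=> [x|x rx].
  have [[q [Kq -> e]]|[e _]] := chart_ext_cases x hK.
    rewrite /continuous_at -(nbhs_singleton e); apply: cvg_trans (near_eq_cvg e) _.
    have cq : cdom c q by exact/pWc/pKW.
    have := smooth_on_continuous (Cinf_smooth_on h (p_atlas P)).
    by move=> /(_ (cmap c q)); apply; exists q.
  rewrite /continuous_at -(nbhs_singleton e); apply: cvg_trans (near_eq_cvg e) _.
  exact: cvg_cst.
rewrite /chart_ext; case: ifPn => // /set_mem[q cq qx].
rewrite -qx chart_cinv //; apply/eqP; apply: contraT => /hK Kq.
by have /= := bd x (ex_intro2 _ _ q Kq qx); rewrite leNgt rx.
Qed.

Lemma pX_supp i h : (forall q, h q != 0 -> K q) -> forall q, pX P i h q != 0 -> K q.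
Proof.
move=> hK q; apply: contraPP => nKq;
rewrite (vfield_local (g := 0) _ (closed_openC (@p_closed _ _ _ P)) nKq).
  by rewrite vf0 Cinf0 eqxx.
by move=> q' nK'; rewrite Cinf0; apply/eqP; apply: contraT => /hK.
Qed.

Lemma chart_ext_derive i h x : (forall q, h q != 0 -> K q) ->
  is_derive x (basis_vec R i) (chart_ext P h) (chart_ext P (pX P i h) x).
Proof.
move=> hK; have [[q [Kq xq e]]|[e nK]] := chart_ext_cases x hK.
  have cq : cdom c q by exact/pWc/pKW.
  rewrite xq chart_ext_cmap // -xq; apply: near_eq_is_derive e _.
  have [Xc _ _] := p_frame P; have := Xc q (pKW Kq) i h; rewrite -xq => ->.
  apply: derivableP; apply: smooth_on_derivable (Cinf_smooth_on h (p_atlas P)) _.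
  by rewrite xq; exists q.
have -> : chart_ext P (pX P i h) x = 0.
  rewrite /chart_ext; case: ifPn => // /set_mem[q cq qx].
  rewrite -qx chart_cinv //; apply/eqP; apply: contraT => /(pX_supp hK) Kq.
  by case: (nK q).
by apply: near_eq_is_derive e _; exact: is_derive_cst.
Qed.

Lemma chart_ext_integral0 i h : (forall q, h q != 0 -> K q) ->
  iterated_integral (chart_ext P (pX P i h)) = 0.
Proof.
move=> hK; have [r r0 rS] := chart_ext_supp.
apply: (iterated_integral_partial (F := chart_ext P h) (i := i) r0).
- exact: rS.
- by apply: rS; exact: pX_supp.
- by move=> x; exact: chart_ext_derive.
Qed.

End ChartExtension.

(** * Positivity of the integral and the divergence theorem *)

Section Integral.
Hypothesis cM : compact [set: M].
Variable I : (M -> R) -> R.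
Hypothesis hI : riemannian_integral g I.

Lemma integral_lin (a : R) (f h : A) : I (Cinf_cst M a * f + h : A) = a * I f + I h.
Proof.
by rewrite -hI.1.
Qed.

Lemma integralD (f h : A) : I (f + h : A) = I f + I h.
Proof.
have := integral_lin 1 f h; rewrite mul1r (_ : Cinf_cst M 1 = 1) ?mul1r //.
exact: Cinf_eq.
Qed.

Lemma integral0 : I (0 : A) = 0.
Proof. by apply: (addrI (I (0 : A))); rewrite -integralD !addr0. Qed.

Lemma integral_sum (J : finType) (f : J -> A) : I (\sum_j f j : A) = \sum_j I (f j).
Proof.
elim/big_rec2 : _ => [|j x y _ <-]; [exact: integral0|exact: integralD].
Qed.

Lemma piece_integral (P : piece M) : exists mu : A,
  [/\ forall q, 0 < mu q,
    forall f : A, (forall q, f q != 0 -> prho P q != 0) ->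
      I f = iterated_integral (chart_ext P (f * mu))
    & forall q, prho P q != 0 -> (mu * mu) q = (\det (gram g (pX P))) q].
Proof.
have [mu [mu0 muv mu2]] := piece_density P; exists mu; split=> // f frho.
have fK q : f q != 0 -> pK P q.
  by move=> /frho h; apply: pchi_K; rewrite (prho_chi h) oner_neq0.
rewrite (hI.2 _ _ (p_atlas P)) => [|q].
  congr iterated_integral; apply/funext => x; rewrite /chart_ext; case: ifP => // _.
  rewrite CinfM; have [->|/frho h] := eqVneq (f (cinv (pc P) x)) 0; first by rewrite !mul0r.
  by rewrite muv.
move=> /(closure_subset fK); rewrite -(closure_id _).1; last exact: p_closed.
by move=> /pKW/pWc.
Qed.

Lemma piece_integral_ge0 (P : piece M) (f : A) : (forall q, f q != 0 -> prho P q != 0) ->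
  (forall q, 0 <= f q) -> 0 <= I f /\ (forall q, 0 < f q -> 0 < I f).
Proof.
move=> frho f0; have [mu [mu0 If _]] := piece_integral P; rewrite If //.
have [r r0 rS] := chart_ext_supp cM P.
have fK q : (f * mu) q != 0 -> pK P q.
  rewrite CinfM mulf_eq0 negb_or => /andP[/frho h _].
  by apply: pchi_K; rewrite (prho_chi h) oner_neq0.
have ge0 x : 0 <= chart_ext P (f * mu) x.
  by rewrite /chart_ext; case: ifP => // _; rewrite CinfM mulr_ge0 // ltW.
split=> [|q fq]; first exact: iterated_integral_ge0.
apply: (iterated_integral_gt0 (x0 := cmap (pc P) q) r0 (rS _ fK) ge0).
have Kq : pK P q by apply: fK; rewrite CinfM mulf_neq0 // gt_eqF.
rewrite chart_ext_cmap; last exact/pWc/pKW.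
by rewrite CinfM mulr_gt0.
Qed.

(** The squares make the first derivatives of [prho ^+ 2 * u] vanish wherever [prho] does, which
    keeps divergences supported in the piece. *)
Lemma partition_of_unity : exists (J : finType) (P : J -> piece M) (w : A),
  \sum_j prho (P j) ^+ 2 * w = 1 /\ (forall q, 0 < w q).
Proof.
have [J [P cover]] := finite_pieces cM.
have H0 q : 0 < (\sum_j prho (P j) ^+ 2) q.
  have [j jq] := cover q; rewrite Cinf_sum (bigD1 j) // ltr_wpDr //.
    by apply: sumr_ge0 => k _; rewrite CinfX sqr_ge0.
  by rewrite CinfX exprn_gt0.
have [w hw w0] := Cinf_inv H0.
by exists J, P, w; rewrite -mulr_suml.
Qed.

Lemma integral_pos_def (f : A) : (forall q, 0 <= f q) -> 0 <= I f /\ (I f = 0 -> f = 0).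
Proof.
move=> f0; have [J [P [w [w1 w0]]]] := partition_of_unity.
pose u j := prho (P j) ^+ 2 * w * f.
have uE j q : u j q = prho (P j) q ^+ 2 * w q * f q by rewrite /u CinfM CinfM CinfX.
have fu : f = \sum_j u j by rewrite -mulr_suml w1 mul1r.
have u0 j q : 0 <= u j q by rewrite uE mulr_ge0 // mulr_ge0 ?sqr_ge0 //; exact: ltW.
have ur j q : u j q != 0 -> prho (P j) q != 0.
  by rewrite uE; apply: contraNneq => ->; rewrite expr0n !mul0r.
have pj j := piece_integral_ge0 (ur j) (u0 j).
rewrite {1 2}fu integral_sum; split; first by apply: sumr_ge0 => j _; have [] := pj j.
move/eqP; rewrite psumr_eq0 => [/allP I0|j _]; last by have [] := pj j.
apply: Cinf_eq => q; rewrite fu Cinf_sum Cinf0 big1 // => j _.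
apply/eqP; apply: contraT => uq; have [_ /(_ q)] := pj j.
rewrite lt_def uq u0 => /(_ isT); have := I0 j (mem_index_enum _) => /eqP ->.
by rewrite ltxx.
Qed.

Lemma div_scl f W : div S (f *: W) = W f + f * div S W.
Proof.
rewrite -actS [act S W f](lin1_frame' S W (act_lin S f)) /div mulr_sumr -big_split.
by apply: eq_bigr => c _; rewrite covZr gDl !gZl addrC; congr (_ + _); exact: mulrC.
Qed.

Lemma divD W W' : div S (W + W') = div S W + div S W'.
Proof. by rewrite /div -big_split; apply: eq_bigr => c _; rewrite covDr gDl. Qed.

Lemma div0 : div S 0 = 0.
Proof. by apply: (addrI (div S 0)); rewrite -divD !addr0. Qed.

Lemma div_sum (J : finType) (W : J -> V) : div S (\sum_j W j) = \sum_j div S (W j).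
Proof. by elim/big_rec2 : _ => [|j x y _ <-]; rewrite ?div0 ?divD. Qed.

(** Coordinate functions have constant derivatives along coordinate fields, so the bracket of two
    such fields kills them. *)
Lemma coord_bracket (P : piece M) q i j al : pW P q -> lin1 al ->
  al (bracket (pX P i) (pX P j)) q = 0 :> R.
Proof.
move=> Wq la; have [_ fr] := piece_frame Wq; rewrite (fr _ la); apply: big1 => k _.
have [_ Xxi _] := p_frame P.
have cst a b : pX P a (pX P b (pxi P k)) q = 0.
  rewrite (vfield_local (g := Cinf_cst M (b == k)%:R) _ (p_open P) Wq) => [|q' Wq'].
    by rewrite vfC.
  by rewrite Xxi.
by rewrite bracketE CinfD CinfN !cst subrr mul0r.
Qed.

(* The second fundamental identity [2 D div X_i = X_i D]: the torsion of the
   connection is trace free. *)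
Lemma piece_div (P : piece M) i q : pW P q ->
  (2 * (\det (gram g (pX P)) * div S (pX P i))) q = pX P i (\det (gram g (pX P))) q.
Proof.
move=> Wq; have fr := piece_frame Wq; set X := pX P; set D := \det _.
have adjE l k : (\adj (gram g X)) l k = cofactor (gram g X) k l by rewrite mxE.
have adjS l k : (\adj (gram g X)) l k = (\adj (gram g X)) k l.
  have GT : (gram g X)^T = gram g X by apply/matrixP => a b; rewrite !mxE gS.
  have := congr1 (fun B : 'M[A]_m => B k l) (trmx_adj (gram g X)).
  by rewrite GT [LHS]mxE.
have e1 : (D * div S (X i)) q =
    (\sum_k \sum_l (\adj (gram g X)) l k * g (cov S (X i) (X k)) (X l)) q.
  rewrite /div (frame_trace (be := fun Y Z => g (cov S Z (X i)) Y) fr) => [|Y|Y]; first last.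
  - by move=> f Z Z'; rewrite covL gL.
  - by move=> f Z Z'; rewrite gDr gZr.
  have e2 : (\sum_k \sum_l (\adj (gram g X)) l k * (om S (X k) (X i) * g (Tv S) (X l))) q = 0.
    rewrite -(frame_trace (be := fun Y Z => om S Z (X i) * g (Tv S) Y) fr).
    - rewrite (_ : \sum_c _ = 0) ?mulr0 // -[RHS](omT S (X i)).
      have lo : lin1 (fun Z => om S Z (X i)) by move=> f Z Z'; rewrite /om JD JZ gDl gZl.
      by rewrite (lin1_frame' S (Tv S) lo); apply: eq_bigr => c _; rewrite mulrC.
    - by move=> Y f Z Z'; rewrite gDr gZr; ring.
    - by move=> Y f Z Z'; rewrite /om JD JZ gDl gZl; ring.
  rewrite -[RHS]addr0 -e2 !Cinf_sum -big_split; apply: eq_bigr => k _ /=.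
  rewrite !Cinf_sum; transitivity (\sum_l (((\adj (gram g X)) l k * g (cov S (X i) (X k)) (X l)) q +
    ((\adj (gram g X)) l k * (om S (X k) (X i) * g (Tv S) (X l))) q)); last by rewrite big_split.
  apply: eq_bigr => l _; rewrite !CinfM -mulrDr; congr (_ * _).
  have := cov_torsion S (X k) (X i); rewrite /tb => /eqP; rewrite subr_eq => /eqP ->.
  rewrite !gDl gZl !CinfD brS.
  by rewrite (coord_bracket k i Wq (gm_linl S (X l))) add0r addrC.
have e3 : X i D = \sum_k \sum_l (\adj (gram g X)) l k *
    (g (cov S (X i) (X k)) (X l) + g (cov S (X i) (X l)) (X k)).
  rewrite /D (derivation_det (D := X i)); [|exact: vfD|exact: vfM].
  apply: eq_bigr => k _; apply: eq_bigr => l _; rewrite mulrC adjE mxE; congr (_ * _).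
  by rewrite -actS cov_metric (gmS S (X k)).
rewrite e3 CinfM e1.
have -> : \sum_k \sum_l (\adj (gram g X)) l k *
    (g (cov S (X i) (X k)) (X l) + g (cov S (X i) (X l)) (X k)) =
  2 * \sum_k \sum_l (\adj (gram g X)) l k * g (cov S (X i) (X k)) (X l).
  rewrite mulr_natl mulr2n -[X in _ = _ + X]exchange_big -big_split; apply: eq_bigr => k _ /=.
  rewrite -big_split; apply: eq_bigr => l _ /=.
  by rewrite mulrDr; congr (_ + _); rewrite adjS.
by rewrite -CinfM.
Qed.

(** With [mu] the square root of the Gram determinant, [div (sum_i v_i X_i) = mu^-1 sum_i X_i (v_i
    mu)]; integration against [mu] in the chart leaves integrals of partial derivatives. *)
Lemma piece_divergence (P : piece M) (Y : V) : I (div S (prho P ^+ 2 *: Y)) = 0.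
Proof.
have [mu [mu0 If mu2]] := piece_integral P; have [nu mn _] := Cinf_inv mu0.
pose X := pX P; pose rho := prho P; pose u i := Y (pxi P i).
have YE : rho ^+ 2 *: Y = \sum_i (rho ^+ 2 * u i) *: X i.
  apply: vfield_eq => f; rewrite vfieldZE vfield_sumE; apply: Cinf_eq => q.
  rewrite CinfM Cinf_sum; under eq_bigr do rewrite vfieldZE CinfM CinfM -mulrA.
  rewrite -mulr_sumr; have [->|rq] := eqVneq ((rho ^+ 2) q) 0; first by rewrite !mul0r.
  have Wq : pW P q by apply: prho_W; move: rq; rewrite CinfX expf_eq0.
  by have [_ _ ->] := p_frame P.
pose h i := rho ^+ 2 * u i * mu.
have rho0 i q : rho q = 0 -> X i (rho ^+ 2 * u i) q = 0.
  move=> rq; rewrite expr2 -mulrA vfM vfM !(CinfD, CinfM) rq; ring.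
have Xh i q : X i (h i) q = X i (rho ^+ 2 * u i) q * mu q + (rho ^+ 2 * u i) q * X i mu q.
  by rewrite /h vfM CinfD CinfM CinfM.
have sX i q : X i (h i) q != 0 -> rho q != 0.
  apply: contraNneq => rq; rewrite Xh rho0 // (CinfM (rho ^+ 2)) CinfX rq.
  by rewrite expr0n !mul0r addr0.
have fE : div S (rho ^+ 2 *: Y) = \sum_i X i (h i) * nu.
  rewrite YE div_sum; apply: eq_bigr => i _; rewrite div_scl.
  have -> : X i (h i) = ((X i (rho ^+ 2 * u i) : A) + rho ^+ 2 * u i * div S (X i)) * mu.
    apply: Cinf_eq => q; rewrite Xh [in RHS]CinfM [in RHS]CinfD mulrDl; congr (_ + _).
    rewrite [in RHS]CinfM -mulrA; have [rq|rq] := eqVneq (rho q) 0.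
      by rewrite CinfM CinfX rq expr0n !mul0r.
    (* Multiplication by [2 mu] turns the derivative of [mu] into that of [mu^2], to which
       [piece_div] applies. *)
    congr (_ * _); apply: (mulfI (x := 2 * mu q)).
      by rewrite mulf_neq0 ?pnatr_eq0 // gt_eqF.
    have e1 := piece_div i (prho_W rq); have e2 := mu2 q rq.
    have e3 : X i (mu * mu) q = X i (\det (gram g X)) q.
      apply: (@vfield_local _ _ _ _ _ _ [set q' : M | 0 < rho q']); first exact: open_gt.
        by rewrite /= lt_def rq prho_ge0.
      by move=> q' /lt0r_neq0; exact: mu2.
    move: e3; rewrite -e1 vfM CinfD !CinfM -e2 CinfM.
    have -> : (2 : A) q = 2 by rewrite -[2]/(1 + 1 : A) CinfD Cinf1.
    move=> e3; transitivity (X i mu q * mu q + mu q * X i mu q); first by ring.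
    by rewrite e3; ring.
  by rewrite -[RHS]mulrA mn mulr1.
rewrite fE (integral_sum _) big1 // => i _; rewrite If => [|q].
  rewrite -mulrA [nu * mu]mulrC mn mulr1; apply: chart_ext_integral0 => // q hq.
  apply: pchi_K; rewrite prho_chi ?oner_neq0 //; apply: contraNneq hq => r0.
  by rewrite /h CinfM CinfM CinfX -/rho r0 expr0n !mul0r.
by rewrite CinfM mulf_eq0 negb_or => /andP[/sX].
Qed.

Lemma integral_div W : I (div S W) = 0.
Proof.
have [J [P [w [w1 _]]]] := partition_of_unity.
have -> : W = \sum_j prho (P j) ^+ 2 *: (w *: W).
  by under eq_bigr do rewrite scalerA; rewrite -scaler_suml w1 scale1r.
by rewrite div_sum integral_sum big1 // => j _; exact: piece_divergence.
Qed.

End Integral.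

End Integration.

(** * Cochains as functions of lists *)

Section ListFormulas.
Variables (A : comPzRingType) (V : lmodType A) (S : sasaki_data V).
Implicit Types (w : seq V -> A) (s t : seq V) (X Y Z : V) (al be : V -> A).

Definition rmat j s := take j s ++ drop j.+1 s.
Definition setat s i Z := take i s ++ Z :: drop i.+1 s.

Lemma rmat0 Y s : rmat 0 (Y :: s) = s. Proof. by rewrite /rmat /= drop0. Qed.
Lemma rmatS j Y s : rmat j.+1 (Y :: s) = Y :: rmat j s. Proof. by []. Qed.
Lemma setat0 Z Y s : setat (Y :: s) 0 Z = Z :: s. Proof. by rewrite /setat /= drop0. Qed.
Lemma setatS i Z Y s : setat (Y :: s) i.+1 Z = Y :: setat s i Z. Proof. by []. Qed.

Lemma eps_sumE al w s :
  eps al w s = \sum_(j < size s) (-1) ^+ j * (al (nth 0 s j) * w (rmat j s)).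
Proof.
elim: s w => [|Y s IH] w; first by rewrite big_ord0.
rewrite big_ord_recl expr0 mul1r /= /rmat /= drop0; congr (_ + _).
rewrite IH -sumrN; apply: eq_bigr => j _.
by rewrite /bump /= add1n exprS mulN1r mulNr.
Qed.

Lemma lie_sumE Y w s :
  lie S Y w s = act S Y (w s) - \sum_(i < size s) w (setat s i (br S Y (nth 0 s i))).
Proof.
elim: s w => [|Z s IH] w; first by rewrite big_ord0 subr0.
rewrite -iotaE iota_lie OmE IH big_ord_recl /= /setat /= drop0 opprD.
by rewrite addrAC -addrA.
Qed.

Lemma form_move w Z j s : isF w -> (j < size s)%N ->
  w (Z :: rmat j s) = (-1) ^+ j * w (setat s j Z).
Proof.
elim: j s w => [|j IH] [|Y s] w Fw //= js.
  by rewrite /rmat /setat /= drop0 mul1r.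
rewrite /rmat /setat /= [LHS](isF_anti [::]) //= -iotaE.
by rewrite -[take j s ++ _]/(rmat j s) (IH s) //; [rewrite exprS mulN1r mulNr|exact: isF_iota].
Qed.

(** Unfolding Cartan's recursion reaches the invariant formula: [L_Y] provides the terms that
    involve the first argument both as differentiating field and in brackets, and [form_move]
    carries a bracket from the front to position [j]. *)
Lemma dd_sumE w s : isF w -> dd S w s =
  \sum_(j < size s) (-1) ^+ j * act S (nth 0 s j) (w (rmat j s)) +
  \sum_(j < size s) \sum_(i < (size s).-1 | (i < j)%N) (-1) ^+ j *
    w (setat (rmat j s) i (br S (nth 0 s i) (nth 0 s j))).
Proof.
elim: s w => [|Y s IH] w Fw; first by rewrite !big_ord0 addr0.
rewrite -iotaE iota_dd !OmE IH; last exact: isF_iota.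
rewrite big_ord_recl expr0 mul1r [X in _ = _ + X]big_ord_recl.
rewrite [X in _ = _ + (X + _)]big1 // add0r lie_sumE rmat0 -!addrA; congr (_ + _).
rewrite opprD addrCA; congr (_ + _).
  rewrite -sumrN; apply: eq_bigr => j _.
  by rewrite lift0 rmatS exprS mulN1r mulNr.
rewrite -opprD -big_split -sumrN; apply: eq_bigr => j _; rewrite lift0 rmatS.
case: s j {IH} => [[] //|W s] j; rewrite [in RHS]big_mkcond big_ord_recl.
rewrite -[X in - X]/(_ + _) opprD; congr (_ + _).
  by rewrite /= setat0 exprS mulN1r mulNr form_move // signrMK.
rewrite -sumrN [in LHS]big_mkcond; apply: eq_bigr => i _.
rewrite lift0 setatS ltnS; case: ifP => _; rewrite ?oppr0 //.
by rewrite exprS mulN1r mulNr.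
Qed.

End ListFormulas.

(** * Passage between cochains and functions of lists *)

Section Cochains.
Variables (R : realType) (m : nat) (M : manifold R m).
Local Notation A := (Cinf M).
Local Notation V := (vfield M).

Definition vals k (X : 'I_k -> V) := [seq X i | i <- enum 'I_k].
(** Extension by 0 to lists of other lengths, so that the list function is homogeneous of degree
    [k]. *)
Definition tolist k (w : cochain M k) : seq V -> A :=
  fun s => if size s == k then w (fun i => nth 0 s i) else 0.
Definition oflist k (v : seq V -> A) : cochain M k := fun X => v (vals X).
Arguments oflist k v _ : clear implicits.

Lemma size_vals k (X : 'I_k -> V) : size (vals X) = k.
Proof. by rewrite size_map size_enum_ord. Qed.

Lemma nth_vals k (X : 'I_k -> V) (i : 'I_k) : nth 0 (vals X) i = X i.
Proof. by rewrite (nth_map i) ?size_enum_ord // nth_ord_enum. Qed.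

Lemma vals_eq k (X : 'I_k -> V) s : size s = k -> (forall i : 'I_k, nth 0 s i = X i) -> vals X = s.
Proof.
move=> sk h; apply: (@eq_from_nth _ 0) => [|i]; rewrite size_vals // => ik.
by rewrite -[i]/(nat_of_ord (Ordinal ik)) nth_vals h.
Qed.

Lemma tolist_vals k (w : cochain M k) X : tolist w (vals X) = w X.
Proof.
rewrite /tolist size_vals eqxx; congr w; apply/funext => i; exact: nth_vals.
Qed.

Lemma tolistK k (w : cochain M k) : oflist k (tolist w) = w.
Proof. by apply/funext => X; exact: tolist_vals. Qed.

Lemma vals_nth s : vals (fun i : 'I_(size s) => nth 0 s i) = s.
Proof. exact: vals_eq. Qed.

Lemma oflistK k v s : size s = k -> tolist (oflist k v) s = v s.
Proof. by move=> <-; rewrite /tolist eqxx /oflist vals_nth. Qed.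

Lemma tolist_deg k (w : cochain M k) s : size s != k -> tolist w s = 0.
Proof. by rewrite /tolist => /negPf ->. Qed.

Lemma tolist_ext k (w : cochain M k) v : (forall s, size s != k -> v s = 0) ->
  (forall X, w X = v (vals X)) -> tolist w = v.
Proof.
move=> v0 wv; apply/funext => s; rewrite /tolist; case: eqP => [sk|/eqP /v0 //].
by subst k; rewrite wv vals_nth.
Qed.

Lemma vals_with k (X : 'I_k -> V) i Z : vals [eta X with i |-> Z] = setat (vals X) i Z.
Proof.
apply: vals_eq => [|j].
  by rewrite size_cat /= size_take size_drop size_vals ltn_ord; have := ltn_ord i; lia.
rewrite nth_cat size_take size_vals ltn_ord /=; case: ltngtP => [ji|ij|/val_inj ->].
- by rewrite nth_take // nth_vals -val_eqE /= ltn_eqF.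
- rewrite -val_eqE /= gtn_eqF // -[(j - i)%N]prednK ?subn_gt0 //= nth_drop.
  by rewrite addSn -addnS prednK ?subn_gt0 // subnKC ?nth_vals // ltnW.
- by rewrite subnn eqxx.
Qed.

Lemma vals_lift k (X : 'I_k.+1 -> V) j : vals (X \o lift j) = rmat j (vals X).
Proof.
apply: vals_eq => [|i].
  by rewrite size_cat size_take size_drop size_vals ltn_ord; have := ltn_ord j; lia.
rewrite nth_cat size_take size_vals ltn_ord /= -nth_vals /= /bump.
case: ltnP => [ij|ji]; first by rewrite nth_take // leqNgt ij.
by rewrite nth_drop addSn subnKC // add1n.
Qed.

Lemma is_form_tolist k (w : cochain M k) : is_form w -> isF (tolist w).
Proof.
move=> [l a]; split=> [t f X Y s|t X s]; last first.
  rewrite /tolist; case: eqP => // sk.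
  have i1 : (size t < k)%N by rewrite -sk size_cat /= -addSnnS leq_addr.
  have i2 : ((size t).+1 < k)%N by rewrite -sk size_cat /= !addnS !ltnS leq_addr.
  apply: (a _ (Ordinal i1) (Ordinal i2)); first by rewrite -val_eqE /= ltn_eqF.
  by rewrite !nth_cat ltnn subnn /= ltnNge leqnSn /= subSnn.
rewrite /tolist !size_cat /=; case: eqP => [sk|_]; last by rewrite mulr0 addr0.
have i1 : (size t < k)%N by rewrite -sk -addSnnS leq_addr.
pose X0 (i : 'I_k) := nth 0 (t ++ X :: s) i.
have e Z : (fun i : 'I_k => nth 0 (t ++ Z :: s) i) = [eta X0 with Ordinal i1 |-> Z].
  apply/funext => i /=; rewrite /X0 !nth_cat -val_eqE /=.
  case: ltngtP => [//|ti|->]; last by rewrite subnn.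
  by rewrite -[(i - size t)%N]prednK ?subn_gt0.
by rewrite !e l.
Qed.

Lemma is_form_oflist k v : isF v -> is_form (oflist k v).
Proof.
move=> Fv; have [l _] := Fv; split=> [X i f Y Z|X i j ij XX].
  by rewrite /oflist !vals_with /setat l.
rewrite /oflist isF_not_uniq //; apply: contra ij => /(uniqP 0)/(_ i j).
by rewrite !inE !size_vals !ltn_ord !nth_vals => /(_ isT isT XX)/val_inj ->.
Qed.

Section Alternating.
Variables (k : nat) (w : cochain M k).
Hypothesis Fw : is_form w.

Lemma form_add X i Y Z : w [eta X with i |-> Y + Z] =
  w [eta X with i |-> Y] + w [eta X with i |-> Z].
Proof. by have := Fw.1 X i 1 Y Z; rewrite scale1r mul1r. Qed.

Lemma form_tperm X (i j : 'I_k) : i != j -> w (X \o tperm i j) = - w X.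
Proof.
move=> ij; have ji : j != i by rewrite eq_sym.
pose U Y Z : 'I_k -> V := fun l => if l == i then Y else if l == j then Z else X l.
have e1 Y Z Y' : U (Y + Y') Z = [eta (U 0 Z) with i |-> Y + Y'].
  by apply/funext => l; rewrite /U /=; case: eqP.
have e2 Y Z : U Y Z = [eta (U 0 Z) with i |-> Y].
  by apply/funext => l; rewrite /U /=; case: eqP.
have e3 Y Z : U Y Z = [eta (U Y 0) with j |-> Z].
  by apply/funext => l; rewrite /U /=; case: (eqVneq l j) => [->|_]; rewrite ?(negPf ji).
have al Y : w (U Y Y) = 0.
  by apply: (Fw.2 _ i j) => //; rewrite /U !eqxx (negPf ji).
have := al (X i + X j); rewrite e2 form_add -!e2 e3 form_add -!e3.
rewrite (e3 (X j)) form_add -!e3 !al add0r addr0.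
have -> : U (X i) (X j) = X.
  by apply/funext => l; rewrite /U; case: eqP => [->//|_]; case: eqP => [->//|].
have -> : U (X j) (X i) = X \o tperm i j.
  apply/funext => l; rewrite /U /=; case: tpermP => [->|->|/eqP li /eqP lj].
  - by rewrite eqxx.
  - by rewrite eqxx (negPf ji).
  - by rewrite (negPf li) (negPf lj).
by move/eqP; rewrite addrC addr_eq0 => /eqP.
Qed.

Lemma form_perm X (s : 'S_k) : w (X \o s) = (-1) ^+ s * w X.
Proof.
have [ts -> dts] := prod_tpermP s.
elim: ts dts X => [|[i j] ts IH] /=.
  move=> _ X; rewrite big_nil odd_perm1 mul1r; congr w; apply/funext => l /=.
  by rewrite perm1.
case/andP => ij dts X; rewrite big_cons odd_mul_tperm /= ij.
rewrite signr_addb expr1 mulN1r mulNr -IH // -(form_tperm (X \o _) ij); congr w.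
by apply/funext => l /=; rewrite permM.
Qed.

End Alternating.

(** Permutations are sorted by the image of [ord0], as in the Laplace expansion of a determinant. *)
Lemma sum_lift_perm k (G : 'I_k.+1 -> 'S_k -> A) (H : 'S_k.+1 -> A) :
  (forall i t, H (lift_perm ord0 i t) = G i t) -> \sum_s H s = \sum_i \sum_t G i t.
Proof.
move=> HG; rewrite (partition_big (fun s : 'S_k.+1 => s ord0) xpredT) //=.
apply: eq_bigr => i _.
rewrite (reindex (lift_perm ord0 i)) /=; last first.
  pose ulsf i (s : 'S_k.+1) k0 := odflt k0 (unlift (s i) (s (lift i k0))).
  have ulsfK i' (s : 'S_k.+1) k0 : lift (s i') (ulsf i' s k0) = s (lift i' k0).
    rewrite /ulsf; have:= neq_lift i' k0.
    by rewrite -(can_eq (permK s)) => /unlift_some[] ? ? ->.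
  have inj_ulsf : injective (ulsf ord0 _).
    move=> s; apply: can_inj (ulsf (s ord0) s^-1%g) _ => k'.
    by rewrite {1}/ulsf ulsfK !permK liftK.
  exists (fun s => perm (inj_ulsf s)) => [s _ | s].
    by apply/permP=> k'; rewrite permE /ulsf lift_perm_lift lift_perm_id liftK.
  rewrite inE /= => /eqP <-; apply/permP => k'.
  by case: (unliftP ord0 k') => [j'|] ->; rewrite ?lift_perm_id // lift_perm_lift permE ulsfK.
rewrite (eq_bigl xpredT) => [|t]; last by rewrite lift_perm_id eqxx.
by apply: eq_bigr => t _; exact: HG.
Qed.

(** Laplace expansion along the first argument: it turns the sum over permutations in [wedge] into
    the recursion of [eps]. *)
Lemma alt_expand k (al : V -> A) (G : ('I_k -> V) -> A) (X : 'I_k.+1 -> V) :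
  \sum_(s : 'S_k.+1) (-1) ^+ s * (al (X (s ord0)) * G (fun j => X (s (lift ord0 j)))) =
  \sum_(j < k.+1) (-1) ^+ j * (al (X j) *
    \sum_(t : 'S_k) (-1) ^+ t * G (fun i => X (lift j (t i)))).
Proof.
rewrite (sum_lift_perm (G := fun i t => (-1) ^+ i * (-1) ^+ t *
  (al (X i) * G (fun j => X (lift i (t j)))))) => [|i t].
  apply: eq_bigr => j _; rewrite !mulr_sumr; apply: eq_bigr => t _.
  by rewrite -mulrA [X in _ * X]mulrCA.
rewrite lift_perm_id odd_lift_perm /= signr_addb signr_odd; congr (_ * _ * (_ * G _)).
by apply/funext => j; rewrite lift_perm_lift.
Qed.

Lemma alt_form k (w : cochain M k) X : is_form w ->
  \sum_(t : 'S_k) (-1) ^+ t * w (fun i => X (t i)) = k`!%:R * w X.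
Proof.
move=> Fw; under eq_bigr => t _ do
  rewrite -[w _]/(w (X \o t)) (form_perm Fw) mulrA -signr_addb addbb mul1r.
by rewrite sumr_const card_Sn mulr_natl.
Qed.

Lemma mulr_shuffle (a b c d : A) : a * (b * (c * d)) = c * (a * (b * d)).
Proof. by ring. Qed.

Lemma alt_eps k (al : V -> A) (w : cochain M k) X : is_form w ->
  \sum_(s : 'S_k.+1) (-1) ^+ s * (al (X (s ord0)) * w (fun j => X (s (lift ord0 j)))) =
  k`!%:R * eps al (tolist w) (vals X).
Proof.
move=> Fw; rewrite (alt_expand al w) eps_sumE size_vals mulr_sumr; apply: eq_bigr => j _.
rewrite (alt_form (X \o lift j) Fw) nth_vals -vals_lift tolist_vals.
exact: mulr_shuffle.
Qed.

Lemma alt_eps2 k (al be : V -> A) (w : cochain M k) X : is_form w ->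
  \sum_(s : 'S_k.+2) (-1) ^+ s * (al (X (s ord0)) * (be (X (s (lift ord0 ord0))) *
     w (fun j => X (s (lift ord0 (lift ord0 j)))))) =
  k`!%:R * eps al (eps be (tolist w)) (vals X).
Proof.
move=> Fw; rewrite (alt_expand al (fun Y => be (Y ord0) * w (fun j => Y (lift ord0 j)))).
rewrite eps_sumE size_vals mulr_sumr; apply: eq_bigr => j _.
rewrite (alt_eps be (X \o lift j) Fw) nth_vals -vals_lift.
exact: mulr_shuffle.
Qed.

End Cochains.
Arguments oflist {R m M} k v _.

(** * Sasakian structures *)

Section SasakianStructure.
Variables (R : realType) (n : nat) (M : manifold R n.*2.+1).
Variables (theta : cochain M 1) (J : {linear vfield M -> vfield M}) (T : vfield M).
Hypothesis sas : sasakian theta J T.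
Local Notation A := (Cinf M).
Local Notation V := (vfield M).
Local Notation th := (app1 theta).
Local Notation dth := (app2 (extd theta)).
Local Notation g := (metric theta J).

Lemma theta_form : is_form theta. Proof. by case: sas => -[]. Qed.

Lemma theta_const (Z : 'I_1 -> V) : theta Z = th (Z ord0).
Proof. by rewrite /app1; congr theta; apply/funext => i; rewrite [i]ord1. Qed.

Lemma th_lin : lin1 th.
Proof.
move=> f X Y; have [l _] := theta_form; have := l (fun=> 0) ord0 f X Y.
by rewrite !theta_const /= .
Qed.

Lemma extd2_const (w : cochain M 2) (Z : 'I_2 -> V) : w Z = app2 w (Z ord0) (Z (lift ord0 ord0)).
Proof.
rewrite /app2; congr w; apply/funext => i; case: (unliftP ord0 i) => [j|] -> //.
by rewrite [j]ord1.
Qed.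

Lemma dthE_bracket X Y : dth X Y = X (th Y) - Y (th X) - th (bracket X Y).
Proof.
rewrite /app2 /extd.
under [X in _ + X]eq_bigr do rewrite big_ord1_cond.
rewrite !big_ord_recl !big_ord0 /= !theta_const /=.
rewrite !addr0 !add0r expr0 !mul1r expr1 !mulN1r.
by [].
Qed.

Lemma vfieldBE (X Y : V) (f : A) : (X - Y : V) f = X f - Y f.
Proof. by rewrite vfieldDE vfieldNE. Qed.

Lemma bracketN (X Y : V) : bracket X Y = - bracket Y X.
Proof. by apply: vfield_eq => f; rewrite vfieldNE !bracketE opprB. Qed.

Lemma bracketL (X : V) f Y Z : bracket X (f *: Y + Z) = f *: bracket X Y + X f *: Y + bracket X Z.
Proof.
apply: vfield_eq => h; rewrite !(bracketE, vfieldDE, vfieldZE) vfD vfM.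
by ring.
Qed.

Lemma bracket_jacobi (X Y Z : V) :
  bracket X (bracket Y Z) = bracket (bracket X Y) Z + bracket Y (bracket X Z).
Proof.
apply: vfield_eq => h; rewrite !(bracketE, vfieldDE) !vfB; ring.
Qed.

Lemma dth_anti X Y : dth X Y = - dth Y X.
Proof.
rewrite !dthE_bracket (bracketN Y X) (lin1N _ th_lin); ring.
Qed.

Lemma dth_linl Y : lin1 (dth ^~ Y).
Proof.
move=> f X Z; rewrite dth_anti !dthE_bracket bracketL !(lin1D _ _ th_lin) !(lin1Z _ _ th_lin).
rewrite vfD vfM vfieldDE vfieldZE (bracketN Y X) (bracketN Y Z) !(lin1N _ th_lin).
by ring.
Qed.

Lemma dth_linr X : lin1 (dth X).
Proof. by move=> f Y Z; rewrite dth_anti dth_linl !(dth_anti X); ring. Qed.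

Lemma thT : th T = 1. Proof. by case: sas => _ []. Qed.

Lemma dthT X : dth T X = 0.
Proof.
case: sas => _ [_ iT] _ _ _; have := congr1 (fun w : cochain M 1 => w (fun=> X)) iT.
rewrite /interior => h; rewrite -[RHS]h /app2; congr (extd theta _); apply/funext => i.
by case: (unliftP ord0 i) => [j|] -> //=.
Qed.

Definition hor (X : V) := X - th X *: T.

Lemma hor_contact X : contact_sub theta (hor X).
Proof.
rewrite /contact_sub /= /hor (lin1D _ _ th_lin) (lin1N _ th_lin) (lin1Z _ _ th_lin) thT.
by rewrite mulr1 subrr.
Qed.

Lemma J_T : J T = 0. Proof. by case: sas => _ _ []. Qed.

Lemma J_hor X : J (hor X) = J X.
Proof. by rewrite /hor linearB linearZ /= J_T scaler0 subr0. Qed.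

Lemma J_contact X : contact_sub theta (J X).
Proof. by case: sas => _ _ [JH _ _ _ _] _ _; rewrite -J_hor; apply/JH/hor_contact. Qed.

Lemma J_J X : J (J X) = - hor X.
Proof. by case: sas => _ _ [_ JJ _ _ _] _ _; rewrite -(J_hor X); apply/JJ/hor_contact. Qed.

Lemma th_J X : th (J X) = 0. Proof. exact: J_contact. Qed.

Lemma dth_hor X Y : dth X (hor Y) = dth X Y.
Proof.
rewrite /hor (lin1D _ _ (dth_linr X)) (lin1N _ (dth_linr X)) (lin1Z _ _ (dth_linr X)).
by rewrite [dth X T]dth_anti dthT oppr0 mulr0 subr0.
Qed.

Lemma dth_horl X Y : dth (hor X) Y = dth X Y.
Proof. by rewrite dth_anti dth_hor -dth_anti. Qed.

Lemma dth_J_sym X Y : dth X (J Y) = dth Y (J X).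
Proof.
case: sas => _ _ [_ _ _ sy _] _ _.
by rewrite -dth_horl -J_hor sy ?dth_horl ?J_hor //; exact: hor_contact.
Qed.

Lemma dth_JJ X Y : dth (J X) (J Y) = dth X Y.
Proof.
by rewrite dth_J_sym J_J (lin1N _ (dth_linr Y)) dth_hor -dth_anti.
Qed.

Lemma metric_lin f X Y Z : g (f *: X + Y) Z = f * g X Z + g Y Z.
Proof. by rewrite /metric dth_linl th_lin; ring. Qed.

Lemma metric_sym X Y : g X Y = g Y X.
Proof. by rewrite /metric dth_J_sym mulrC. Qed.

Lemma metric_T X : g T X = th X.
Proof. by rewrite /metric dthT thT add0r mul1r. Qed.

Lemma metric_J X Y : g (J X) Y = dth X Y.
Proof. by rewrite /metric th_J mul0r addr0 dth_JJ. Qed.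

(** If the horizontal part of [X] vanishes at [p], so does its [d theta] term by tensoriality, and
    then [theta X] cannot vanish at [p]. *)
Lemma metric_pos (X : V) (p : M) : (exists f : A, X f p <> 0) -> 0 < g X X p.
Proof.
case: sas => _ _ [_ _ _ _ pos] _ _ Xp.
have hX : dth X (J X) = dth (hor X) (J (hor X)) by rewrite J_hor dth_horl.
rewrite /metric hX CinfD CinfM.
have [hp|hp] := pselect (nonzero_at (hor X) p).
  by rewrite ltr_wpDr -?expr2 ?sqr_ge0 // pos //; exact: hor_contact.
have [xi [Y [_ fr]]] := point_frame p.
have h0 f : hor X f p = 0 by apply: contrapT => h; apply: hp; exists f.
have -> : dth (hor X) (J (hor X)) p = 0.
  by rewrite (fr _ (dth_linl _)) big1 // => i _; rewrite h0 mul0r.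
rewrite add0r -expr2 lt_def sqr_ge0 andbT expf_eq0 /=.
apply/eqP => tp; case: Xp => f; apply.
have := h0 f; rewrite /hor vfieldBE CinfD CinfN vfieldZE CinfM tp mul0r subr0.
exact.
Qed.

(** The pairs [(X, - J X)] encode sections of [H^{1,0}]; integrability for two of them is the
    claim. *)
Lemma metric_nijenhuis X Y : th X = 0 -> th Y = 0 ->
  J (bracket X Y - bracket (J X) (J Y)) = bracket X (J Y) + bracket (J X) Y.
Proof.
move=> hX hY; case: sas => _ _ [_ JJ _ _ _] _ H.
have h Z : th Z = 0 -> H10 theta J (Z, - J Z).
  move=> hZ; split => //=; first by rewrite /contact_sub /= (lin1N _ th_lin) th_J oppr0.
    by rewrite opprK.
  by rewrite linearN /= JJ // opprK.
have [_ _ /= + _] := H _ _ (h X hX) (h Y hY).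
have brNl (U W : V) : bracket (- U) W = - bracket U W.
  by apply: vfield_eq => f; rewrite vfieldNE !bracketE !vfieldNE vfN opprD.
have brNr (U W : V) : bracket U (- W) = - bracket U W by rewrite bracketN brNl -bracketN.
by rewrite !brNl !brNr opprK opprD !opprK.
Qed.

Lemma Cinf_natE k q : (k%:R : A) q = k%:R.
Proof. by elim: k => [|k IH]; rewrite ?Cinf0 // -natr1 CinfD Cinf1 IH natr1. Qed.

Lemma half_Cinf : Cinf_cst M 2^-1 * 2 = 1.
Proof.
by apply: Cinf_eq => q; rewrite CinfM CinfC Cinf_natE Cinf1 mulVf // pnatr_eq0.
Qed.

Lemma ninv_Cinf k : Cinf_cst M k.+1%:R^-1 * k.+1%:R = 1.
Proof.
by apply: Cinf_eq => q; rewrite CinfM CinfC Cinf_natE Cinf1 mulVf // pnatr_eq0.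
Qed.

Lemma sasaki_data_exists : compact [set: M] -> exists S : sasaki_data V,
  [/\ [/\ forall X f, act S X f = X f, forall X Y, br S X Y = bracket X Y & gm S = g],
    Tv S = T, forall X, Jv S X = J X & \sum_c gm S (@Fr A V S c) (@Fr' A V S c) = n.*2.+1%:R].
Proof.
move=> cM; have [I [F [F' [fP tr]]]] := dual_frames metric_lin metric_sym metric_pos cM.
case: sas => _ _ _ bTJ _.
unshelve eexists.
  apply: (@SasakiData A V (fun X f => X f) (@bracket _ _ M) _ _ _ _ _ _ _
    (Cinf_cst M 2^-1) half_Cinf (fun k => Cinf_cst M k.+1%:R^-1) ninv_Cinf
    g metric_sym metric_lin T _ J _ J_T _ _ _ bTJ _ I F F' fP).
  - exact: vfD.
  - by move=> X f h; rewrite vfM.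
  - by move=> f X Y h; rewrite vfieldDE vfieldZE.
  - exact: bracketN.
  - by move=> X f Y Z; rewrite bracketL.
  - by move=> X Y f.
  - exact: bracket_jacobi.
  - by rewrite metric_T thT.
  - by move=> f X Y; rewrite linearP.
  - by move=> X; rewrite J_J metric_T opprB.
  - by move=> X Y; rewrite metric_J [in RHS]metric_sym metric_J (dth_anti Y) opprK.
  - by move=> X Y; rewrite metric_J !metric_T dthE_bracket.
  - by move=> X Y; rewrite !metric_T; exact: metric_nijenhuis.
by [].
Qed.

End SasakianStructure.

(** * Homogeneous degree of the operators *)

Section Degrees.
Variables (A : comPzRingType) (V : lmodType A) (S : sasaki_data V).
Implicit Types (v : seq V -> A) (s : seq V) (X Y : V).

Definition hdeg k v := forall s, size s != k -> v s = 0.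

Lemma hdeg_iota k Y v : hdeg k.+1 v -> hdeg k (iota Y v).
Proof. by move=> h s sk; apply: h. Qed.

Lemma hdeg_iota0 Y v : hdeg 0 v -> iota Y v = 0.
Proof. by move=> h; apply/funext => s; exact: h. Qed.

Lemma hdegD k u v : hdeg k u -> hdeg k v -> hdeg k (u + v).
Proof. by move=> hu hv s sk; rewrite OmD hu // hv // addr0. Qed.

Lemma hdegN k v : hdeg k v -> hdeg k (- v).
Proof. by move=> hv s sk; rewrite OmN hv // oppr0. Qed.

Lemma hdeg_scl k f v : hdeg k v -> hdeg k (scl f v).
Proof. by move=> hv s sk; rewrite sclE hv // mulr0. Qed.

Lemma hdeg_sum k (I : Type) (r : seq I) (P : pred I) (W : I -> seq V -> A) :
  (forall i, P i -> hdeg k (W i)) -> hdeg k (\sum_(i <- r | P i) W i).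
Proof. by move=> h; elim/big_ind : _ => //; exact: hdegD. Qed.

Lemma hdeg_der D B k v : D 0 = 0 -> hdeg k v -> hdeg k (der D B v).
Proof.
move=> D0 hv s; elim: s k v hv => [|Y s IH] k v hv sk /=; first by rewrite hv.
rewrite (hv (_ :: _)) // subr0; case: k hv sk => [|k] hv sk.
  by rewrite hdeg_iota0 //; elim: s {IH sk} => //= Z s IH; rewrite iota0 IH subr0.
by apply: IH sk; exact: hdeg_iota.
Qed.

Lemma hdeg_eps al k v : hdeg k v -> hdeg k.+1 (eps al v).
Proof.
move=> hv s; elim: s k v hv => [|Y s IH] k v hv sk //=.
rewrite hv // mulr0 sub0r; case: k hv sk => [|k] hv sk.
  by rewrite hdeg_iota0 // eps0 oppr0.
by rewrite (IH k) ?oppr0 //; exact: hdeg_iota.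
Qed.

Lemma hdeg_lie k Y v : hdeg k v -> hdeg k (lie S Y v).
Proof. exact/hdeg_der/act0. Qed.

Lemma hdeg_nab k Y v : hdeg k v -> hdeg k (nab S Y v).
Proof. exact/hdeg_der/act0. Qed.

Lemma hdeg_dd k v : hdeg k v -> hdeg k.+1 (dd S v).
Proof.
move=> hv s; elim: s k v hv => [|Y s IH] k v hv sk //=.
rewrite (hdeg_lie Y hv) // sub0r; case: k hv sk => [|k] hv sk.
  by rewrite hdeg_iota0 // dd0 oppr0.
by rewrite (IH k) ?oppr0 //; exact: hdeg_iota.
Qed.

Lemma hdeg_lef k v : hdeg k v -> hdeg k.+2 (lef S v).
Proof. by move=> hv; apply/hdeg_scl/hdeg_sum => c _; do 2 apply: hdeg_eps. Qed.

Lemma hdeg_lam k v : hdeg k.+2 v -> hdeg k (lam S v).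
Proof. by move=> hv; apply/hdeg_scl/hdeg_sum => c _; do 2 apply: hdeg_iota. Qed.

Lemma hdeg_dB B k v : hdeg k v -> hdeg k.+1 (dB S B v).
Proof. by move=> hv; apply/hdeg_sum => c _; exact/hdeg_eps/hdeg_nab. Qed.

Lemma hdeg_delB B k v : hdeg k.+1 v -> hdeg k (delB S B v).
Proof. by move=> hv; apply/hdegN/hdeg_sum => c _; exact/hdeg_iota/hdeg_nab. Qed.

Lemma hdeg0_delB B v : hdeg 0 v -> delB S B v = 0.
Proof.
move=> hv; rewrite /delB big1 ?oppr0 // => c _.
by apply: hdeg_iota0; exact: hdeg_nab.
Qed.

Lemma hdeg0_lam v : hdeg 0 v -> lam S v = 0.
Proof. by move=> hv; rewrite /lam big1 ?scl0 // => c _; rewrite (hdeg_iota0 _ hv). Qed.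

Lemma hdeg1_lam v : hdeg 1 v -> lam S v = 0.
Proof.
move=> hv; rewrite /lam big1 ?scl0 // => c _.
by rewrite [iota (Jv S _) _]hdeg_iota0 //; exact: hdeg_iota.
Qed.

Lemma ip_hdeg k j a b : hdeg k a -> j != k -> ip S j a b = 0.
Proof.
elim: j k a b => [|j IH] k a b ha jk /=; first by rewrite ha // mul0r.
rewrite big1 ?mulr0 // => c _; case: k ha jk => [|k] ha jk.
  by rewrite hdeg_iota0 // ip0l.
by apply: (IH k) => //; exact: hdeg_iota.
Qed.

End Degrees.

(** * Cochain operators as operators on list functions *)

Section Correspondence.
Variables (R : realType) (n : nat) (M : manifold R n.*2.+1).
Variables (theta : cochain M 1) (J : {linear vfield M -> vfield M}) (T : vfield M).
Hypothesis sas : sasakian theta J T.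
Local Notation A := (Cinf M).
Local Notation V := (vfield M).
Local Notation th := (app1 theta).
Local Notation dth := (app2 (extd theta)).
Variable S : sasaki_data V.
Hypothesis actS : forall X f, act S X f = X f.
Hypothesis brS : forall X Y, br S X Y = bracket X Y.
Hypothesis gS : gm S = metric theta J.
Hypothesis TS : Tv S = T.
Hypothesis JS : forall X, Jv S X = J X.

Lemma gm_T X : gm S (Tv S) X = th X.
Proof. by rewrite gS TS (metric_T sas). Qed.

Lemma om_dth X Y : gm S (Jv S X) Y = dth X Y.
Proof. by rewrite JS gS (metric_J sas). Qed.

Lemma hdeg_tolist k (w : cochain M k) : hdeg k (tolist w).
Proof. by move=> s; exact: tolist_deg. Qed.

Lemma tolist_isF k (w : cochain M k) : isF (tolist w) -> is_form w.
Proof. by move=> Fw; rewrite -(tolistK w); exact: is_form_oflist. Qed.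

Lemma tolist_extd k (w : cochain M k) : is_form w -> tolist (extd w) = dd S (tolist w).
Proof.
move=> Fw; apply: tolist_ext => [|X]; first exact/hdeg_dd/hdeg_tolist.
rewrite dd_sumE; last exact: is_form_tolist.
rewrite size_vals /extd; congr (_ + _); apply: eq_bigr => j _.
  by rewrite nth_vals actS -vals_lift tolist_vals.
apply: eq_bigr => i ij; rewrite brS nth_vals -vals_lift.
have -> : nth 0 (vals X) i = X (lift j i).
  by rewrite -nth_vals /= /bump leqNgt ij.
by rewrite -vals_with tolist_vals.
Qed.

Lemma vals_cons k (X : 'I_k -> V) Y :
  vals (fun i : 'I_k.+1 => if unlift ord0 i is Some j then X j else Y) = Y :: vals X.
Proof.
apply: vals_eq => [|i]; first by rewrite /= size_vals.
by case: (unliftP ord0 i) => [j|] -> //=; rewrite nth_vals.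
Qed.

Lemma tolist_interior k (w : cochain M k.+1) : tolist (interior T w) = iota T (tolist w).
Proof.
apply: tolist_ext => [|X]; first exact/hdeg_iota/hdeg_tolist.
by rewrite iotaE -vals_cons tolist_vals.
Qed.

Lemma tolist_lie k (w : cochain M k) : tolist (lie_derivative T w) = lie S T (tolist w).
Proof.
apply: tolist_ext => [|X]; first exact/hdeg_lie/hdeg_tolist.
rewrite lie_sumE size_vals actS tolist_vals; congr (_ - _); apply: eq_bigr => i _.
by rewrite nth_vals brS -vals_with tolist_vals.
Qed.

Lemma Cinf_cst_sign (b : bool) (a : R) :
  Cinf_cst M ((-1) ^+ b / a) = Cinf_cst M a^-1 * (-1) ^+ b.
Proof.
by apply: Cinf_eq => q; rewrite CinfM !CinfC CinfX CinfN Cinf1 mulrC.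
Qed.

Lemma tolist_theta k (w : cochain M k) : is_form w ->
  tolist (theta_wedge theta w) = eX S (Tv S) (tolist w).
Proof.
move=> Fw; apply: tolist_ext => [|X]; first exact/hdeg_eps/hdeg_tolist.
rewrite /theta_wedge /wedge.
transitivity (\sum_(s : 'S_k.+1) Cinf_cst M (1`! * k`!)%:R^-1 * ((-1) ^+ s *
    (th (X (s ord0)) * w (fun j => X (s (lift ord0 j)))))).
  apply: eq_bigr => s _; rewrite Cinf_cst_sign -mulrA; congr (_ * (_ * (_ * _))).
    by rewrite theta_const; congr (th (X (s _))); exact: val_inj.
  by congr w; apply/funext => j; congr (X (s _)); exact: val_inj.
rewrite -mulr_sumr (alt_eps th X Fw) mulrA factS fact0 !mul1n.
rewrite [X in X * _](_ : _ = 1) ?mul1r.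
  by rewrite /eX; apply: (congr1 (fun v : seq V -> A => v (vals X)));
    apply: eps_ext => Y; rewrite gm_T.
by apply: Cinf_eq => q; rewrite CinfM CinfC Cinf_natE Cinf1 mulVf // pnatr_eq0 -lt0n fact_gt0.
Qed.

Lemma dth_frame X Y : dth X Y = half S * \sum_c
  (gm S (@Fr A V S c) X * gm S (Jv S (@Fr' A V S c)) Y -
   gm S (Jv S (@Fr' A V S c)) X * gm S (@Fr A V S c) Y).
Proof.
rewrite sumrB.
have e U W : \sum_c gm S (@Fr A V S c) U * gm S (Jv S (@Fr' A V S c)) W = dth U W.
  rewrite -om_dth (gmJ S U W) (lin1_frame' S U (gm_linl S (Jv S W))) -sumrN.
  by apply: eq_bigr => c _; rewrite gmJ mulrN (gmS S _ U).
rewrite e; under eq_bigr do rewrite mulrC.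
by rewrite e (dth_anti sas Y) opprK; exact: half_split.
Qed.

Lemma tolist_lefschetz k (w : cochain M k) : is_form w ->
  tolist (lefschetz theta w) = lef S (tolist w).
Proof.
move=> Fw; apply: tolist_ext => [|X]; first exact/hdeg_lef/hdeg_tolist.
pose al c := gm S (@Fr A V S c); pose be c := gm S (Jv S (@Fr' A V S c)).
rewrite /lefschetz /wedge.
transitivity (\sum_(s : 'S_k.+2) Cinf_cst M (2`! * k`!)%:R^-1 * (half S * \sum_c (
  (-1) ^+ s * (al c (X (s ord0)) * (be c (X (s (lift ord0 ord0))) *
    w (fun j => X (s (lift ord0 (lift ord0 j)))))) -
  (-1) ^+ s * (be c (X (s ord0)) * (al c (X (s (lift ord0 ord0))) *
    w (fun j => X (s (lift ord0 (lift ord0 j))))))))).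
  apply: eq_bigr => s _; rewrite Cinf_cst_sign -mulrA; congr (_ * _).
  rewrite (extd2_const _) dth_frame.
  have -> : lshift k (ord0 : 'I_2) = ord0 by exact: val_inj.
  have -> : lshift k (lift ord0 ord0 : 'I_2) = lift ord0 ord0 by exact: val_inj.
  have -> : (fun j => X (s (rshift 2 j))) = fun j => X (s (lift ord0 (lift ord0 j))).
    by apply/funext => j; congr (X (s _)); exact: val_inj.
  set W := w _; rewrite -!mulrA mulrCA; congr (_ * _).
  rewrite mulr_suml mulr_sumr; apply: eq_bigr => c _.
  by rewrite mulrBl mulrBr !mulrA.
rewrite -!mulr_sumr exchange_big /=.
under eq_bigr => c _ do rewrite sumrB (alt_eps2 (al c) (be c) X Fw) (alt_eps2 (be c) (al c) X Fw)
  -mulrBr.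
rewrite -mulr_sumr /lef sclE Om_sum mulrCA; congr (_ * _).
rewrite mulrA; set q := Cinf_cst _ _ * _%:R.
(* The normalisation [1 / (2! k!)] of [wedge] against the [k!] of [alt_eps2] leaves 1/2. *)
have -> : q = half S.
  apply: Cinf_eq => p; rewrite /q CinfM CinfC Cinf_natE.
  have := congr1 (fun f : A => f p) (halfP S); rewrite CinfM Cinf_natE Cinf1 => h.
  have h' : half S p = 2^-1.
    by apply: (mulIf (x := 2)); rewrite ?pnatr_eq0 // h mulVf // pnatr_eq0.
  have k0 : k`!%:R != 0 :> R by rewrite pnatr_eq0 -lt0n fact_gt0.
  by rewrite h' natrM invfM -mulrA mulVf // mulr1 !factS fact0.
rewrite mulr_sumr; apply: eq_bigr => c _.
by rewrite (eps_eps (be c) (al c)) OmN opprK -half_split.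
Qed.

End Correspondence.

(** * The space of all forms *)

Section FormSpace.
Variables (A : comPzRingType) (V : lmodType A).

Definition isFp : {pred (seq V -> A)} := fun w => `[< isF w >].

Fact isFp_zmod : zmod_closed isFp.
Proof.
split=> [|u v /asboolP Fu /asboolP Fv]; apply/asboolP; first exact: isF0.
by apply: isFD => //; exact: isFN.
Qed.

HB.instance Definition _ := GRing.isZmodClosed.Build (seq V -> A) isFp isFp_zmod.

Record form := Form { fval :> seq V -> A; fvalP : fval \in isFp }.

HB.instance Definition _ := [isSub for fval].
HB.instance Definition _ := [Choice of form by <:].
HB.instance Definition _ :=
  GRing.SubChoice_isSubZmodule.Build (seq V -> A) isFp form isFp_zmod.

Lemma fF (w : form) : isF w. Proof. exact/asboolP/fvalP. Qed.
Definition mkF w (Fw : isF w) : form := @Form w (asboolT Fw).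

Lemma form_eq (u v : form) : (forall s, u s = v s) -> u = v.
Proof. by move=> uv; apply/val_inj/funext. Qed.

(** Operators that respect [isF] act on the subtype [form], where the abstract Hodge argument
    expects additive maps. *)
Record formop := FormOp {
  fop : (seq V -> A) -> (seq V -> A);
  fopF : forall w, isF w -> isF (fop w);
  fopD : forall u v, fop (u + v) = fop u + fop v }.

Definition app_op (o : formop) (w : form) : form := mkF (fopF o (fF w)).

Fact app_op_zmod o : zmod_morphism (app_op o).
Proof.
move=> u v; apply: val_inj => /=; have D := fopD o.
apply: (addIr (fop o v)); rewrite subrK -D; congr fop.
exact: subrK.
Qed.

HB.instance Definition _ o := GRing.isZmodMorphism.Build form form (app_op o) (app_op_zmod o).

Lemma form_Mn (w : form) k s : (w *+ k) s = w s *+ k.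
Proof. by elim: k => // k IH; rewrite !mulrS -IH. Qed.

End FormSpace.

(** * The L^2 product and the Kaehler algebra of forms *)

Section HodgeInstance.
Variables (R : realType) (n : nat) (M : manifold R n.*2.+1).
Local Notation A := (Cinf M).
Local Notation V := (vfield M).
Local Notation Om := (seq V -> A).
Variable S : sasaki_data V.
Local Notation g := (gm S).
Local Notation T := (Tv S).
Hypothesis actS : forall X f, act S X f = X f.
Hypothesis brS : forall X Y, br S X Y = bracket X Y.
Hypothesis gpos : forall (X : V) (p : M), (exists f : A, X f p <> 0) -> 0 < g X X p.
Hypothesis trS : \sum_c g (@Fr A V S c) (@Fr' A V S c) = n.*2.+1%:R.
Hypothesis cM : compact [set: M].
Variable I : (M -> R) -> R.
Hypothesis hI : riemannian_integral g I.

(** The sum over degrees [0 .. 2n + 1] treats forms of mixed degree at once; by [isF_top] no higher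
    degree occurs. *)
Definition ipT (a b : Om) : R := \sum_(k < n.*2.+2) I (ip S k a b).

Lemma ipT_Dl a b c : ipT (a + b) c = ipT a c + ipT b c.
Proof.
by rewrite /ipT -big_split; apply: eq_bigr => k _; rewrite ipDl (integralD hI).
Qed.

Lemma ipT_Dr a b c : ipT a (b + c) = ipT a b + ipT a c.
Proof.
by rewrite /ipT -big_split; apply: eq_bigr => k _; rewrite ipDr (integralD hI).
Qed.

Lemma ipT_0l b : ipT 0 b = 0.
Proof. by apply: (addrI (ipT 0 b)); rewrite -ipT_Dl !addr0. Qed.

Lemma ipT_0r b : ipT b 0 = 0.
Proof. by apply: (addrI (ipT b 0)); rewrite -ipT_Dr !addr0. Qed.

Lemma ipT_suml b (C : finType) (W : C -> Om) : ipT (\sum_c W c) b = \sum_c ipT (W c) b.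
Proof. by elim/big_rec2 : _ => [|c x y _ <-]; rewrite ?ipT_0l ?ipT_Dl. Qed.

Lemma ipT_sumr b (C : finType) (W : C -> Om) : ipT b (\sum_c W c) = \sum_c ipT b (W c).
Proof. by elim/big_rec2 : _ => [|c x y _ <-]; rewrite ?ipT_0r ?ipT_Dr. Qed.

Lemma ipT_scl f a b : ipT (scl f a) b = ipT a (scl f b).
Proof. by apply: eq_bigr => k _; rewrite ipZl ipZr. Qed.

Lemma ipT_sym a b : isF a -> isF b -> ipT a b = ipT b a.
Proof. by move=> Fa Fb; apply: eq_bigr => k _; rewrite ip_sym. Qed.

Lemma ip_vanish k a b : (forall s, size s = k -> b s = 0) -> ip S k a b = 0.
Proof.
elim: k a b => [|k IH] a b hb /=; first by rewrite hb // mulr0.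
by rewrite big1 ?mulr0 // => c _; rewrite IH // => s sk; rewrite iotaE hb //= sk.
Qed.

(** An operator raising the degree shifts the sum by one; the two unmatched terms, degree 0 of [f a]
    and top degree of [h b], vanish. *)
Lemma ipT_shift (f h : Om -> Om) a b : (f a) [::] = 0 ->
  (forall s, size s = n.*2.+1 -> h b s = 0) ->
  (forall k, I (ip S k.+1 (f a) b) = I (ip S k a (h b))) -> ipT (f a) b = ipT a (h b).
Proof.
move=> f0 h0 fh; rewrite /ipT big_ord_recl [RHS]big_ord_recr.
have -> : ip S (@ord0 n.*2.+1) (f a) b = 0.
  exact: (etrans (congr1 (fun x => x * _) f0) (mul0r _)).
have -> : ip S (@ord_max n.*2.+1) a (h b) = 0 by exact: ip_vanish.
rewrite (integral0 hI) add0r -[RHS]/(_ + 0) addr0; apply: eq_bigr => k _.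
by rewrite lift0; exact: fh.
Qed.

Lemma ipT_eX X a b : isF a -> isF b -> ipT (eX S X a) b = ipT a (iota X b).
Proof.
move=> Fa Fb; apply: (ipT_shift (f := eX S X) (h := iota X)) => // [s sn|k].
  by rewrite iotaE (isF_top Fb) //= sn.
by rewrite ip_eX.
Qed.

Lemma ipT_lef a b : isF a -> isF b -> ipT (lef S a) b = ipT a (lam S b).
Proof.
move=> Fa Fb; rewrite /lef /lam ipT_scl ipT_suml scl_sum ipT_sumr; apply: eq_bigr => c _.
have Fe : isF (eX S (Jv S (Fr' c)) a) by exact: isF_eX.
rewrite -iota_scl -iota_scl ipT_eX // ?ipT_eX //.
- by apply: isF_iota; exact: isF_scl.
- exact: isF_scl.
Qed.

Lemma ipT_dB (B : V -> V) a b : lin2 B -> (forall X Y, cov S X (B Y) = B (cov S X Y)) ->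
  isF a -> isF b -> ipT (dB S B a) b = ipT a (delB S B b).
Proof.
move=> lB pB Fa Fb; apply: (ipT_shift (f := dB S B) (h := delB S B)) => [|s sn|k].
- by rewrite /dB Om_sum big1.
- rewrite /delB OmN Om_sum big1 ?oppr0 // => c _; rewrite iotaE (isF_top (isF_nab S _ Fb)) //=.
  by rewrite sn.
- by rewrite ip_dB // (integralD hI) (integral_div actS brS gpos cM hI) addr0.
Qed.

Lemma ipT_lie a b : isF a -> isF b -> ipT (lie S T a) b = - ipT a (lie S T b).
Proof.
move=> Fa Fb; rewrite /ipT -sumrN; apply: eq_bigr => k _.
apply/eqP; rewrite -addr_eq0 -(integralD hI) -lieT_ip // -div_T; apply/eqP.
exact: (integral_div actS brS gpos cM hI).
Qed.

Lemma ipT_ge0 a : isF a -> 0 <= ipT a a.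
Proof.
move=> Fa; apply: sumr_ge0 => k _.
by have [] := integral_pos_def gpos cM hI (fun q => ip_ge0 gpos k q Fa).
Qed.

Lemma ipT_def a : isF a -> ipT a a = 0 -> a = 0.
Proof.
move=> Fa /eqP; rewrite psumr_eq0 => [/allP h|k _]; last first.
  by have [] := integral_pos_def gpos cM hI (fun q => ip_ge0 gpos k q Fa).
apply/funext => s; have [sn|ns] := leqP (size s) n.*2.+1; last exact: isF_top.
have := h (Ordinal (sn : (size s < n.*2.+2)%N)) (mem_index_enum _) => /eqP I0.
have [_ /(_ I0) i0] := integral_pos_def gpos cM hI (fun q => ip_ge0 gpos (size s) q Fa).
exact: (ip_def gpos Fa i0).
Qed.

(* On [form V]: [fe], [fi] and [fl] are exterior product by theta, interior product by
   [T] and Lie derivative along [T]; [fs0] and [fs1] are adjoint to [fd0] and [fd1]. *)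
Definition fd0 : {additive form V -> form V} := app_op (FormOp (@isF_d0 A V S) (d0D S)).
Definition fd1 : {additive form V -> form V} := app_op (FormOp (@isF_d1 A V S) (d1D S)).
Definition fs0 : {additive form V -> form V} :=
  app_op (FormOp (@isF_delB A V S (hpr S)) (delBD S (hpr S))).
Definition fs1 : {additive form V -> form V} :=
  app_op (FormOp (@isF_delB A V S (Jv S)) (delBD S (Jv S))).
Definition fL : {additive form V -> form V} := app_op (FormOp (@isF_lef A V S) (lefD S)).
Definition fLam : {additive form V -> form V} := app_op (FormOp (@isF_lam A V S) (lamD S)).
Definition fe : {additive form V -> form V} := app_op (FormOp (@isF_eX A V S T) (eXD S T)).
Definition fi : {additive form V -> form V} := app_op (FormOp (@isF_iota A V T) (iotaD T)).
Definition fl : {additive form V -> form V} := app_op (FormOp (@isF_lie A V S T) (lieD S T)).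
Definition hz k (w : form V) := iota T w = 0 /\ hdeg k w.
Definition fip (a b : form V) := ipT a b.
Definition dF (w : form V) := dOm fd0 fL fe fi fl w.
Definition sF (w : form V) := sOm fs0 fLam fe fi fl w.

Implicit Types (u v w : form V).

Lemma fip_Dl u v w : fip (u + v) w = fip u w + fip v w. Proof. exact: ipT_Dl. Qed.
Lemma fip_S u v : fip u v = fip v u. Proof. by apply: ipT_sym; exact: fF. Qed.
Lemma fip_ge0 u : 0 <= fip u u. Proof. by apply: ipT_ge0; exact: fF. Qed.
Lemma fip_eq0 u : fip u u = 0 -> u = 0.
Proof. by move=> h; apply: val_inj; apply: ipT_def h; exact: fF. Qed.
Lemma fadj_d0 u v : fip (fd0 u) v = fip u (fs0 v).
Proof. by apply: ipT_dB (fF u) (fF v); [exact: lin2_hpr|exact: cov_hpr]. Qed.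
Lemma fadj_d1 u v : fip (fd1 u) v = fip u (fs1 v).
Proof. by apply: ipT_dB (fF u) (fF v); [exact: lin2_J|exact: cov_J]. Qed.
Lemma fadj_L u v : fip (fL u) v = fip u (fLam v).
Proof. exact: ipT_lef (fF u) (fF v). Qed.
Lemma fadj_e u v : fip (fe u) v = fip u (fi v).
Proof. exact: ipT_eX (fF u) (fF v). Qed.
Lemma fadj_l u v : fip (fl u) v = - fip u (fl v).
Proof. exact: ipT_lie (fF u) (fF v). Qed.

Lemma fLam_d0 w : fLam (fd0 w) = fd0 (fLam w) - fs1 w.
Proof. by apply: val_inj; exact: (lam_d0 S (fF w)). Qed.
Lemma fLam_d1 w : fLam (fd1 w) = fd1 (fLam w) + fs0 w.
Proof. by apply: val_inj; exact: (lam_d1 S (fF w)). Qed.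
Lemma fL_d0 w : fL (fd0 w) = fd0 (fL w).
Proof. by apply: val_inj; exact: (lef_d0 S w). Qed.
Lemma fL_d1 w : fL (fd1 w) = fd1 (fL w).
Proof. by apply: val_inj; exact: (lef_d1 S w). Qed.
Lemma fd0_d0 w : fd0 (fd0 w) = - fL (fl w).
Proof. by apply: val_inj; exact: (d0_d0 S (fF w)). Qed.
Lemma fd1_d1 w : fd1 (fd1 w) = - fL (fl w).
Proof. by rewrite -fd0_d0; apply: val_inj; exact: (d1_d1 S (fF w)). Qed.
Lemma fd0_d1 w : fd0 (fd1 w) + fd1 (fd0 w) = 0.
Proof. by apply: val_inj; exact: (d0_d1 S (fF w)). Qed.
Lemma fl_L w : fl (fL w) = fL (fl w).
Proof. by apply: val_inj; exact: (lieT_lef S w). Qed.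
Lemma fl_e w : fl (fe w) = fe (fl w).
Proof. by apply: val_inj; exact: (lieT_eXT S w). Qed.
Lemma fl_i w : fl (fi w) = fi (fl w).
Proof. by apply: val_inj; exact: (lieT_iotaT S (fF w)). Qed.
Lemma fl_d0 w : fl (fd0 w) = fd0 (fl w).
Proof. by apply: val_inj; exact: (lieT_d0 S (fF w)). Qed.
Lemma fl_d1 w : fl (fd1 w) = fd1 (fl w).
Proof. by apply: val_inj; exact: (lieT_d1 S (fF w)). Qed.
Lemma fi_e w : fi (fe w) = w - fe (fi w).
Proof. by apply: val_inj; exact: (eXT_iotaT S w). Qed.
Lemma fi_i w : fi (fi w) = 0.
Proof. by apply: val_inj; exact: (iota_iota_id T (fF w)). Qed.
Lemma fe_e w : fe (fe w) = 0.
Proof. by apply: val_inj; exact: (eX_sq S T w). Qed.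
Lemma fe_d0 w : fe (fd0 w) = - fd0 (fe w).
Proof. by apply: val_inj; exact: (eXT_d0 S w). Qed.
Lemma fi_d0 w : fi (fd0 w) = - fd0 (fi w).
Proof. by apply: val_inj; exact: (iotaT_d0 S (fF w)). Qed.
Lemma fi_d1 w : fi (fd1 w) = - fd1 (fi w).
Proof. by apply: val_inj; exact: (iotaT_d1 S (fF w)). Qed.
Lemma fL_e w : fL (fe w) = fe (fL w).
Proof. by apply: val_inj; exact: (lef_eXT S w). Qed.
Lemma fL_i w : fi (fL w) = fL (fi w).
Proof. by apply: val_inj; exact: (lef_iotaT S w). Qed.
Lemma fi_Lam w : fi (fLam w) = fLam (fi w).
Proof. by apply: val_inj; rewrite /= lam_iota //; exact: fF. Qed.

Lemma fhz_i k w : hz k w -> fi w = 0.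
Proof. by case=> h _; apply: val_inj. Qed.

Lemma fLam_L k w : hz k w -> fLam (fL w) = fL (fLam w) + w *+ n - w *+ k.
Proof.
case=> hi hd; apply: form_eq => s.
rewrite -[LHS]/(lam S (lef S w) s) (lam_lef trS (fF w)) hi [eX S T 0]eps0 addr0.
rewrite OmD OmN OmD sclE numE; last exact: fF.
rewrite -[RHS]/((lef S (lam S w) s + (w *+ n) s) - (w *+ k) s) !form_Mn mulr_natl.
congr (_ - _).
by have [->|sk] := eqVneq (size s) k; rewrite ?mulr_natl // hd ?mul0rn ?mulr0.
Qed.

Lemma hz_D k u v : hz k u -> hz k v -> hz k (u + v).
Proof.
case=> iu hu [iv hv]; split; last exact: hdegD.
by rewrite -[LHS]/(iota T u + iota T v) iu iv addr0.
Qed.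

Lemma hz_N k u : hz k u -> hz k (- u).
Proof.
by case=> iu hu; split; [rewrite -[LHS]/(- iota T u) iu oppr0|exact: hdegN].
Qed.

Lemma hz_op k k' (o : {additive form V -> form V}) : (forall w, fi w = 0 -> fi (o w) = 0) ->
  (forall w, hdeg k w -> hdeg k' (o w)) -> forall w, hz k w -> hz k' (o w).
Proof.
move=> h1 h2 w [iw hw]; split; last exact: h2.
have /h1 : fi w = 0 by apply: val_inj.
exact: (congr1 val).
Qed.

(** The Kaehler identity expresses [fs0] by operators whose commutation with [fi] is known. *)
Lemma fi_s0 w : fi w = 0 -> fi (fs0 w) = 0.
Proof.
move=> iw; have -> : fs0 w = fLam (fd1 w) - fd1 (fLam w) by rewrite fLam_d1 addrAC subrr add0r.
by rewrite [LHS]raddfB /= fi_Lam !fi_d1 fi_Lam iw !(raddf0, oppr0) addr0.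
Qed.

Lemma fi_s1 w : fi w = 0 -> fi (fs1 w) = 0.
Proof.
move=> iw; have -> : fs1 w = fd0 (fLam w) - fLam (fd0 w) by rewrite fLam_d0 opprB addrC subrK.
by rewrite [LHS]raddfB /= fi_Lam !fi_d0 fi_Lam iw !(raddf0, oppr0) addr0.
Qed.

Lemma hz_d0 q w : hz q w -> hz q.+1 (fd0 w).
Proof.
apply: hz_op => [u iu|u]; first by rewrite fi_d0 iu raddf0 oppr0.
exact: hdeg_dB.
Qed.

Lemma hz_d1 q w : hz q w -> hz q.+1 (fd1 w).
Proof.
apply: hz_op => [u iu|u]; first by rewrite fi_d1 iu raddf0 oppr0.
exact: hdeg_dB.
Qed.

Lemma hz_s0 q w : hz q.+1 w -> hz q (fs0 w).
Proof. by apply: hz_op => u; [exact: fi_s0|exact: hdeg_delB]. Qed.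

Lemma hz_s1 q w : hz q.+1 w -> hz q (fs1 w).
Proof. by apply: hz_op => u; [exact: fi_s1|exact: hdeg_delB]. Qed.

Lemma hz_L q w : hz q w -> hz q.+2 (fL w).
Proof.
apply: hz_op => [u iu|u]; first by rewrite fL_i iu raddf0.
exact: hdeg_lef.
Qed.

Lemma hz_Lam q w : hz q.+2 w -> hz q (fLam w).
Proof.
apply: hz_op => [u iu|u]; first by rewrite fi_Lam iu raddf0.
exact: hdeg_lam.
Qed.

Lemma hz_l q w : hz q w -> hz q (fl w).
Proof.
apply: hz_op => [u iu|u]; first by rewrite -fl_i iu raddf0.
exact: hdeg_lie.
Qed.

Lemma fs0_0 w : hz 0 w -> fs0 w = 0.
Proof. by case=> _ hw; apply: val_inj; exact: hdeg0_delB. Qed.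

Lemma fs1_0 w : hz 0 w -> fs1 w = 0.
Proof. by case=> _ hw; apply: val_inj; exact: hdeg0_delB. Qed.

Lemma forms_kaehler : kaehler_algebra fip fd0 fd1 fs0 fs1 fL fLam fe fi fl n hz.
Proof.
exact: (KaehlerAlgebra fip_Dl fip_S fip_ge0 fip_eq0 fadj_d0 fadj_d1 fadj_L fadj_e fadj_l
  fLam_d0 fLam_d1 fL_d0 fL_d1 fd0_d0 fd1_d1 fd0_d1 fl_L fl_e fl_i fl_d0 fl_d1 fi_e fi_i fe_e
  fe_d0 fi_d0 fL_e fL_i fhz_i fLam_L hz_D hz_N hz_d0 hz_d1 hz_s0 hz_s1 hz_L hz_Lam hz_l
  fs0_0 fs1_0).
Qed.

Lemma dF_val w : fval (dF w) = dd S w.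
Proof. by rewrite (ddE S (fF w)). Qed.

Lemma sF_val w : fval (sF w) = delB S (hpr S) w - iota T (lie S T w) + eX S T (lam S w).
Proof. by []. Qed.

Lemma hdeg_sF q w : hdeg q.+1 w -> hdeg q (sF w).
Proof.
rewrite sF_val; move: (fval w) => {}w hw.
apply: hdegD; first apply: hdegD; first exact: hdeg_delB.
  by apply/hdegN/hdeg_iota/hdeg_lie.
case: q hw => [|q] hw; last exact/hdeg_eps/hdeg_lam.
by move=> s _; rewrite (hdeg1_lam S hw) [eX S T 0]eps0.
Qed.

Lemma sF_0 w : hdeg 0 w -> sF w = 0.
Proof.
move=> hw; apply: form_eq => s; rewrite sF_val; move: (fval w) hw => {}w hw.
rewrite (hdeg0_delB S _ hw) (hdeg0_lam S hw) hdeg_iota0; last exact: hdeg_lie.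
by rewrite [eX S T 0]eps0 subrr addr0.
Qed.

End HodgeInstance.

(** * Harmonic forms and the Rumin complex *)

Section Rumin.
Variables (R : realType) (n : nat) (M : manifold R n.*2.+1).
Variables (theta : cochain M 1) (J : {linear vfield M -> vfield M}) (T : vfield M).
Local Notation A := (Cinf M).
Local Notation V := (vfield M).
Local Notation met := (metric theta J).
Hypothesis cM : compact [set: M].
Hypothesis sas : sasakian theta J T.
Variable I : (M -> R) -> R.
Hypothesis hI : riemannian_integral met I.
Variable S : sasaki_data V.
Hypothesis actS : forall X f, act S X f = X f.
Hypothesis brS : forall X Y, br S X Y = bracket X Y.
Hypothesis gS : gm S = met.
Hypothesis TS : Tv S = T.
Hypothesis JS : forall X, Jv S X = J X.
Hypothesis trS : \sum_c gm S (@Fr A V S c) (@Fr' A V S c) = n.*2.+1%:R.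
Local Notation fd0 := (fd0 S).
Local Notation fs0 := (fs0 S).
Local Notation fs1 := (fs1 S).
Local Notation fL := (fL S).
Local Notation fLam := (fLam S).
Local Notation fe := (fe S).
Local Notation fi := (fi S).
Local Notation fl := (fl S).
Local Notation hz := (hz S).
Local Notation dF := (dF S).
Local Notation sF := (sF S).
Local Notation fip := (fip S I).
Implicit Types (u v : form V) (k j : nat).

Let gpos (X : V) (p : M) : (exists f : A, X f p <> 0) -> 0 < gm S X X p.
Proof. by rewrite gS; exact: (metric_pos sas). Qed.

Let hIS : riemannian_integral (gm S) I. Proof. by rewrite gS. Qed.

Let K := forms_kaehler actS brS gpos trS cM hIS.
Let Dl := K_ipDl K.
Let sym := K_ipS K.
Let eq0 := K_ip_eq0 K.

(** The default 0 is taken only for cochains that are not forms. Most lemmas on [fo] give, along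
    with the image, the fact that the result is a form. *)
Definition fo k (w : cochain M k) : form V := insubd 0 (tolist w).

Lemma tolist_fo k (w : cochain M k) : is_form w -> tolist w = fo w.
Proof. by move=> Fw; rewrite [RHS]insubdK //; exact/asboolP/is_form_tolist. Qed.

Lemma fo_of k (w : cochain M k) u : tolist w = u -> is_form w /\ fo w = u.
Proof.
move=> wu; have Fw : is_form w by apply: tolist_isF; rewrite wu; exact: fF.
by split=> //; apply: val_inj; rewrite -[LHS]tolist_fo.
Qed.

Lemma fo_hdeg k (w : cochain M k) : is_form w -> hdeg k (fo w).
Proof. by move=> Fw; rewrite -tolist_fo //; exact: hdeg_tolist. Qed.

Lemma foK k u : hdeg k u -> is_form (oflist k u) /\ fo (oflist k u) = u.
Proof.
move=> hu; apply: fo_of; apply/funext => s.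
by have [/oflistK->//|sk] := eqVneq (size s) k; rewrite tolist_deg // hu.
Qed.

Lemma fo_inj k (w w' : cochain M k) : is_form w -> is_form w' -> fo w = fo w' -> w = w'.
Proof.
by move=> Fw Fw' e; rewrite -(tolistK w) -(tolistK w') !tolist_fo // e.
Qed.

Lemma fo0 k : is_form (0 : cochain M k) /\ fo (0 : cochain M k) = 0.
Proof. by apply: fo_of; apply/funext => s; rewrite /tolist; case: eqP. Qed.

Lemma fo_eq0 k (w : cochain M k) : is_form w -> fo w = 0 -> w = 0.
Proof. by have [F0 e0] := fo0 k; move=> Fw e; apply: fo_inj => //; rewrite e0. Qed.

Lemma foD k (w w' : cochain M k) : is_form w -> is_form w' ->
  is_form (w + w') /\ fo (w + w') = fo w + fo w'.
Proof.
move=> Fw Fw'; apply: fo_of; rewrite -[RHS]/(fval (fo w) + fval (fo w')) -!tolist_fo //.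
by apply/funext => s; rewrite OmD /tolist; case: eqP => // _; rewrite addr0.
Qed.

Lemma foB k (w w' : cochain M k) : is_form w -> is_form w' ->
  is_form (w - w') /\ fo (w - w') = fo w - fo w'.
Proof.
move=> Fw Fw'; apply: fo_of; rewrite -[RHS]/(fval (fo w) - fval (fo w')) -!tolist_fo //.
by apply/funext => s; rewrite OmD OmN /tolist; case: eqP => // _; rewrite subr0.
Qed.

Lemma fo_extd k (w : cochain M k) : is_form w -> is_form (extd w) /\ fo (extd w) = dF (fo w).
Proof.
by move=> Fw; apply: fo_of; rewrite dF_val -tolist_fo //; exact: tolist_extd.
Qed.

Lemma fo_theta k (w : cochain M k) : is_form w ->
  is_form (theta_wedge theta w) /\ fo (theta_wedge theta w) = fe (fo w).
Proof.
by move=> Fw; apply: fo_of; rewrite (tolist_theta sas gS TS Fw) tolist_fo.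
Qed.

Lemma fo_lefschetz k (w : cochain M k) : is_form w ->
  is_form (lefschetz theta w) /\ fo (lefschetz theta w) = fL (fo w).
Proof.
by move=> Fw; apply: fo_of; rewrite (tolist_lefschetz sas gS JS Fw) tolist_fo.
Qed.

Lemma fo_interior k (w : cochain M k.+1) : is_form w ->
  is_form (interior T w) /\ fo (interior T w) = fi (fo w).
Proof.
by move=> Fw; apply: fo_of; rewrite tolist_interior tolist_fo // -TS.
Qed.

Lemma fo_lie k (w : cochain M k) : is_form w ->
  is_form (lie_derivative T w) /\ fo (lie_derivative T w) = fl (fo w).
Proof.
by move=> Fw; apply: fo_of; rewrite (tolist_lie T actS brS) tolist_fo // -TS.
Qed.

Definition fscale (a : R) u : form V := mkF (isF_scl (Cinf_cst M a) (fF u)).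

Lemma fo_rscale k a (w : cochain M k) : is_form w ->
  is_form (rscale a w) /\ fo (rscale a w) = fscale a (fo w).
Proof.
move=> Fw; apply: fo_of; rewrite -[RHS]/(scl (Cinf_cst M a) (fo w)) -tolist_fo //.
by apply/funext => s; rewrite sclE /tolist; case: eqP => // _; rewrite mulr0.
Qed.

Lemma integralZ (a : R) (f : A) : I (Cinf_cst M a * f : A) = a * I f.
Proof.
by rewrite -[X in I X]/((Cinf_cst M a * f : A) : M -> R) -[_ * f]addr0
  (integral_lin hIS) (integral0 hIS) addr0.
Qed.

Lemma fip_scale a u v : fip (fscale a u) v = a * fip u v.
Proof.
rewrite /fip /ipT mulr_sumr; apply: eq_bigr => k _.
by rewrite -integralZ -ipZl.
Qed.

Lemma fscale_eq0 a u : a != 0 -> fscale a u = 0 -> u = 0.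
Proof.
move=> a0 h; apply: eq0; have := fip_scale a u u; rewrite h (hip0 K) => /esym/eqP.
by rewrite mulf_eq0 (negPf a0) => /eqP.
Qed.

Lemma integral_form_ip k (a b : cochain M k) : is_form a -> is_form b ->
  I (form_ip met a b) = fip (fo a) (fo b).
Proof.
move=> Fa Fb.
have e : form_ip met a b = ip S k (tolist a) (tolist b) :> (M -> R).
  apply/funext => p; have [xi [X fr]] := point_frame p.
  (* [form_ip] picks some orthonormal basis at [p]; one exists, and the frame trace does not depend
     on it. *)
  have oE : orthonormal_at (gm S) p (xget (fun=> 0) (orthonormal_at met p)).
    have [E oE] := orthonormal_at_nonempty (gmL S) (gmS S) gpos fr.
    by rewrite gS in oE *; apply: (xgetPex _ (ex_intro _ E oE)).
  rewrite (ip_atE k oE (is_form_tolist Fa) (is_form_tolist Fb)) ip_at_sum /form_ip.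
  congr (_ * _); apply: eq_bigr => s _.
  by rewrite -(tolist_vals a) -(tolist_vals b).
have ha := fo_hdeg Fa.
rewrite e !tolist_fo // /fip /ipT.
have [kn|nk] := ltnP k n.*2.+2.
  rewrite (bigD1 (Ordinal kn)) //= big1 ?addr0 // => j jk.
  by rewrite (ip_hdeg _ _ ha) ?(integral0 hIS).
rewrite big1 => [|j _].
  by rewrite ip_vanish ?(integral0 hIS) // => s sk; apply: isF_top; [exact: fF|rewrite sk].
by rewrite (ip_hdeg _ _ ha) ?(integral0 hIS) // neq_ltn (leq_trans (ltn_ord j) nk).
Qed.

(** Forms of degree [k] are separated by the product, so an operator given only by an adjunction
    equals the explicit one. *)
Lemma fip_test k u v : hdeg k u -> hdeg k v ->
  (forall a : cochain M k, is_form a -> fip (fo a) u = fip (fo a) v) -> u = v.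
Proof.
move=> hu hv h; have hd : hdeg k (u - v : form V) := hdegD hu (hdegN hv).
have [Fa ea] := foK hd.
apply/eqP; rewrite -subr_eq0; apply/eqP/eq0.
have := h _ Fa; rewrite ea => /eqP; rewrite -subr_eq0 => /eqP.
by rewrite (hipDr K) (hipNr K).
Qed.

Variable dadj : forall k, cochain M k.+1 -> cochain M k.
Hypothesis hdadj : forall k, formal_adjoint met I
  (@is_form R _ M k) (@is_form R _ M k.+1) (@extd R _ M k) (dadj (k:=k)).

Lemma fo_dadj k (w : cochain M k.+1) : is_form w ->
  is_form (dadj w) /\ fo (dadj w) = sF (fo w).
Proof.
move=> Fw; have [Fd adj] := hdadj Fw; split=> //.
apply: (fip_test (fo_hdeg Fd) (hdeg_sF S (fo_hdeg Fw))) => a Fa.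
have [Fe ee] := fo_extd Fa.
by rewrite -(ip_d K) -/(dF _) -ee -!integral_form_ip // adj.
Qed.

(** Pairing the Laplacian with the form itself gives [|d w|^2 + |d^* w|^2 = 0]. *)
Lemma hodge_kerP k (w : cochain M k) :
  hodge_ker dadj w <-> [/\ is_form w, dF (fo w) = 0 & sF (fo w) = 0].
Proof.
have Lap : is_form w -> is_form (hodge_laplacian dadj w) /\
    fo (hodge_laplacian dadj w) = dF (sF (fo w)) + sF (dF (fo w)).
  move=> Fw; have [Fe ee] := fo_extd Fw; have [Fd ed] := fo_dadj Fe.
  case: k w Fw Fe ee Fd ed => [|k] w Fw Fe ee Fd ed /=.
    by split=> //; rewrite ed ee (sF_0 S (fo_hdeg Fw)) [dF 0]dOm0 add0r.
  have [Fs es] := fo_dadj Fw; have [Fse ese] := fo_extd Fs.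
  by have [FD ->] := foD Fse Fd; rewrite ese es ed ee.
split=> [[Fw h]|[Fw d0w s0w]].
  have [_] := Lap Fw; rewrite h; have [_ ->] := fo0 k => /esym e.
  have e1 : fip (dF (sF (fo w))) (fo w) = fip (sF (fo w)) (sF (fo w)) by exact: (ip_d K).
  have e2 : fip (sF (dF (fo w))) (fo w) = fip (dF (fo w)) (dF (fo w)).
    by rewrite sym; exact/esym/(ip_d K).
  have := congr1 (fip ^~ (fo w)) e; rewrite (hip0 K) Dl e1 e2 => {}e.
  have p1 := K_ip_ge0 K (sF (fo w)); have p2 := K_ip_ge0 K (dF (fo w)).
  by split=> //; apply: eq0; lra.
split=> //; have [FL eL] := Lap Fw; apply: fo_eq0 => //.
by rewrite eL d0w s0w [dF 0]dOm0 [sF 0]sOm0 addr0.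
Qed.

Variable Lam : forall k, cochain M k.+2 -> cochain M k.
Hypothesis hLam : forall k, pointwise_adjoint met (@lefschetz R n M theta k) (Lam (k:=k)).

Lemma fo_Lam k (w : cochain M k.+2) : is_form w -> is_form (Lam w) /\ fo (Lam w) = fLam (fo w).
Proof.
move=> Fw; have [Fl adj] := hLam Fw; split=> //.
apply: (fip_test (fo_hdeg Fl)) => [|a Fa]; first exact/hdeg_lam/fo_hdeg.
have [FL eL] := fo_lefschetz Fa.
rewrite -(K_adj_L K) -eL -!integral_form_ip //; congr (I _).
by apply/funext => p; rewrite adj.
Qed.

Lemma fLam_0 k u : (k < 2)%N -> hdeg k u -> fLam u = 0.
Proof.
case: k => [|[|//]] _ hu; apply: val_inj; first exact: hdeg0_lam.
exact: hdeg1_lam.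
Qed.

(** [fi] sees only the first slot; a transposition moves [T] there. *)
Lemma horizontalP k (w : cochain M k) : is_form w -> horizontal T w <-> fi (fo w) = 0.
Proof.
move=> Fw; split=> [h|h].
  apply: form_eq => s; rewrite -[LHS]/(fo w (Tv S :: s)) -tolist_fo // TS /tolist.
  case: eqP => // sk; have k0 : (0 < k)%N by rewrite -sk.
  exact: (h _ (Ordinal k0)).
have hw s : tolist w (T :: s) = 0.
  by rewrite tolist_fo // -TS; exact: (congr1 (fun u : form V => u s) h).
case: k w Fw h hw => [w _ _ _ X []//|k] w Fw _ hw X i Xi.
have h0 Y : Y ord0 = T -> w Y = 0.
  by move=> YT; rewrite -tolist_vals /vals enum_ordSl /= YT hw.
have [i0|i0] := eqVneq ord0 i; first by apply: h0; rewrite i0.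
rewrite -[w X]opprK -(form_tperm Fw X i0) h0 ?oppr0 //=.
by rewrite tpermL.
Qed.

Lemma rumin_lowP k (w : cochain M k) : rumin_low T Lam w <->
  [/\ is_form w, hz k (fo w) & fLam (fo w) = 0].
Proof.
have prim : is_form w -> primitive Lam w <-> fLam (fo w) = 0.
  move=> Fw; have hw := fo_hdeg Fw; case: k w Fw hw => [|[|k]] w Fw hw.
  - by split=> // _; exact: fLam_0 hw.
  - by split=> // _; exact: fLam_0 hw.
  have [Fl el] := fo_Lam Fw; split=> [h|h]; last by apply: fo_eq0; rewrite ?el.
  by rewrite -el h; have [_ ->] := fo0 k.
split=> [[Fw hw pw]|[Fw [iw _] Lw]].
  split=> //; last exact/prim.
  split; last exact: fo_hdeg.
  by have /(congr1 (@fval _ _)) := (horizontalP Fw).1 hw.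
split=> //; last exact/prim.
by apply/horizontalP => //; apply: val_inj.
Qed.

Lemma rumin_highP k (w : cochain M k.+1) : rumin_high theta T w <->
  is_form w /\ exists u, [/\ hz k u, fL u = 0 & fo w = fe u].
Proof.
split=> [[v [Fv hv Lv] <-]|[Fw [u [[iu hu] Lu wu]]]].
  have [Ft et] := fo_theta Fv; split=> //; exists (fo v); split=> //.
    split; last exact: fo_hdeg.
    by have /(congr1 (@fval _ _)) := (horizontalP Fv).1 hv.
  by have [_ <-] := fo_lefschetz Fv; rewrite Lv; have [_ ->] := fo0 k.+2.
have [Fv ev] := foK hu; exists (oflist k u).
  split=> //; first by apply/horizontalP => //; rewrite ev; apply: val_inj.
  by have [FL eL] := fo_lefschetz Fv; apply: fo_eq0; rewrite ?eL ?ev.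
by have [Ft et] := fo_theta Fv; apply: fo_inj; rewrite // et ev.
Qed.

Variable P : forall k, cochain M k -> cochain M k.
Hypothesis hP : forall k, (k <= n)%N ->
  orthogonal_projection met (rumin_space theta T Lam (k:=k)) (P (k:=k)).
Variable Linv : forall k, cochain M k.+2 -> cochain M k.
Hypothesis hLinv : lefschetz_inverse theta T Linv.
Local Notation E := (rumin_space theta T Lam).

Lemma rumin_form k (w : cochain M k) : E w -> is_form w.
Proof.
rewrite /rumin_space; case: ifP => _; first by case.
by case: k w => [//|k] w /rumin_highP[].
Qed.

Lemma rumin_spaceP_low k (w : cochain M k) : (k <= n)%N ->
  E w <-> [/\ is_form w, hz k (fo w) & fLam (fo w) = 0].
Proof. by rewrite /rumin_space => ->; exact: rumin_lowP. Qed.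

Lemma rumin_spaceP_high k (w : cochain M k.+1) : (n <= k)%N ->
  E w <-> is_form w /\ exists u, [/\ hz k u, fL u = 0 & fo w = fe u].
Proof. by move=> nk; rewrite /rumin_space ltnNge nk; exact: rumin_highP. Qed.

Lemma fo_db k (w : cochain M k) : is_form w -> fi (fo w) = 0 ->
  [/\ is_form (db theta T w), fo (db theta T w) = fd0 (fo w) & fi (fo (db theta T w)) = 0].
Proof.
move=> Fw iw; have [Fe ee] := fo_extd Fw; have [Fi ei] := fo_interior Fe.
have [Ft et] := fo_theta Fi; have [Fb eb] := foB Fe Ft.
have e : fo (db theta T w) = fd0 (fo w).
  rewrite -[LHS]/(fo (_ - _)) eb et ei ee /dF /dOm iw raddf0 addr0 raddfD /=.
  rewrite (K_i_d0 K) (K_i_e K) -(K_l_i K) iw !raddf0 ?oppr0 add0r ?subr0 ?addr0.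
  by rewrite addrK.
by split=> //; rewrite e (K_i_d0 K) iw raddf0 ?oppr0.
Qed.

(** Since [L w = 0], the adjoint Kaehler identity reads [L (s1 w) = - d0 w], so [L^-1 d0 w = - s1 w]
    by injectivity of [L] in degree [n - 1]. *)
Lemma fo_rumin_D k (w : cochain M k) : k = n -> E w ->
  is_form (rumin_D theta T Linv w) /\
  fo (rumin_D theta T Linv w) = fe (fl (fo w) - fd0 (fs1 (fo w))).
Proof.
move=> kn Ew; have [Fw hw Lw] : [/\ is_form w, hz k (fo w) & fLam (fo w) = 0].
  by apply/rumin_spaceP_low; rewrite ?kn.
have iw := K_hz_i K hw; have [Fl el] := fo_lie Fw.
case: k w kn Ew Fw hw Lw iw Fl el => [|k] w kn Ew Fw hw Lw iw Fl el /=.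
  by have [Ft et] := fo_theta Fl; split=> //; rewrite et el (K_s1_0 K hw) raddf0 ?subr0.
have [Fb eb ib] := fo_db Fw iw.
have [FX /(horizontalP FX) iX LX] := hLinv kn Fb ((horizontalP Fb).2 ib).
have [_ eL] := fo_lefschetz FX; rewrite LX eb in eL.
have [Fd ed _] := fo_db FX iX.
have LW : fL (fo w) = 0.
  by apply/(L_Lam_mid K) => //; exact: (eq_ind _ (fun q => hz q (fo w)) hw _ kn).
have eX : fo (Linv (db theta T w)) = - fs1 (fo w).
  apply/eqP; rewrite -addr_eq0; apply/eqP; apply: (L_inj K (q := k)) => //.
  - apply: (K_hzD K); last exact: (K_hz_s1 K hw).
    split; last exact: fo_hdeg.
    exact: (congr1 (@fval _ _) iX).
  - by rewrite -kn.
  by rewrite raddfD /= -eL (L_s1 K) LW raddf0 sub0r subrr.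
have [Fs es] := foD Fl Fd; have [Ft et] := fo_theta Fs; split=> //.
by rewrite et es el ed eX raddfN.
Qed.

(** In degree [n] the point is that [L] kills [l w - d0 (s1 w)]: from [L w = 0] follow [L l w = 0]
    and [L d0 s1 w = - d0 d0 w = L l w]. *)
Lemma dR_space k (w : cochain M k) : E w -> E (dR theta T P Linv w).
Proof.
move=> Ew; have Fw := rumin_form Ew; have [Fe ee] := fo_extd Fw; rewrite /dR.
have [kn|nk|kn] := ltngtP k n; first by have [] := hP kn Fe.
  case: k w nk Ew Fw Fe ee => [//|k] w nk Ew Fw Fe ee.
  apply/rumin_spaceP_high; first by rewrite ltnW.
  split=> //; have [_ [u [hu Lu wu]]] := (rumin_spaceP_high w nk).1 Ew.
  have iu := K_hz_i K hu.
  exists (- fd0 u); split; first by apply/(K_hzN K)/(K_hz_d0 K).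
    by rewrite raddfN /= (K_L_d0 K) Lu raddf0 ?oppr0.
  by rewrite ee wu /dF (high_dOm K iu) Lu addr0 raddfN.
have [FD eD] := fo_rumin_D kn Ew; apply/rumin_spaceP_high; first by rewrite kn.
have [_ hw Lw] := (rumin_spaceP_low w (eq_leq kn)).1 Ew.
have LW : fL (fo w) = 0.
  by apply/(L_Lam_mid K) => //; exact: (eq_ind _ (fun q => hz q (fo w)) hw _ kn).
split=> //; exists (fl (fo w) - fd0 (fs1 (fo w))); split=> //.
  apply: (K_hzD K); first exact: (K_hz_l K).
  apply: (K_hzN K); case: k w kn Ew Fw Fe ee FD eD hw Lw LW => [|k] w kn Ew Fw Fe ee FD eD hw Lw LW.
    by rewrite (K_s1_0 K hw) raddf0 -(subrr (fo w)); apply: (K_hzD K) => //; exact: (K_hzN K).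
  exact/(K_hz_d0 K)/(K_hz_s1 K).
rewrite raddfB /= -(K_l_L K) (K_L_d0 K) (L_s1 K) LW (raddf0 (fs1)) (raddf0 fl) !sub0r.
by rewrite (raddfN fd0) /= opprK (K_d0_d0 K) -(K_l_L K) LW (raddf0 fl) oppr0.
Qed.

Lemma dR_mid k (w : cochain M k) : k = n -> dR theta T P Linv w = rumin_D theta T Linv w.
Proof.
move=> kn; have kn' : (k < n)%N = false by rewrite kn ltnn.
have e : k == n by apply/eqP.
by rewrite /dR kn' e.
Qed.

(** The projection is invisible to test forms in the Rumin space. *)
Lemma dR_low k (w : cochain M k) (b : cochain M k.+1) : (k < n)%N -> E w -> E b ->
  fip (fo (dR theta T P Linv w)) (fo b) = fip (dF (fo w)) (fo b).
Proof.
move=> kn Ew Eb; have [Fe <-] := fo_extd (rumin_form Ew).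
rewrite /dR kn; have [EP orth] := hP kn Fe; have Fb := rumin_form Eb.
have [Fd ed] := foB Fe (rumin_form EP).
have := integral_form_ip Fd Fb; rewrite ed Dl (hipNl K).
rewrite (_ : form_ip met _ b = (0 : A)); last by apply/funext => p; rewrite orth.
by rewrite (integral0 hIS) => /eqP; rewrite eq_sym subr_eq0 => /eqP.
Qed.

Variable dEadj : forall k, cochain M k.+1 -> cochain M k.
Hypothesis hdEadj : forall k, formal_adjoint met I (E (k:=k)) (E (k:=k.+1))
  (@dE R n M theta T P Linv k) (dEadj (k:=k)).
Local Notation dE := (dE theta T P Linv).
Local Notation dR := (dR theta T P Linv).

Lemma acoef_neq0 k : acoef R n k != 0.
Proof.
rewrite /acoef; case: (eqVneq k n) => [_|kn]; first by rewrite oner_eq0.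
by rewrite invr_neq0 // sqrtr_eq0 -ltNge normr_gt0 subr_eq0 eqr_nat eq_sym.
Qed.

Lemma fo_dE k (w : cochain M k) : E w ->
  is_form (dE w) /\ fo (dE w) = fscale (acoef R n k) (fo (dR w)).
Proof. by move=> Ew; apply/fo_rscale/rumin_form/dR_space. Qed.

Lemma hz_scale a k u : hz k u -> hz k (fscale a u).
Proof.
case=> iu hu; split; last exact: hdeg_scl.
by rewrite [LHS]iota_scl iu scl0.
Qed.

Lemma dE_space k (w : cochain M k) : E w -> E (dE w).
Proof.
move=> Ew; have ER := dR_space Ew; have [Fd ed] := fo_dE Ew.
set a := acoef R n k in ed.
have lamZ u : fLam (fscale a u) = fscale a (fLam u).
  apply: form_eq => s; rewrite -[LHS]/(lam S (scl _ u) s) -[RHS]/(_ * lam S u s).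
  rewrite /lam !sclE mulrCA; congr (_ * _); rewrite !Om_sum mulr_sumr.
  exact: eq_bigr.
have lefZ u : fL (fscale a u) = fscale a (fL u).
  apply: form_eq => s; rewrite -[LHS]/(lef S (scl _ u) s) -[RHS]/(_ * lef S u s).
  rewrite /lef !sclE mulrCA; congr (_ * _); rewrite !Om_sum mulr_sumr; apply: eq_bigr => c _.
  by rewrite !eX_scl sclE.
have eZ u : fe (fscale a u) = fscale a (fe u).
  by apply: val_inj; exact: eX_scl.
have Z0 : fscale a 0 = 0 by apply: val_inj; exact: scl0.
have [kn|nk] := ltnP k n.
  have [_ hR LR] := (rumin_spaceP_low (dR w) kn).1 ER.
  apply/rumin_spaceP_low => //; rewrite ed lamZ LR Z0.
  by split=> //; exact: hz_scale.
have [_ [u [hu Lu eu]]] := (rumin_spaceP_high (dR w) nk).1 ER.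
apply/rumin_spaceP_high => //; split=> //; exists (fscale a u).
by split; [exact: hz_scale|rewrite lefZ Lu Z0|rewrite eZ ed eu].
Qed.

Lemma dE_adj k (a : cochain M k) (b : cochain M k.+1) : E a -> E b ->
  fip (fo (dE a)) (fo b) = fip (fo a) (fo (dEadj b)).
Proof.
move=> Ea Eb; have [Ed adj] := hdEadj Eb.
rewrite -!integral_form_ip ?adj //; try exact: rumin_form.
exact/rumin_form/dE_space.
Qed.

Lemma dEadj_space k (b : cochain M k.+1) : E b -> E (dEadj b).
Proof. by move=> Eb; have [] := hdEadj Eb. Qed.

Lemma fip_dE k (a : cochain M k) v : E a ->
  fip (fo (dE a)) v = acoef R n k * fip (fo (dR a)) v.
Proof. by move=> Ea; have [_ ->] := fo_dE Ea; exact: fip_scale. Qed.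

(* Pairing the Laplacian with [w] gives squared norms whose vanishing forces
   [d_E w = 0] and [d_E^* w = 0]; outside the middle degrees this takes two steps,
   from [d_E^* d_E w = 0] to [|d_E w|^2 = 0]. *)
Lemma rumin_kerP k (w : cochain M k) : E w -> rumin_laplacian theta T P Linv dEadj w = 0 ->
  fo (dE w) = 0 /\
  (forall j (e : k = j.+1) (a : cochain M j), E a ->
     fip (fo (dE a)) (fo w) = 0).
Proof.
move=> Ew.
have ge0 u : 0 <= fip u u := K_ip_ge0 K u.
have Fup : E (rumin_lap_up theta T P Linv dEadj w).
  by rewrite /rumin_lap_up; case: ifP => _; do ?[apply: dEadj_space|apply: dE_space].
have Fdn : is_form (rumin_lap_down theta T P Linv dEadj w).
  case: k w Ew Fup => [|k] w Ew _ /=; first by have [] := fo0 0.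
  by case: ifP => _; apply: rumin_form; do ?[apply: dE_space|apply: dEadj_space].
have [up0 up] : 0 <= fip (fo (rumin_lap_up theta T P Linv dEadj w)) (fo w) /\
    (fip (fo (rumin_lap_up theta T P Linv dEadj w)) (fo w) = 0 -> fo (dE w) = 0).
  have Ed := dE_space Ew; have Es := dEadj_space Ed.
  have h : fip (fo (dE w)) (fo (dE w)) = fip (fo w) (fo (dEadj (dE w))) by exact: dE_adj.
  rewrite /rumin_lap_up; case: ifP => _.
    by rewrite sym -h; split=> // /eq0.
  have Eds := dE_space Es.
  rewrite sym -dE_adj // sym dE_adj //; split=> // /eq0 s0.
  by apply: eq0; rewrite h s0 (hip0r K).
have [dn0 dn] : 0 <= fip (fo (rumin_lap_down theta T P Linv dEadj w)) (fo w) /\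
    (fip (fo (rumin_lap_down theta T P Linv dEadj w)) (fo w) = 0 ->
     forall j (e : k = j.+1) (a : cochain M j), E a -> fip (fo (dE a)) (fo w) = 0).
  case: k w Ew {Fup Fdn up0 up} => [|k] w Ew.
    by rewrite /=; have [_ ->] := fo0 0; rewrite (hip0 K); split.
  have Es := dEadj_space Ew; have Ed := dE_space Es.
  have h : fip (fo (dE (dEadj w))) (fo w) = fip (fo (dEadj w)) (fo (dEadj w)) by exact: dE_adj.
  have key : fo (dEadj w) = 0 ->
      forall j (e : k.+1 = j.+1) (a : cochain M j), E a -> fip (fo (dE a)) (fo w) = 0.
    move=> s0 j [e]; subst j => a Ea; rewrite dE_adj // s0; exact: (hip0r K).
  rewrite /rumin_lap_down; case: ifP => _.
    by rewrite h; split=> // /eq0.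
  have Esd := dEadj_space Ed.
  rewrite dE_adj // sym -dE_adj //; split=> // /eq0 d0.
  by apply/key/eq0; rewrite -h d0 (hip0 K).
move=> lap0; have [_] := foD Fdn (rumin_form Fup).
rewrite [X in fo X](_ : _ = 0) //; have [_ ->] := fo0 k => /esym/(congr1 (fip ^~ (fo w))).
rewrite (hip0 K) Dl => e.
by split; [apply: up; lra|apply: dn; lra].
Qed.

(** The nonzero factors [acoef] are removed and coclosedness is rewritten as orthogonality to the
    image of [dR], after which each range of degrees is one case of the abstract argument. *)
Lemma rumin_harmonic k (w : cochain M k) : rumin_ker theta T Lam P Linv dEadj w ->
  dF (fo w) = 0 /\ sF (fo w) = 0.
Proof.
case=> Ew /(rumin_kerP Ew)[dw adj].
have {}dw : fo (dR w) = 0.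
  by have [_ e] := fo_dE Ew; apply: (fscale_eq0 (acoef_neq0 k)); rewrite -e.
have {}adj j (e : k = j.+1) (a : cochain M j) : E a -> fip (fo (dR a)) (fo w) = 0.
  move=> Ea; have /eqP := adj j e a Ea; rewrite fip_dE // mulf_eq0 (negPf (acoef_neq0 j)).
  by move/eqP.
have low j v : (j <= n)%N -> hz j v -> fLam v = 0 -> E (oflist j v) /\ fo (oflist j v) = v.
  move=> jn hv Lv; have [Fv ev] := foK hv.2; split=> //.
  by apply/rumin_spaceP_low; rewrite ?ev.
have hdn : (k <= n)%N -> forall j v, j.+1 = k -> hz j v -> fLam v = 0 ->
    fip (dF v) (fo w) = 0.
  move=> kn j v jk hv Lv; subst k; have [Ev ev] := low j v (ltnW kn) hv Lv.
  by have := adj j erefl _ Ev; rewrite (dR_low kn Ev Ew) ev.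
case: (ltngtP k n) => kn.
- have [Fw hw Lw] := (rumin_spaceP_low w (ltnW kn)).1 Ew.
  apply: (rumin_low_harmonic K kn hw Lw) => [b hb Lb|]; last exact: hdn (ltnW kn).
  have [Eb eb] := low k.+1 b kn hb Lb.
  by rewrite -[b]eb -/(dF _) -dR_low // dw (hip0 K).
- case: k w Ew dw adj kn {hdn} => [//|k] w Ew dw adj nk.
  have [Fw [u [hu Lu wu]]] := (rumin_spaceP_high w nk).1 Ew.
  have {}dw : dF (fe u) = 0.
    by have [_ ed] := fo_extd Fw; rewrite -wu -ed -dw /dR ltnNge (ltnW nk) gtn_eqF.
  rewrite wu; move: nk; rewrite ltnS leq_eqVlt => /orP[/eqP nk|nk].
    have adj' a : hz n a -> fLam a = 0 -> fip (fe (fl a - fd0 (fs1 a))) (fe u) = 0.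
      move=> ha La; have [Ea ea] := low n a (leqnn n) ha La.
      have := adj n (congr1 succn (esym nk)) _ Ea.
      by rewrite dR_mid //; have [_ ->] := fo_rumin_D erefl Ea; rewrite ea wu.
    apply: (rumin_mid_high_harmonic K) => //.
    exact: (eq_ind _ (fun q => hz q u) hu _ (esym nk)).
  apply: (rumin_high_harmonic K nk) => // y hy Ly.
  case: k w Ew dw adj nk Fw hu wu hy => [//|k] w Ew dw adj nk Fw hu wu hy.
  have hey : hdeg k.+1 (fe y) by apply: hdeg_eps; case: hy.
  have [Fy ey] := foK hey.
  have Ey : E (oflist k.+1 (fe y)).
    by apply/rumin_spaceP_high => //; split=> //; exists y.
  have := adj k.+1 erefl _ Ey; rewrite /dR ltnNge (ltnW nk) gtn_eqF //=.
  by have [_ ->] := fo_extd Fy; rewrite ey wu.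
- have [Fw hw Lw] := (rumin_spaceP_low w (eq_leq kn)).1 Ew.
  have hwn : hz n (fo w) := eq_ind _ (fun q => hz q (fo w)) hw _ kn.
  apply: (rumin_mid_harmonic K hwn Lw) => [|j v jn]; last exact/(hdn (eq_leq kn))/(etrans jn).
  have hz_Dw : hz k (fl (fo w) - fd0 (fs1 (fo w))).
    apply: (K_hzD K); first exact: (K_hz_l K).
    apply: (K_hzN K); case: k w hw {Ew dw adj hdn kn Fw Lw hwn} => [|k] w hw.
      by rewrite (K_s1_0 K hw) raddf0 -(subrr (fo w)); apply: (K_hzD K) => //; exact: (K_hzN K).
    exact/(K_hz_d0 K)/(K_hz_s1 K).
  apply: (e_inj K (K_hz_i K hz_Dw)).
  by move: dw; rewrite (dR_mid _ kn); have [_ ->] := fo_rumin_D kn Ew.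
Qed.

(** Vanishing of [d_E^* w] is expressed by orthogonality to all [dE a], which avoids any formula for
    [dEadj]. *)
Lemma harmonic_rumin k (w : cochain M k) : is_form w -> dF (fo w) = 0 -> sF (fo w) = 0 ->
  [/\ E w, dE w = 0 & forall j (e : k = j.+1) (a : cochain M j), E a -> fip (fo (dE a)) (fo w) = 0].
Proof.
move=> Fw dw sw; have hw := fo_hdeg Fw.
have hdv : hdeg k (fo w - fe (fi (fo w)) : form V).
  apply: hdegD => //; apply: hdegN; case: k w {Fw dw sw} hw => [|k] w hw; last first.
    exact/hdeg_eps/hdeg_iota.
  move=> s _; rewrite -[LHS]/(eX S (Tv S) (iota (Tv S) (fo w)) s) (hdeg_iota0 _ hw).
  by rewrite [eX S _ 0]eps0.
have hza : hz k (fo w - fe (fi (fo w))).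
  split=> //; have : fi (fo w - fe (fi (fo w))) = 0.
    by rewrite raddfB /= (K_i_e K) (K_i_i K) raddf0 subr0 subrr.
  exact: (congr1 (@fval _ _)).
have hzi q : k = q.+1 -> hz q (fi (fo w)).
  move=> kq; subst k; split; last exact: hdeg_iota.
  by have := K_i_i K (fo w); exact: (congr1 (@fval _ _)).
have i0 : k = 0%N -> fi (fo w) = 0.
  by move=> k0; subst k; apply: val_inj; exact: hdeg_iota0.
have dE0 : E w -> fo (dR w) = 0 -> dE w = 0.
  move=> Ew h; have [Fd ed] := fo_dE Ew; apply: fo_eq0 => //.
  by rewrite ed h; apply: val_inj; exact: scl0.
have ext0 : extd w = 0 by have [Fe ee] := fo_extd Fw; apply: fo_eq0; rewrite ?ee.
have adj_d v : fip (dF v) (fo w) = 0 by rewrite (ip_d K) -/(sF _) sw (hip0r K).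
have dR_high j (a : cochain M j) : (n < j)%N -> E a -> fo (dR a) = dF (fo a).
  by move=> nj Ea; rewrite /dR ltnNge (ltnW nj) gtn_eqF //; have [] := fo_extd (rumin_form Ea).
have adjE j (a : cochain M j) : E a -> fip (fo (dR a)) (fo w) = 0 -> fip (fo (dE a)) (fo w) = 0.
  by move=> Ea h; rewrite fip_dE // h mulr0.
have [kn|nk] := leqP k n.
  have [iw Lw d0w s0w lw] := harmonic_low K kn hza hzi i0 dw sw.
  have Ew : E w.
    apply/rumin_spaceP_low => //; split=> //; split=> //.
    exact: (congr1 (@fval _ _) iw).
  split=> //; last first.
    by move=> j e a Ea; subst k; apply: adjE; rewrite // dR_low.
  apply: dE0 => //; move: kn; rewrite leq_eqVlt => /orP[/eqP kn|kn]; last first.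
    have [Fd ed] := fo_extd Fw.
    by apply: eq0; rewrite dR_low // ?dw ?(hip0 K) //; exact: dR_space.
  rewrite (dR_mid _ kn); have [_ ->] := fo_rumin_D kn Ew.
  (* [s1 w] vanishes because [w] is primitive and [d0]-closed. *)
  have -> : fs1 (fo w) = fd0 (fLam (fo w)) - fLam (fd0 (fo w)).
    by rewrite (K_Lam_d0 K) opprB addrC subrK.
  by rewrite Lw d0w lw !(raddf0, addr0).
have [wE d0u s0u Lu lu] := harmonic_high K nk hza dw sw.
case: k w Fw dw sw hw hdv hza hzi i0 dE0 ext0 adj_d adjE nk wE d0u s0u Lu lu =>
  [//|k] w Fw dw sw hw hdv hza hzi i0 dE0 ext0 adj_d adjE nk wE d0u s0u Lu lu.
have Ew : E w.
  apply/rumin_spaceP_high => //; split=> //; exists (fi (fo w)).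
  by split=> //; exact: hzi.
split=> //.
  by apply: dE0; rewrite ?dR_high.
move=> j [e] a Ea; subst j; apply: adjE => //.
move: nk; rewrite ltnS leq_eqVlt => /orP[/eqP nk|nk]; last by rewrite dR_high.
rewrite dR_mid //; have [_ ->] := fo_rumin_D (esym nk) Ea.
rewrite (K_adj_e K) Dl (hipNl K) (K_adj_l K) lu (hip0r K) (K_adj_d0 K) s0u (hip0r K).
by rewrite !oppr0 addr0.
Qed.

Lemma hodge_ker_rumin_ker k : hodge_ker dadj (k:=k) = rumin_ker theta T Lam P Linv dEadj (k:=k).
Proof.
apply/seteqP; split=> w; last first.
  move=> h; have [dw sw] := rumin_harmonic h; apply/hodge_kerP; split=> //.
  by case: h => /rumin_form.
case/hodge_kerP => Fw dw sw; have [Ew dE0 adj] := harmonic_rumin Fw dw sw.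
(* [P], [Linv] and [dEadj] are given as mere functions, so that [dE] and [dEadj] send 0 to 0 is
   deduced from the harmonicity of 0. *)
have h0 j : E (0 : cochain M j) /\ dE (0 : cochain M j) = 0.
  have [F0 e0] := fo0 j.
  have [] := harmonic_rumin F0; rewrite ?e0 => //; [exact: dOm0|exact: sOm0].
have s0 j (b : cochain M j.+1) : E b -> dF (fo b) = 0 -> sF (fo b) = 0 -> dEadj b = 0.
  move=> Eb db sb; have [_ _ h] := harmonic_rumin (rumin_form Eb) db sb.
  have Es := dEadj_space Eb; apply: fo_eq0; first exact: rumin_form.
  by apply: eq0; rewrite -dE_adj // (h j erefl).
have s00 j : dEadj (0 : cochain M j.+1) = 0.
  have [F0 e0] := fo0 j.+1.
  by apply: s0; rewrite ?e0; [have [] := h0 j.+1|exact: dOm0|exact: sOm0].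
split=> //.
have up : rumin_lap_up theta T P Linv dEadj w = 0.
  by rewrite /rumin_lap_up dE0 s00; case: ifP => // _; rewrite (h0 _).2 s00.
rewrite /rumin_laplacian up addr0.
case: k w Fw dw sw Ew dE0 adj up => [//|k] w Fw dw sw Ew dE0 adj up.
by rewrite /rumin_lap_down s0 // (h0 _).2 s00 (h0 _).2; case: ifP.
Qed.

End Rumin.

Theorem theorem1p1 (R : realType) (n : nat) (M : manifold R n.*2.+1)
    (theta : cochain M 1) (J : {linear vfield M -> vfield M}) (T : vfield M)
    (hcompact : compact [set: M]) (hsasakian : sasakian theta J T)
    (* integration against the volume measure of g = g_{theta,J} *)
    (I : (M -> R) -> R) (hI : riemannian_integral (metric theta J) I)
    (* the formal adjoint of d *)
    (dadj : forall k, cochain M k.+1 -> cochain M k)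
    (hdadj : forall k, formal_adjoint (metric theta J) I
       (@is_form R _ M k) (@is_form R _ M k.+1) (@extd R _ M k) (dadj k))
    (* Lambda, the pointwise adjoint of L *)
    (Lam : forall k, cochain M k.+2 -> cochain M k)
    (hLam : forall k, pointwise_adjoint (metric theta J)
       (@lefschetz R n M theta k) (Lam k))
    (* the fiberwise orthogonal projections P onto the Rumin spaces, k <= n *)
    (P : forall k, cochain M k -> cochain M k)
    (hP : forall k, (k <= n)%N -> orthogonal_projection (metric theta J)
       (rumin_space theta T Lam (k:=k)) (P k))
    (* L^-1 from degree n + 1 to degree n - 1 *)
    (Linv : forall k, cochain M k.+2 -> cochain M k)
    (hLinv : lefschetz_inverse theta T Linv)
    (* the formal adjoint of d_E *)
    (dEadj : forall k, cochain M k.+1 -> cochain M k)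
    (hdEadj : forall k, formal_adjoint (metric theta J) I
       (rumin_space theta T Lam (k:=k)) (rumin_space theta T Lam (k:=k.+1))
       (@dE R n M theta T P Linv k) (dEadj k))
    (k : nat) (hk : (k <= n.*2.+1)%N) :
  hodge_ker dadj (k:=k) =
  rumin_ker theta T Lam P Linv dEadj (k:=k) :> set (cochain M k).
Proof.
have [S [[actS brS gS] TS JS trS]] := sasaki_data_exists hsasakian hcompact.
exact: (hodge_ker_rumin_ker hcompact hsasakian hI actS brS gS TS JS trS hdadj hLam hP hLinv hdEadj).
Qed.
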